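(* Let $(M,g)$ be a four dimensional scalar-flat K\''ahler metric with antiselfdual complex structure $J$ (so that its conformal class $\mathsf c$ is selfdual), admitting a holomorphic selfdual conformal submersion $\xi$. Then the conformal submersion is affine over an Einstein-Weyl space $(B,\mathsf c_B,D^B)$ with a shear-free geodesic congruence $\chi$ (induced by $J\xi$), and the linear part $w_1$ of the affine monopole is $w_1=-2\kappa$, where $\kappa$ is the twist of $\chi$. All such metrics are locally of the form $$g=(\rho-2\mu_t^{-1}\kappa)\mathsf c_B+\frac{\bigl(D^B(\mu_t^{-1})+2\tau\chi\mu_t^{-1}+\Phi\bigr)^2}{\rho-2\mu_t^{-1}\kappa},$$ where $\rho\in C^\infty(B,L_B^{-2})$, $\Phi\in C^\infty(B,L_B^{-1}T^*B)$, $\mu_t^{-1}$ is a section of $L^{-1}$ increasing along the fibres, and $\tau$ is the divergence of $\chi$. Conversely, for any three dimensional Einstein-Weyl space $(B,\mathsf c_B,D^B)$ and shear-free geodesic congruence $\chi$ with twist $\kappa$ and divergence $\tau$, this metric is scalar-flat K\''ahler if and only if $(\rho,\Phi)$ satisfy the linear differential equation $$*_B(D^B\rho+2\tau\chi\rho+2\kappa\Phi)=d^B\Phi+2\tau\chi\wedge\Phi.$$ Furthermore the metric is hyperK\''ahler if and only if $D^0\tau=0$, i.e., if and only if $\tau=0$, or $D^0$ is exact and $\tau$ is constant in this gauge.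
   Context: Everything is smooth and local. On an $n$-manifold, $L^w$ is the oriented real line bundle of densities of weight $w$, associated to the frame bundle by $A\mapsto|\det A|^{w/n}$; $L=L^1$. A conformal structure $\mathsf c$ is a (unit determinant) metric on $L^{-1}TM$, i.e. an $L^2$-valued inner product $\langle\cdot,\cdot\rangle$ on $TM$; it identifies vectors and $1$-forms of the same weight. A Weyl derivative $D$ is a covariant derivative on $L$ (hence on every $L^w$), with curvature $2$-form $F^D$; it is exact if it has a parallel length scale (nonvanishing section of $L$); on a conformal manifold it determines a unique torsion-free connection $D$ on $TM$ with $D\mathsf c=0$. $d^B$ is the exterior derivative on $L_B^w$-valued forms twisted by $D^B$. $D$ is Einstein-Weyl if the symmetric tracefree part of its Ricci tensor vanishes. A conformal submersion with oriented one dimensional fibres is a surjective submersion $\pi\colon M\to B$ of conformal manifolds with $d\pi_x$ restricted to $\mathcal H_x=(\ker d\pi_x)^\perp$ a nonzero conformal map; $\xi\in L^{-1}TM$ is the weightless positive unit vertical vector field, also viewed as a weightless $1$-form; $L\cong\pi^*L_B$. The minimal Weyl derivative $D^0$ is the unique one with $D^0_\xi\xi=0$, $\mathrm{tr}\,D^0\xi=0$; $F^0$ is its curvature. On the oriented $4$-manifold $M$, $*$ on weighted forms satisfies $\iota_X{*\alpha}=*(\langle X,\cdot\rangle\wedge\alpha)$ with $*1$ the orientation; the same convention is used for $*_B$ on $B$ (so $*_B^2=-1$), and $*1=*_B1\wedge\xi$. (Anti)selfdual refers to the $\pm1$ eigenspaces of $*$ on $2$-forms; an orthogonal complex structure $J$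 is antiselfdual if the $2$-form $\langle J\cdot,\cdot\rangle$ is. With $\omega=-( *d^D\xi)(\xi,\cdot)$ (independent of $D$), $\xi$ is selfdual if $F^0$ is selfdual; then $D^0+\omega$ is the pullback of a Weyl derivative $D^B$ on $B$, the Weyl structure of the quotient. $\xi$ is holomorphic if $(D^0\otimes D^g)\xi$ ($D^0$ on $L^{-1}$, Levi-Civita connection $D^g$ on $TM$) is complex linear with respect to $J$; then $J\xi$ descends to a weightless unit vector field $\chi$ on $B$. A shear-free geodesic congruence on $(B,\mathsf c_B,D^B)$ is a weightless unit vector field $\chi$ with $D^B\chi=\tau(\mathrm{id}-\chi\otimes\chi)+\kappa\,{*_B\chi}$, with $\tau,\kappa\in C^\infty(B,L_B^{-1})$; $\tau$ is its divergence and $\kappa$ its twist. Affine conformal submersions: $\mathcal V=\ker d\pi\cong L$ via $\xi$, and $\pi^*L_B\cong L\cong\mathcal V$ is the relative length scale. $\pi$ is affine if there is a flat torsion-free connection on each fibre such that (i) for each vector field $X$ on $B$ with horizontal lift $\tilde X$, $U\mapsto[\tilde X,U]$ preserves vertical vector fields parallel on each fibre, and (ii) the relative length scale maps sections of $L_B$ to vertical vector fields affine on each fibre. In an affine fibre coordinate $t$ then $\mathsf c=\pi^*\mathsf c_B+(tw_1+w_0)^{-2}(dt+tA_1+A_0)^2$ with $w_i\in C^\infty(B,L_B^{-1})$, $A_i\in C^\infty(B,T^*B)$; $w_1$ is the linear part of the affine monopole. In the formula for $g$, $\pi^*$ is omitted; in terms of a length scale $\mu_B$ on $B$, $\mu_t^{-1}=t\mu_B^{-1}$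 with $t$ an increasing fibre coordinate (so $D^B(\mu_t^{-1})=(dt-t\omega_B)\mu_B^{-1}$ where $D^B\mu_B=\omega_B\mu_B$), and the formula is considered where $\rho-2\mu_t^{-1}\kappa>0$. The complex structure in the converse is the antiselfdual orthogonal $J$ on $M$ determined by $J\xi=\chi$. *)

(* Defs.v *)
(* Everything is local, so manifolds are open subsets of ['rV[R]_n], with
   positively oriented coordinates.  Tensor fields are given by their
   coordinate components: vector fields and 1-forms are row-vector fields,
   bilinear forms, 2-forms and endomorphisms are matrix fields (an endomorphism
   [A] acts on row vectors by [v *m A]).

   Weighted objects are written in a gauge.  A conformal structure [c] is
   represented by an arbitrary metric [g] in its class, equivalently by the
   length scale [mu] with [c = mu^2 g].  A section [f mu^w] of [L^w] (possibly
   tensored with vectors or forms) is represented by its component [f], and the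
   Weyl derivative [D] by the 1-form [a] with [D mu = a mu]; so [D] acts on
   weight [w] components as [d + w a].  Statements quantify over all gauges. *)
From HB Require Import structures.
From mathcomp Require Import all_boot all_order all_algebra.
From mathcomp Require Import boolp classical_sets functions reals.
From mathcomp Require Import topology normedtype derive.
From mathcomp Require Import ring.

Set Implicit Arguments.
Unset Strict Implicit.
Unset Printing Implicit Defensive.
Import Order.TTheory GRing.Theory Num.Theory numFieldNormedType.Exports.
Local Open Scope classical_set_scope.
Local Open Scope ring_scope.

Section Calculus.
Context {R : realType} {n : nat}.
Implicit Types (U : set 'rV[R]_n) (x : 'rV[R]_n).

Definition bvec (i : 'I_n) : 'rV[R]_n := delta_mx 0 i.

Definition pd (i : 'I_n) (f : 'rV[R]_n -> R) x : R := 'D_(bvec i) f x.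

Fixpoint Ck (k : nat) U (f : 'rV[R]_n -> R) : Prop :=
  match k with
  | 0 => forall x, U x -> {for x, continuous f}
  | k'.+1 => (forall x, U x -> differentiable f x) /\
             (forall i, Ck k' U (pd i f))
  end.

Definition smooth U (f : 'rV[R]_n -> R) : Prop := forall k, Ck k U f.

Definition smooth_mx p q U (A : 'rV[R]_n -> 'M[R]_(p, q)) : Prop :=
  forall i j, smooth U (fun x => A x i j).

Definition grad (f : 'rV[R]_n -> R) x : 'rV[R]_n := \row_i pd i f x.

Definition lie (X Y : 'rV[R]_n -> 'rV[R]_n) x : 'rV[R]_n :=
  'D_(X x) Y x - 'D_(Y x) X x.

Definition wedge (a b : 'rV[R]_n) : 'M[R]_n := a^T *m b - b^T *m a.

Definition d1 (a : 'rV[R]_n -> 'rV[R]_n) x : 'M[R]_n :=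
  \matrix_(i, j) (pd i (fun z => a z 0 j) x - pd j (fun z => a z 0 i) x).

Definition pull1 p (f : 'rV[R]_n -> 'rV[R]_p) (b : 'rV[R]_p -> 'rV[R]_p) x
  : 'rV[R]_n := b (f x) *m ('J f x)^T.

Definition pull2 p (f : 'rV[R]_n -> 'rV[R]_p) (h : 'rV[R]_p -> 'M[R]_p) x
  : 'M[R]_n := 'J f x *m h (f x) *m ('J f x)^T.

End Calculus.

Section WeylGeometry.
Context {R : realType} {n : nat}.
Implicit Types (U : set 'rV[R]_n) (x : 'rV[R]_n).
Implicit Types (g J : 'rV[R]_n -> 'M[R]_n) (a X : 'rV[R]_n -> 'rV[R]_n).
Implicit Types (G : 'I_n -> 'I_n -> 'I_n -> 'rV[R]_n -> R) (w : R).

Definition inner g x (u v : 'rV[R]_n) : R := (u *m g x *m v^T) 0 0.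

Record riemannian U g : Prop := Riemannian {
  met_smooth : smooth_mx U g;
  met_sym : forall x, U x -> (g x)^T = g x;
  met_pos : forall x, U x -> forall v, v != 0 -> 0 < inner g x v v }.

Definition flat g X x : 'rV[R]_n := X x *m g x.

(* The orientation form on the [n] vectors listed in [s]. *)
Definition vol g x (s : seq 'rV[R]_n) : R :=
  Num.sqrt (\det (g x)) * \det (\matrix_(k < n) s`_k).

(* The Koszul formula for the unique torsion-free [D] with [D c = 0].
   In a gauge [D c = 0] reads [D g = - 2 a (x) g].
   [weyl_chr g a k i j] is the component along [d_k] of [D_{d_i} d_j]; see
   [weyl_chr_torsion_free] and [weyl_chr_conformal] below. *)
Definition weyl_chr g a (k i j : 'I_n) x : R :=
  let Dg i j l := pd i (fun z => g z j l) x + 2 * a x 0 i * g x j l in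
  2^-1 * \sum_l invmx (g x) k l * (Dg i j l + Dg j i l - Dg l i j).

Definition levi_civita g := weyl_chr g (fun=> 0).

(* [D] on [L^w], on [L^w (x) TM] (row [i] is [D_{d_i} X]), and the exterior
   derivative on [L^w]-valued 1-forms twisted by [D].  The derivative [a] used
   on [L^w] and the connection [G] used on [TM] are independent arguments. *)
Definition covd_fun w a (f : 'rV[R]_n -> R) x : 'rV[R]_n :=
  grad f x + (w * f x) *: a x.

Definition covd_vec w a G X x : 'M[R]_n :=
  \matrix_(i, k) (pd i (fun z => X z 0 k) x + \sum_j G k i j x * X x 0 j
                  + w * a x 0 i * X x 0 k).

Definition twisted_d w a (b : 'rV[R]_n -> 'rV[R]_n) x : 'M[R]_n :=
  d1 b x + w *: wedge (a x) (b x).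

(* Row [j] of [covd_end G J i x] is [(D_{d_i} J) d_j]. *)
Definition covd_end G J (i : 'I_n) x : 'M[R]_n :=
  \matrix_(j, k) (pd i (fun z => J z j k) x
    + \sum_m (G k i m x * J x j m - G m i j x * J x m k)).

(* [riem G i j k l] is the component along [d_l] of [R(d_i, d_j) d_k]. *)
Definition riem G (i j k l : 'I_n) x : R :=
  pd i (G l j k) x - pd j (G l i k) x
  + \sum_m (G l i m x * G m j k x - G l j m x * G m i k x).

Definition ricci G x : 'M[R]_n := \matrix_(j, k) \sum_i riem G i j k i x.

Definition scal g x : R := \tr (invmx (g x) *m ricci (levi_civita g) x).

Definition einstein_weyl U g a : Prop := forall x, U x ->
  let S := ricci (weyl_chr g a) x + (ricci (weyl_chr g a) x)^T in
  S = (n%:R^-1 * \tr (invmx (g x) *m S)) *: g x.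

Record kahler U g J : Prop := Kahler {
  kahler_smooth : smooth_mx U J;
  kahler_square : forall x, U x -> J x *m J x = - 1%:M;
  kahler_orth : forall x, U x -> J x *m g x *m (J x)^T = g x;
  kahler_parallel : forall x, U x ->
    forall i, covd_end (levi_civita g) J i x = 0 }.

Definition scalar_flat_kahler U g J : Prop :=
  kahler U g J /\ forall x, U x -> scal g x = 0.

(* Everything being local, the parallel triple is only required near each
   point; [J x *m I x] is the composite of [I] after [J]. *)
Definition hyperkahler U g : Prop := forall x0, U x0 ->
  exists W : set 'rV[R]_n, [/\ open W, W x0, W `<=` U &
    exists I J K, [/\ kahler W g I, kahler W g J, kahler W g K &
      forall x, W x -> J x *m I x = K x]].

End WeylGeometry.

Section WeylConnection.
Context {R : realType} {n : nat}.
Context (U : set 'rV[R]_n) (g : 'rV[R]_n -> 'M[R]_n)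
  (a : 'rV[R]_n -> 'rV[R]_n) (x : 'rV[R]_n)
  (oU : open U) (mg : riemannian U g) (Ux : U x).

Lemma metric_unitmx : g x \in unitmx.
Proof.
rewrite unitmxE unitfE; apply/det0P => -[v v0 vg].
by have := met_pos mg Ux v0; rewrite /inner vg mul0mx mxE ltxx.
Qed.

Lemma pd_metric_sym i j l :
  pd i (fun z => g z j l) x = pd i (fun z => g z l j) x.
Proof.
apply: near_eq_derive; have := open_nbhs_nbhs (conj oU Ux).
by apply: filterS => z Uz; rewrite -{1}(met_sym mg Uz) mxE.
Qed.

Lemma weyl_chr_torsion_free k i j : weyl_chr g a k i j x = weyl_chr g a k j i x.
Proof.
have gs p q : g x p q = g x q p by rewrite -{1}(met_sym mg Ux) mxE.
rewrite /weyl_chr; congr (_ * _); apply: eq_bigr => l _.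
by rewrite (pd_metric_sym l i j) (gs i j); ring.
Qed.

Lemma weyl_chr_conformal i j l :
  pd i (fun z => g z j l) x
  - \sum_m (weyl_chr g a m i j x * g x m l + weyl_chr g a m i l x * g x j m)
  = - 2 * a x 0 i * g x j l.
Proof.
have gs p q : g x p q = g x q p by rewrite -{1}(met_sym mg Ux) mxE.
pose Dg p q r := pd p (fun z => g z q r) x + 2 * a x 0 p * g x q r.
have low p q r : \sum_m weyl_chr g a m p q x * g x r m
    = 2^-1 * (Dg p q r + Dg q p r - Dg r p q).
  transitivity (\sum_m 2^-1 * \sum_s g x r m * invmx (g x) m s
      * (Dg p q s + Dg q p s - Dg s p q)).
    apply: eq_bigr => m _; rewrite /weyl_chr -mulrA mulr_suml; congr (_ * _).
    by apply: eq_bigr => s _; rewrite /Dg; ring.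
  rewrite -mulr_sumr exchange_big /=; congr (_ * _).
  transitivity (\sum_s (1%:M : 'M[R]_n) r s * (Dg p q s + Dg q p s - Dg s p q)).
    apply: eq_bigr => s _; by rewrite -(mulmxV metric_unitmx) mxE mulr_suml.
  rewrite (bigD1 r) //= big1 ?addr0 ?mxE ?eqxx ?mul1r // => s sr.
  by rewrite mxE eq_sym (negbTE sr) mul0r.
rewrite big_split /= low; under eq_bigr do rewrite gs.
rewrite low /Dg (pd_metric_sym i l j) (gs l j).
by field.
Qed.
End WeylConnection.

(* The star operator is fixed by [i_X *b = *(<X,.> /\ b)], [*1] = orientation.
   On 1-forms this gives [*b = vol(b^#, ...)], and on 2-forms
   [*(X /\ Y) = vol(Y, X, ...)]: in dimension 4 this is the opposite of the
   usual Hodge star. *)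
Definition star3 {R : realType} (h : 'rV[R]_3 -> 'M[R]_3) (y : 'rV[R]_3)
    (b : 'rV[R]_3) : 'M[R]_3 :=
  \matrix_(i, j) vol h y [:: b *m invmx (h y); bvec i; bvec j].

Definition star4 {R : realType} (g : 'rV[R]_4 -> 'M[R]_4) (x : 'rV[R]_4)
    (F : 'M[R]_4) : 'M[R]_4 :=
  let F' := invmx (g x) *m F *m (invmx (g x))^T in
  \matrix_(k, l) (2^-1 * \sum_i \sum_j
    F' i j * vol g x [:: bvec j; bvec i; bvec k; bvec l]).

Section FourDimensions.
Context {R : realType}.
Implicit Types (U W : set 'rV[R]_4) (g J : 'rV[R]_4 -> 'M[R]_4).
Implicit Types (x : 'rV[R]_4) (xi a : 'rV[R]_4 -> 'rV[R]_4).

(* An orthogonal almost complex structure whose 2-form [<J.,.>] is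
   antiselfdual. *)
Record antiselfdual_acs U g J : Prop := AntiselfdualAcs {
  asd_smooth : smooth_mx U J;
  asd_square : forall x, U x -> J x *m J x = - 1%:M;
  asd_orth : forall x, U x -> J x *m g x *m (J x)^T = g x;
  asd_form : forall x, U x -> star4 g x (J x *m g x) = - (J x *m g x) }.

(* [W(d_i, d_j)] as a 2-form, the curvature being lowered by [g]; [S] is the
   Schouten tensor. *)
Definition weyl_tensor g x (i j : 'I_4) : 'M[R]_4 :=
  let S := 2^-1 *: (ricci (levi_civita g) x - (scal g x / 6) *: g x) in
  \matrix_(k, l) (\sum_m riem (levi_civita g) i j k m x * g x m l
    - (S j k * g x i l + g x j k * S i l - S i k * g x j l - g x i k * S j l)).

Definition selfdual_conformal U g : Prop := forall x, U x -> forall i j,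
  star4 g x (weyl_tensor g x i j) = weyl_tensor g x i j.

(* A conformal submersion with oriented one dimensional fibres, in gauges [g]
   on [U] and [h] on [V]: the weightless unit vertical vector field is
   [mu_g^{-1} xi], and [lam] expresses the identification of [L] with the
   pullback of [L_B], namely [mu_g = lam (mu_h o pi)].  The orientation clause
   is [*1 = *_B 1 /\ xi]. *)
Record conformal_submersion U (V : set 'rV[R]_3) g (h : 'rV[R]_3 -> 'M[R]_3)
    (pi : 'rV[R]_4 -> 'rV[R]_3) xi (lam : 'rV[R]_4 -> R) : Prop :=
  ConformalSubmersion {
  csub_smooth : smooth_mx U pi;
  csub_surj : pi @` U = V;
  csub_submersion : forall x, U x -> row_full ('J pi x);
  csub_xi_smooth : smooth_mx U xi;
  csub_xi_unit : forall x, U x -> inner g x (xi x) (xi x) = 1;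
  csub_xi_vert : forall x, U x -> xi x *m 'J pi x = 0;
  csub_lam_smooth : smooth U lam;
  csub_lam_pos : forall x, U x -> 0 < lam x;
  csub_conformal : forall x, U x -> forall u v,
    inner g x u (xi x) = 0 -> inner g x v (xi x) = 0 ->
    inner h (pi x) (u *m 'J pi x) (v *m 'J pi x) = lam x ^+ 2 * inner g x u v;
  csub_orient : forall x, U x -> forall u v w,
    lam x ^+ 3 * vol g x [:: u; v; w; xi x] =
    vol h (pi x) [:: u *m 'J pi x; v *m 'J pi x; w *m 'J pi x] }.

(* The minimal Weyl derivative: [D xi] is computed with [xi] of weight -1. *)
Definition minimal_weyl U g xi a : Prop :=
  smooth_mx U a /\ forall x, U x ->
    let Dxi := covd_vec (-1) a (weyl_chr g a) xi x in
    xi x *m Dxi = 0 /\ \tr Dxi = 0.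

(* As a 1-form, the weightless [xi] has values in [L^1]; the result is
   independent of the Weyl derivative [a]. *)
Definition omega g xi a x : 'rV[R]_4 :=
  - (xi x *m star4 g x (twisted_d 1 a (flat g xi) x)).

Definition selfdual_xi U g a : Prop :=
  forall x, U x -> star4 g x (d1 a x) = d1 a x.

(* [D^0 + omega] is the pullback of the Weyl derivative [b] on [B]; the
   logarithmic derivative of [lam] compares the gauges [mu_g], [mu_h o pi]. *)
Definition quotient_weyl U (V : set 'rV[R]_3) g pi xi (lam : 'rV[R]_4 -> R) a
    (b : 'rV[R]_3 -> 'rV[R]_3) : Prop :=
  smooth_mx V b /\ forall x, U x ->
    a x + omega g xi a x = (lam x)^-1 *: grad lam x + pull1 pi b x.

Definition holomorphic_xi U g J xi a : Prop := forall x, U x ->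
  let Dxi := covd_vec (-1) a (levi_civita g) xi x in
  J x *m Dxi = Dxi *m J x.

(* [J xi] descends to [chi]. *)
Definition induces U J (pi : 'rV[R]_4 -> 'rV[R]_3) xi (lam : 'rV[R]_4 -> R)
    (chi : 'rV[R]_3 -> 'rV[R]_3) : Prop :=
  forall x, U x -> (xi x *m J x) *m 'J pi x = lam x *: chi (pi x).

(* A connection on the (one dimensional) fibres is given by [gam] with
   [nabla_xi xi = gam xi]; it is automatically flat and torsion-free.  For a
   vertical [f xi], [nabla_xi (f xi) = (fibre_d xi gam f) xi]. *)
Definition fibre_d xi (gam f : 'rV[R]_4 -> R) x : R :=
  'D_(xi x) f x + gam x * f x.

Definition parallel_vertical W xi gam (Z : 'rV[R]_4 -> 'rV[R]_4) : Prop :=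
  exists f, smooth W f /\
    forall x, W x -> Z x = f x *: xi x /\ fibre_d xi gam f x = 0.

(* [Z = f xi] is affine on the fibres when its second covariant derivative
   [nabla nabla Z] vanishes; [nabla Z = (fibre_d xi gam f) id]. *)
Definition affine_vertical W xi gam (Z : 'rV[R]_4 -> 'rV[R]_4) : Prop :=
  exists f, smooth W f /\
    forall x, W x -> Z x = f x *: xi x /\
                     'D_(xi x) (fibre_d xi gam f) x = 0.

Record affine_submersion U (V : set 'rV[R]_3) g (pi : 'rV[R]_4 -> 'rV[R]_3)
    xi (lam gam : 'rV[R]_4 -> R) : Prop := AffineSubmersion {
  aff_smooth : smooth U gam;
  aff_lift : forall (X : 'rV[R]_3 -> 'rV[R]_3) (Xt : 'rV[R]_4 -> 'rV[R]_4),
    smooth_mx V X -> smooth_mx U Xt ->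
    (forall x, U x -> Xt x *m 'J pi x = X (pi x)
                      /\ inner g x (Xt x) (xi x) = 0) ->
    forall W Z, open W -> W `<=` U -> parallel_vertical W xi gam Z ->
      parallel_vertical W xi gam (lie Xt Z);
  (* the relative length scale maps [s mu_h] to the vertical field below *)
  aff_scale : forall s : 'rV[R]_3 -> R, smooth V s ->
    affine_vertical U xi gam (fun x => (s (pi x) / lam x) *: xi x) }.

(* An increasing function with [nabla dt = 0] on the fibres. *)
Definition affine_coordinate U xi gam (t : 'rV[R]_4 -> R) : Prop :=
  smooth U t /\ forall x, U x -> 0 < 'D_(xi x) t x /\
    'D_(xi x) (fun z => 'D_(xi z) t z) x = gam x * 'D_(xi x) t x.

(* [c = pi^* c_B + (t w1 + w0)^-2 (dt + t A1 + A0)^2] in the gauge [mu_h], for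
   the fibre coordinate [t], some [w0], [A0], [A1] and the given [w1]. *)
Definition monopole_linear_part U (V : set 'rV[R]_3) g h
    (pi : 'rV[R]_4 -> 'rV[R]_3) (lam t : 'rV[R]_4 -> R) (w1 : 'rV[R]_3 -> R)
    : Prop :=
  smooth V w1 /\
  exists (w0 : 'rV[R]_3 -> R) (A0 A1 : 'rV[R]_3 -> 'rV[R]_3),
    [/\ smooth V w0, smooth_mx V A0, smooth_mx V A1 &
    forall x, U x ->
      let v := t x * w1 (pi x) + w0 (pi x) in
      let th := grad t x + t x *: pull1 pi A1 x + pull1 pi A0 x in
      0 < v /\
      lam x ^+ 2 *: g x = pull2 pi h x + (v ^+ 2)^-1 *: (th^T *m th)].

End FourDimensions.

Section ThreeDimensions.
Context {R : realType}.
Implicit Types (V : set 'rV[R]_3) (h : 'rV[R]_3 -> 'M[R]_3).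
Implicit Types (b chi Phi : 'rV[R]_3 -> 'rV[R]_3) (tau kap rho : 'rV[R]_3 -> R).

(* [D^B chi = tau (id - chi (x) chi) + kap *chi], both sides lowered by [h];
   the first slot is the direction of differentiation. *)
Record shear_free_geodesic V h b chi tau kap : Prop := ShearFreeGeodesic {
  sfg_smooth : smooth_mx V chi;
  sfg_tau_smooth : smooth V tau;
  sfg_kap_smooth : smooth V kap;
  sfg_unit : forall y, V y -> inner h y (chi y) (chi y) = 1;
  sfg_eq : forall y, V y ->
    covd_vec (-1) b (weyl_chr h b) chi y *m h y =
    tau y *: (h y - (flat h chi y)^T *m flat h chi y)
    + kap y *: star3 h y (flat h chi y) }.

(* Sections [rho] of [L_B^-2] and [Phi] of [L_B^-1 T^*B]. *)
Definition monopole_eq V h b chi tau kap rho Phi : Prop := forall y, V y ->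
  star3 h y (covd_fun (-2) b rho y + (2 * tau y * rho y) *: flat h chi y
             + (2 * kap y) *: Phi y)
  = twisted_d (-1) b Phi y + (2 * tau y) *: wedge (flat h chi y) (Phi y).

Definition gfactor (pi : 'rV[R]_4 -> 'rV[R]_3) (t : 'rV[R]_4 -> R) kap rho
    (x : 'rV[R]_4) : R := rho (pi x) - 2 * t x * kap (pi x).

(* The metric [g], with [mu_t^-1 = t mu_h^-1], so that
   [D^B (mu_t^-1)] has component [dt - t b]. *)
Definition gform (pi : 'rV[R]_4 -> 'rV[R]_3) (t : 'rV[R]_4 -> R)
    h b chi tau kap rho Phi (x : 'rV[R]_4) : 'M[R]_4 :=
  let th := grad t x - t x *: pull1 pi b x
            + (2 * tau (pi x) * t x) *: pull1 pi (flat h chi) x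
            + pull1 pi Phi x in
  gfactor pi t kap rho x *: pull2 pi h x
  + (gfactor pi t kap rho x)^-1 *: (th^T *m th).

End ThreeDimensions.

(* Coordinates on [B x R]: the base point and the fibre coordinate. *)
Definition base {R : realType} (z : 'rV[R]_4) : 'rV[R]_3 :=
  \row_(i < 3) z 0 (lshift 1 i).

Definition fibre_t {R : realType} (z : 'rV[R]_4) : R := z 0 ord_max.

(* Main.v *)
Require Import Defs.
From HB Require Import structures.
From mathcomp Require Import all_boot all_order all_algebra.
From mathcomp Require Import boolp classical_sets functions reals.
From mathcomp Require Import topology normedtype derive.
From mathcomp Require Import interval_inference constructive_ereal measure.
From mathcomp Require Import lebesgue_measure lebesgue_integral ftc.
From mathcomp Require Import landau realfun sequences trigo ring lra.
Import Order.TTheory GRing.Theory Num.Theory numFieldNormedType.Exports.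
Local Open Scope classical_set_scope.
Local Open Scope ring_scope.
Set Implicit Arguments.
Unset Strict Implicit.
Unset Printing Implicit Defensive.

(** Both directions are computed in one frame.  Below a point of the total
    space choose an oriented orthonormal frame of the base, lift it
    horizontally and complete it by the vertical field [lam^-1 xi]
    ([lfr]); it is orthonormal up to the factor [lam^-2].
    The only structure functions that do not come from the base are those of
    the vertical coframe leg [e = lam <xi,.>], and
    [d e = - A /\ e - *omega], where [A] is the minimal Weyl derivative in the
    gauge pulled back from the base.  Together with the logarithmic derivative
    of [lam], the components of [A] and [omega] therefore determine the
    Levi-Civita connection ([lc_gamma3], [lc_gammaw]).

    The quotient: [F^0 = d A] has the vertical derivative of [A] as its mixed
    part, and by [d (d e) = 0] its horizontal part is minus the dual of the
    vertical derivative of [omega].  If [F^0] is selfdual, then [A + omega] is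
    invariant along the fibres ([quotient_invariant]) and descends to [D^B].

    The Kaehler condition: a conformal connection acts on antiselfdual
    endomorphisms by a vector product with a triple of components ([asd_part]), and a [J] that is
    constant in the frame is parallel exactly when two of the three components
    vanish ([adapted_kahlerP]).  Holomorphy makes [J xi] basic, so a frame with
    first leg [chi] has this form.  The vanishing then says that [chi] is
    shear-free and geodesic for [D^B], that the vertical derivative of
    [lam^-1] is [- kappa], and that [omega / 2 - d log lam - D^B] is
    [- tau chi] ([adapted_of_sfg]).

    The curvature: the third component is minus a one-form [nu], a connection
    form of the canonical bundle, and [d nu] is the Ricci form ([ricci_nu]).
    Since [nu] is [- tau e] plus a form from the base, the antiselfdual part of
    [d nu] is the defect of the equation [D tau = *d(...)] to which the
    Einstein-Weyl equation of the base reduces in the presence of [chi]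
    ([base_einstein_weylP]).  The Ricci tensor being [J]-invariant, only the
    component along the Kaehler form can be nonzero, and it is the scalar
    curvature.  So the metric is scalar-flat if and only if the base is
    Einstein-Weyl, and then the antiselfdual Weyl tensor vanishes too
    ([adapted_selfdual]).

    The normal form: let [t] satisfy [D_xi t = lam^-1].  The equations above
    say that [lam^-2 + 2 t kappa] and
    [lam^-1 <xi,.> - (dt - t b + 2 t tau chi)] are basic, and these are [rho]
    and [Phi] ([normal_form]).  In such a coordinate [lam^-2] is affine, with
    linear part [- 2 kappa], and an increasing affine coordinate is an affine
    function of [t] with basic coefficients ([affine_monopole]).

    The converse: for the metric of the statement the structure functions are
    read off from the contact form ([structure_of_contact]), and the Kaehler
    condition becomes an equation whose part linear in [t] is
    [d (b - 2 tau chi) = 2 *D kappa].  This holds on every Einstein-Weyl space,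
    by the first Bianchi identity ([bchi_curvature]); what remains is the
    monopole equation ([kahler_monopoleP]).

    The hyperKaehler case: the mixed components of [d nu] are those of
    [D^0 tau], and a selfdual form is determined by them.  Ricci-flatness thus
    gives [D^0 tau = 0]; conversely [d nu = 0] gives a potential of [- nu], and
    rotating the other two antiselfdual endomorphisms of the frame by this
    angle makes them parallel ([rotated_triple]).  A parallel section on a
    connected set has no zeros unless it vanishes ([parallel_zero_or_nonzero]),
    which gives the description by gauges.

    The local coordinates, potentials and descended functions come from
    the inverse function theorem, from integration along a coordinate with
    smooth dependence on the other coordinates, and from the Poincare lemma. *)

(** * Calculus of smooth functions and matrices *)

Section Diff.
Context {R : realType} {n : nat}.
Implicit Types (U : set 'rV[R]_n) (f g : 'rV[R]_n -> R) (x v : 'rV[R]_n).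

Lemma diff_eps f x (L : {linear 'rV[R]_n -> R}) : continuous L ->
  (forall e, 0 < e -> \forall h \near (0 : 'rV[R]_n), `|f (h + x) - f x - L h| <= e * `|h|) ->
  differentiable f x /\ 'd f x = L :> (_ -> _).
Proof.
move=> cL H.
have E : f \o shift x = cst (f x) + L +o_ (0 : 'rV[R]_n) id.
  apply/eqaddoP => e e0; have := H e e0; apply: filterS => h /=.
  by rewrite -[(_ - _) h]/(_ - (_ + _)) opprD addrA.
have dE := diff_unique cL E; split=> //.
by apply/diff_locallyP; rewrite dE.
Qed.

Lemma diff_eps_inv f x : differentiable f x ->
  forall e, 0 < e -> \forall h \near (0 : 'rV[R]_n), `|f (h + x) - f x - 'd f x h| <= e * `|h|.
Proof.
move=> df e e0; have /eqaddoP/(_ e e0) := diff_locally df; apply: filterS => h /=.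
by rewrite -[(_ - _) h]/(_ - (_ + _)) opprD addrA.
Qed.

Lemma near_shift0 (P : set 'rV[R]_n) x :
  (\forall y \near x, P y) <-> \forall h \near (0 : 'rV[R]_n), P (h + x).
Proof. by rewrite (near_shift 0) subr0; split; apply: filterS. Qed.

Lemma near_eq_differentiable f g x : (\forall y \near x, f y = g y) ->
  differentiable f x -> differentiable g x.
Proof.
move=> fg df; have [||//] := @diff_eps g x ('d f x).
  exact: diff_continuous.
move=> e e0; have fg0 := nbhs_singleton fg; move/near_shift0 : fg => fg.
have := diff_eps_inv df e0; apply: filterS2 fg => h.
by rewrite -fg0 => <-.
Qed.

(** Exhibits the differential as the pairing with a column of candidate
    partials; this is the form in which an antiderivative with parameters is
    differentiated. *)
Lemma diff_eps_mx f x (c : 'cV[R]_n) :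
  (forall e, 0 < e -> \forall h \near (0 : 'rV[R]_n), `|f (h + x) - f x - (h *m c) 0 0| <= e * `|h|) ->
  differentiable f x /\ forall v, 'D_v f x = (v *m c) 0 0.
Proof.
move=> H; pose L0 := fun v : 'rV[R]_n => (v *m c) 0 0.
have lin : linear L0 by move=> k u v; rewrite /L0 mulmxDl -scalemxAl !mxE.
pose LM := GRing.isLinear.Build _ _ _ _ _ lin.
pose L : {linear 'rV[R]_n -> R} := HB.pack L0 LM.
have cL : continuous L.
  move=> v; apply: differentiable_continuous.
  have -> : (L : 'rV[R]_n -> R) = \sum_(j < n) (fun v => v 0 j * c j 0).
    by apply/funext => u; rewrite fct_sumE /= /L0 mxE.
  apply: differentiable_sum => j; apply: differentiableM => //.
  exact: differentiable_coord.
have [df dE] := diff_eps cL H; split=> // v.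
by rewrite deriveE // dE.
Qed.

Lemma differentiable_row p (f : 'rV[R]_n -> 'rV[R]_p) x :
  (forall j, differentiable (fun z => f z 0 j) x) -> differentiable f x.
Proof.
move=> H.
have -> : f = \sum_(j < p) (fun z => f z 0 j *: (delta_mx 0 j : 'rV[R]_p)).
  apply/funext => z; rewrite fct_sumE {1}[f z]row_sum_delta.
  by [].
by apply: differentiable_sum => j; apply: differentiableZl.
Qed.

Lemma derive_sum_pd f x v : differentiable f x ->
  'D_v f x = \sum_i v 0 i * pd i f x.
Proof.
move=> df; rewrite deriveE // {1}[v]row_sum_delta linear_sum /=.
by apply: eq_bigr => i _; rewrite linearZ /= /pd deriveE.
Qed.

End Diff.

Section PdRules.
Context {R : realType} {n : nat}.
Implicit Types (U : set 'rV[R]_n) (f g : 'rV[R]_n -> R) (x v : 'rV[R]_n).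

Lemma pd_ext i U f g x : open U -> U x -> (forall z, U z -> f z = g z) ->
  pd i f x = pd i g x.
Proof.
move=> oU Ux fg; apply: near_eq_derive; have := open_nbhs_nbhs (conj oU Ux).
by apply: filterS => z /fg.
Qed.

Lemma pd_cst i c x : pd i (fun=> c) x = 0 :> R.
Proof. exact: derive_cst. Qed.

Lemma pdD i f g x : differentiable f x -> differentiable g x ->
  pd i (fun z => f z + g z) x = pd i f x + pd i g x.
Proof. by move=> df dg; apply: deriveD; apply: diff_derivable. Qed.

Lemma pdN i f x : differentiable f x -> pd i (fun z => - f z) x = - pd i f x.
Proof. by move=> df; apply: deriveN; apply: diff_derivable. Qed.

Lemma pdB i f g x : differentiable f x -> differentiable g x ->
  pd i (fun z => f z - g z) x = pd i f x - pd i g x.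
Proof. by move=> df dg; apply: deriveB; apply: diff_derivable. Qed.

Lemma pdM i f g x : differentiable f x -> differentiable g x ->
  pd i (fun z => f z * g z) x = pd i f x * g x + f x * pd i g x.
Proof.
move=> df dg; rewrite addrC (mulrC (pd i f x)).
by apply: (@deriveM _ _ f g x); apply: diff_derivable.
Qed.

Lemma pdZ i c f x : differentiable f x ->
  pd i (fun z => c * f z) x = c * pd i f x.
Proof. by move=> df; rewrite pdM // pd_cst mul0r add0r. Qed.

Lemma diff_sum (I : Type) (r : seq I) (P : pred I) (F : I -> 'rV[R]_n -> R) x :
  (forall j, P j -> differentiable (F j) x) ->
  differentiable (fun z => \sum_(j <- r | P j) F j z) x.
Proof.
move=> H; elim: r => [|j r IH].
  by under eq_fun do rewrite big_nil; apply: differentiable_cst.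
under eq_fun do rewrite big_cons; case Pj : (P j) => //.
by apply: differentiableD => //; apply: H.
Qed.

Lemma pd_sum i (I : Type) (r : seq I) (P : pred I) (F : I -> 'rV[R]_n -> R) x :
  (forall j, P j -> differentiable (F j) x) ->
  pd i (fun z => \sum_(j <- r | P j) F j z) x = \sum_(j <- r | P j) pd i (F j) x.
Proof.
move=> H; elim: r => [|j r IH].
  by under eq_fun do rewrite big_nil; rewrite pd_cst big_nil.
under eq_fun do rewrite big_cons; rewrite big_cons; case Pj : (P j) => //.
by rewrite pdD ?IH //; [apply: H|apply: diff_sum].
Qed.

Lemma pdV i f x : f x != 0 -> differentiable f x ->
  pd i (fun z => (f z)^-1) x = - ((f x)^-1 * (f x)^-1 * pd i f x).
Proof.
move=> f0 df; rewrite /pd (@deriveV _ _ f x (bvec i)) //.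
  by rewrite -mulNr -invfM -expr2.
exact: diff_derivable.
Qed.

Lemma is_diff_sqrt (y : R) : 0 < y -> is_diff y Num.sqrt ( *:%R^~ (2 * Num.sqrt y)^-1).
Proof.
move=> y0; have [d e] := is_derive1_sqrt y0.
apply: DiffDef; first exact/derivable1_diffP.
by rewrite deriv1E // derive1E e.
Qed.

Lemma differentiable_comp1 (phi : R -> R) f x : differentiable f x ->
  differentiable phi (f x) -> differentiable (fun z => phi (f z)) x.
Proof. exact: differentiable_comp. Qed.

Lemma pd_comp1 (phi : R -> R) d i f x : differentiable f x ->
  is_derive (f x) 1 phi d ->
  pd i (fun z => phi (f z)) x = d * pd i f x.
Proof.
move=> df [dphi e].
have dp : differentiable phi (f x) by apply/derivable1_diffP.
rewrite /pd deriveE; last exact: differentiable_comp.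
rewrite (diff_comp df dp) /= -(deriveE _ df) (deriv1E dphi) /= derive1E e.
by rewrite /= mulrC.
Qed.

Lemma differentiable_sqrt f x : 0 < f x -> differentiable f x ->
  differentiable (fun z => Num.sqrt (f z)) x.
Proof.
move=> f0 df; apply: differentiable_comp1 => //.
by have [] := is_diff_sqrt f0.
Qed.

Lemma pd_sqrt i f x : 0 < f x -> differentiable f x ->
  pd i (fun z => Num.sqrt (f z)) x = (2 * Num.sqrt (f x))^-1 * pd i f x.
Proof. by move=> f0 df; apply: pd_comp1 => //; apply: is_derive1_sqrt. Qed.

Lemma pd_coord i j x : pd i (fun z : 'rV[R]_n => z 0 j) x = (i == j)%:R.
Proof.
rewrite /pd; have := @derive_mx _ _ 1 n id x (bvec i) (@derivable_id _ _ _ _).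
rewrite derive_id => /matrixP/(_ 0 j); rewrite !mxE eqxx /= => <-.
by rewrite eq_sym.
Qed.

End PdRules.

Section CkTheory.
Context {R : realType} {n : nat}.
Implicit Types (U W : set 'rV[R]_n) (f g : 'rV[R]_n -> R) (x v : 'rV[R]_n).

Lemma Ck_ext k U f g : open U -> (forall x, U x -> f x = g x) ->
  Ck k U f -> Ck k U g.
Proof.
move=> oU; elim: k f g => [|k IH] f g fg /=.
  move=> cf x Ux; have fgx : \forall y \near x, f y = g y.
    by have := open_nbhs_nbhs (conj oU Ux); apply: filterS => z /fg.
  rewrite /prop_for /continuous_at -(fg x Ux).
  apply: cvg_trans (cf x Ux); exact: (@near_eq_cvg _ _ _ _ f g fgx).
move=> [df cf]; split=> [x Ux|i].
  apply: (near_eq_differentiable _ (df x Ux)).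
  by have := open_nbhs_nbhs (conj oU Ux); apply: filterS => z /fg.
apply: (IH _ _ _ (cf i)) => x Ux; exact: (pd_ext i oU Ux fg).
Qed.

Lemma CkW k U f : Ck k.+1 U f -> Ck k U f.
Proof.
elim: k f => [|k IH] f /= [df cf].
  by move=> x /df /differentiable_continuous.
by split=> // i; apply: IH.
Qed.

Lemma Ck_sub k U W f : W `<=` U -> Ck k U f -> Ck k W f.
Proof.
move=> WU; elim: k f => [|k IH] f /=; first by move=> cf x /WU /cf.
by move=> [df cf]; split=> [x /WU /df//|i]; apply: IH.
Qed.

Lemma Ck_cst k U (c : R) : Ck k U (fun=> c).
Proof.
elim: k c => [|k IH] c /=; first by move=> x _; exact: cst_continuous.
split=> [x _|i]; first exact: differentiable_cst.
by rewrite (_ : pd i _ = fun=> 0) //; apply/funext => x; exact: pd_cst.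
Qed.

Lemma CkD k U f g : open U -> Ck k U f -> Ck k U g ->
  Ck k U (fun x => f x + g x).
Proof.
move=> oU; elim: k f g => [|k IH] f g /=.
  by move=> cf cg x Ux; exact: (continuousD (cf x Ux) (cg x Ux)).
move=> [df cf] [dg cg]; split=> [x Ux|i].
  by apply: differentiableD; [exact: df|exact: dg].
apply: (@Ck_ext _ _ (fun x => pd i f x + pd i g x)) => //; last exact: IH.
by move=> x Ux; rewrite pdD //; [exact: df|exact: dg].
Qed.

Lemma CkM k U f g : open U -> Ck k U f -> Ck k U g ->
  Ck k U (fun x => f x * g x).
Proof.
move=> oU; elim: k f g => [|k IH] f g /=.
  by move=> cf cg x Ux; exact: (continuousM (cf x Ux) (cg x Ux)).
move=> Cf Cg; have [df cf] := Cf; have [dg cg] := Cg; split=> [x Ux|i].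
  by apply: differentiableM; [exact: df|exact: dg].
apply: (@Ck_ext _ _ (fun x => pd i f x * g x + f x * pd i g x)) => //.
  by move=> x Ux; rewrite pdM //; [exact: df|exact: dg].
by apply: CkD => //; apply: IH => //; exact: CkW.
Qed.

Lemma CkV k U f : open U -> (forall x, U x -> f x != 0) -> Ck k U f ->
  Ck k U (fun x => (f x)^-1).
Proof.
move=> oU f0; elim: k => [|k IH] /=.
  by move=> cf x Ux; exact: (continuousV (f0 x Ux) (cf x Ux)).
move=> Cf; have [df cf] := Cf; split=> [x Ux|i].
  by apply: differentiableV; [exact: df|exact: f0].
have CV := IH (CkW Cf).
apply: (@Ck_ext _ _ (fun x => -1 * ((f x)^-1 * (f x)^-1 * pd i f x))) => //.
  by move=> x Ux; rewrite pdV //; [ring|exact: f0|exact: df].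
apply: CkM => //; first exact: Ck_cst.
by apply: CkM => //; apply: CkM.
Qed.

Lemma Ck_sqrt k U f : open U -> (forall x, U x -> 0 < f x) -> Ck k U f ->
  Ck k U (fun x => Num.sqrt (f x)).
Proof.
move=> oU f0; elim: k => [|k IH] /=.
  move=> cf x Ux; apply: (@continuous_comp _ _ _ f Num.sqrt); first exact: cf.
  exact: sqrt_continuous.
move=> Cf; have [df cf] := Cf; split=> [x Ux|i].
  by apply: differentiable_sqrt; [exact: f0|exact: df].
have CS := IH (CkW Cf).
apply: (@Ck_ext _ _ (fun x => (2 * Num.sqrt (f x))^-1 * pd i f x)) => //.
  by move=> x Ux; rewrite pd_sqrt //; [exact: f0|exact: df].
apply: CkM => //; apply: CkV => //.
  by move=> x Ux; rewrite mulf_neq0 ?pnatr_eq0 // gt_eqF // sqrtr_gt0 f0.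
by apply: CkM => //; exact: Ck_cst.
Qed.

Lemma Ck_coord k U j : Ck k U (fun x : 'rV[R]_n => x 0 j).
Proof.
case: k => [|k] /=; first by move=> x _; exact: coord_continuous.
split=> [x _|i]; first exact: differentiable_coord.
rewrite (_ : pd i _ = fun=> (i == j)%:R); first exact: Ck_cst.
by apply/funext => x; exact: pd_coord.
Qed.

End CkTheory.

Section Chain.
Context {R : realType} {n p : nat}.
Implicit Types (U : set 'rV[R]_n) (V : set 'rV[R]_p).
Implicit Types (f : 'rV[R]_p -> R) (q : 'rV[R]_n -> 'rV[R]_p).

Lemma jacobianE q x i j : (forall j, differentiable (fun z => q z 0 j) x) ->
  'J q x i j = pd i (fun z => q z 0 j) x.
Proof.
move=> dq; have dqx := differentiable_row dq.
rewrite -[RHS](_ : 'D_(bvec i) q x 0 j = _); last first.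
  by rewrite derive_mx ?mxE //; exact: diff_derivable.
by rewrite deriveEjacobian // /bvec -rowE [RHS]mxE.
Qed.

Lemma differentiable_chain f q x : (forall j, differentiable (fun z => q z 0 j) x) ->
  differentiable f (q x) -> differentiable (fun z => f (q z)) x.
Proof. by move=> /differentiable_row dq df; exact: differentiable_comp. Qed.

Lemma pd_chain f q x i : (forall j, differentiable (fun z => q z 0 j) x) ->
  differentiable f (q x) ->
  pd i (fun z => f (q z)) x = \sum_j pd i (fun z => q z 0 j) x * pd j f (q x).
Proof.
move=> dq df; have dqx := differentiable_row dq.
rewrite /pd deriveE; last exact: differentiable_comp.
rewrite (diff_comp dqx df) /= -!deriveE // derive_sum_pd //.
apply: eq_bigr => j _; congr (_ * _).
by rewrite derive_mx ?mxE //; exact: diff_derivable.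
Qed.

Lemma continuous_row q (x : 'rV[R]_n) :
  (forall j, {for x, continuous (fun z => q z 0 j)}) -> {for x, continuous q}.
Proof.
have FF : Filter (nbhs x) := nbhs_filter x.
move=> cq; apply/(@cvgrPdist_le _ _ _ _ FF) => e e0; near=> y.
rewrite /Num.norm /= mx_normrE (bigmax_le _ (ltW e0)) //= => -[i j] _.
rewrite !mxE !ord1 /=; move: j; near: y; apply: filter_forall => j.
by move/cvgrPdist_le : (cq j); apply.
Unshelve. all: by end_near. Qed.

Lemma Ck_chain k U V f q : open U ->
  (forall x, U x -> V (q x)) -> (forall j, Ck k U (fun z => q z 0 j)) ->
  Ck k V f -> Ck k U (fun z => f (q z)).
Proof.
move=> oU qV; elim: k f => [|k IH] f /=.
  move=> cq cf x Ux.
  apply: (@continuous_comp _ _ _ q f); last exact/cf/qV.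
  by apply: continuous_row => j; exact: cq.
move=> Cq Cf; have [df cf] := Cf.
have dq x : U x -> forall j, differentiable (fun z => q z 0 j) x.
  by move=> Ux j; have [dq _] := Cq j; exact: dq.
split=> [x Ux|i].
  by apply: differentiable_chain; [exact: dq|exact/df/qV].
apply: (@Ck_ext _ _ _ _ (fun x => \sum_j pd i (fun z => q z 0 j) x * pd j f (q x))) => //.
  by move=> x Ux; rewrite pd_chain //; [exact: dq|exact/df/qV].
have IH' j : Ck k U (fun z => pd j f (q z)).
  by apply: IH => // l; exact: CkW.
elim: (index_enum _) => [|j r IHr].
  by under eq_fun do rewrite big_nil; exact: Ck_cst.
under eq_fun do rewrite big_cons; apply: CkD => //; apply: CkM => //.
by have [_] := Cq j.
Qed.

End Chain.

Section SmoothTheory.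
Context {R : realType} {n : nat}.
Implicit Types (U W : set 'rV[R]_n) (f g : 'rV[R]_n -> R) (x v : 'rV[R]_n).

Lemma smooth_diff U f x : smooth U f -> U x -> differentiable f x.
Proof. by move=> /(_ 1%N) [df _] /df. Qed.

Lemma smooth_pd U f i : smooth U f -> smooth U (pd i f).
Proof. by move=> sf k; have [_ H] := sf k.+1; exact: H. Qed.

Lemma smooth_ext U f g : open U -> (forall x, U x -> f x = g x) ->
  smooth U f -> smooth U g.
Proof. by move=> oU fg sf k; apply: (Ck_ext oU fg). Qed.

Lemma smooth_sub U W f : W `<=` U -> smooth U f -> smooth W f.
Proof. by move=> WU sf k; apply: (Ck_sub WU). Qed.

Lemma smooth_cst U (c : R) : smooth U (fun=> c).
Proof. by move=> k; exact: Ck_cst. Qed.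

Lemma smoothD U f g : open U -> smooth U f -> smooth U g ->
  smooth U (fun x => f x + g x).
Proof. by move=> oU sf sg k; apply: CkD. Qed.

Lemma smoothM U f g : open U -> smooth U f -> smooth U g ->
  smooth U (fun x => f x * g x).
Proof. by move=> oU sf sg k; apply: CkM. Qed.

Lemma smoothZ U c f : open U -> smooth U f -> smooth U (fun x => c * f x).
Proof. by move=> oU sf; apply: smoothM => //; exact: smooth_cst. Qed.

Lemma smoothN U f : open U -> smooth U f -> smooth U (fun x => - f x).
Proof.
move=> oU sf; apply: (@smooth_ext U (fun x => -1 * f x)) => //.
  by move=> x _; rewrite mulN1r.
exact: smoothZ.
Qed.

Lemma smoothB U f g : open U -> smooth U f -> smooth U g ->
  smooth U (fun x => f x - g x).
Proof. by move=> oU sf sg; apply: smoothD => //; exact: smoothN. Qed.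

Lemma smoothV U f : open U -> (forall x, U x -> f x != 0) -> smooth U f ->
  smooth U (fun x => (f x)^-1).
Proof. by move=> oU f0 sf k; apply: CkV. Qed.

Lemma smooth_sqrt U f : open U -> (forall x, U x -> 0 < f x) -> smooth U f ->
  smooth U (fun x => Num.sqrt (f x)).
Proof. by move=> oU f0 sf k; apply: Ck_sqrt. Qed.

Lemma smooth_coord U j : smooth U (fun x : 'rV[R]_n => x 0 j).
Proof. by move=> k; exact: Ck_coord. Qed.

Lemma smoothX U f k : open U -> smooth U f -> smooth U (fun x => f x ^+ k).
Proof.
move=> oU sf; elim: k => [|k IH]; first exact: smooth_cst.
by under eq_fun do rewrite exprS; apply: smoothM.
Qed.

Lemma smooth_sum U (I : Type) (r : seq I) (P : pred I) (F : I -> 'rV[R]_n -> R) :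
  open U -> (forall j, smooth U (F j)) ->
  smooth U (fun z => \sum_(j <- r | P j) F j z).
Proof.
move=> oU H; elim: r => [|j r IH].
  by under eq_fun do rewrite big_nil; exact: smooth_cst.
under eq_fun do rewrite big_cons; case Pj : (P j) => //.
by apply: smoothD => //; apply: H.
Qed.

Lemma smooth_prod U (I : Type) (r : seq I) (P : pred I) (F : I -> 'rV[R]_n -> R) :
  open U -> (forall j, smooth U (F j)) ->
  smooth U (fun z => \prod_(j <- r | P j) F j z).
Proof.
move=> oU H; elim: r => [|j r IH].
  by under eq_fun do rewrite big_nil; exact: smooth_cst.
under eq_fun do rewrite big_cons; case Pj : (P j) => //.
by apply: smoothM => //; apply: H.
Qed.

Lemma smooth_continuous U f x : smooth U f -> U x -> {for x, continuous f}.
Proof. by move=> /(_ 0%N); apply. Qed.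

Lemma smooth_near U f x e : open U -> smooth U f -> U x -> 0 < e ->
  \forall y \near x, `|f y - f x| < e.
Proof.
move=> oU sf Ux e0; have /cvgrPdist_lt/(_ e e0) := smooth_continuous sf Ux.
by apply: filterS => y; rewrite distrC.
Qed.

Lemma smooth_det U m (A : 'rV[R]_n -> 'M[R]_m) : open U -> smooth_mx U A ->
  smooth U (fun x => \det (A x)).
Proof.
move=> oU sA; apply: smooth_sum => // s; apply: smoothZ => //.
by apply: smooth_prod => // i; exact: sA.
Qed.

Lemma smooth_mx_ext U m p (A B : 'rV[R]_n -> 'M[R]_(m, p)) : open U ->
  (forall x, U x -> A x = B x) -> smooth_mx U A -> smooth_mx U B.
Proof.
by move=> oU AB sA i j; apply: smooth_ext (sA i j) => // x /AB ->.
Qed.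

Lemma smooth_mx_sub U W m p (A : 'rV[R]_n -> 'M[R]_(m, p)) : W `<=` U ->
  smooth_mx U A -> smooth_mx W A.
Proof. by move=> WU sA i j; apply: smooth_sub (sA i j). Qed.

Lemma smooth_mulmx U m p q (A : 'rV[R]_n -> 'M[R]_(m, p)) (B : 'rV[R]_n -> 'M[R]_(p, q)) :
  open U -> smooth_mx U A -> smooth_mx U B -> smooth_mx U (fun x => A x *m B x).
Proof.
move=> oU sA sB i j; under eq_fun do rewrite mxE.
by apply: smooth_sum => // k; apply: smoothM; [|exact: sA|exact: sB].
Qed.

Lemma smooth_trmx U m p (A : 'rV[R]_n -> 'M[R]_(m, p)) :
  smooth_mx U A -> smooth_mx U (fun x => (A x)^T).
Proof. by move=> sA i j; under eq_fun do rewrite mxE; exact: sA. Qed.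

Lemma smooth_addmx U m p (A B : 'rV[R]_n -> 'M[R]_(m, p)) : open U ->
  smooth_mx U A -> smooth_mx U B -> smooth_mx U (fun x => A x + B x).
Proof.
by move=> oU sA sB i j; under eq_fun do rewrite mxE; apply: smoothD; [|exact: sA|exact: sB].
Qed.

Lemma smooth_oppmx U m p (A : 'rV[R]_n -> 'M[R]_(m, p)) : open U ->
  smooth_mx U A -> smooth_mx U (fun x => - A x).
Proof.
by move=> oU sA i j; under eq_fun do rewrite mxE; apply: smoothN; [|exact: sA].
Qed.

Lemma smooth_scalemx U m p f (A : 'rV[R]_n -> 'M[R]_(m, p)) : open U ->
  smooth U f -> smooth_mx U A -> smooth_mx U (fun x => f x *: A x).
Proof.
by move=> oU sf sA i j; under eq_fun do rewrite mxE; apply: smoothM; [| |exact: sA].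
Qed.

Lemma smooth_cstmx U m p (A : 'M[R]_(m, p)) : smooth_mx U (fun=> A).
Proof. by move=> i j; exact: smooth_cst. Qed.

Lemma smooth_invmx U m (A : 'rV[R]_n -> 'M[R]_m) : open U ->
  (forall x, U x -> A x \in unitmx) -> smooth_mx U A ->
  smooth_mx U (fun x => invmx (A x)).
Proof.
move=> oU uA sA; apply: (@smooth_mx_ext U _ _ (fun x => (\det (A x))^-1 *: \adj (A x))) => //.
  by move=> x Ux; rewrite /invmx uA.
apply: smooth_scalemx => //.
  apply: smoothV => //; last exact: smooth_det.
  by move=> x Ux; have := uA x Ux; rewrite unitmxE unitfE.
move=> i j; under eq_fun do rewrite mxE; apply: smoothZ => //.
apply: smooth_det => // k l; under eq_fun do rewrite !mxE.
exact: sA.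
Qed.

Lemma smooth_grad U f : smooth U f -> smooth_mx U (grad f).
Proof. by move=> sf i j; under eq_fun do rewrite mxE; exact: smooth_pd. Qed.

Lemma derive_smooth U f x v : smooth U f -> U x ->
  'D_v f x = (v *m (grad f x)^T) 0 0.
Proof.
move=> sf Ux; rewrite derive_sum_pd; last exact: smooth_diff Ux.
by rewrite mxE; apply: eq_bigr => i _; rewrite !mxE.
Qed.

Lemma smooth_derive U f (X : 'rV[R]_n -> 'rV[R]_n) : open U -> smooth U f -> smooth_mx U X ->
  smooth U (fun x => 'D_(X x) f x).
Proof.
move=> oU sf sX; apply: (@smooth_ext U (fun x => (X x *m (grad f x)^T) 0 0)) => //.
  by move=> x Ux; rewrite (derive_smooth _ sf Ux).
by apply: smooth_mulmx => //; apply: smooth_trmx; exact: smooth_grad.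
Qed.

End SmoothTheory.

Section SmoothChain.
Context {R : realType} {n p : nat}.
Implicit Types (U : set 'rV[R]_n) (V : set 'rV[R]_p).
Implicit Types (f : 'rV[R]_p -> R) (q : 'rV[R]_n -> 'rV[R]_p).

Lemma smooth_chain U V f q : open U -> (forall x, U x -> V (q x)) ->
  smooth_mx U q -> smooth V f -> smooth U (fun z => f (q z)).
Proof.
by move=> oU qV sq sf k; apply: (Ck_chain oU qV) => // j; exact: sq.
Qed.

Lemma smooth_chain_mx m m' U V (A : 'rV[R]_p -> 'M[R]_(m, m')) q : open U -> (forall x, U x -> V (q x)) ->
  smooth_mx U q -> smooth_mx V A -> smooth_mx U (fun z => A (q z)).
Proof. by move=> oU qV sq sA i j; exact: (smooth_chain oU qV sq (sA i j)). Qed.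

Lemma jacobian_smooth U q x i j : smooth_mx U q -> U x ->
  'J q x i j = pd i (fun z => q z 0 j) x.
Proof. by move=> sq Ux; apply: jacobianE => k; apply: smooth_diff (sq 0 k) Ux. Qed.

Lemma smooth_jacobian U q : open U -> smooth_mx U q -> smooth_mx U (jacobian q).
Proof.
move=> oU sq i j; apply: (@smooth_ext _ _ U (fun x => pd i (fun z => q z 0 j) x)) => //.
  by move=> x Ux; rewrite (jacobian_smooth _ _ sq Ux).
by apply: smooth_pd; exact: sq.
Qed.

Lemma grad_chain U V f q x : smooth_mx U q -> smooth V f -> U x -> V (q x) ->
  grad (fun z => f (q z)) x = pull1 q (grad f) x.
Proof.
move=> sq sf Ux Vq; apply/rowP => i; rewrite !mxE pd_chain.
- by apply: eq_bigr => j _; rewrite [_^T _ _]mxE (jacobian_smooth _ _ sq Ux) [grad _ _ _ _]mxE mulrC.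
- by move=> j; apply: smooth_diff (sq 0 j) Ux.
- exact: smooth_diff Vq.
Qed.

End SmoothChain.

Section Lines.
Context {R : realType} {n : nat}.
Implicit Types (U W : set 'rV[R]_n) (f g : 'rV[R]_n -> R) (x v : 'rV[R]_n).

Lemma is_derive_line f x v (s : R) : differentiable f (x + s *: v) ->
  is_derive s 1 (fun r => f (x + r *: v)) ('D_v f (x + s *: v)).
Proof.
move=> df.
have [dv ev] := derivableP (diff_derivable (v := v) df).
have E : (fun h : R => h^-1 *: (((fun r => f (x + r *: v)) \o shift s) (h *: (1 : R)) - f (x + s *: v)))
   = (fun h : R => h^-1 *: ((f \o shift (x + s *: v)) (h *: v) - f (x + s *: v))).
  apply/funext => h /=; congr (_ *: (f _ - _)).
  by rewrite [h *: 1]mulr1 scalerDl addrCA addrA addrC addrA addrAC.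
by apply: DeriveDef; rewrite /derivable /derive E.
Qed.

Lemma mvt_line f x v (h : R) : 0 < h ->
  (forall s, 0 <= s <= h -> differentiable f (x + s *: v)) ->
  exists2 s, 0 < s < h & f (x + h *: v) - f x = h * 'D_v f (x + s *: v).
Proof.
move=> h0 df.
have [||c] := @MVT R (fun r => f (x + r *: v)) (fun s => 'D_v f (x + s *: v)) 0 h h0.
- move=> s; rewrite in_itv /= => /andP[s0 sh]; apply: is_derive_line; apply: df.
  by rewrite !ltW.
- apply: derivable_within_continuous => s; rewrite in_itv /= => sh.
  by have [] := is_derive_line (df s sh).
rewrite in_itv /= scale0r addr0 subr0 => ch ->; exists c => //.
by rewrite mulrC.
Qed.

(** Two applications of the mean value theorem, first in direction [i] and
    then in direction [j], to the second difference of [f]. *)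
Lemma pd_pd_near U f x i j (e : R) : open U -> smooth U f -> U x -> 0 < e ->
  exists2 h0, 0 < h0 & forall h, 0 < h < h0 ->
   `|f (x + h *: bvec j + h *: bvec i) - f (x + h *: bvec i)
     - (f (x + h *: bvec j) - f x) - h * (h * pd j (pd i f) x)| < e * h ^+ 2.
Proof.
move=> oU sf Ux e0; pose k := pd j (pd i f).
have sk : smooth U k by do 2!apply: smooth_pd.
have : \forall y \near x, U y /\ `|k y - k x| < e.
  apply: filterI; last exact: (smooth_near oU).
  exact: open_nbhs_nbhs.
case/nbhs_ballP => d /= d0 Hd; exists (d / 2); first by rewrite divr_gt0.
move=> h /andP[h0 hd].
have bn l : `|bvec l : 'rV[R]_n| <= 1.
  rewrite /Num.norm /= mx_normrE; apply: bigmax_le => // [[a b] _].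
  by rewrite mxE; case: (_ && _); rewrite ?normr1 ?normr0.
have Hp s t : 0 <= s <= h -> 0 <= t <= h -> ball x d (x + s *: bvec i + t *: bvec j).
  move=> /andP[s0 sh] /andP[t0 th]; rewrite -ball_normE /ball_ /= -addrA opprD addrA subrr add0r normrN.
  apply: le_lt_trans (ler_normD _ _) _; rewrite !normrZ !ger0_norm //.
  have := ler_wpM2l s0 (bn i); have := ler_wpM2l t0 (bn j); lra.
have hh : 0 <= h <= h by rewrite ltW ?lexx.
have h00 : 0 <= (0:R) <= h by rewrite lexx ltW.
have D1 r : 0 <= r <= h -> is_derive r 1 (fun r => f (x + h *: bvec j + r *: bvec i) - f (x + r *: bvec i))
   (pd i f (x + h *: bvec j + r *: bvec i) - pd i f (x + r *: bvec i)).
  move=> rh; apply: is_deriveB; apply: is_derive_line; apply: (smooth_diff sf).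
    by rewrite addrAC; have [] := Hd _ (Hp r h rh hh).
  by have [] := Hd _ (Hp r 0 rh h00); rewrite scale0r addr0.
pose phi r := f (x + h *: bvec j + r *: bvec i) - f (x + r *: bvec i).
pose dphi r := pd i f (x + h *: bvec j + r *: bvec i) - pd i f (x + r *: bvec i).
have [||s] := @MVT R phi dphi 0 h h0.
- move=> r; rewrite in_itv /= => /andP[/ltW r0 /ltW rh].
  by apply: D1; rewrite r0.
- apply: derivable_within_continuous => r; rewrite in_itv /= => rh.
  by have [] := D1 r rh.
rewrite in_itv /= /phi /dphi scale0r !addr0 subr0 => /andP[s0 sh].
have sh' : 0 <= s <= h by rewrite !ltW.
have [t th E2] : exists2 t, 0 < t < h &
   pd i f (x + s *: bvec i + h *: bvec j) - pd i f (x + s *: bvec i) = h * k (x + s *: bvec i + t *: bvec j).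
  apply: mvt_line => // t th; apply: (smooth_diff (smooth_pd i sf)).
  by have [] := Hd _ (Hp s t sh' th).
rewrite [x + h *: _ + s *: _]addrAC E2 => ->.
have th' : 0 <= t <= h by case/andP: th => /ltW -> /ltW ->.
have [_ kk] := Hd _ (Hp s t sh' th').
have E p q : h * p * h - h * (h * q) = h ^+ 2 * (p - q) by ring.
rewrite -/(k x) E.
rewrite normrM gtr0_norm ?exprn_gt0 // mulrC.
by rewrite ltr_pM2r // exprn_gt0.
Qed.

(** Both mixed partials are limits of the same symmetric second difference
    quotient. *)
Lemma schwarz U f x i j : open U -> smooth U f -> U x ->
  pd i (pd j f) x = pd j (pd i f) x.
Proof.
move=> oU sf Ux; apply/eqP; rewrite -subr_eq0 -normr_le0; apply/ler_addgt0Pl => e e0.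
rewrite addr0; have e2 : 0 < e / 2 by rewrite divr_gt0.
have [h1 h10 H1] := pd_pd_near i j oU sf Ux e2.
have [h2 h20 H2] := pd_pd_near j i oU sf Ux e2.
pose h := Num.min h1 h2 / 2.
have m0 : 0 < Num.min h1 h2 by rewrite lt_min h10.
have h0 : 0 < h by rewrite divr_gt0.
have hm : h < Num.min h1 h2 by rewrite ltr_pdivrMr // ltr_pMr // ltr1n.
have /andP[hh1 hh2] : (h < h1) && (h < h2) by rewrite -lt_min.
have A1 := H1 h (introT andP (conj h0 hh1)).
have A2 := H2 h (introT andP (conj h0 hh2)).
rewrite [x + h *: bvec i + _]addrAC in A2.
have hh : 0 < h ^+ 2 by rewrite exprn_gt0.
rewrite -(ler_pM2r hh) -[in leLHS](gtr0_norm hh) -normrM.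
move: A1 A2 hh; move: (f (x + h *: bvec j + h *: bvec i)) (f (x + h *: bvec i)) (f (x + h *: bvec j)) (f x) (pd i (pd j f) x) (pd j (pd i f) x).
clear hh1 hh2 h0 hm; move: h => h a b c d p q.
rewrite ltr_norml => /andP[B1 B2]; rewrite ltr_norml => /andP[B3 B4] hh.
by rewrite ler_norml; apply/andP; split; lra.
Qed.

End Lines.

(** * The inverse function theorem *)

Section Rows.
Context {R : realType} {n : nat}.
Implicit Types (v w x : 'rV[R]_n).

Lemma row_norm_le v (c : R) : 0 <= c -> (forall j, `|v 0 j| <= c) -> `|v| <= c.
Proof.
move=> c0 H; rewrite /Num.norm /= mx_normrE; apply: bigmax_le => // [[i j] _] /=.
by rewrite ord1.
Qed.

Lemma row_coord_le v j : `|v 0 j| <= `|v|.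
Proof.
rewrite [leRHS]/Num.norm /= mx_normrE.
exact: (@le_bigmax _ _ _ _ (fun ij : 'I_1 * 'I_n => `|v ij.1 ij.2|) (0, j)).
Qed.

Lemma ball_rowP x v (r : R) : ball x r v <-> `|v - x| < r.
Proof. by rewrite -ball_normE /ball_ /= distrC. Qed.

Lemma near_forall m x (P : 'I_m -> set 'rV[R]_n) :
  (forall l, \forall h \near x, P l h) -> \forall h \near x, forall l, P l h.
Proof. by move=> H; exact: (@filter_forall _ _ P (nbhs x) (nbhs_filter x) H). Qed.

Lemma ball_convex x v w (r s : R) : ball x r v -> ball x r w -> 0 <= s <= 1 ->
  ball x r (v + s *: (w - v)).
Proof.
move=> /ball_rowP Hv /ball_rowP Hw /andP[s0 s1]; apply/ball_rowP.
rewrite (_ : _ - x = (1 - s) *: (v - x) + s *: (w - x)); last first.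
  by apply/rowP => j; rewrite !mxE; ring.
have s1' : 0 <= 1 - s by rewrite subr_ge0.
apply: le_lt_trans (ler_normD _ _) _; rewrite !normrZ !ger0_norm //.
move: (`|v - x|) (`|w - x|) Hv Hw => p q pr qr.
have [s0'|s0'] := eqVneq s 0; first by rewrite s0'; lra.
have : 0 < s * (r - q) by rewrite mulr_gt0 ?lt_def ?s0' ?subr_ge0 ?subr_eq0 ?gt_eqF // ltW.
have : 0 <= (1 - s) * (r - p) by rewrite mulr_ge0 // subr_ge0 ltW.
lra.
Qed.

End Rows.

Section Bounds.
Context {R : realType} {n : nat}.

Lemma mulmx_bound p (L : 'M[R]_(n, p)) : exists2 C, 0 < C & forall v : 'rV[R]_n, `|v *m L| <= C * `|v|.
Proof.
exists (1 + \sum_i \sum_j `|L i j|).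
  by apply: ltr_wpDr => //; apply: sumr_ge0 => i _; apply: sumr_ge0.
move=> v; apply: row_norm_le => [|j].
  by rewrite mulr_ge0 // addr_ge0 //; apply: sumr_ge0 => i _; apply: sumr_ge0.
rewrite mxE mulrDl mul1r; apply: le_trans (ler_norm_sum _ _ _) _.
apply: ler_wpDl => //; rewrite mulr_suml; apply: ler_sum => i _.
rewrite normrM mulrC; apply: ler_pM => //; last exact: row_coord_le.
by rewrite (bigD1 j) //= lerDl; apply: sumr_ge0.
Qed.

End Bounds.

Section InverseFunction.
Context {R : realType} {n : nat}.
Implicit Types (U : set 'rV[R]_n) (f : 'rV[R]_n -> 'rV[R]_n) (x : 'rV[R]_n).

(** The mean value theorem on a convex ball; the supremum norm sums [n]
    partials, and [n.+1] keeps the constant nonzero for [n = 0]. *)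
Lemma small_partials_lipschitz (k : 'rV[R]_n -> 'rV[R]_n) x0 r :
  (forall x j, ball x0 r x -> differentiable (fun z => k z 0 j) x) ->
  (forall x i j, ball x0 r x -> `|pd i (fun z => k z 0 j) x| <= (2 * n.+1%:R)^-1) ->
  forall x x', ball x0 r x -> ball x0 r x' -> `|k x' - k x| <= 2^-1 * `|x' - x|.
Proof.
move=> dk bk x x' bx bx'.
apply: row_norm_le => [|j]; first by rewrite mulr_ge0 ?invr_ge0.
have [|s /andP[s0 s1]] := @mvt_line R n (fun z => k z 0 j) x (x' - x) 1 ltr01.
  by move=> s hs; apply: dk; exact: ball_convex.
rewrite scale1r addrCA subrr addr0 mul1r !mxE => ->.
have bs : ball x0 r (x + s *: (x' - x)) by apply: ball_convex; rewrite // !ltW.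
rewrite derive_sum_pd; last exact: dk.
apply: le_trans (ler_norm_sum _ _ _) _.
apply: (@le_trans _ _ (\sum_(i < n) `|x' - x| * (2 * n.+1%:R)^-1)).
  apply: ler_sum => i _; rewrite normrM; apply: ler_pM => //; first exact: row_coord_le.
  exact: bk.
rewrite sumr_const card_ord -[_ *+ n]mulr_natr invfM.
rewrite (_ : _ * _ * _ = 2^-1 * `|x' - x| * (n%:R * n.+1%:R^-1)); last first.
  by move: (n.+1%:R^-1) (n%:R) (`|_|) => a b c; ring.
apply: ler_piMr; first by rewrite mulr_ge0 ?invr_ge0.
by rewrite ler_pdivrMr ?ltr0Sn // mul1r ler_nat.
Qed.

Lemma near_neq0 (p q : R) : `|p - q| < `|q| -> p != 0.
Proof. by move=> H; apply: contraTneq H => ->; rewrite sub0r normrN ltxx. Qed.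

(** Banach's theorem on a closed ball. *)
Lemma contraction_fixpoint (k : 'rV[R]_n -> 'rV[R]_n) x0 r : 0 < r ->
  (forall x, `|x0 - x| <= r -> `|x0 - k x| <= r) ->
  (forall x x', `|x0 - x| <= r -> `|x0 - x'| <= r -> `|k x - k x'| <= 2^-1 * `|x - x'|) ->
  exists2 x, `|x0 - x| <= r & k x = x.
Proof.
move=> r0 kr kl; pose B : set 'rV[R]_n := closed_ball_ (fun v : 'rV[R]_n => `|v|) x0 r.
have kB : {homo k : x / B x >-> B x} by move=> x; exact: kr.
pose X : completeNormedModType R := HB.pack 'rV[R]_n.
have [|||x Bx Ex] := @banach_fixed_point R X B (mkfun_fun kB).
- exists (2^-1)%:nng; split => /=; first by rewrite invf_lt1 // ltr1n.
  by move=> [x x'] [/= Bx Bx']; exact: kl.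
- exact: closed_closed_ball_.
- by exists x0; rewrite /B /closed_ball_ /= subrr normr0 ltW.
by exists x => //; rewrite {2}Ex.
Qed.

(** Newton's method with frozen derivative: [x |-> x - (f x - y) L] with [L]
    the inverse of the differential at [x0] is a contraction, uniformly in
    [y].  The inverse is Lipschitz, hence differentiable, and its partials are
    rational in those of [f] composed with it, so smoothness follows by
    induction on the order. *)
Theorem inverse_function U f x0 : open U -> smooth_mx U f -> U x0 ->
  'J f x0 \in unitmx ->
  exists (A : set 'rV[R]_n) (d : R) (g : 'rV[R]_n -> 'rV[R]_n),
    [/\ open A /\ A x0, A `<=` U, 0 < d /\ smooth_mx (ball (f x0) d) g,
     forall x, A x -> [/\ ball (f x0) d (f x), g (f x) = x & 'J f x \in unitmx] &
     forall y, ball (f x0) d y -> A (g y) /\ f (g y) = y].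
Proof.
move=> oU sf Ux0 uJ; pose L := invmx ('J f x0).
pose k x := x - f x *m L.
have sk : smooth_mx U k.
  apply: smooth_addmx => //; first by move=> i j; rewrite ord1; exact: smooth_coord.
  by apply: smooth_oppmx => //; apply: smooth_mulmx => //; exact: smooth_cstmx.
have pk0 i j : pd i (fun z => k z 0 j) x0 = 0.
  rewrite (_ : (fun z => k z 0 j) = fun z => z 0 j - \sum_l f z 0 l * L l j); last first.
    by apply/funext => z; rewrite !mxE.
  rewrite pdB ?pd_coord; first last.
  - apply: diff_sum => l _; apply: differentiableM => //.
    exact: smooth_diff (sf _ _) Ux0.
  - exact: differentiable_coord.
  rewrite pd_sum => [|l _]; last first.
    by apply: differentiableM => //; exact: smooth_diff (sf _ _) Ux0.
  have -> : (i == j)%:R = (1%:M : 'M[R]_n) i j by rewrite mxE.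
  rewrite -(mulmxV uJ) mxE; apply/eqP; rewrite subr_eq0; apply/eqP.
  apply: eq_bigr => l _; rewrite pdM //; last exact: smooth_diff (sf _ _) Ux0.
  by rewrite pd_cst mulr0 addr0 (jacobian_smooth _ _ sf Ux0).
have N0 : 0 < (2 * n.+1%:R)^-1 :> R by rewrite invr_gt0 mulr_gt0 // ltr0Sn.
have sJ : smooth U (fun x => \det ('J f x)) by apply: smooth_det => //; exact: smooth_jacobian.
have dJ0 : 0 < `|\det ('J f x0)| by rewrite normr_gt0 -unitfE -unitmxE.
have : \forall x \near x0, [/\ U x, forall i j, `|pd i (fun z => k z 0 j) x| < (2 * n.+1%:R)^-1 &
     'J f x \in unitmx].
  near=> x; split.
  - by near: x; exact: open_nbhs_nbhs.
  - near: x; apply: near_forall => i; apply: near_forall => j.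
    have := smooth_near oU (smooth_pd i (sk 0 j)) Ux0 N0; apply: filterS => x.
    by rewrite pk0 subr0.
  - rewrite unitmxE unitfE; near: x.
    have := smooth_near oU sJ Ux0 dJ0; apply: filterS => x.
    exact: near_neq0.
case/nbhs_ballP => r /= r0 Hr.
have lk x x' : ball x0 r x -> ball x0 r x' -> `|k x' - k x| <= 2^-1 * `|x' - x|.
  apply: small_partials_lipschitz => z.
    by move=> j /Hr [Uz _ _]; exact: smooth_diff (sk 0 j) Uz.
  by move=> i j /Hr [_ H _]; rewrite ltW.
have [C C0 HC] := mulmx_bound L.
(* With this radius the iteration maps the ball of radius [r / 2] into itself.
   *)
pose d := r / (4 * C).
have d0 : 0 < d by rewrite divr_gt0 // mulr_gt0.
pose A := [set x | ball x0 r x /\ ball (f x0) d (f x)].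
have bilip x x' : ball x0 r x -> ball x0 r x' -> `|x' - x| <= 2 * C * `|f x' - f x|.
  move=> bx bx'; have := lk x x' bx bx'; have := HC (f x' - f x).
  have -> : x' - x = (k x' - k x) + (f x' - f x) *m L.
    by apply/rowP => j; rewrite mulmxBl !mxE; ring.
  have := ler_normD (k x' - k x) ((f x' - f x) *m L).
  move: (`|k x' - k x|) (`|_ *m L|) (`|_ + _|) (`|f x' - f x|) => a b c e; nra.
have ex y : ball (f x0) d y -> exists2 x, `|x0 - x| <= r / 2 & f x = y.
  move=> /ball_rowP yd.
  have h0 : 0 < r / 2 by rewrite divr_gt0.
  have inr x : `|x0 - x| <= r / 2 -> ball x0 r x.
    by move=> h; apply/ball_rowP; rewrite distrC (le_lt_trans h) // ltr_pdivrMr // ltr_pMr // ltr1n.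
  have [||x xr] := @contraction_fixpoint (fun x => k x + y *m L) x0 (r / 2) h0.
  - move=> x xr; have bx := inr x xr; have := lk x x0 bx (ballxx _ r0).
    have := HC (y - f x0).
    have -> : x0 - (k x + y *m L) = (k x0 - k x) - (y - f x0) *m L.
      by apply/rowP => j; rewrite mulmxBl !mxE; ring.
    have := ler_normB (k x0 - k x) ((y - f x0) *m L).
    have : C * `|y - f x0| <= r / 4.
      by move: yd => /ltW; rewrite /d invfM mulrA ler_pdivlMr // mulrC.
    move: xr; move: (`|k x0 - k x|) (`|_ *m L|) (`|_ - _ *m L|) (`|y - f x0|) (`|x0 - x|) => a b c e g; lra.
  - move=> x x' /inr bx /inr bx'; rewrite (_ : _ - _ = k x - k x'); last first.
      by apply/rowP => j; rewrite !mxE; ring.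
    exact: lk.
  move=> E; exists x => //.
  have : (y - f x) *m L = 0.
    rewrite mulmxBl; move/rowP: E => E; apply/rowP => j; have := E j.
    by rewrite !mxE; lra.
  move/(congr1 (mulmx^~ ('J f x0))); rewrite -mulmxA mulVmx // mulmx1 mul0mx.
  by move/eqP; rewrite subr_eq0 => /eqP.
have inr x : `|x0 - x| <= r / 2 -> ball x0 r x.
  by move=> h; apply/ball_rowP; rewrite distrC (le_lt_trans h) // ltr_pdivrMr // ltr_pMr // ltr1n.
have /choice [g gP] : forall y, exists x, ball (f x0) d y -> `|x0 - x| <= r / 2 /\ f x = y.
  move=> y; case: (pselect (ball (f x0) d y)) => [/ex[x h1 h2]|h]; last by exists x0.
  by exists x.
have gA y : ball (f x0) d y -> A (g y) /\ f (g y) = y.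
  by move=> By; have [h e] := gP y By; rewrite /A /= e; split => //; split=> //; exact: inr.
have gf x : A x -> g (f x) = x.
  move=> [bx bf]; have [[bg _] e] := gA _ bf.
  have := bilip _ _ bx bg; rewrite e subrr normr0 mulr0 normr_le0 subr_eq0.
  by move/eqP.
have cf x : U x -> {for x, continuous f}.
  by move=> Ux; apply: continuous_row => j; exact: smooth_continuous (sf 0 j) Ux.
have oA : open A.
  rewrite openE => x [bx bf]; rewrite /interior.
  apply: filterI; first by apply: open_nbhs_nbhs; split=> //; exact: ball_open.
  have [Ux _ _] := Hr x bx; have := cf x Ux; apply.
  by apply: open_nbhs_nbhs; split=> //; exact: ball_open.
have dg y j : ball (f x0) d y -> differentiable (fun z => g z 0 j) y /\
    forall v, 'D_v (fun z => g z 0 j) y = (v *m (invmx ('J f (g y)) *m (delta_mx j 0 : 'cV[R]_n))) 0 0.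
  move=> By; have [[bg Bg] fg] := gA _ By; have [Ug _ ug] := Hr _ bg.
  pose M := invmx ('J f (g y)).
  have [C' C'0 HC'] := mulmx_bound M.
  apply: diff_eps_mx => e e0.
  have : \forall h \near (0 : 'rV[R]_n), forall l, `|f (h + g y) 0 l - f (g y) 0 l - (h *m 'J f (g y)) 0 l|
      <= e / (C' * (2 * C)) * `|h|.
    apply: near_forall => l.
    have dfl := smooth_diff (sf 0 l) Ug.
    have := diff_eps_inv dfl; move/(_ (e / (C' * (2 * C)))).
    rewrite divr_gt0 ?mulr_gt0 // => /(_ isT); apply: filterS => h.
    rewrite -deriveE // derive_sum_pd // [(h *m _) _ _]mxE.
    by under eq_bigr do rewrite -(jacobian_smooth _ _ sf Ug).
  case/nbhs_ballP => rho /= rho0 Hrho.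
  have : \forall h \near (0 : 'rV[R]_n), ball (f x0) d (h + y) /\ `|h| < rho / (2 * C).
    apply: filterI.
      apply: (near_shift0 (ball (f x0) d) y).1.
    by apply: open_nbhs_nbhs; split=> //; exact: ball_open.
    apply/nbhs_ballP; exists (rho / (2 * C)) => /=; first by rewrite divr_gt0 // mulr_gt0.
    by move=> h /ball_rowP; rewrite subr0.
  apply: filterS => h [Bh hr].
  have [[bg' _] fg'] := gA _ Bh.
  have := bilip _ _ bg bg'; rewrite fg fg' addrK => kh.
  have bk : ball (0 : 'rV[R]_n) rho (g (h + y) - g y).
    apply/ball_rowP; rewrite subr0 (le_lt_trans kh) // mulrC -ltr_pdivlMr // mulr_gt0 //.
  have := Hrho _ bk; rewrite subrK fg fg' => E.
  have E' : `|h - (g (h + y) - g y) *m 'J f (g y)| <= e / (C' * (2 * C)) * `|g (h + y) - g y|.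
    apply: row_norm_le => [|l].
      by rewrite mulr_ge0 // divr_ge0 ?ltW // mulr_gt0 // mulr_gt0.
    by have := E l; rewrite !mxE addrK.
  have -> : g (h + y) 0 j - g y 0 j - (h *m (M *m (delta_mx j 0 : 'cV[R]_n))) 0 0
     = ((-1) *: ((h - (g (h + y) - g y) *m 'J f (g y)) *m M)) 0 j.
    rewrite mulmxBl -mulmxA mulmxV // mulmx1 mulmxA -colE !mxE; ring.
  apply: le_trans (row_coord_le _ _) _; rewrite normrZ normrN1 mul1r.
  apply: le_trans (HC' _) _; apply: le_trans (ler_wpM2l (ltW C'0) E') _.
  apply: le_trans (ler_wpM2l (ltW C'0) (ler_wpM2l _ kh)) _.
    by rewrite divr_ge0 ?ltW // mulr_gt0 // mulr_gt0.
  have F m : C' * (e / (C' * (2 * C)) * (2 * C * m)) = e * m.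
    by field; rewrite !gt_eqF.
  by rewrite F.
exists A, d, g; split.
- by split; [exact: oA|split; exact: ballxx].
- by move=> x [/Hr[]].
- split; first exact: d0.
  move=> i j l; rewrite (ord1 i) => {i}; elim: l j => [|l IH] j /=.
    by move=> y By; have [+ _] := dg y j By; exact: differentiable_continuous.
  split=> [y By|i]; first by have [] := dg y j By.
  apply: (@Ck_ext _ _ _ _ (fun y => invmx ('J f (g y)) i j)) => [|y By|].
  - exact: ball_open.
  - by rewrite /pd; have [_ ->] := dg y j By; rewrite /bvec mulmxA -rowE -colE [RHS]mxE [RHS]mxE.
  apply: (@Ck_chain _ _ _ _ _ A (fun x => invmx ('J f x) i j)).
  - exact: ball_open.
  - by move=> y /gA[].
  - exact: IH.
  - apply: (smooth_invmx oA _ _); first by move=> x [/Hr[_ _ u] _]; exact: u.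
    by apply: smooth_mx_sub (smooth_jacobian oU sf) => x [/Hr[Ux _ _] _]; exact: Ux.
- by move=> x Ax; have [/Hr[_ _ u] bf] := Ax; split; [exact: bf|exact: gf|exact: u].
- exact: gA.
Unshelve. all: by end_near.
Qed.

End InverseFunction.

(** * Integration along a coordinate and the Poincare lemma *)

Section Antiderivative1.
Context {R : realType}.

(** Integration over an interval larger than the one considered, to have
    two-sided derivatives in its interior. *)
Lemma antiderivative1 (k : R -> R) (p q : R) (a : R) :
  p < a < q -> (forall u, p <= u <= q -> {for u, continuous k}) ->
  exists G : R -> R, G a = 0 /\ forall u, p < u < q -> is_derive u 1 G (k u).
Proof.
move=> /andP[pa aq] ck.
have ci : lebesgue_measure.-integrable `[p, q] (EFin \o k).
  apply: continuous_compact_integrable; first exact: segment_compact.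
  apply/continuous_in_subspaceT => u; rewrite inE /= in_itv /=; exact: ck.
pose G0 := fun x : R => (\int[lebesgue_measure]_(t in [set` `[p, x]]) (k t))%R.
have D u : p < u < q -> is_derive u 1 G0 (k u).
  move=> /andP[pu uq].
  have [] := @continuous_FTC1_closed R k p u q uq ci pu.
    by apply: ck; rewrite !ltW.
  move=> h1 h2; apply: DeriveDef; first exact: h1.
  by rewrite -derive1E; exact: h2.
move: G0 D => G0 D.
exists (fun x => G0 x - G0 a); split; first by rewrite subrr.
move=> u /D Du; have [d1 d2] := Du; apply: DeriveDef.
  by apply: derivableB; [exact: d1|exact: derivable_cst].
rewrite (deriveB d1 (derivable_cst _ _ _)).
by rewrite derive_cst subr0.
Qed.

Lemma mvt_abs (H : R -> R) dH (a b M : R) :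
  (forall u, Num.min a b <= u <= Num.max a b -> is_derive u 1 H (dH u)) ->
  (forall u, Num.min a b <= u <= Num.max a b -> `|dH u| <= M) ->
  `|H b - H a| <= M * `|b - a|.
Proof.
wlog ab : a b / a <= b.
  move=> W D B; have [ab|/ltW ba] := leP a b; first exact: W.
  by rewrite distrC [`|b - a|]distrC; apply: W => //; rewrite minC maxC.
rewrite (min_l ab) (max_r ab) => D B.
have [->|nab] := eqVneq a b; first by rewrite !subrr normr0 mulr0.
have {nab}ab : a < b by rewrite lt_def eq_sym nab.
have [||c cab ->] := @MVT R H dH a b ab.
- move=> u; rewrite in_itv /= => /andP[/ltW ua /ltW ub]; apply: D.
  by rewrite ua ub.
- apply: derivable_within_continuous => u; rewrite in_itv /= => ub.
  by have [] := D u ub.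
rewrite normrM ler_wpM2r //; apply: B.
by move: cab; rewrite in_itv /= => /andP[/ltW -> /ltW ->].
Qed.

End Antiderivative1.

Section Antiderivative.
Context {R : realType} {n : nat}.
Implicit Types (c x y h : 'rV[R]_n) (f : 'rV[R]_n -> R).

Definition upd (i : 'I_n) x (u : R) : 'rV[R]_n := x + (u - x 0 i) *: bvec i.

Lemma updE i x u j : upd i x u 0 j = if j == i then u else x 0 j.
Proof.
rewrite !mxE eqxx /=; case: eqP => [->|_]; last by rewrite mulr0 addr0.
by rewrite mulr1 addrC subrK.
Qed.

Lemma ball_coordP c x (r : R) : 0 < r -> ball c r x <-> forall j, `|x 0 j - c 0 j| < r.
Proof.
move=> r0; split=> [/ball_rowP H j|H].
  by apply: le_lt_trans H; have := row_coord_le (x - c) j; rewrite !mxE.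
apply/ball_rowP; rewrite /Num.norm /= mx_normrE; apply: bigmax_lt => // [[i j] _].
by rewrite /= ord1 !mxE.
Qed.

Lemma ball_upd c x r i u : 0 < r -> ball c r x -> `|u - c 0 i| < r -> ball c r (upd i x u).
Proof.
move=> r0 /(ball_coordP _ _ r0) H hu; apply/ball_coordP => // j.
by rewrite updE; case: eqP => [->|_].
Qed.

Lemma is_derive_upd f i x u : differentiable f (upd i x u) ->
  is_derive u 1 (fun v => f (upd i x v)) (pd i f (upd i x u)).
Proof.
move=> df; have E v : upd i x v = upd i x 0 + v *: bvec i.
  by rewrite /upd -addrA -scalerDl; congr (_ + _ *: _); ring.
rewrite E in df *.
rewrite (_ : (fun v => f (upd i x v)) = fun v => f (upd i x 0 + v *: bvec i)).
  exact: is_derive_line.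
by apply/funext => v; rewrite E.
Qed.

(** A tube lemma around a compact segment parallel to the [i]-th axis. *)
Lemma uniform_near_upd f i x (a b e : R) : 0 < e ->
  (forall u, a <= u <= b -> {for upd i x u, continuous f}) ->
  exists2 d, 0 < d & forall u z, a <= u <= b -> `|z - upd i x u| < d ->
     `|f z - f (upd i x u)| < e.
Proof.
move=> e0 cf.
have /compact_near_coveringP cc := @segment_compact R a b.
have FF : Filter (nbhs (0 : 'rV[R]_n)) := nbhs_filter (0 : 'rV[R]_n).
have : \forall h \near (0 : 'rV[R]_n), `[a, b] `<=` (fun u => `|f (h + upd i x u) - f (upd i x u)| < e).
  apply: (cc 'rV[R]_n (nbhs (0 : 'rV[R]_n)) (fun h u => `|f (h + upd i x u) - f (upd i x u)| < e) FF).
  move=> u; rewrite /= in_itv /= => uab.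
  have /cvgrPdist_lt/(_ (e / 2)) := cf u uab.
  rewrite divr_gt0 // => /(_ isT) /nbhs_ballP[r /= r0 Hr].
  have bn w : `|upd i x w - upd i x u| <= `|w - u|.
    rewrite /upd opprD addrACA subrr add0r -scalerBl normrZ.
    have -> : w - x 0 i - (u - x 0 i) = w - u by ring.
    rewrite ler_piMr //; apply: row_norm_le => // j.
    by rewrite mxE; case: (_ && _); rewrite ?normr1 ?normr0.
  exists (ball u (r / 2), ball (0 : 'rV[R]_n) (r / 2)) => /=.
    by split; apply: nbhsx_ballx; rewrite divr_gt0.
  move=> [w h] /= [bw /ball_rowP]; rewrite subr0 => bh.
  have {}bw : `|w - u| < r / 2 by move: bw; rewrite /ball /= distrC.
  have b1 : ball (upd i x u) r (upd i x w).
    by apply/ball_rowP; apply: le_lt_trans (bn w) _; lra.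
  have b2 : ball (upd i x u) r (h + upd i x w).
    apply/ball_rowP; rewrite -addrA; apply: le_lt_trans (ler_normD _ _) _.
    have := bn w; move: (`|upd i x w - _|) => q; lra.
  have := Hr _ b1; have := Hr _ b2 => /=.
  move: (f (upd i x u)) (f (upd i x w)) (f (h + upd i x w)) => p q s.
  rewrite !ltr_norml => /andP[A1 A2] /andP[A3 A4]; apply/andP; split; lra.
case/nbhs_ballP => r /= r0 Hr; exists r => // u z uab zr.
have bz : ball (0 : 'rV[R]_n) r (z - upd i x u) by apply/ball_rowP; rewrite subr0.
have := Hr _ bz u.
by rewrite /= in_itv /= subrK; apply.
Qed.

Variables (c : 'rV[R]_n) (r r' : R) (i : 'I_n).
Hypotheses (r'0 : 0 < r') (r'r : r' < r).

(** A primitive of [f] on the line through [x] parallel to the [i]-th axis,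
    normalized at the hyperplane through the centre. *)
Definition line_primitive f x (G : R -> R) := G (c 0 i) = 0 /\
  forall u, `|u - c 0 i| < r' -> is_derive u 1 G (f (upd i x u)).

Definition antider f x : R := xget (fun=> 0) (line_primitive f x) (x 0 i).

Lemma antiderP f x : smooth (ball c r) f -> ball c r' x ->
  line_primitive f x (xget (fun=> 0) (line_primitive f x)).
Proof.
move=> sf bx; suff [G GP] : exists G, line_primitive f x G by exact: (xgetPex _ (ex_intro _ G GP)).
have r0 : 0 < r by apply: lt_trans r'r.
have bx' : ball c r x by move/ball_rowP: bx => bx; apply/ball_rowP; apply: lt_trans r'r.
have [||G [G0 dG]] := @antiderivative1 R (fun u => f (upd i x u)) (c 0 i - r') (c 0 i + r') (c 0 i).
- by rewrite gtrBl ltrDl r'0.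
- move=> u /andP[u1 u2].
  have bu : ball c r (upd i x u).
    by apply: ball_upd => //; apply: le_lt_trans r'r; rewrite ler_distl u1 u2.
  have [+ _] := is_derive_upd (smooth_diff sf bu).
  by move/derivable1_diffP => /differentiable_continuous.
exists G; split=> // u; rewrite ltr_distl => /andP[u1 u2]; apply: dG; by rewrite u1 u2.
Qed.

Lemma is_derive_lin (G1 G2 : R -> R) (I : finType) (P : pred I) (a : I -> R) (K : I -> R -> R) (g1 g2 : R) (k : I -> R) (u : R) :
  is_derive u 1 G1 g1 -> is_derive u 1 G2 g2 -> (forall j, P j -> is_derive u 1 (K j) (k j)) ->
  is_derive u 1 (fun v => G1 v - G2 v - \sum_(j | P j) a j * K j v) (g1 - g2 - \sum_(j | P j) a j * k j).
Proof.
move=> D1 D2 DK; have D12 := is_deriveB D1 D2.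
suff DS : is_derive u 1 (fun v => \sum_(j | P j) a j * K j v) (\sum_(j | P j) a j * k j).
  exact: is_deriveB D12 DS.
elim: (index_enum I) => [|j s IH].
  by rewrite big_nil; under eq_fun do rewrite big_nil; exact: is_derive_cst.
under eq_fun do rewrite big_cons; rewrite big_cons; case Pj : (P j) => //.
by apply: is_deriveD => //; apply: is_deriveZ; exact: DK.
Qed.

(** Differentiation under the integral sign, without integrals: subtract from
    the increment of the primitive its expected first order part, and bound
    the derivative of the result along the segment, uniformly by compactness.
    *)
Lemma antider_diff f x : smooth (ball c r) f -> ball c r' x ->
  differentiable (antider f) x /\
  forall v, 'D_v (antider f) x = (v *m (\col_j if j == i then f x else antider (pd j f) x)) 0 0.
Proof.
move=> sf bx; apply: diff_eps_mx => e e0.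
have r0 : 0 < r by apply: lt_trans r'r.
have inr z : ball c r' z -> ball c r z.
  by move=> /ball_rowP bz; apply/ball_rowP; apply: lt_trans r'r.
have [Gx0 dGx] := antiderP sf bx.
pose K j := xget (fun=> 0) (line_primitive (pd j f) x).
have KP j : line_primitive (pd j f) x (K j) by apply: antiderP => //; exact: smooth_pd.
set Gx := xget _ _ in Gx0 dGx.
have xc : `|x 0 i - c 0 i| < r' by apply: (ball_coordP c x r'0).1 bx i.
pose a := Num.min (c 0 i) (x 0 i); pose b := Num.max (c 0 i) (x 0 i).
have ab u : a <= u <= b -> `|u - c 0 i| < r'.
  rewrite /a /b; move: xc; rewrite !ltr_norml; move: (c 0 i) (x 0 i) => p q.
  by case: (leP p q) => _ /andP[h1 h2] /andP[h3 h4]; apply/andP; split; lra.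
have inu u : a <= u <= b -> ball c r' (upd i x u) by move=> /ab; exact: ball_upd.
(* The error is integrated over a length at most [r'] and summed over [n]
   directions; the other half of [e] is for the moving endpoint. *)
pose eta := e / 2 / (r' * n.+1%:R).
have eta0 : 0 < eta by rewrite !divr_gt0 // mulr_gt0 // ltr0Sn.
have : \forall d \near (0 : R)^'+, forall j u z, a <= u <= b -> `|z - upd i x u| < d ->
    `|pd j f z - pd j f (upd i x u)| < eta.
  apply: filter_forall => j.
  have [u uab|d d0 Hd] := @uniform_near_upd (pd j f) i x a b eta eta0.
    exact: (smooth_continuous (smooth_pd j sf) (inr _ (inu u uab))).
  near=> d' => u z uab zd; apply: Hd => //; apply: lt_trans zd _.
  by near: d'; exact: nbhs_right_lt.
move=> Hu.
have [d d0 Hd] : exists2 d : R, 0 < d & forall j u z, a <= u <= b -> `|z - upd i x u| < d ->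
    `|pd j f z - pd j f (upd i x u)| < eta.
  have [|d [d0 Hd]] := @filter_ex _ (0^'+) _ (fun d : R => 0 < d /\ forall j u z, a <= u <= b -> `|z - upd i x u| < d ->
    `|pd j f z - pd j f (upd i x u)| < eta).
    by apply: filterI => //; exact: nbhs_right_gt.
  by exists d.
have e2 : 0 < e / 2 by rewrite divr_gt0.
have := smooth_near (ball_open c r) sf (inr _ bx) e2; case/nbhs_ballP => rho /= rho0 Hrho.
have bc : \forall h \near (0 : 'rV[R]_n), ball c r' (h + x).
  by apply: (near_shift0 (ball c r') x).1; apply: open_nbhs_nbhs; split=> //; exact: ball_open.
near=> h.
have hd : `|h| < d.
  by near: h; apply/nbhs_ballP; exists d => // h /ball_rowP; rewrite subr0.
have hrho : `|h| < rho.
  by near: h; apply/nbhs_ballP; exists rho => // h /ball_rowP; rewrite subr0.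
have by_ : ball c r' (h + x) by near: h.
have [Gy0 dGy] := antiderP sf by_.
rewrite /antider -/Gx; set Gy := xget _ (line_primitive f (h + x)) in Gy0 dGy *.
pose h' := h - h 0 i *: bvec i.
have updh u : upd i (h + x) u = upd i x u + h'.
  apply/rowP => j; rewrite [RHS]mxE !updE !mxE eqxx /=.
  by case: eqP => [->|_]; rewrite ?mulr1 ?mulr0; ring.
have h'n : `|h'| <= `|h|.
  apply: row_norm_le => // j; rewrite !mxE eqxx /=; case: eqP => [->|_].
    by rewrite mulr1 subrr normr0.
  by rewrite mulr0 subr0 row_coord_le.
(* The increment of the primitive minus its expected linear part in the other
   directions. *)
pose H u := Gy u - Gx u - \sum_(j | j != i) h 0 j * K j u.
pose dH u := f (upd i (h + x) u) - f (upd i x u) - \sum_(j | j != i) h 0 j * pd j f (upd i x u).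
have DH u : a <= u <= b -> is_derive u 1 H (dH u).
  move=> uab; apply: is_derive_lin => [||j _]; [apply: dGy|apply: dGx|apply: (KP j).2]; exact: ab.
have BH u : a <= u <= b -> `|dH u| <= n%:R * (`|h| * eta).
  move=> uab; rewrite /dH updh.
  have [|s /andP[s0 s1]] := @mvt_line R n f (upd i x u) h' 1 ltr01.
    move=> s /andP[s0 s1]; apply: smooth_diff sf _.
    rewrite (_ : h' = (upd i (h + x) u) - (upd i x u)); last by rewrite updh addrAC subrr add0r.
    apply: ball_convex; rewrite ?s0 //; apply: inr; first exact: inu.
    by apply: ball_upd => //; exact: ab.
  rewrite scale1r mul1r => ->; rewrite derive_sum_pd; last first.
    apply: smooth_diff sf _.
    rewrite (_ : h' = (upd i (h + x) u) - (upd i x u)); last by rewrite updh addrAC subrr add0r.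
    apply: ball_convex; rewrite ?ltW //; apply: inr; first exact: inu.
    by apply: ball_upd => //; exact: ab.
  rewrite (bigD1 i) //= {1}/h' !mxE !eqxx mulr1 subrr mul0r add0r -sumrB.
  apply: le_trans (ler_norm_sum _ _ _) _.
  apply: (@le_trans _ _ (\sum_(j < n) `|h| * eta)); last by rewrite sumr_const card_ord mulr_natl.
  rewrite [leRHS](bigD1 i) //=; apply: ler_wpDl; first by rewrite mulr_ge0 // ltW.
  apply: ler_sum => j ji; rewrite !mxE eqxx (negbTE ji) mulr0 subr0 -mulrBr normrM.
  apply: ler_pM => //; first exact: row_coord_le.
  apply/ltW/Hd => //; rewrite addrAC subrr add0r normrZ ger0_norm ?ltW //.
  by apply: le_lt_trans hd; apply: le_trans h'n; rewrite ler_piMl // ltW.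
have := @mvt_abs R H dH (c 0 i) (x 0 i) _ DH BH.
have -> : H (c 0 i) = 0.
  rewrite /H Gy0 Gx0 big1 ?subr0 // => j _; by rewrite (KP j).1 mulr0.
rewrite subr0 => HB.
have xy : `|(h + x) 0 i - c 0 i| < r' by apply: (ball_coordP c _ r'0).1 by_ i.
have GB : `|(Gy ((h + x) 0 i) - Gy (x 0 i)) - h 0 i * f x| <= e / 2 * `|h|.
  have DP u : `|u - c 0 i| < r' ->
      is_derive u 1 (fun v => Gy v - 0 - f x * v) (f (upd i (h + x) u) - 0 - f x * 1).
    move=> uc; have := @is_derive_lin Gy (cst 0) 'I_1 xpredT (fun=> f x) (fun=> id) _ _ (fun=> 1) u
      (dGy u uc) (is_derive_cst _ _ _) (fun _ _ => is_derive_id _ _).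
    by rewrite big_ord1; under eq_fun do rewrite big_ord1.
  have -> : Gy ((h + x) 0 i) - Gy (x 0 i) - h 0 i * f x =
     (Gy ((h + x) 0 i) - 0 - f x * ((h + x) 0 i)) - (Gy (x 0 i) - 0 - f x * (x 0 i)).
    rewrite !mxE; move: (Gy _) (Gy _) => g1 g2; ring.
  apply: le_trans (@mvt_abs R _ _ (x 0 i) ((h + x) 0 i) (e / 2) (fun u hu => DP u _) _) _; first last.
  - by apply: ler_wpM2l; [exact: ltW|rewrite mxE addrK; exact: row_coord_le].
  - move=> u uab; rewrite subr0 mulr1; apply/ltW/Hrho/ball_rowP.
    apply: le_lt_trans hrho; apply: row_norm_le => // j.
    have -> : (upd i (h + x) u - x) 0 j = upd i (h + x) u 0 j - x 0 j by rewrite [LHS]mxE [X in _ + X]mxE.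
    rewrite updE.
    case: eqP => [->|_]; last by rewrite mxE addrK row_coord_le.
    apply: le_trans (row_coord_le h i); move: uab; rewrite mxE.
    move: (x 0 i) (h 0 i) => p q; case: (leP p (q + p)) => pq /andP[A1 A2].
      by rewrite !ger0_norm; lra.
    by rewrite !ler0_norm; lra.
  - move=> u uab; move: uab xc xy; rewrite !ltr_norml; move: (x 0 i) ((h + x) 0 i) (c 0 i) => p q s.
    by case: (leP p q) => _ /andP[A1 A2] /andP[A3 A4] /andP[A5 A6]; apply/andP; split; lra.
have -> : Gy ((h + x) 0 i) - Gx (x 0 i) - (h *m (\col_j (if j == i then f x else K j (x 0 i)))) 0 0
   = (Gy ((h + x) 0 i) - Gy (x 0 i) - h 0 i * f x) + H (x 0 i).
  rewrite [(_ *m _) _ _]mxE (bigD1 i) //= [(\col_j _) i 0]mxE eqxx /H.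
  under eq_bigr => j ji do rewrite mxE (negbTE ji).
  move: (\sum_(_ | _) _) (Gy _) (Gy _) (Gx _) => s g1 g2 g3; ring.
apply: le_trans (ler_normD _ _) _; apply: le_trans (lerD GB HB) _.
have E2 : n%:R * (`|h| * eta) * `|x 0 i - c 0 i| <= e / 2 * `|h|.
  apply: (@le_trans _ _ (n%:R * (`|h| * eta) * r')).
    by apply: ler_wpM2l; [apply: mulr_ge0 => //; apply: mulr_ge0 => //; exact: ltW|exact: ltW].
  have -> : n%:R * (`|h| * eta) * r' = (e / 2 * `|h|) * (n%:R / n.+1%:R).
    rewrite /eta; move: (n%:R) (n.+1%:R) (`|h|) (pnatr_eq0 R n.+1) => p q s /= q0.
    have q1 : q != 0 by rewrite q0.
    have r1 : r' != 0 by rewrite gt_eqF.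
    by field; rewrite ?q1 ?r1.
  apply: ler_piMr; first by apply: mulr_ge0 => //; exact: ltW.
  by rewrite ler_pdivrMr ?ltr0Sn // mul1r ler_nat.
move: (`|h|) E2 => m E2; lra.
Unshelve. all: by end_near.
Qed.

Lemma antider_pd f x j : smooth (ball c r) f -> ball c r' x ->
  pd j (antider f) x = if j == i then f x else antider (pd j f) x.
Proof.
by move=> sf bx; have [_ H] := antider_diff sf bx; rewrite /pd H /bvec -rowE !mxE.
Qed.

(** The partials of an antiderivative are [f] or antiderivatives of partials
    of [f]. *)
Lemma antider_smooth f : smooth (ball c r) f -> smooth (ball c r') (antider f).
Proof.
move=> sf k; elim: k f sf => [|k IH] f sf /=.
  by move=> x bx; have [+ _] := antider_diff sf bx; exact: differentiable_continuous.
split=> [x bx|j]; first by have [] := antider_diff sf bx.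
case: (eqVneq j i) => [ji|ji].
  apply: (@Ck_ext _ _ _ _ f) => [|x bx|]; first exact: ball_open.
    by rewrite antider_pd // ji eqxx.
  apply: Ck_sub (sf k) => x /ball_rowP bx; apply/ball_rowP; exact: lt_trans r'r.
apply: (@Ck_ext _ _ _ _ (antider (pd j f))) => [|x bx|]; first exact: ball_open.
  by rewrite antider_pd // (negbTE ji).
by apply: IH; exact: smooth_pd.
Qed.

Lemma antider_0 f x : smooth (ball c r) f -> (forall z, ball c r z -> f z = 0) -> ball c r' x ->
  antider f x = 0.
Proof.
move=> sf f0 bx; have [G0 dG] := antiderP sf bx; rewrite /antider; set G := xget _ _ in G0 dG *.
have xc : `|x 0 i - c 0 i| < r' by apply: (ball_coordP c x r'0).1 bx i.
suff : `|G (x 0 i) - G (c 0 i)| <= 0 * `|x 0 i - c 0 i|.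
  by rewrite G0 subr0 mul0r normr_le0 => /eqP.
apply: (@mvt_abs R G (fun=> 0)) => [u uab|u _]; last by rewrite normr0.
have uc : `|u - c 0 i| < r'.
  move: uab xc; rewrite !ltr_norml; move: (c 0 i) (x 0 i) => p q.
  by case: (leP p q) => _ /andP[h1 h2] /andP[h3 h4]; apply/andP; split; lra.
have := dG u uc; rewrite f0 //; apply: ball_upd => //; first by apply: lt_trans r'r.
  by move/ball_rowP: bx => bx; apply/ball_rowP; exact: lt_trans r'r.
exact: lt_trans r'r.
Qed.

End Antiderivative.

Section Poincare.
Context {R : realType} {n : nat}.

Lemma ball_le (x : 'rV[R]_n) (r s : R) : r <= s -> ball x r `<=` ball x s.
Proof. by move=> rs y /ball_rowP H; apply/ball_rowP; exact: lt_le_trans rs. Qed.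

(** The partials along the coordinate axes are integrated away one axis at a
    time; closedness keeps the partials already matched equal to zero. *)
Lemma poincare (c : 'rV[R]_n) (r : R) (a : 'rV[R]_n -> 'rV[R]_n) :
  0 < r -> smooth_mx (ball c r) a -> (forall x, ball c r x -> d1 a x = 0) ->
  exists r' (phi : 'rV[R]_n -> R), [/\ 0 < r' <= r, smooth (ball c r') phi &
    forall x, ball c r' x -> grad phi x = a x].
Proof.
move=> r0 sa da.
suff H m : (m <= n)%N -> exists r' (phi : 'rV[R]_n -> R), [/\ 0 < r' <= r, smooth (ball c r') phi &
    forall x (i : 'I_n), ball c r' x -> (i < m)%N -> pd i phi x = a x 0 i].
  have [r' [phi [h1 h2 h3]]] := H n (leqnn n); exists r', phi; split=> // x bx.
  by apply/rowP => i; rewrite mxE h3.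
elim: m => [_|m IH mn].
  by exists r, (fun=> 0); split; rewrite ?r0 ?lexx //; exact: smooth_cst.
have [s [phi [/andP[s0 sr] sphi Hphi]]] := IH (ltnW mn).
pose i : 'I_n := Ordinal mn.
pose f x := a x 0 i - pd i phi x.
have bo : open (ball c s) := ball_open c s.
have sas j : smooth (ball c s) (fun x => a x 0 j) by apply: smooth_sub (sa 0 j); exact: ball_le.
have sf : smooth (ball c s) f by apply: smoothB => //; exact: smooth_pd.
pose t := s / 2.
have t0 : 0 < t by rewrite divr_gt0.
have ts : t < s by rewrite ltr_pdivrMr // ltr_pMr // ltr1n.
have sA := antider_smooth i t0 ts sf.
have sphi' : smooth (ball c t) phi by apply: smooth_sub sphi; apply: ball_le; exact: ltW.
exists t, (fun x => phi x + antider c t i f x); split.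
- by rewrite t0 (le_trans (ltW ts)).
- by apply: smoothD => //; exact: ball_open.
move=> x j bx; rewrite ltnS leq_eqVlt pdD; first last.
- exact: smooth_diff sA bx.
- exact: smooth_diff sphi' bx.
have bxs : ball c s x by apply: ball_le bx; exact: ltW.
rewrite (antider_pd i t0 ts j sf bx); case: (eqVneq j i) => [ji _|ji].
  by rewrite ji /f addrC subrK.
case/orP => [/eqP e|jm]; first by case/eqP: ji; exact: val_inj.
rewrite Hphi // [X in _ + X](_ : _ = 0) ?addr0 //.
apply: (antider_0 i t0 ts) => //; first exact: smooth_pd.
move=> z bz; rewrite /f pdB; first last.
- exact: smooth_diff (smooth_pd _ sphi) bz.
- exact: smooth_diff (sas i) bz.
rewrite (schwarz j i bo sphi bz).
have : (d1 a z) j i = 0 by rewrite da ?mxE //; apply: ball_le bz.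
rewrite mxE => /eqP; rewrite subr_eq0 => /eqP ->.
rewrite -(pd_ext i bo bz (_ : forall y, ball c s y -> pd j phi y = a y 0 j)) ?subrr //.
by move=> y bys; rewrite Hphi.
Qed.

End Poincare.

(** * Straightening the fibres of a submersion *)

Section Straighten.
Context {R : realType} {n : nat}.
Implicit Types (U A : set 'rV[R]_(n + 1)) (q : 'rV[R]_(n + 1) -> 'rV[R]_n).

Lemma ball_row_mx (y0 : 'rV[R]_n) (s0 : 'rV[R]_1) (d : R) y s : 0 < d ->
  ball (row_mx y0 s0) d (row_mx y s) <-> ball y0 d y /\ ball s0 d s.
Proof.
move=> d0; split=> [/(ball_coordP _ _ d0) H|[/(ball_coordP _ _ d0) H1 /(ball_coordP _ _ d0) H2]].
  split; apply/(ball_coordP _ _ d0) => j.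
    by have := H (lshift 1 j); rewrite !row_mxEl.
  by have := H (rshift n j); rewrite !row_mxEr.
apply/(ball_coordP _ _ d0) => j; rewrite -(splitK j).
by case: (fintype.split j) => l /=; rewrite ?row_mxEl ?row_mxEr.
Qed.

Lemma smooth_row_mx m p1 p2 (U : set 'rV[R]_m) (f : 'rV[R]_m -> 'rV[R]_p1) (g : 'rV[R]_m -> 'rV[R]_p2) :
  smooth_mx U f -> smooth_mx U g -> smooth_mx U (fun x => row_mx (f x) (g x)).
Proof.
move=> sf sg i j; rewrite ord1 -(splitK j); case: (fintype.split j) => l /=.
  by under eq_fun do rewrite row_mxEl; exact: sf.
by under eq_fun do rewrite row_mxEr; exact: sg.
Qed.

Lemma derive_chain m p (U : set 'rV[R]_m) (V : set 'rV[R]_p) (psi : 'rV[R]_m -> 'rV[R]_p) f x v :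
  smooth_mx U psi -> smooth V f -> U x -> V (psi x) ->
  'D_v (fun z => f (psi z)) x = (v *m 'J psi x *m (grad f (psi x))^T) 0 0.
Proof.
move=> sp sf Ux Vx; rewrite derive_sum_pd; last first.
  apply: differentiable_chain; last exact: smooth_diff Vx.
  by move=> j; apply: smooth_diff (sp 0 j) Ux.
rewrite -mulmxA mxE; apply: eq_bigr => i _; congr (_ * _).
have := congr1 (fun M : 'rV[R]_m => M 0 i) (grad_chain sp sf Ux Vx).
rewrite [LHS]mxE => ->; rewrite /pull1 mxE [RHS]mxE; apply: eq_bigr => j _.
by rewrite [_^T j i]mxE [_^T j 0]mxE mulrC.
Qed.

(** Near a point the map [q], completed by a coordinate whose [xi]-derivative
    does not vanish, is a chart in which the fibres are parallel segments and
    [xi] points along them.  A function killed by [xi] is constant on each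
    segment, hence a function of [q], and [D_xi t = k] is solved by
    integration. *)
Theorem straighten U q (xi : 'rV[R]_(n + 1) -> 'rV[R]_(n + 1)) x0 :
  open U -> smooth_mx U q -> U x0 ->
  (forall x, U x -> xi x *m 'J q x = 0) -> (forall x, U x -> xi x != 0) ->
  (forall v, v *m 'J q x0 = 0 -> exists c : R, v = c *: xi x0) ->
  exists A (d : R), [/\ [/\ open A, A x0 & A `<=` U], 0 < d /\ q @` A = ball (q x0) d,
    (exists s : 'rV[R]_n -> 'rV[R]_(n + 1), [/\ smooth_mx (ball (q x0) d) s,
         forall y, ball (q x0) d y -> A (s y) & forall y, ball (q x0) d y -> q (s y) = y]),
    (forall f, smooth A f -> (forall x, A x -> 'D_(xi x) f x = 0) ->
       exists F, smooth (ball (q x0) d) F /\ forall x, A x -> f x = F (q x)) &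
    (forall k, smooth U k -> smooth_mx U xi -> exists t, smooth A t /\ forall x, A x -> 'D_(xi x) t x = k x)].
Proof.
move=> oU sq Ux0 xiq xi0 kq.
(* A coordinate with nonzero [xi]-derivative completes [q] to a chart. *)
have [k0 k0P] : exists k0, xi x0 0 k0 != 0.
  apply/existsP; apply: contraTT (xi0 x0 Ux0) => /existsPn H; rewrite negbK.
  by apply/eqP/rowP => j; have := H j; rewrite negbK mxE => /eqP.
pose psi x : 'rV[R]_(n + 1) := row_mx (q x) (x 0 k0)%:M.
have spsi : smooth_mx U psi.
  apply: smooth_row_mx => // i j; rewrite !ord1; under eq_fun do rewrite mxE eqxx mulr1n.
  exact: smooth_coord.
have Jpsi x v : U x -> v *m 'J psi x = row_mx (v *m 'J q x) (v 0 k0)%:M.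
  move=> Ux; apply/rowP => j; rewrite -(splitK j) mxE.
  case: (fintype.split j) => l /=; rewrite ?row_mxEl ?row_mxEr mxE.
    apply: eq_bigr => i _; rewrite (jacobian_smooth _ _ spsi Ux) (jacobian_smooth _ _ sq Ux).
    have -> : (fun z => psi z 0 (lshift 1 l)) = fun z => q z 0 l by apply/funext => z; exact: row_mxEl.
    by [].
  rewrite (bigD1 k0) //= big1 ?addr0 => [|i ik].
    rewrite (jacobian_smooth _ _ spsi Ux) ord1 mulr1n.
    rewrite (_ : (fun z => psi z 0 (rshift n 0)) = fun z => z 0 k0); last first.
      by apply/funext => z; rewrite row_mxEr mxE eqxx mulr1n.
    by rewrite pd_coord eqxx mulr1.
  rewrite (jacobian_smooth _ _ spsi Ux) (_ : (fun z => psi z 0 (rshift n l)) = fun z => z 0 k0); last first.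
    by apply/funext => z; rewrite row_mxEr ord1 mxE eqxx mulr1n.
  by rewrite pd_coord (negbTE ik) mulr0.
have uJ : 'J psi x0 \in unitmx.
  rewrite unitmxE unitfE; apply/det0P => -[v v0]; rewrite Jpsi // => E.
  have E1 : v *m 'J q x0 = 0 by have := congr1 lsubmx E; rewrite row_mxKl => ->; apply/rowP => j; rewrite !mxE.
  have E2 : v 0 k0 = 0.
    by have := congr1 rsubmx E; rewrite row_mxKr => /rowP/(_ 0); rewrite !mxE eqxx mulr1n.
  have [c vc] := kq v E1; move: E2; rewrite vc mxE => /eqP; rewrite mulf_eq0 (negbTE k0P) orbF => /eqP c0.
  by move: v0; rewrite vc c0 scale0r eqxx.
have [A0 [d0 [g [[oA0 A0x0] A0U [d00 sg] HA HB]]]] := inverse_function oU spsi Ux0 uJ.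
pose d := d0 / 2.
have dd : 0 < d by rewrite divr_gt0.
have ddd : d < d0 by rewrite ltr_pdivrMr // ltr_pMr // ltr1n.
pose A := [set x | A0 x /\ ball (psi x0) d (psi x)].
have AU : A `<=` U by move=> x [/A0U].
have oA : open A.
  rewrite openE => x [Ax bx]; rewrite /interior; apply: filterI.
    exact: open_nbhs_nbhs.
  have cp : {for x, continuous psi}.
    by apply: continuous_row => j; exact: smooth_continuous (spsi 0 j) (A0U _ Ax).
  by apply: cp; apply: open_nbhs_nbhs; split; [exact: ball_open|exact: bx].
have bd : ball (psi x0) d `<=` ball (psi x0) d0 by apply: ball_le; exact: ltW.
have gA y : ball (psi x0) d y -> A (g y) /\ psi (g y) = y.
  by move=> By; have [h1 h2] := HB y (bd _ By); rewrite /A /= h2.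
have psiE x : psi x = row_mx (q x) (x 0 k0)%:M by [].
pose z0 : 'rV[R]_1 := (x0 0 k0)%:M.
have bq x : A x -> ball (q x0) d (q x) by move=> [_ /(ball_row_mx _ _ _ _ dd)[]].
pose s (y : 'rV[R]_n) := g (row_mx y z0).
have bs y : ball (q x0) d y -> ball (psi x0) d (row_mx y z0).
  by move=> By; apply/(ball_row_mx _ _ _ _ dd); split=> //; exact: ballxx.
have sA y : ball (q x0) d y -> A (s y) by move=> /bs /gA[].
have qs y : ball (q x0) d y -> q (s y) = y.
  by move=> /bs /gA[_]; rewrite psiE => /(congr1 lsubmx); rewrite !row_mxKl.
have ss : smooth_mx (ball (q x0) d) (fun y : 'rV[R]_n => row_mx y z0).
  apply: smooth_row_mx; first by move=> i j; rewrite ord1; exact: smooth_coord.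
  exact: smooth_cstmx.
have sgd : smooth_mx (ball (psi x0) d) g by apply: smooth_mx_sub sg; exact: bd.
have bo m (c : 'rV[R]_m) (e : R) : open (ball c e) by exact: ball_open.
have ssm : smooth_mx (ball (q x0) d) s.
  by apply: (smooth_chain_mx (bo _ _ _) bs) sgd.
have xik x : A0 x -> xi x 0 k0 != 0.
  move=> A0x; apply: contra_neq (xi0 x (A0U _ A0x)) => E.
  have [_ _ ux] := HA x A0x; apply: (can_inj (mulmxK ux)).
  rewrite mul0mx Jpsi; last exact: A0U.
  rewrite xiq; last exact: A0U.
  by rewrite E raddf0 row_mx0.
have dir f x (e : R) : smooth (ball (psi x0) e) f -> A0 x -> ball (psi x0) e (psi x) ->
    'D_(xi x) (fun z => f (psi z)) x = xi x 0 k0 * pd (rshift n ord0) f (psi x).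
  move=> sf A0x bx; rewrite (derive_chain _ spsi sf (A0U _ A0x) bx).
  rewrite Jpsi; last exact: A0U.
  rewrite xiq; last exact: A0U.
  rewrite mxE (bigD1 (rshift n ord0)) //= big1 ?addr0 => [|j jr].
    by rewrite row_mxEr !mxE eqxx mulr1n.
  rewrite -(splitK j) in jr *; case: (fintype.split j) jr => l /= jr.
    by rewrite row_mxEl mxE mul0r.
  by rewrite ord1 eqxx in jr.
exists A, d; split.
- by split=> //; split=> //; exact: ballxx.
- split=> //; apply/seteqP; split=> [y [x Ax <-]|y By]; first exact: bq.
  by exists (s y); [exact: sA|exact: qs].
- by exists s.
- move=> f sf Df; exists (fun y => f (s y)).
  split; first by apply: (smooth_chain (bo _ _ _) sA ssm sf).
  move=> x Ax; have [A0x bx] := Ax.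
  pose F z := f (g z).
  have sF : smooth (ball (psi x0) d) F by exact: (smooth_chain (bo _ _ _) (fun z Bz => (gA z Bz).1) sgd sf).
  have Fp z : A z -> F (psi z) = f z by move=> [/HA[_ e _] _]; rewrite /F e.
  have pF z : ball (psi x0) d z -> pd (rshift n ord0) F z = 0.
    move=> /gA[Agz gz]; have [A0gz bgz] := Agz.
    have := dir F (g z) d sF A0gz bgz; rewrite gz => E.
    have : 'D_(xi (g z)) (fun z => F (psi z)) (g z) = 0.
      rewrite -(Df _ Agz); apply: near_eq_derive.
      by apply: filterS (open_nbhs_nbhs (conj oA Agz)) => w /Fp.
    by rewrite E => /eqP; rewrite mulf_eq0 (negbTE (xik _ A0gz)) => /eqP.
  rewrite -(Fp _ Ax) /s -/(F _).
  have b0 := bs _ (bq _ Ax).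
  pose w := row_mx (q x) z0.
  pose dl := x 0 k0 - x0 0 k0.
  have E : psi x = w + dl *: bvec (rshift n ord0).
    apply/rowP => j; rewrite -(splitK j) psiE [RHS]mxE [X in _ + X]mxE [bvec _ _ _]mxE eqxx /w.
    case: (fintype.split j) => l /=.
      by rewrite eq_lrshift mulr0 addr0 !row_mxEl.
    by rewrite !ord1 eqxx !row_mxEr !mxE eqxx /dl !mulr1n mulr1 addrC subrK.
  pose v : 'rV[R]_(n+1) := dl *: bvec (rshift n ord0).
  have inb (e : R) : 0 <= e <= 1 -> ball (psi x0) d (w + e *: v).
    move=> he; rewrite (_ : v = psi x - w); last by rewrite E addrAC subrr add0r.
    exact: ball_convex.
  have [|e /andP[e0 e1]] := @mvt_line R _ F w v 1 ltr01.
    by move=> e /inb be; exact: smooth_diff sF be.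
  have be : ball (psi x0) d (w + e *: v) by apply: inb; rewrite !ltW.
  rewrite scale1r -E mul1r (derive_smooth _ sF be) mxE (bigD1 (rshift n ord0)) //= big1 => [|j jr].
    by rewrite [(grad _ _)^T _ _]mxE [grad _ _ _ _]mxE pF // mulr0 addr0 => /eqP; rewrite subr_eq0 => /eqP.
  by rewrite !mxE (negbTE jr) andbF mulr0 mul0r.
- move=> k sk sxi.
  pose f z := k (g z) / xi (g z) 0 k0.
  have gU z : ball (psi x0) d0 z -> U (g z) by move=> /HB[/A0U].
  have sf : smooth (ball (psi x0) d0) f.
    apply: (smoothM (bo _ _ _)); first exact: (smooth_chain (bo _ _ _) gU sg sk).
    apply: (smoothV (bo _ _ _)); first by move=> z /HB[/xik].
    exact: (smooth_chain (bo _ _ _) gU sg (sxi 0 k0)).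
  have st := antider_smooth (rshift n ord0) dd ddd sf.
  exists (fun x => antider (psi x0) d (rshift n ord0) f (psi x)); split.
    have Abx x : A x -> ball (psi x0) d (psi x) by case.
    exact: (smooth_chain oA Abx (smooth_mx_sub AU spsi) st).
  move=> x [A0x bx]; rewrite (dir _ _ d) // (antider_pd (rshift n ord0) dd ddd _ sf bx) eqxx /f.
  have [_ -> _] := HA x A0x.
  by rewrite mulrCA divff ?mulr1 // xik.
Qed.

End Straighten.

(** * Connections and curvature in matrix form *)

Section MatrixCalculus.
Context {R : realType} {n : nat}.
Implicit Types (U : set 'rV[R]_n) (x : 'rV[R]_n).

Definition pdm p q (i : 'I_n) (A : 'rV[R]_n -> 'M[R]_(p, q)) x : 'M[R]_(p, q) :=
  \matrix_(j, k) pd i (fun z => A z j k) x.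

Lemma pdm_ext p q i U (A B : 'rV[R]_n -> 'M[R]_(p, q)) x : open U -> U x ->
  (forall z, U z -> A z = B z) -> pdm i A x = pdm i B x.
Proof.
by move=> oU Ux AB; apply/matrixP => j k; rewrite !mxE; apply: (pd_ext i oU Ux) => z /AB ->.
Qed.

Lemma pdm_cst p q i (A : 'M[R]_(p, q)) x : pdm i (fun=> A) x = 0.
Proof. by apply/matrixP => j k; rewrite !mxE pd_cst. Qed.

Lemma pdm_mul p q r i U (A : 'rV[R]_n -> 'M[R]_(p, q)) (B : 'rV[R]_n -> 'M[R]_(q, r)) x :
  smooth_mx U A -> smooth_mx U B -> U x ->
  pdm i (fun z => A z *m B z) x = pdm i A x *m B x + A x *m pdm i B x.
Proof.
move=> sA sB Ux; apply/matrixP => j k; rewrite !mxE.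
under eq_fun do rewrite mxE.
rewrite pd_sum => [|l _]; last first.
  by apply: differentiableM; [exact: smooth_diff (sA _ _) Ux|exact: smooth_diff (sB _ _) Ux].
rewrite -big_split /=; apply: eq_bigr => l _; rewrite !mxE.
by apply: pdM; [exact: smooth_diff (sA _ _) Ux|exact: smooth_diff (sB _ _) Ux].
Qed.

Lemma pdm_add p q i U (A B : 'rV[R]_n -> 'M[R]_(p, q)) x :
  smooth_mx U A -> smooth_mx U B -> U x ->
  pdm i (fun z => A z + B z) x = pdm i A x + pdm i B x.
Proof.
move=> sA sB Ux; apply/matrixP => j k; rewrite !mxE; under eq_fun do rewrite mxE.
by apply: pdD; [exact: smooth_diff (sA _ _) Ux|exact: smooth_diff (sB _ _) Ux].
Qed.

Lemma pdm_opp p q i U (A : 'rV[R]_n -> 'M[R]_(p, q)) x :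
  smooth_mx U A -> U x -> pdm i (fun z => - A z) x = - pdm i A x.
Proof.
move=> sA Ux; apply/matrixP => j k; rewrite !mxE; under eq_fun do rewrite mxE.
by apply: pdN; exact: smooth_diff (sA _ _) Ux.
Qed.

Lemma pdm_sub p q i U (A B : 'rV[R]_n -> 'M[R]_(p, q)) x : open U ->
  smooth_mx U A -> smooth_mx U B -> U x ->
  pdm i (fun z => A z - B z) x = pdm i A x - pdm i B x.
Proof.
move=> oU sA sB Ux; rewrite (pdm_add i sA (smooth_oppmx oU sB) Ux).
by rewrite (pdm_opp i sB Ux).
Qed.

Lemma pdm_scale p q i U f (A : 'rV[R]_n -> 'M[R]_(p, q)) x :
  smooth U f -> smooth_mx U A -> U x ->
  pdm i (fun z => f z *: A z) x = pd i f x *: A x + f x *: pdm i A x.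
Proof.
move=> sf sA Ux; apply/matrixP => j k; rewrite !mxE; under eq_fun do rewrite mxE.
by apply: pdM; [exact: smooth_diff sf Ux|exact: smooth_diff (sA _ _) Ux].
Qed.

Lemma pdm_tr p q i (A : 'rV[R]_n -> 'M[R]_(p, q)) x :
  pdm i (fun z => (A z)^T) x = (pdm i A x)^T.
Proof. by apply/matrixP => j k; rewrite !mxE; under eq_fun do rewrite mxE. Qed.

Lemma smooth_pdm p q i U (A : 'rV[R]_n -> 'M[R]_(p, q)) :
  smooth_mx U A -> smooth_mx U (pdm i A).
Proof. by move=> sA j k; under eq_fun do rewrite mxE; exact: smooth_pd. Qed.

Lemma pdm_schwarz p q i j U (A : 'rV[R]_n -> 'M[R]_(p, q)) x : open U -> smooth_mx U A -> U x ->
  pdm i (pdm j A) x = pdm j (pdm i A) x.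
Proof.
move=> oU sA Ux; apply/matrixP => k l.
have E a : (fun z => pdm a A z k l) = pd a (fun z => A z k l).
  by apply/funext => z; rewrite mxE.
rewrite [LHS]mxE [RHS]mxE !E; exact: schwarz oU (sA k l) Ux.
Qed.

(** A connection is given by its matrices [N i], acting on row vectors by [pdm
    i X + X *m N i]. *)
Definition curv p (N : 'I_n -> 'rV[R]_n -> 'M[R]_p) i j x : 'M[R]_p :=
  pdm i (N j) x - pdm j (N i) x + N j x *m N i x - N i x *m N j x.

Lemma curv_anti p (N : 'I_n -> 'rV[R]_n -> 'M[R]_p) i j x : curv N i j x = - curv N j i x.
Proof. by rewrite /curv; apply/matrixP => k l; rewrite !mxE; ring. Qed.

Lemma second_derivatives_cancel p q (P1 P2 Q1 Q2 S T X1 X2 Y1 Y2 : 'M[R]_(p, q)) :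
  P1 + (Q1 - S) - (T - X1 + Y1) = P2 + (Q2 - T) - (S - X2 + Y2) ->
  P1 - P2 + Q1 - Q2 = Y1 - Y2 + X2 - X1.
Proof.
by move=> /matrixP H; apply/matrixP => k l; move: (H k l); rewrite !mxE; lra.
Qed.

(** Differentiate the hypothesis once more and antisymmetrize: the second
    derivatives of [E] drop out.  It is applied to a moving frame and to a
    parallel endomorphism. *)
Lemma curv_intertwine p q U (E : 'rV[R]_n -> 'M[R]_(p, q)) N w x : open U ->
  smooth_mx U E -> (forall i, smooth_mx U (N i)) -> (forall i, smooth_mx U (w i)) -> U x ->
  (forall i z, U z -> pdm i E z + E z *m N i z = w i z *m E z) ->
  forall i j, E x *m curv N i j x = curv w i j x *m E x.
Proof.
move=> oU sE sN sw Ux EN i j.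
have pE k z : U z -> pdm k E z = w k z *m E z - E z *m N k z.
  by move=> Uz; rewrite -EN // addrK.
have D2 k l : pdm k (pdm l E) x = pdm k (w l) x *m E x + w l x *m pdm k E x
     - (pdm k E x *m N l x + E x *m pdm k (N l) x).
  rewrite (pdm_ext k oU Ux (pE l)) (pdm_sub k oU _ _ Ux); last first.
  - exact: smooth_mulmx.
  - exact: smooth_mulmx.
  by rewrite (pdm_mul k (sw l) sE Ux) (pdm_mul k sE (sN l) Ux).
have := pdm_schwarz i j oU sE Ux; rewrite !D2 !(pE _ x Ux).
rewrite /curv !(mulmxDl, mulmxDr, mulmxBl, mulmxBr, mulmxA, mulmxN, mulNmx).
move=> H; symmetry; exact: second_derivatives_cancel H.
Qed.

End MatrixCalculus.

Section CoordinateConnections.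
Context {R : realType} {n : nat}.
Implicit Types (U : set 'rV[R]_n) (x : 'rV[R]_n) (G : 'I_n -> 'I_n -> 'I_n -> 'rV[R]_n -> R).

Definition cmat G (i : 'I_n) x : 'M[R]_n := \matrix_(j, k) G k i j x.

Lemma covd_endE G J i x :
  covd_end G J i x = pdm i J x + J x *m cmat G i x - cmat G i x *m J x.
Proof.
apply/matrixP => j k; rewrite !mxE -addrA -sumrB; congr (_ + _).
by apply: eq_bigr => m _; rewrite !mxE mulrC.
Qed.

Lemma riemE G i j k l x : riem G i j k l x = curv (cmat G) i j x k l.
Proof.
rewrite /riem /curv !mxE -addrA -sumrB; congr (_ - _ + _).
- by congr (pd _ _ _); apply/funext => z; rewrite mxE.
- by congr (pd _ _ _); apply/funext => z; rewrite mxE.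
- by apply: eq_bigr => m _; rewrite !mxE; congr (_ - _); rewrite mulrC.
Qed.

Lemma ricciE G x j k : ricci G x j k = \sum_i curv (cmat G) i j x k i.
Proof. by rewrite mxE; apply: eq_bigr => i _; rewrite riemE. Qed.

(** The quadratic terms and the derivatives cancel in pairs since the
    connection is torsion-free. *)
Lemma bianchi1 U G x : open U -> U x ->
  (forall z i j k, U z -> G k i j z = G k j i z) ->
  forall i j k l, curv (cmat G) i j x k l + curv (cmat G) j k x i l + curv (cmat G) k i x j l = 0.
Proof.
move=> oU Ux sG i j k l; rewrite /curv !mxE.
have pdG a b c d : pd a (fun z => cmat G b z c d) x = pd a (fun z => cmat G c z b d) x.
  by apply: (pd_ext a oU Ux) => z Uz; rewrite !mxE; exact: sG.
have S a b c : \sum_m cmat G a x b m * cmat G c x m l = \sum_m cmat G b x a m * cmat G c x m l.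
  by apply: eq_bigr => m _; rewrite !mxE (sG x a b m Ux).
rewrite (pdG i j k l) (pdG j k i l) (pdG k i j l) (S j k i) (S k i j) (S i j k).
ring.
Qed.

Variables (U : set 'rV[R]_n) (g : 'rV[R]_n -> 'M[R]_n) (a : 'rV[R]_n -> 'rV[R]_n).
Hypotheses (oU : open U) (mg : riemannian U g) (sa : smooth_mx U a).

Lemma smooth_weyl_chr k i j : smooth U (weyl_chr g a k i j).
Proof.
have sg := met_smooth mg.
have si : smooth_mx U (fun z => invmx (g z)).
  by apply: smooth_invmx => // x Ux; exact: metric_unitmx Ux.
have sD p q s : smooth U (fun x => pd p (fun z => g z q s) x + 2 * a x 0 p * g x q s).
  apply: smoothD => //; first exact/smooth_pd/sg.
  exact: (smoothM oU (smoothZ _ oU (sa 0 p)) (sg q s)).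
apply: (smoothZ _ oU); apply: (smooth_sum _ _ oU) => l.
apply: (smoothM oU (si k l)).
by apply: (smoothB oU _ (sD _ _ _)); apply: (smoothD oU (sD _ _ _) (sD _ _ _)).
Qed.

Lemma smooth_cmat_weyl i : smooth_mx U (cmat (weyl_chr g a) i).
Proof. by move=> j k; under eq_fun do rewrite mxE; exact: smooth_weyl_chr. Qed.

Lemma weyl_metric i x : U x ->
  pdm i g x = cmat (weyl_chr g a) i x *m g x + g x *m (cmat (weyl_chr g a) i x)^T
              - (2 * a x 0 i) *: g x.
Proof.
move=> Ux; apply/matrixP => j l; have := weyl_chr_conformal a oU mg Ux i j l.
rewrite big_split /= !mxE => E.
rewrite (eq_bigr (fun m => weyl_chr g a m i j x * g x m l)); last by move=> m _; rewrite mxE.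
rewrite [X in _ + X - _](eq_bigr (fun m => weyl_chr g a m i l x * g x j m)); last first.
  by move=> m _; rewrite !mxE mulrC.
move: E; move: (\sum_j0 _) (\sum_j0 _) (pd _ _ _) => p q s E; lra.
Qed.

End CoordinateConnections.

(** * The Ricci form of a Kaehler metric *)

Section KahlerCurvature.
Context {R : realType} {n : nat}.
Variables (U : set 'rV[R]_n) (g J : 'rV[R]_n -> 'M[R]_n).
Hypotheses (oU : open U) (mg : riemannian U g) (kJ : kahler U g J).

Let N := cmat (levi_civita g).
Let Rm i j x := curv N i j x.

Let s0 : smooth_mx U (fun=> 0 : 'rV[R]_n). Proof. exact: smooth_cstmx. Qed.
Let sN i : smooth_mx U (N i). Proof. exact: smooth_cmat_weyl oU mg s0 i. Qed.

Lemma kahler_curv_comm i j x : U x -> J x *m Rm i j x = Rm i j x *m J x.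
Proof.
move=> Ux; apply: (curv_intertwine oU (kahler_smooth kJ) sN sN Ux) => k z Uz.
by have := kahler_parallel kJ Uz k; rewrite covd_endE => /eqP; rewrite subr_eq0 => /eqP.
Qed.

Lemma lc_bianchi i j k l x : U x -> Rm i j x k l + Rm j k x i l + Rm k i x j l = 0.
Proof.
by move=> Ux; apply: (bianchi1 oU Ux) => z a b c Uz; exact: weyl_chr_torsion_free oU mg Uz _ _ _.
Qed.

Lemma lc_skew i j x : U x -> Rm i j x *m g x = - (Rm i j x *m g x)^T.
Proof.
move=> Ux; rewrite trmx_mul (met_sym mg Ux).
have sN' k : smooth_mx U (fun z => - (N k z)^T) by apply: smooth_oppmx => //; exact: smooth_trmx.
have H := @curv_intertwine R n n n U g (fun k z => - (N k z)^T) N x oU (met_smooth mg) sN' sN Ux.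
rewrite /Rm -H => [|k z Uz].
  rewrite -mulmxN; congr (_ *m _); rewrite /curv.
  rewrite !(pdm_opp _ (smooth_trmx (sN _)) Ux) !pdm_tr.
  rewrite !(mulmxN, mulNmx, opprK) -!trmx_mul.
  move: (_ *m _) (_ *m _) (pdm _ _ _) (pdm _ _ _) => A B C D.
  by apply/matrixP => a b; rewrite !mxE; ring.
have s0z := weyl_metric (fun=> 0) oU mg k Uz.
rewrite s0z mulmxN addrAC mxE mulr0 scale0r subr0 addrK //.
Qed.

End KahlerCurvature.

Section AlgebraicCurvature.
Context {R : realType} {n : nat}.
Variables (T : 'I_n -> 'I_n -> 'M[R]_n) (g : 'M[R]_n).
Hypotheses (T_anti : forall i j, T i j = - T j i)
  (T_bianchi : forall i j k l, T i j k l + T j k i l + T k i j l = 0)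
  (T_skew : forall i j, T i j *m g = - (T i j *m g)^T)
  (g_sym : g^T = g) (g_unit : g \in unitmx).

Let L i j k l := (T i j *m g) k l.

(** Pair symmetry follows from the Bianchi identity in four cyclic positions
    and the two antisymmetries; for the lowered curvature this is linear
    arithmetic. *)
Lemma low_pair i j k l : L i j k l = L k l i j.
Proof.
have a1 p q r s : L p q r s = - L q p r s by rewrite /L T_anti mulNmx mxE.
have a2 p q r s : L p q r s = - L p q s r by rewrite /L {1}T_skew !mxE.
have a3 p q r s : L p q r s + L q r p s + L r p q s = 0.
  rewrite /L !mxE -!big_split /= big1 // => m _.
  by rewrite -!mulrDl T_bianchi mul0r.
move: L a1 a2 a3 => M a1 a2 a3.
move: (a3 i j k l) (a3 j k l i) (a3 k l i j) (a3 l i j k) (a2 j k l i) (a2 k l j i) (a1 j l i k)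
  (a2 l j i k) (a2 l i j k) (a1 i k l j) (a2 k i l j) (a2 i j l k); lra.
Qed.

Definition ric_of (S : 'I_n -> 'I_n -> 'M[R]_n) : 'M[R]_n := \matrix_(j, k) \sum_i S i j k i.

Let ric := ric_of T.

Lemma T_low i j k l : T i j k l = \sum_m L i j k m * invmx g m l.
Proof.
by have := congr1 (fun M : 'M[R]_n => M k l) (mulmxK g_unit (T i j)); rewrite mxE => <-.
Qed.

Lemma ric_sym : ric^T = ric.
Proof.
have gi : (invmx g)^T = invmx g by rewrite trmx_inv g_sym.
apply/matrixP => j k; rewrite !mxE.
under eq_bigr do rewrite T_low; under [RHS]eq_bigr do rewrite T_low.
rewrite exchange_big; apply: eq_bigr => m _; apply: eq_bigr => i _.
rewrite -[in LHS]gi [in LHS]mxE; congr (_ * _).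
by rewrite [LHS]low_pair /L (T_anti j m) mulNmx {1}T_skew opprK mxE.
Qed.

Variable J : 'M[R]_n.
Hypotheses (JJ : J *m J = - 1%:M) (Jg : J *m g *m J^T = g)
  (TJ : forall i j, J *m T i j = T i j *m J).

(** By pair symmetry, commuting with [J] as an endomorphism is invariance
    under [J] as a two-form. *)
Lemma T_Jinv i j : \sum_p \sum_q (J i p * J j q) *: T p q = T i j.
Proof.
apply: (can_inj (mulmxK g_unit)); apply/matrixP => k l.
rewrite mulmx_suml summxE -[RHS]/(L i j k l) low_pair.
have -> : L k l i j = (J *m (T k l *m g) *m J^T) i j.
  have -> : J *m (T k l *m g) *m J^T = T k l *m (J *m g *m J^T) by rewrite !mulmxA TJ.
  by rewrite Jg.
rewrite [RHS]mxE.
transitivity (\sum_q \sum_p J i p * (T k l *m g) p q * J j q); last first.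
  by apply: eq_bigr => q _; rewrite [(J *m _) _ _]mxE mulr_suml; apply: eq_bigr => p _; rewrite [J^T _ _]mxE.
rewrite exchange_big /=; apply: eq_bigr => p _; rewrite mulmx_suml summxE.
apply: eq_bigr => q _; rewrite -scalemxAl mxE -/(L p q k l) low_pair /L.
by move: ((T k l *m g) p q) => z; ring.
Qed.

Lemma ric_Jinv : J *m ric *m J^T = ric.
Proof.
apply/matrixP => j k; rewrite mxE.
transitivity (\sum_q \sum_p J j p * J k q * ric p q).
  by apply: eq_bigr => q _; rewrite !mxE mulr_suml; apply: eq_bigr => p _; rewrite mulrAC.
transitivity (\sum_p J j p * \sum_i (J *m T i p) k i).
  rewrite exchange_big /=; apply: eq_bigr => p _; rewrite mulr_sumr.
  under eq_bigr do rewrite mxE mulr_sumr.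
  rewrite exchange_big /=; apply: eq_bigr => i _; rewrite mxE mulr_sumr.
  by apply: eq_bigr => q _; ring.
transitivity (\sum_m (\sum_i \sum_p (J m i * J j p) *: T i p) k m).
  transitivity (\sum_i \sum_p \sum_m J j p * (T i p k m * J m i)).
    rewrite exchange_big /=; apply: eq_bigr => p _; rewrite mulr_sumr.
    by apply: eq_bigr => i _; rewrite TJ mxE mulr_sumr.
  transitivity (\sum_i \sum_m \sum_p (J m i * J j p) * T i p k m).
    apply: eq_bigr => i _; rewrite exchange_big /=; apply: eq_bigr => m _.
    by apply: eq_bigr => p _; ring.
  rewrite exchange_big /=; apply: eq_bigr => m _; rewrite summxE.
  by apply: eq_bigr => i _; rewrite summxE; apply: eq_bigr => p _; rewrite mxE.
by rewrite mxE; apply: eq_bigr => m _; rewrite T_Jinv.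
Qed.

(** Expand the trace by the Bianchi identity into two Ricci contractions. *)
Lemma tr_JT i j : \tr (J *m T i j) = 2 * (J *m ric) i j.
Proof.
have S1 : \sum_k \sum_l J k l * T j l i k = - (J *m ric^T) i j.
  rewrite exchange_big /= [in RHS]mxE -sumrN.
  transitivity (\sum_l (J *m T j l) i l).
    by apply: eq_bigr => l _; rewrite TJ mxE; apply: eq_bigr => k _; rewrite mulrC.
  under eq_bigr do rewrite mxE; rewrite exchange_big /=; apply: eq_bigr => m _.
  rewrite !mxE -mulrN -sumrN mulr_sumr; apply: eq_bigr => l _.
  by rewrite (T_anti j l) mxE.
have S2 : \sum_k \sum_l J k l * T l i j k = (J *m ric^T) j i.
  rewrite exchange_big /= [in RHS]mxE.
  transitivity (\sum_l (J *m T l i) j l).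
    by apply: eq_bigr => l _; rewrite TJ mxE; apply: eq_bigr => k _; rewrite mulrC.
  under eq_bigr do rewrite mxE; rewrite exchange_big /=; apply: eq_bigr => m _.
  by rewrite !mxE mulr_sumr.
have -> : \tr (J *m T i j) = - (\sum_k \sum_l J k l * T j l i k) - (\sum_k \sum_l J k l * T l i j k).
  rewrite /mxtrace -!sumrN -big_split /=; apply: eq_bigr => k _.
  rewrite mxE -!sumrN -big_split /=; apply: eq_bigr => l _.
  have := T_bianchi i j l k; move: (T i j l k) (T j l i k) (T l i j k) => p q r E.
  have -> : p = - q - r by lra.
  ring.
rewrite S1 S2 ric_sym opprK.
have E : J *m ric = - (J *m ric)^T.
  rewrite trmx_mul ric_sym; have := congr1 (mulmx J) ric_Jinv.
  by rewrite !mulmxA JJ !mulNmx mul1mx => <-.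
have -> : (J *m ric) j i = - (J *m ric) i j by rewrite {1}E !mxE.
by rewrite opprK mulrDl mul1r.
Qed.

End AlgebraicCurvature.

Section KahlerRicci.
Context {R : realType} {n : nat}.
Variables (U : set 'rV[R]_n) (g J : 'rV[R]_n -> 'M[R]_n).
Hypotheses (oU : open U) (mg : riemannian U g).

Let Rm x i j := curv (cmat (levi_civita g)) i j x.

Lemma ricci_of x : ricci (levi_civita g) x = ric_of (Rm x).
Proof. by apply/matrixP => j k; rewrite ricciE mxE. Qed.

Lemma ricci_sym x : U x -> (ricci (levi_civita g) x)^T = ricci (levi_civita g) x.
Proof.
move=> Ux; rewrite ricci_of; apply: ric_sym (met_sym mg Ux) (metric_unitmx mg Ux).
- by move=> i j; exact: curv_anti.
- by move=> *; apply: (lc_bianchi oU mg) => //.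
- by move=> *; apply: (lc_skew oU mg) => //.
Qed.

Hypothesis (kJ : kahler U g J).

(** Up to normalization the left hand side is the curvature of the canonical
    bundle. *)
Lemma kahler_ricci_form x i j : U x ->
  \tr (J x *m Rm x i j) = 2 * (J x *m ricci (levi_civita g) x) i j.
Proof.
move=> Ux; rewrite ricci_of; apply: (tr_JT (g := g x)).
all: first [by move=> k l; exact: curv_anti | by move=> *; apply: (lc_bianchi oU mg)
  | by move=> *; apply: (lc_skew oU mg) | exact: (met_sym mg Ux) | exact: (metric_unitmx mg Ux)
  | exact: (kahler_square kJ Ux) | exact: (kahler_orth kJ Ux)
  | by move=> k l; exact: (kahler_curv_comm oU mg kJ)].
Qed.

End KahlerRicci.

(** The curvature commutes with both complex structures, so the trace of [J
    Rm] changes sign under conjugation by the anticommuting [I]. *)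
Lemma hyperkahler_ricci_flat {R : realType} n (U : set 'rV[R]_n) g x : open U -> riemannian U g ->
  hyperkahler U g -> U x -> ricci (levi_civita g) x = 0.
Proof.
move=> oU mg hk Ux; have [W [oW Wx WU [I [J [K [kI kJ kK JI]]]]]] := hk x Ux.
have mgW : riemannian W g.
  split; first exact: smooth_mx_sub (met_smooth mg).
    by move=> z /WU; exact: met_sym.
  by move=> z /WU; exact: met_pos.
have II := kahler_square kI Wx; have JJ := kahler_square kJ Wx; have KK := kahler_square kK Wx.
have anti : J x *m I x = - (I x *m J x).
  have : J x *m (K x *m K x) *m I x = - (J x *m I x) by rewrite KK mulmxN mulNmx mulmx1.
  rewrite -(JI x Wx) !mulmxA JJ -!mulmxA II mulNmx mul1mx !mulmxN mulmx1 opprK.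
  by move=> ->; rewrite opprK.
have tr0 i j : \tr (J x *m curv (cmat (levi_civita g)) i j x) = 0.
  set S := curv _ i j x.
  have cI : I x *m S = S *m I x by exact: (kahler_curv_comm oW mgW kI).
  have E : \tr (J x *m S) = - \tr (J x *m S).
    rewrite -{1}[J x *m S]mulmx1 -[1%:M]opprK -II mulmxN linearN /= mulmxA mxtrace_mulC !mulmxA.
    by rewrite -(mulmxA _ S) -cI !mulmxA -[I x *m J x]opprK -anti mulNmx -(mulmxA (J x)) II mulmxN mulmx1 opprK -linearN.
  by move: E; move: (\tr _) => z; lra.
have JR : J x *m ricci (levi_civita g) x = 0.
  apply/matrixP => i j; rewrite [RHS]mxE; have := kahler_ricci_form oW mgW kJ i j Wx.
  by rewrite tr0 => /eqP; rewrite eq_sym mulf_eq0 pnatr_eq0 /= => /eqP.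
have := congr1 (mulmx (J x)) JR; rewrite mulmxA JJ mulNmx mul1mx mulmx0.
by move/eqP; rewrite oppr_eq0 => /eqP.
Qed.

(** * Exterior calculus and Cartan structure equations *)

Section Exterior.
Context {R : realType} {n : nat}.
Implicit Types (U : set 'rV[R]_n) (x : 'rV[R]_n) (al be : 'rV[R]_n -> 'rV[R]_n).

Lemma d1_ext U al be x : open U -> U x -> (forall z, U z -> al z = be z) -> d1 al x = d1 be x.
Proof.
move=> oU Ux E; apply/matrixP => i j; rewrite !mxE.
by congr (_ - _); apply: (pd_ext _ oU Ux) => z /E ->.
Qed.

Lemma d1_add U al be x : smooth_mx U al -> smooth_mx U be -> U x ->
  d1 (fun z => al z + be z) x = d1 al x + d1 be x.
Proof.
move=> sa sb Ux; apply/matrixP => i j; rewrite !mxE.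
have E k l : pd k (fun z => (al z + be z) 0 l) x = pd k (fun z => al z 0 l) x + pd k (fun z => be z 0 l) x.
  under eq_fun do rewrite mxE.
  by apply: pdD; [exact: smooth_diff (sa _ _) Ux|exact: smooth_diff (sb _ _) Ux].
rewrite !E; ring.
Qed.

Lemma d1_scale U f al x : smooth U f -> smooth_mx U al -> U x ->
  d1 (fun z => f z *: al z) x = wedge (grad f x) (al x) + f x *: d1 al x.
Proof.
move=> sf sa Ux; apply/matrixP => i j; rewrite !mxE !big_ord1 !mxE.
have E k l : pd k (fun z => (f z *: al z) 0 l) x = pd k f x * al x 0 l + f x * pd k (fun z => al z 0 l) x.
  under eq_fun do rewrite mxE.
  by apply: pdM; [exact: smooth_diff sf Ux|exact: smooth_diff (sa _ _) Ux].
rewrite !E; ring.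
Qed.

Lemma d1_opp U al x : open U -> smooth_mx U al -> U x ->
  d1 (fun z => - al z) x = - d1 al x.
Proof.
move=> oU sa Ux; apply/matrixP => i j; rewrite !mxE.
have E k l : pd k (fun z => (- al z) 0 l) x = - pd k (fun z => al z 0 l) x.
  under eq_fun do rewrite mxE.
  by apply: pdN; exact: smooth_diff (sa _ _) Ux.
rewrite !E; ring.
Qed.

Lemma d1_sub U al be x : open U -> smooth_mx U al -> smooth_mx U be -> U x ->
  d1 (fun z => al z - be z) x = d1 al x - d1 be x.
Proof.
move=> oU sa sb Ux; rewrite (d1_add sa (smooth_oppmx oU sb) Ux).
by rewrite (d1_opp oU sb Ux).
Qed.

Lemma d1_grad U f x : open U -> smooth U f -> U x -> d1 (grad f) x = 0.
Proof.
move=> oU sf Ux; apply/matrixP => i j; rewrite !mxE.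
have E l : (fun z => grad f z 0 l) = pd l f by apply/funext => z; rewrite mxE.
by rewrite !E (schwarz i j oU sf Ux) subrr.
Qed.

Lemma d1_anti al x : (d1 al x)^T = - d1 al x.
Proof. by apply/matrixP => i j; rewrite !mxE opprB. Qed.

Lemma wedgeE (a b : 'rV[R]_n) i j : wedge a b i j = a 0 i * b 0 j - b 0 i * a 0 j.
Proof. by rewrite !mxE !big_ord1 !mxE. Qed.

Lemma wedge_conj p (E : 'M[R]_(p, n)) (a b : 'rV[R]_n) :
  E *m wedge a b *m E^T = wedge (a *m E^T) (b *m E^T).
Proof. by rewrite /wedge mulmxBr mulmxBl !trmx_mul !trmxK !mulmxA. Qed.

Lemma smooth_d1 U al : open U -> smooth_mx U al -> smooth_mx U (d1 al).
Proof.
move=> oU sa i j; under eq_fun do rewrite mxE.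
by apply: smoothB => //; apply: smooth_pd; exact: sa.
Qed.

(** [d (d al)] contracted with three vectors; the six second derivatives
    cancel in pairs. *)
Lemma d1_closed U al x (u v w : 'rV[R]_n) : open U -> smooth_mx U al -> U x ->
  (v *m 'D_u (d1 al) x *m w^T + w *m 'D_v (d1 al) x *m u^T + u *m 'D_w (d1 al) x *m v^T) 0 0 = 0.
Proof.
move=> oU sa Ux.
have sd := smooth_d1 oU sa.
have D (z : 'rV[R]_n) : 'D_z (d1 al) x = \sum_i z 0 i *: pdm i (d1 al) x.
  apply/matrixP => j k; rewrite summxE derive_mx; last first.
    apply/derivable_mxP => a b; apply: diff_derivable; exact: smooth_diff (sd a b) Ux.
  rewrite mxE derive_sum_pd; last exact: smooth_diff (sd j k) Ux.
  by apply: eq_bigr => i _; rewrite !mxE.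
pose P i j k := pdm i (d1 al) x j k.
have T (p q r : 'rV[R]_n) : (q *m 'D_p (d1 al) x *m r^T) 0 0 =
    \sum_i \sum_j \sum_k p 0 i * q 0 j * r 0 k * P i j k.
  rewrite D mulmx_sumr mulmx_suml summxE; apply: eq_bigr => i _.
  rewrite -scalemxAr -scalemxAl [LHS]mxE [(_ *m r^T) _ _]mxE mulr_sumr exchange_big /=.
  apply: eq_bigr => k _; rewrite [(q *m _) _ _]mxE [r^T _ _]mxE mulr_suml mulr_sumr.
  by apply: eq_bigr => j _; rewrite -/(P i j k); move: (P i j k) (p 0 i) (q 0 j) (r 0 k) => *; ring.
rewrite [LHS]mxE [X in X + _]mxE !T.
have -> : \sum_i \sum_j \sum_k v 0 i * w 0 j * u 0 k * P i j k =
   \sum_i \sum_j \sum_k u 0 i * v 0 j * w 0 k * P j k i.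
  rewrite exchange_big /=; under eq_bigr do rewrite exchange_big /=.
  rewrite exchange_big /=; apply: eq_bigr => i _; rewrite exchange_big /=; apply: eq_bigr => j _.
  by apply: eq_bigr => k _; move: (P _ _ _) (u 0 _) (v 0 _) (w 0 _) => *; ring.
have -> : \sum_i \sum_j \sum_k w 0 i * u 0 j * v 0 k * P i j k =
   \sum_i \sum_j \sum_k u 0 i * v 0 j * w 0 k * P k i j.
  rewrite exchange_big /=; apply: eq_bigr => i _; rewrite exchange_big /=; apply: eq_bigr => j _.
  by apply: eq_bigr => k _; move: (P _ _ _) (u 0 _) (v 0 _) (w 0 _) => *; ring.
rewrite -!big_split /= big1 // => i _; rewrite -!big_split /= big1 // => j _.
rewrite -!big_split /= big1 // => k _; rewrite -!mulrDr.
suff -> : P i j k + P j k i + P k i j = 0 by rewrite mulr0.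
have PE a b c : P a b c = pd a (pd b (fun z => al z 0 c)) x - pd a (pd c (fun z => al z 0 b)) x.
  rewrite /P mxE (_ : (fun z => d1 al z b c) = fun z => pd b (fun z => al z 0 c) z - pd c (fun z => al z 0 b) z).
    by rewrite pdB //; apply: (smooth_diff (smooth_pd _ (sa _ _)) Ux).
  by apply/funext => z; rewrite mxE.
rewrite !PE (schwarz i j oU (sa 0 k) Ux) (schwarz j k oU (sa 0 i) Ux) (schwarz k i oU (sa 0 j) Ux).
move: (pd j _ x) (pd i (pd k _) x) (pd k (pd j _) x) => p q r.
by rewrite addrC !addrA; lra.
Qed.

End Exterior.

Section Pullback.
Context {R : realType} {n p : nat}.
Implicit Types (U : set 'rV[R]_n) (V : set 'rV[R]_p) (q : 'rV[R]_n -> 'rV[R]_p).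

Lemma smooth_pull1 U V q b : open U -> (forall x, U x -> V (q x)) -> smooth_mx U q -> smooth_mx V b ->
  smooth_mx U (pull1 q b).
Proof.
move=> oU qV sq sb; apply: smooth_mulmx => //; first exact: smooth_chain_mx qV sq sb.
by apply: smooth_trmx; exact: smooth_jacobian.
Qed.

(** The second derivatives of [q] are symmetric and drop out. *)
Lemma d1_pull1 U V q b x : open U -> (forall x, U x -> V (q x)) -> smooth_mx U q -> smooth_mx V b -> U x ->
  d1 (pull1 q b) x = pull2 q (d1 b) x.
Proof.
move=> oU qV sq sb Ux; apply/matrixP => i j.
have JE z k l : U z -> 'J q z k l = pd k (fun z => q z 0 l) z by move=> Uz; exact: jacobian_smooth sq Uz.
have dq l : differentiable (fun z => q z 0 l) x by exact: smooth_diff (sq 0 l) Ux.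
have E k l : pd k (fun z => pull1 q b z 0 l) x =
   \sum_m ((\sum_s 'J q x k s * pd s (fun y => b y 0 m) (q x)) * 'J q x l m
     + b (q x) 0 m * pd k (pd l (fun z => q z 0 m)) x).
  rewrite (@pd_ext _ _ k U _ (fun z => \sum_m b (q z) 0 m * pd l (fun z => q z 0 m) z)) //; last first.
    by move=> z Uz; rewrite /pull1 mxE; apply: eq_bigr => m _; rewrite [_^T _ _]mxE JE.
  have db m : differentiable (fun z => b (q z) 0 m) x.
    exact: (@differentiable_chain _ _ _ (fun y => b y 0 m) q x dq (smooth_diff (sb 0 m) (qV _ Ux))).
  have dp m : differentiable (pd l (fun z => q z 0 m)) x by exact: smooth_diff (smooth_pd _ (sq 0 m)) Ux.
  rewrite pd_sum => [|m _]; last exact: differentiableM.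
  apply: eq_bigr => m _; rewrite pdM // JE //; congr (_ * _ + _).
  rewrite (@pd_chain _ _ _ (fun y => b y 0 m) q x k dq (smooth_diff (sb 0 m) (qV _ Ux))).
  by apply: eq_bigr => s _; rewrite JE.
rewrite mxE !E -sumrB.
transitivity (\sum_m ((\sum_s 'J q x i s * pd s (fun y => b y 0 m) (q x)) * 'J q x j m
      - (\sum_s 'J q x j s * pd s (fun y => b y 0 m) (q x)) * 'J q x i m)).
  apply: eq_bigr => m _; rewrite (schwarz i j oU (sq 0 m) Ux).
  by move: (pd j _ x) (\sum_s _) (\sum_s _) => *; ring.
rewrite sumrB /pull2 mxE.
under [RHS]eq_bigr => m _ do rewrite [_^T _ _]mxE [(_ *m _) _ _]mxE.
transitivity (\sum_m (\sum_s 'J q x i s * (pd s (fun y => b y 0 m) (q x) - pd m (fun y => b y 0 s) (q x))) * 'J q x j m); last first.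
  by apply: eq_bigr => m _; congr (_ * _); apply: eq_bigr => s _; rewrite [d1 _ _ _ _]mxE.
under [RHS]eq_bigr => m _ do (under eq_bigr do rewrite mulrBr; rewrite sumrB mulrBl).
rewrite sumrB; congr (_ - _).
under eq_bigr do rewrite mulr_suml; under [RHS]eq_bigr do rewrite mulr_suml.
rewrite exchange_big /=; apply: eq_bigr => s _; apply: eq_bigr => m _.
by move: (pd _ _ _) ('J q x) => z M; ring.
Qed.

End Pullback.

Section WeylFrame.
Context {R : realType} {n : nat}.
Variables (U : set 'rV[R]_n) (g E : 'rV[R]_n -> 'M[R]_n) (a : 'rV[R]_n -> 'rV[R]_n) (phi : 'rV[R]_n -> R).
Hypotheses (oU : open U) (mg : riemannian U g) (sa : smooth_mx U a) (sE : smooth_mx U E)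
  (uE : forall x, U x -> E x \in unitmx) (sphi : smooth U phi) (phi0 : forall x, U x -> 0 < phi x)
  (EgE : forall x, U x -> E x *m g x *m (E x)^T = (phi x)%:M).

Let N := cmat (weyl_chr g a).
Let sN i : smooth_mx U (N i). Proof. exact: smooth_cmat_weyl oU mg sa i. Qed.

(** [fconn] is the connection matrix of the frame [E] in coordinate directions
    and [fgam] in frame directions; [cof] is the dual coframe and [fstr b] the
    matrix of [d (cof b)] in the frame. *)
Definition fconn i x : 'M[R]_n := (pdm i E x + E x *m cmat (weyl_chr g a) i x) *m invmx (E x).
Definition fgam c x : 'M[R]_n := \sum_i E x c i *: fconn i x.
Definition cof b x : 'rV[R]_n := (col b (invmx (E x)))^T.
Definition fstr b x : 'M[R]_n := E x *m d1 (cof b) x *m (E x)^T.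

Lemma smooth_invE : smooth_mx U (fun x => invmx (E x)).
Proof. exact: smooth_invmx oU uE sE. Qed.

Lemma smooth_fconn i : smooth_mx U (fconn i).
Proof.
apply: (smooth_mulmx oU _ smooth_invE); apply: (smooth_addmx oU); first exact: smooth_pdm.
exact: smooth_mulmx oU sE (sN i).
Qed.

Lemma fconnE i x : U x -> pdm i E x + E x *m N i x = fconn i x *m E x.
Proof. by move=> Ux; rewrite /fconn mulmxKV // uE. Qed.

Lemma fconn_curv i j x : U x -> E x *m curv N i j x = curv fconn i j x *m E x.
Proof.
move=> Ux; apply: (curv_intertwine oU sE sN smooth_fconn Ux) => k z Uz; exact: fconnE.
Qed.

(** The connection is conformal and the frame orthonormal up to [phi]. *)
Lemma fconn_skew i x : U x ->
  fconn i x + (fconn i x)^T = (2 * a x 0 i + pd i phi x / phi x)%:M.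
Proof.
move=> Ux.
have D := pdm_ext i oU Ux EgE.
have pphi : pdm i (fun z => (phi z)%:M : 'M[R]_n) x = (pd i phi x)%:M.
  apply/matrixP => j k; rewrite !mxE.
  rewrite (_ : (fun z => (phi z)%:M j k) = fun z => (j == k)%:R * phi z); last first.
    by apply/funext => z; rewrite mxE mulr_natl.
  by rewrite pdZ ?mulr_natl //; exact: smooth_diff sphi Ux.
have sg := met_smooth mg.
rewrite pphi (pdm_mul i (smooth_mulmx oU sE sg) (smooth_trmx sE) Ux) pdm_tr in D.
rewrite (pdm_mul i sE sg Ux) (weyl_metric a oU mg i Ux) in D.
have pE : pdm i E x = fconn i x *m E x - E x *m N i x by rewrite -fconnE // addrK.
rewrite pE in D; apply: (scalerI (a := phi x)); first by rewrite gt_eqF // phi0.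
have -> : phi x *: (2 * a x 0 i + pd i phi x / phi x)%:M = (2 * a x 0 i * phi x)%:M + (pd i phi x)%:M :> 'M[R]_n.
  rewrite scale_scalar_mx -raddfD /=; congr (_%:M).
  by field; rewrite gt_eqF // phi0.
rewrite -D.
have P1 : fconn i x *m (E x *m g x *m (E x)^T) = phi x *: fconn i x.
  by rewrite EgE // mul_mx_scalar.
have P2 : (E x *m g x *m (E x)^T) *m (fconn i x)^T = phi x *: (fconn i x)^T.
  by rewrite EgE // mul_scalar_mx.
have P3 : (2 * a x 0 i * phi x)%:M = (2 * a x 0 i) *: (E x *m g x *m (E x)^T) :> 'M[R]_n.
  by rewrite EgE // scale_scalar_mx.
rewrite scalerDr -P1 -P2 P3 /N; move: (fconn i x) (cmat (weyl_chr g a) i x) (E x) (g x) (2 * a x 0 i) => F M e G c.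
rewrite [(F *m e - _)^T]linearB /= !trmx_mul.
rewrite !(mulmxDl, mulmxDr, mulNmx, mulmxN) -!scalemxAr -!scalemxAl !mulmxA.
move: (F *m _ *m _ *m _) (e *m M *m _ *m _) (e *m G *m M^T *m _) (e *m G *m e^T *m F^T) (e *m G *m e^T) => A1 A2 A3 A4 A5.
by apply/matrixP => j k; rewrite !mxE; move: (A1 j k) (A2 j k) (A3 j k) (A4 j k) (A5 j k) => *; ring.
Qed.

Lemma pdm_coframe i x : U x ->
  pdm i (fun z => invmx (E z)) x = N i x *m invmx (E x) - invmx (E x) *m fconn i x.
Proof.
move=> Ux; have u := uE Ux.
have D : pdm i (fun z => E z *m invmx (E z)) x = 0.
  by rewrite (pdm_ext i oU Ux (fun z Uz => mulmxV (uE Uz))) pdm_cst.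
rewrite (pdm_mul i sE smooth_invE Ux) in D.
have pE : pdm i E x = fconn i x *m E x - E x *m N i x by rewrite -fconnE // addrK.
have := congr1 (mulmx (invmx (E x))) D.
rewrite mulmx0 mulmxDr mulKmx // pE mulmxBl -!mulmxA mulmxV // mulmx1 mulmxBr mulKmx //.
by move/eqP; rewrite addrC addr_eq0 opprB => /eqP.
Qed.

Lemma d1_cof b x i j : U x ->
  d1 (cof b) x i j = (invmx (E x) *m fconn j x) i b - (invmx (E x) *m fconn i x) j b.
Proof.
move=> Ux.
have C k l : pd k (fun z => cof b z 0 l) x = pdm k (fun z => invmx (E z)) x l b.
  have -> : (fun z => cof b z 0 l) = fun z => invmx (E z) l b by apply/funext => z; rewrite [LHS]mxE [LHS]mxE.
  by rewrite [RHS]mxE.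
rewrite mxE !C !pdm_coframe // !mxE.
have S : \sum_k N i x j k * invmx (E x) k b = \sum_k N j x i k * invmx (E x) k b.
  apply: eq_bigr => k _; congr (_ * _); rewrite !mxE; exact: (weyl_chr_torsion_free a oU mg Ux).
rewrite S; move: (\sum_j0 _) (\sum_j0 _) (\sum_j0 _) => p q r; ring.
Qed.

(** The first structure equation. *)
Lemma fstrE b x c d : U x -> fstr b x c d = fgam d x c b - fgam c x d b.
Proof.
move=> Ux; have u := uE Ux.
have EK (M : 'M[R]_n) k l : \sum_i E x k i * (invmx (E x) *m M) i l = M k l.
  by have := congr1 (fun M : 'M[R]_n => M k l) (mulKVmx u M); rewrite mxE.
rewrite /fstr mxE.
transitivity (\sum_j \sum_i (E x c i * E x d j) * ((invmx (E x) *m fconn j x) i b - (invmx (E x) *m fconn i x) j b)).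
  apply: eq_bigr => j _; rewrite mxE mulr_suml; apply: eq_bigr => i _.
  by rewrite d1_cof // [_^T _ _]mxE; move: (_ - _) => z; ring.
under eq_bigr do (under eq_bigr do rewrite mulrBr; rewrite sumrB).
rewrite sumrB /fgam !summxE; congr (_ - _).
  apply: eq_bigr => j _; rewrite [RHS]mxE -(EK (fconn j x) c b) mulr_sumr; apply: eq_bigr => i _.
  by rewrite mulrA (mulrC (E x d j)).
rewrite exchange_big /=; apply: eq_bigr => i _; rewrite [RHS]mxE -(EK (fconn i x) d b) mulr_sumr.
by apply: eq_bigr => j _; rewrite mulrA.
Qed.

(** The trace part of the connection: [D] acts on the frame by this Weyl form
    plus a skew part. *)
Definition fwt c x : R := \sum_i E x c i * (a x 0 i + pd i phi x / (2 * phi x)).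

Lemma fgam_skew c x : U x -> fgam c x + (fgam c x)^T = (2 * fwt c x)%:M.
Proof.
move=> Ux; rewrite /fgam /fwt linear_sum -big_split /= mulr_sumr raddf_sum /=.
apply: eq_bigr => i _; rewrite linearZ /= -scalerDr fconn_skew // scale_scalar_mx; congr (_%:M).
by field; rewrite gt_eqF // phi0.
Qed.

(** The Koszul formula: a skew connection with given torsion is determined by
    the structure functions. *)
Lemma koszul c x i j : U x ->
  fgam c x i j - fwt c x * (i == j)%:R =
  2^-1 * (fstr c x i j - fstr i x j c - fstr j x c i) + fwt i x * (c == j)%:R - fwt j x * (c == i)%:R.
Proof.
move=> Ux; have f1 := fstrE c i j Ux; have f2 := fstrE i j c Ux; have f3 := fstrE j c i Ux.
have S k p q : fgam k x p q + fgam k x q p = 2 * fwt k x * (p == q)%:R.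
  have := congr1 (fun M : 'M[R]_n => M p q) (fgam_skew k Ux).
  by rewrite !mxE mulr_natr.
have A (p1 p2 p3 g1 g2 g3 g4 g5 g6 w1 w2 w3 d1 d2 d3 : R) :
    p1 = g1 - g2 -> p2 = g3 - g4 -> p3 = g5 - g6 -> g6 + g3 = 2 * w1 * d1 -> g2 + g5 = 2 * w2 * d2 ->
    g4 + g1 = 2 * w3 * d3 -> g6 - w1 * d1 = 2^-1 * (p1 - p2 - p3) + w2 * d2 - w3 * d3 by lra.
by apply: (A _ _ _ _ _ _ _ _ _ _ _ _ _ _ _ f1 f2 f3 (S c i j) _ (S j c i)); rewrite (eq_sym c j); exact: S.
Qed.

End WeylFrame.

(** * Determinants and star operators in an oriented frame *)

(** Indices of the base and of the total space; in a frame of the total space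
    [q3] is the vertical leg. *)
Definition t0 : 'I_3 := Ordinal (isT : (0 < 3)%N).
Definition t1 : 'I_3 := Ordinal (isT : (1 < 3)%N).
Definition t2 : 'I_3 := Ordinal (isT : (2 < 3)%N).
Definition q0 : 'I_4 := Ordinal (isT : (0 < 4)%N).
Definition q1 : 'I_4 := Ordinal (isT : (1 < 4)%N).
Definition q2 : 'I_4 := Ordinal (isT : (2 < 4)%N).
Definition q3 : 'I_4 := Ordinal (isT : (3 < 4)%N).

Lemma ord3P (P : 'I_3 -> Prop) : P t0 -> P t1 -> P t2 -> forall i, P i.
Proof.
move=> p0 p1 p2 [[|[|[|//]]] p].
- by rewrite (_ : Ordinal p = t0) //; exact: val_inj.
- by rewrite (_ : Ordinal p = t1) //; exact: val_inj.
- by rewrite (_ : Ordinal p = t2) //; exact: val_inj.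
Qed.

Lemma ord4P (P : 'I_4 -> Prop) : P q0 -> P q1 -> P q2 -> P q3 -> forall i, P i.
Proof.
move=> p0 p1 p2 p3 [[|[|[|[|//]]]] p].
- by rewrite (_ : Ordinal p = q0) //; exact: val_inj.
- by rewrite (_ : Ordinal p = q1) //; exact: val_inj.
- by rewrite (_ : Ordinal p = q2) //; exact: val_inj.
- by rewrite (_ : Ordinal p = q3) //; exact: val_inj.
Qed.

Lemma sum3 (V : nmodType) (f : 'I_3 -> V) : \sum_i f i = f t0 + f t1 + f t2.
Proof.
rewrite !big_ord_recl big_ord0 addr0 addrA.
by congr (f _ + f _ + f _); exact: val_inj.
Qed.

Lemma sum4 (V : nmodType) (f : 'I_4 -> V) : \sum_i f i = f q0 + f q1 + f q2 + f q3.
Proof.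
rewrite !big_ord_recl big_ord0 addr0 !addrA.
by congr (f _ + f _ + f _ + f _); exact: val_inj.
Qed.

(** Arithmetic is done on variables in place of matrix entries, whose
    comparison up to conversion is costly. *)
Ltac gen_entries := repeat match goal with
  |- context [@fun_of_matrix ?T ?m ?n ?M ?i ?j] => generalize (@fun_of_matrix T m n M i j); intro end.
Ltac gen_deltas := repeat match goal with
  |- context [@GRing.natmul ?V 1 (nat_of_bool ?b)] => generalize (@GRing.natmul V 1 (nat_of_bool b)); intro end.
Section Determinants.
Context {R : realType}.

Lemma det_row_expand n (M : 'M[R]_n) r :
  \det M = \sum_j M r j * \det (\matrix_(i, k) if i == r then (j == k)%:R else M i k).
Proof.
rewrite (expand_det_row M r); apply: eq_bigr => j _; congr (_ * _).
rewrite (expand_det_row _ r) (bigD1 j) //= mxE !eqxx mul1r big1 ?addr0 => [|k kj]; last first.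
  by rewrite mxE eqxx eq_sym (negbTE kj) mul0r.
rewrite /cofactor; congr (_ * \det _); apply/matrixP => a b; rewrite !mxE.
by rewrite eq_sym (negbTE (neq_lift _ _)).
Qed.


Lemma matrix_natE m n (M : 'M[R]_(m.+1, n.+1)) :
  exists f : nat -> nat -> R, M = \matrix_(i, j) f i j.
Proof.
exists (fun a b => M (inord a) (inord b)).
by apply/matrixP => i j; rewrite mxE !inord_val.
Qed.

Lemma det3E (M : 'M[R]_3) : \det M =
  M t0 t0 * (M t1 t1 * M t2 t2 - M t1 t2 * M t2 t1)
  - M t0 t1 * (M t1 t0 * M t2 t2 - M t1 t2 * M t2 t0)
  + M t0 t2 * (M t1 t0 * M t2 t1 - M t1 t1 * M t2 t0).
Proof.
have [f ->] := matrix_natE M.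
rewrite (expand_det_row _ t0) sum3 /cofactor.
rewrite !(expand_det_row _ ord0) !big_ord_recl !big_ord0 /cofactor !det_mx11 !mxE /= /bump /=.
rewrite !addn0 !add0n !add1n /=.
move: (f 0%N) (f 1%N) (f 2%N) => f0 f1 f2.
move: (f0 0%N) (f0 1%N) (f0 2%N) (f1 0%N) (f1 1%N) (f1 2%N) (f2 0%N) (f2 1%N) (f2 2%N) => *.
ring.
Qed.

Lemma det4E (M : 'M[R]_4) : \det M =
  M q0 q0 * (M q1 q1 * (M q2 q2 * M q3 q3 - M q2 q3 * M q3 q2)
    - M q1 q2 * (M q2 q1 * M q3 q3 - M q2 q3 * M q3 q1) + M q1 q3 * (M q2 q1 * M q3 q2 - M q2 q2 * M q3 q1))
  - M q0 q1 * (M q1 q0 * (M q2 q2 * M q3 q3 - M q2 q3 * M q3 q2)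
    - M q1 q2 * (M q2 q0 * M q3 q3 - M q2 q3 * M q3 q0) + M q1 q3 * (M q2 q0 * M q3 q2 - M q2 q2 * M q3 q0))
  + M q0 q2 * (M q1 q0 * (M q2 q1 * M q3 q3 - M q2 q3 * M q3 q1)
    - M q1 q1 * (M q2 q0 * M q3 q3 - M q2 q3 * M q3 q0) + M q1 q3 * (M q2 q0 * M q3 q1 - M q2 q1 * M q3 q0))
  - M q0 q3 * (M q1 q0 * (M q2 q1 * M q3 q2 - M q2 q2 * M q3 q1)
    - M q1 q1 * (M q2 q0 * M q3 q2 - M q2 q2 * M q3 q0) + M q1 q2 * (M q2 q0 * M q3 q1 - M q2 q1 * M q3 q0)).
Proof.
have [f ->] := matrix_natE M.
rewrite (expand_det_row _ q0) sum4 /cofactor !det3E !mxE /= /bump /=.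
rewrite !addn0 !add0n !add1n /=.
move: (f 0%N) (f 1%N) (f 2%N) (f 3%N) => f0 f1 f2 f3.
move: (f0 0%N) (f0 1%N) (f0 2%N) (f0 3%N) (f1 0%N) (f1 1%N) (f1 2%N) (f1 3%N) => *.
move: (f2 0%N) (f2 1%N) (f2 2%N) (f2 3%N) (f3 0%N) (f3 1%N) (f3 2%N) (f3 3%N) => *.
ring.
Qed.

Definition rows n (s : seq 'rV[R]_n) : 'M[R]_n := \matrix_(k < n) s`_k.

Lemma rows_mul n (s : seq 'rV[R]_n) (A : 'M[R]_n) : rows [seq u *m A | u <- s] = rows s *m A.
Proof.
apply/row_matrixP => i; rewrite row_mul !rowK.
have [si|si] := ltnP i (size s); first by rewrite (nth_map 0).
by rewrite !nth_default ?size_map // mul0mx.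
Qed.

Lemma det_rows_slot n (p s : seq 'rV[R]_n) u : (size p < n)%N ->
  \det (rows (p ++ u :: s)) = \sum_j u 0 j * \det (rows (p ++ bvec j :: s)).
Proof.
move=> pn; rewrite (det_row_expand _ (Ordinal pn)); apply: eq_bigr => j _.
rewrite mxE nth_cat ltnn subnn /=; congr (_ * \det _); apply/matrixP => i k; rewrite !mxE.
rewrite !nth_cat -val_eqE /=; case: (ltngtP i (size p)) => // ip.
  have : (0 < i - size p)%N by rewrite subn_gt0.
  by case: (i - size p)%N.
by rewrite ip subnn /= mxE eqxx eq_sym.
Qed.

End Determinants.

Section Stars.
Context {R : realType}.

Definition eps (i j k l : 'I_4) : R := \det (rows [:: bvec i; bvec j; bvec k; bvec l]).

(** The formula of [star4] for an orthonormal frame. *)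
Definition fstar (M : 'M[R]_4) : 'M[R]_4 :=
  \matrix_(a, b) (2^-1 * \sum_c \sum_d M c d * eps d c a b).

Lemma det_rows_pair01 (u v w z : 'rV[R]_4) :
  \det (rows [:: u; v; w; z]) = \sum_j \sum_i u 0 j * v 0 i * \det (rows [:: bvec j; bvec i; w; z]).
Proof.
rewrite (@det_rows_slot _ _ [::] [:: v; w; z] u) //; apply: eq_bigr => j _.
rewrite (@det_rows_slot _ _ [:: bvec j] [:: w; z] v) // mulr_sumr; apply: eq_bigr => i _.
by rewrite mulrA.
Qed.

Lemma det_rows_pair23 (u v w z : 'rV[R]_4) :
  \det (rows [:: u; v; w; z]) = \sum_j \sum_i w 0 j * z 0 i * \det (rows [:: u; v; bvec j; bvec i]).
Proof.
rewrite (@det_rows_slot _ _ [:: u; v] [:: z] w) //; apply: eq_bigr => j _.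
rewrite (@det_rows_slot _ _ [:: u; v; bvec j] [::] z) // mulr_sumr; apply: eq_bigr => i _.
by rewrite mulrA.
Qed.

(** The star operator of a conformal class in the middle degree depends on the
    metric only through the orientation and the conformal class: the two
    inverse metrics compensate the volume. *)
Lemma star4_frame (g : 'rV[R]_4 -> 'M[R]_4) x (E M : 'M[R]_4) W : 
  0 < W -> 0 < \det E -> E *m g x *m E^T = W%:M ->
  E *m star4 g x M *m E^T = fstar (E *m M *m E^T).
Proof.
move=> W0 dE EgE.
have uE : E \in unitmx by rewrite unitmxE unitfE gt_eqF.
have ET : E^T \in unitmx by rewrite unitmx_tr.
have gi : invmx (g x) = W^-1 *: (E^T *m E).
  have gE : g x = W *: (invmx E *m invmx E^T).
    have : invmx E *m (E *m g x *m E^T) *m invmx E^T = invmx E *m W%:M *m invmx E^T by rewrite EgE.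
    by rewrite !mulmxA mulVmx // mul1mx mulmxK // mul_mx_scalar -scalemxAl.
  have Wu : W \is a GRing.unit by rewrite unitfE gt_eqF.
  rewrite gE invmxZ ?unitmx_mul ?unitmx_inv ?uE ?ET //; last first.
    by rewrite -mul_scalar_mx unitmx_mul unitmx_mul !unitmx_inv uE ET andbT unitmxE det_scalar unitrX.
  congr (_ *: _); apply: (@mulrI _ (invmx E *m invmx E^T)).
    by rewrite unitmx_mul !unitmx_inv uE.
  rewrite [LHS]mulmxV ?unitmx_mul ?unitmx_inv ?uE //.
  by rewrite [RHS]/= -[RHS]/(_ *m _) mulmxA -(mulmxA (invmx E)) mulVmx // mulmx1 mulVmx.
have sd : Num.sqrt (\det (g x)) = W ^+ 2 / \det E.
  have dg : \det (g x) = (W ^+ 2 / \det E) ^+ 2.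
    have := congr1 determinant EgE; rewrite !det_mulmx det_tr det_scalar => D.
    have d0 : \det E != 0 by rewrite gt_eqF.
    by apply: (mulfI d0); apply: (mulIf d0); rewrite D; field.
  by rewrite dg sqrtr_sqr ger0_norm // ltW // divr_gt0 // exprn_gt0.
apply/matrixP => a b.
pose Q w z : 'M[R]_4 := \matrix_(j, i) \det (rows [:: bvec j; bvec i; w; z]).
have sQ k l : star4 g x M k l = 2^-1 * (Num.sqrt (\det (g x)) *
    \tr (invmx (g x) *m M *m (invmx (g x))^T *m Q (bvec k) (bvec l))).
  rewrite mxE; congr (_ * _); rewrite /mxtrace mulr_sumr; apply: eq_bigr => i _.
  rewrite [(_ *m Q _ _) _ _]mxE mulr_sumr; apply: eq_bigr => j _; rewrite /vol [Q _ _ _ _]mxE.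
  by rewrite mulrCA.
have -> : (E *m star4 g x M *m E^T) a b = 2^-1 * (Num.sqrt (\det (g x)) *
    \tr (invmx (g x) *m M *m (invmx (g x))^T *m Q (row a E) (row b E))).
  have QE : Q (row a E) (row b E) = \sum_k \sum_l (E a k * E b l) *: Q (bvec k) (bvec l).
    apply/matrixP => j i; rewrite [LHS]mxE det_rows_pair23 summxE; apply: eq_bigr => k _.
    by rewrite summxE; apply: eq_bigr => l _; rewrite [RHS]mxE [Q _ _ _ _]mxE !mxE.
  rewrite QE mulmx_sumr raddf_sum /= !mulr_sumr mxE.
  under eq_bigr do rewrite [(_ *m star4 _ _ _) _ _]mxE mulr_suml.
  rewrite exchange_big /=; apply: eq_bigr => k _.
  rewrite mulmx_sumr raddf_sum /= !mulr_sumr; apply: eq_bigr => l _.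
  rewrite -scalemxAr mxtraceZ [_^T _ _]mxE sQ; move: (\tr _) (Num.sqrt _) (E a k) (E b l) => *; ring.
have Qe : E *m Q (row a E) (row b E) *m E^T = \det E *: \matrix_(d, c) eps d c a b.
  apply/matrixP => d c; transitivity (\det (rows [:: row d E; row c E; row a E; row b E])).
    rewrite det_rows_pair01 mxE exchange_big /=; apply: eq_bigr => i _.
    rewrite [(E *m _) _ _]mxE mulr_suml; apply: eq_bigr => j _.
    by rewrite [Q _ _ _ _]mxE ![row _ _ _ _]mxE [_^T _ _]mxE mulrAC.
  rewrite mxE [X in _ = _ * X]mxE /eps mulrC -det_mulmx -rows_mul /= /bvec -!rowE //.
rewrite gi linearZ /= trmx_mul trmxK -!scalemxAl -scalemxAr -!scalemxAl !mxtraceZ.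
have -> : \tr (E^T *m E *m M *m (E^T *m E) *m Q (row a E) (row b E)) =
   \det E * \tr (E *m M *m E^T *m \matrix_(d, c) eps d c a b).
  rewrite -mxtraceZ scalemxAr -Qe -!mulmxA mxtrace_mulC !mulmxA; congr (\tr _); rewrite !mulmxA //.
rewrite sd [RHS]mxE /mxtrace; congr (_ * _).
have Q1 z : W ^+ 2 / \det E * (W^-1 * (W^-1 * (\det E * z))) = z.
  by move: (\det E) dE => e e0; field; rewrite !gt_eqF.
rewrite Q1; apply: eq_bigr => c _; rewrite mxE; apply: eq_bigr => d _.
by rewrite [X in _ * X]mxE.
Qed.

Lemma epsE i j k l : eps i j k l = \det (\matrix_(r < 4, s < 4)
  nth 0 [:: (i == s)%:R; (j == s)%:R; (k == s)%:R; (l == s)%:R] r).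
Proof.
rewrite /eps /rows; congr (\det _); apply/matrixP => r s.
by elim/ord4P: r; rewrite [LHS]mxE [RHS]mxE /= mxE eqxx eq_sym.
Qed.


Lemma eps30 d c : eps d c q3 q0 = (d == q2)%:R * (c == q1)%:R - (d == q1)%:R * (c == q2)%:R.
Proof. by rewrite epsE det4E !mxE /=; gen_deltas; ring. Qed.

Lemma eps31 d c : eps d c q3 q1 = (d == q0)%:R * (c == q2)%:R - (d == q2)%:R * (c == q0)%:R.
Proof. by rewrite epsE det4E !mxE /=; gen_deltas; ring. Qed.

Lemma eps32 d c : eps d c q3 q2 = (d == q1)%:R * (c == q0)%:R - (d == q0)%:R * (c == q1)%:R.
Proof. by rewrite epsE det4E !mxE /=; gen_deltas; ring. Qed.

Lemma eps12 d c : eps d c q1 q2 = (d == q0)%:R * (c == q3)%:R - (d == q3)%:R * (c == q0)%:R.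
Proof. by rewrite epsE det4E !mxE /=; gen_deltas; ring. Qed.

Lemma eps20 d c : eps d c q2 q0 = (d == q1)%:R * (c == q3)%:R - (d == q3)%:R * (c == q1)%:R.
Proof. by rewrite epsE det4E !mxE /=; gen_deltas; ring. Qed.

Lemma eps01 d c : eps d c q0 q1 = (d == q2)%:R * (c == q3)%:R - (d == q3)%:R * (c == q2)%:R.
Proof. by rewrite epsE det4E !mxE /=; gen_deltas; ring. Qed.

Lemma eps_swap d c a b : eps d c b a = - eps d c a b.
Proof. by rewrite !epsE !det4E !mxE /=; gen_deltas; ring. Qed.

(** In an oriented conformal frame with vertical leg last, the star
    interchanges the legs [3 k] and [k+1 k+2] without a sign; this is where
    the sign convention and the orientation [*1 = *_B 1 /\ xi] enter. *)
Lemma fstarE (M : 'M[R]_4) : M^T = - M ->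
  [/\ fstar M q3 q0 = M q1 q2, fstar M q3 q1 = M q2 q0 & fstar M q3 q2 = M q0 q1]
  /\ [/\ fstar M q1 q2 = M q3 q0, fstar M q2 q0 = M q3 q1 & fstar M q0 q1 = M q3 q2].
Proof.
move=> Mt; have S a b : M b a = - M a b by have := congr1 (fun N : 'M[R]_4 => N a b) Mt; rewrite !mxE.
split; split; rewrite mxE !sum4 ?eps30 ?eps31 ?eps32 ?eps12 ?eps20 ?eps01 /=.
- by rewrite (S q1 q2); gen_entries; field.
- by rewrite (S q0 q2); gen_entries; field.
- by rewrite (S q0 q1); gen_entries; field.
- by rewrite (S q0 q3); gen_entries; field.
- by rewrite (S q1 q3); gen_entries; field.
- by rewrite (S q2 q3); gen_entries; field.
Qed.

Lemma fstar_skew (M : 'M[R]_4) : (fstar M)^T = - fstar M.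
Proof.
apply/matrixP => a b; rewrite [LHS]mxE [RHS]mxE [LHS]mxE [X in - X]mxE -mulrN -sumrN.
congr (_ * _); apply: eq_bigr => c _; rewrite -sumrN; apply: eq_bigr => d _.
by rewrite eps_swap mulrN.
Qed.

Lemma fstarZ w (M : 'M[R]_4) : fstar (w *: M) = w *: fstar M.
Proof.
apply/matrixP => a b; rewrite [LHS]mxE [RHS]mxE [X in _ = _ * X]mxE mulrCA; congr (_ * _).
rewrite mulr_sumr; apply: eq_bigr => p _; rewrite [RHS]mulr_sumr.
by apply: eq_bigr => r _; rewrite [(w *: M) _ _]mxE mulrA.
Qed.

Lemma skewP (M : 'M[R]_4) : M^T = - M -> forall a b, M b a = - M a b.
Proof. by move=> Mt a b; have := congr1 (fun N : 'M[R]_4 => N a b) Mt; rewrite !mxE. Qed.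

Lemma skew_ext (M N : 'M[R]_4) : M^T = - M -> N^T = - N ->
  M q3 q0 = N q3 q0 -> M q3 q1 = N q3 q1 -> M q3 q2 = N q3 q2 ->
  M q1 q2 = N q1 q2 -> M q2 q0 = N q2 q0 -> M q0 q1 = N q0 q1 -> M = N.
Proof.
move=> /skewP SM /skewP SN e30 e31 e32 e12 e20 e01.
have dM a : M a a = 0 by have := SM a a; lra.
have dN a : N a a = 0 by have := SN a a; lra.
apply/matrixP => a b; elim/ord4P: a; elim/ord4P: b; rewrite ?dM ?dN ?e30 ?e31 ?e32 ?e12 ?e20 ?e01 //.
all: by rewrite SM ?e01 ?e20 ?e12 ?e30 ?e31 ?e32 -SN.
Qed.

Lemma fstar_eigen (M : 'M[R]_4) s : M^T = - M -> (s = 1 \/ s = -1) ->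
  fstar M = s *: M <-> [/\ M q3 q0 = s * M q1 q2, M q3 q1 = s * M q2 q0 & M q3 q2 = s * M q0 q1].
Proof.
move=> Mt s1; have [[a1 a2 a3] [b1 b2 b3]] := fstarE Mt.
have ss : s * s = 1 by case: s1 => ->; lra.
have E z : s * (s * z) = z by rewrite mulrA ss mul1r.
split=> [e|[e1 e2 e3]].
  have P a b : fstar M a b = s * M a b by rewrite e mxE.
  by split; rewrite -[LHS]E -P ?a1 ?a2 ?a3.
apply: skew_ext; first exact: fstar_skew.
- by rewrite linearZ /= Mt scalerN.
- by rewrite a1 [RHS]mxE e1 E.
- by rewrite a2 [RHS]mxE e2 E.
- by rewrite a3 [RHS]mxE e3 E.
- by rewrite b1 [RHS]mxE e1.
- by rewrite b2 [RHS]mxE e2.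
- by rewrite b3 [RHS]mxE e3.
Qed.

(** The antiselfdual endomorphisms of the frame fibre; in the coordinates [c]
    the unit vectors square to [-1] and commutators are proportional to vector
    products. *)
Definition asd (c0 c1 c2 : R) : 'M[R]_4 := \matrix_(i < 4, j < 4)
  match nat_of_ord i, nat_of_ord j with
  | 3, 0 => c0 | 3, 1 => c1 | 3, 2 => c2
  | 0, 3 => - c0 | 1, 3 => - c1 | 2, 3 => - c2
  | 1, 2 => - c0 | 2, 0 => - c1 | 0, 1 => - c2
  | 2, 1 => c0 | 0, 2 => c1 | 1, 0 => c2
  | _, _ => 0
  end.

Lemma asd_tr c0 c1 c2 : (asd c0 c1 c2)^T = - asd c0 c1 c2.
Proof.
apply/matrixP => a b; elim/ord4P: a; elim/ord4P: b; by rewrite !mxE /= ?opprK ?oppr0.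
Qed.

Lemma asd_sq c0 c1 c2 : asd c0 c1 c2 *m asd c0 c1 c2 = (- (c0 ^+ 2 + c1 ^+ 2 + c2 ^+ 2))%:M.
Proof.
apply/matrixP => a b; elim/ord4P: a; elim/ord4P: b; rewrite mxE sum4 !mxE /=; ring.
Qed.

(** The antiselfdual part of [G], in the coordinates dual to those of [asd]:
    the only part that acts on antiselfdual endomorphisms. *)
Definition asd_part (G : 'M[R]_4) (k : 'I_3) : R :=
  match nat_of_ord k with
  | 0 => G q3 q0 - G q1 q2 | 1 => G q3 q1 - G q2 q0 | _ => G q3 q2 - G q0 q1 end.

(** Conformal matrices act on antiselfdual endomorphisms by the vector product
    with their antiselfdual part. *)
Lemma asd_comm c0 c1 c2 (G : 'M[R]_4) w : G + G^T = (2 * w)%:M ->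
  asd c0 c1 c2 *m G - G *m asd c0 c1 c2 =
  asd (c1 * asd_part G t2 - c2 * asd_part G t1) (c2 * asd_part G t0 - c0 * asd_part G t2) (c0 * asd_part G t1 - c1 * asd_part G t0).
Proof.
move=> H; have S a b : G b a = (2 * w) *+ (a == b) - G a b.
  by have := congr1 (fun N : 'M[R]_4 => N a b) H; rewrite !mxE => <-; rewrite addrAC subrr add0r.
have D a : G a a = w by have := S a a; rewrite eqxx mulr1n; lra.
have [e1 e2 e3] := And3 (S q3 q0) (S q3 q1) (S q3 q2).
have [e4 e5 e6] := And3 (S q1 q2) (S q2 q0) (S q0 q1).
rewrite !mulr0n !sub0r in e1 e2 e3 e4 e5 e6.
apply/matrixP => a b; elim/ord4P: a; elim/ord4P: b; rewrite [LHS]mxE [X in _ + X]mxE ![(_ *m _) _ _]mxE !sum4 !mxE /asd_part /= ?D ?e1 ?e2 ?e3 ?e4 ?e5 ?e6; gen_entries; ring.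
Qed.

Lemma asd_tr1 (G : 'M[R]_4) w : G + G^T = (2 * w)%:M -> \tr (asd 1 0 0 *m G) = - 2 * asd_part G t0.
Proof.
move=> H; have S a b : G b a = (2 * w) *+ (a == b) - G a b.
  by have := congr1 (fun N : 'M[R]_4 => N a b) H; rewrite !mxE => <-; rewrite addrAC subrr add0r.
have e1 := S q3 q0; have e4 := S q1 q2; rewrite !mulr0n !sub0r in e1 e4.
by rewrite /mxtrace sum4 ![(_ *m _) _ _]mxE !sum4 !mxE /asd_part /= e1 e4; gen_entries; ring.
Qed.

Lemma asd_inj c0 c1 c2 d0 d1 d2 : asd c0 c1 c2 = asd d0 d1 d2 -> [/\ c0 = d0, c1 = d1 & c2 = d2].
Proof.
move=> E; have P k := congr1 (fun M : 'M[R]_4 => M q3 k) E.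
by have := P q0; have := P q1; have := P q2; rewrite !mxE /= => -> -> ->.
Qed.

(** Orthogonality and [J^2 = -1] make the frame matrix skew, and three of its
    components determine it because its form is antiselfdual. *)
Lemma asd_of_form (g : 'rV[R]_4 -> 'M[R]_4) x (E J : 'M[R]_4) W : 
  0 < W -> 0 < \det E -> E *m g x *m E^T = W%:M -> (g x)^T = g x ->
  J *m J = - 1%:M -> J *m g x *m J^T = g x -> star4 g x (J *m g x) = - (J *m g x) ->
  let Jh := E *m J *m invmx E in let c k := Jh q3 k in
  Jh = asd (c q0) (c q1) (c q2) /\ c q0 ^+ 2 + c q1 ^+ 2 + c q2 ^+ 2 = 1.
Proof.
move=> W0 dE EgE gs JJ Jg sJ Jh c.
have uE : E \in unitmx by rewrite unitmxE unitfE gt_eqF.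
have WJ : E *m (J *m g x) *m E^T = W *: Jh.
  rewrite -mul_mx_scalar -EgE /Jh !mulmxA mulmxKV //.
have skJ : (J *m g x)^T = - (J *m g x).
  rewrite trmx_mul gs; have : J *m (J *m g x *m J^T) = J *m g x by rewrite Jg.
  by rewrite !mulmxA JJ mulNmx mul1mx mulNmx => /eqP; rewrite eqr_oppLR => /eqP.
have W0' : W != 0 by rewrite gt_eqF.
have skh : Jh^T = - Jh.
  apply: (scalerI W0'); rewrite scalerN -WJ -[LHS]linearZ /= -WJ.
  by rewrite [LHS]trmx_mul [in LHS]trmx_mul skJ trmxK mulNmx mulmxN mulmxA.
have sh : fstar Jh = (-1) *: Jh.
  have := star4_frame (J *m g x) W0 dE EgE; rewrite sJ mulmxN mulNmx WJ => h.
  by apply: (scalerI W0'); rewrite scaleN1r scalerN h fstarZ.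
have [e0 e1 e2] := (fstar_eigen skh (or_intror (erefl (-1)))).1 sh.
have JhE : Jh = asd (c q0) (c q1) (c q2).
  by apply: skew_ext; rewrite ?asd_tr //; rewrite /asd [RHS]mxE /= /c ?e0 ?e1 ?e2 ?mulN1r ?opprK.
split=> //.
have : Jh *m Jh = - 1%:M.
  by rewrite /Jh !mulmxA mulmxKV // -(mulmxA E) JJ mulmxN mulmx1 mulNmx mulmxV.
rewrite JhE asd_sq => /(congr1 (fun M : 'M[R]_4 => M q0 q0)); rewrite !mxE /= !mulr1n.
by move/oppr_inj.
Qed.

End Stars.

(** * Differential forms and curvature in a frame *)

Section FrameCalculus.
Context {R : realType} {n : nat}.
Variables (U : set 'rV[R]_n) (E : 'rV[R]_n -> 'M[R]_n).
Hypotheses (oU : open U) (sE : smooth_mx U E) (uE : forall x, U x -> E x \in unitmx).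

Definition fd c f x : R := \sum_i E x c i * pd i f x.
Definition fdm p q c (A : 'rV[R]_n -> 'M[R]_(p, q)) x := \sum_i E x c i *: pdm i A x.

Lemma smooth_fd c f : smooth U f -> smooth U (fd c f).
Proof. by move=> sf; apply: (smooth_sum _ _ oU) => i; exact: (smoothM oU (sE c i) (smooth_pd i sf)). Qed.

Lemma fdE c f x : fd c f x = (grad f x *m (E x)^T) 0 c.
Proof. by rewrite mxE; apply: eq_bigr => i _; rewrite !mxE mulrC. Qed.

Lemma fd_ext c (f h : 'rV[R]_n -> R) x : U x -> (forall z, U z -> f z = h z) -> fd c f x = fd c h x.
Proof. by move=> Ux fh; apply: eq_bigr => i _; rewrite (pd_ext i oU Ux fh). Qed.

Lemma fdD c f h x : smooth U f -> smooth U h -> U x -> fd c (fun z => f z + h z) x = fd c f x + fd c h x.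
Proof.
move=> sf sh Ux; rewrite /fd -big_split; apply: eq_bigr => i _.
by rewrite pdD ?mulrDr //; [exact: smooth_diff sf Ux|exact: smooth_diff sh Ux].
Qed.

Lemma fdM c f h x : smooth U f -> smooth U h -> U x ->
  fd c (fun z => f z * h z) x = fd c f x * h x + f x * fd c h x.
Proof.
move=> sf sh Ux; rewrite /fd mulr_suml mulr_sumr -big_split; apply: eq_bigr => i _.
by rewrite pdM; [rewrite /=; move: (pd i f x) (pd i h x) (E x c i) => *; ring|exact: smooth_diff sf Ux|exact: smooth_diff sh Ux].
Qed.

Lemma fdN c f x : smooth U f -> U x -> fd c (fun z => - f z) x = - fd c f x.
Proof.
move=> sf Ux; rewrite /fd -sumrN; apply: eq_bigr => i _.
by rewrite pdN ?mulrN //; exact: smooth_diff sf Ux.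
Qed.

Lemma fdB c f h x : smooth U f -> smooth U h -> U x -> fd c (fun z => f z - h z) x = fd c f x - fd c h x.
Proof. by move=> sf sh Ux; rewrite (fdD c sf (smoothN oU sh) Ux) (fdN c sh Ux). Qed.

Lemma fdZ c (k : R) f x : smooth U f -> U x -> fd c (fun z => k * f z) x = k * fd c f x.
Proof.
move=> sf Ux; rewrite /fd mulr_sumr; apply: eq_bigr => i _.
by rewrite pdZ 1?mulrCA //; exact: smooth_diff sf Ux.
Qed.

Lemma fd_cst c k x : fd c (fun=> k) x = 0.
Proof. by rewrite /fd big1 // => i _; rewrite pd_cst mulr0. Qed.

Lemma fdmE p q c (A : 'rV[R]_n -> 'M[R]_(p, q)) x i j : fdm c A x i j = fd c (fun z => A z i j) x.
Proof. by rewrite summxE; apply: eq_bigr => k _; rewrite !mxE. Qed.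

Lemma pdm_inv i x : U x -> pdm i (fun z => invmx (E z)) x = - (invmx (E x) *m pdm i E x *m invmx (E x)).
Proof.
move=> Ux; have u := uE Ux.
have D : pdm i (fun z => E z *m invmx (E z)) x = 0.
  by rewrite (pdm_ext i oU Ux (fun z Uz => mulmxV (uE Uz))) pdm_cst.
rewrite (pdm_mul i sE (smooth_invE oU sE uE) Ux) in D.
have := congr1 (mulmx (invmx (E x))) D.
rewrite mulmx0 mulmxDr mulKmx // mulmxA => /eqP.
by rewrite addrC addr_eq0 => /eqP.
Qed.

(** The value of [d (cof b)] on frame fields is minus [cof b] of their
    bracket. *)
Lemma fstr_bracket b x c d : U x -> fstr E b x c d =
  (fdm d E x *m invmx (E x)) c b - (fdm c E x *m invmx (E x)) d b.
Proof.
move=> Ux; have u := uE Ux.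
have C k l : pd k (fun z => cof E b z 0 l) x = pdm k (fun z => invmx (E z)) x l b.
  have -> : (fun z => cof E b z 0 l) = fun z => invmx (E z) l b by apply/funext => z; rewrite [LHS]mxE [LHS]mxE.
  by rewrite [RHS]mxE.
have EK (M : 'M[R]_n) k l : \sum_i E x k i * (invmx (E x) *m M) i l = M k l.
  by have := congr1 (fun M : 'M[R]_n => M k l) (mulKVmx u M); rewrite mxE.
pose P i := pdm i E x *m invmx (E x).
have D i j : d1 (cof E b) x i j = (invmx (E x) *m P j) i b - (invmx (E x) *m P i) j b.
  rewrite mxE !C !pdm_inv // /P !mulmxA [X in X - _]mxE [X in _ - X]mxE; lra.
have Pf k l m : (fdm k E x *m invmx (E x)) l m = \sum_i E x k i * P i l m.
  by rewrite mulmx_suml summxE; apply: eq_bigr => i _; rewrite -scalemxAl mxE.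
rewrite /fstr mxE !Pf.
transitivity (\sum_j \sum_i (E x c i * E x d j) * ((invmx (E x) *m P j) i b - (invmx (E x) *m P i) j b)).
  apply: eq_bigr => j _; rewrite mxE mulr_suml; apply: eq_bigr => i _.
  by rewrite D [_^T _ _]mxE; move: (_ - _) => z; ring.
under eq_bigr do (under eq_bigr do rewrite mulrBr; rewrite sumrB).
rewrite sumrB; congr (_ - _).
  apply: eq_bigr => j _; rewrite -(EK (P j) c b) mulr_sumr; apply: eq_bigr => i _.
  by rewrite mulrA (mulrC (E x d j)).
rewrite exchange_big /=; apply: eq_bigr => i _; rewrite -(EK (P i) d b) mulr_sumr.
by apply: eq_bigr => j _; rewrite mulrA.
Qed.

Lemma smooth_cof b : smooth_mx U (cof E b).
Proof.
move=> i j; rewrite (ord1 i).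
by apply: (smooth_ext oU _ (smooth_invE oU sE uE j b)) => z Uz; rewrite /cof [_^T _ _]mxE [col _ _ _ _]mxE.
Qed.

Lemma cof_frame b x : U x -> cof E b x *m (E x)^T = bvec b.
Proof.
move=> Ux; rewrite /cof -trmx_mul colE mulmxA mulmxV ?uE // mul1mx.
by apply/matrixP => i j; rewrite !mxE andbC.
Qed.

Lemma d1_sum (I : eqType) (r : seq I) (al : I -> 'rV[R]_n -> 'rV[R]_n) x :
  (forall i, smooth_mx U (al i)) -> U x ->
  d1 (fun z => \sum_(i <- r) al i z) x = \sum_(i <- r) d1 (al i) x.
Proof.
move=> sal Ux; elim: r => [|i r IH].
  rewrite big_nil; apply/matrixP => j k; rewrite !mxE.
  by under eq_fun do rewrite big_nil mxE; under [X in _ - pd _ X _]eq_fun do rewrite big_nil mxE; rewrite !pd_cst subrr.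
rewrite big_cons -IH -(@d1_add _ _ U) //.
  by congr (d1 _ x); apply/funext => z; rewrite big_cons.
move=> j k; apply: (smooth_ext oU (f := fun z => \sum_(i <- r) al i z j k)).
  by move=> z _; rewrite summxE.
by apply: (smooth_sum _ _ oU) => l; exact: sal.
Qed.

Definition fco (al : 'rV[R]_n -> 'rV[R]_n) b x : R := \sum_i al x 0 i * E x b i.

Lemma fcoE al b x : fco al b x = (al x *m (E x)^T) 0 b.
Proof. by rewrite mxE; apply: eq_bigr => i _; rewrite !mxE. Qed.

Lemma smooth_fco al b : smooth_mx U al -> smooth U (fco al b).
Proof. by move=> sal; apply: (smooth_sum _ _ oU) => i; exact: (smoothM oU (sal 0 i) (sE b i)). Qed.

Lemma fco_expand al x : U x -> al x = \sum_b fco al b x *: cof E b x.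
Proof.
move=> Ux; apply: (can_inj (mulmxK (_ : (E x)^T \in unitmx))); first by rewrite unitmx_tr uE.
rewrite mulmx_suml; apply/rowP => c; rewrite summxE (bigD1 c) //= big1 ?addr0 => [|b bc].
  by rewrite -scalemxAl cof_frame // [RHS]mxE /bvec [delta_mx _ _ _ _]mxE !eqxx mulr1 fcoE.
by rewrite -scalemxAl cof_frame // [LHS]mxE /bvec [delta_mx _ _ _ _]mxE eq_sym (negbTE bc) andbF mulr0.
Qed.

(** The derivatives of the frame fields are collected in the structure
    functions. *)
Lemma frame_d1 al x c d : smooth_mx U al -> U x ->
  (E x *m d1 al x *m (E x)^T) c d =
  fd c (fco al d) x - fd d (fco al c) x + \sum_b fco al b x * fstr E b x c d.
Proof.
move=> sal Ux.
have sf b : smooth U (fco al b) by exact: smooth_fco.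
have st b : smooth_mx U (fun z => fco al b z *: cof E b z).
  by apply: smooth_scalemx => //; exact: smooth_cof.
rewrite (d1_ext oU Ux (fun z Uz => fco_expand al Uz)) (d1_sum _ st Ux).
rewrite mulmx_sumr mulmx_suml summxE.
have T b : (E x *m d1 (fun z => fco al b z *: cof E b z) x *m (E x)^T) c d =
   fd c (fco al b) x * (d == b)%:R - fd d (fco al b) x * (c == b)%:R + fco al b x * fstr E b x c d.
  rewrite (d1_scale (sf b) (smooth_cof b) Ux) mulmxDr mulmxDl wedge_conj [LHS]mxE wedgeE.
  rewrite cof_frame // -!fdE -scalemxAr -scalemxAl [(_ *: (_ *m _)) _ _]mxE.
  by rewrite /bvec ![delta_mx _ _ _ _]mxE /= mulrC [X in _ - X]mulrC (mulrC _ (fd c _ _)).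
under eq_bigr do rewrite T.
rewrite big_split /= sumrB; congr (_ - _ + _).
  rewrite (bigD1 d) //= eqxx mulr1 big1 ?addr0 // => b bd.
  by rewrite eq_sym (negbTE bd) mulr0.
rewrite (bigD1 c) //= eqxx mulr1 big1 ?addr0 // => b bd.
by rewrite eq_sym (negbTE bd) mulr0.
Qed.

Definition f2co al b c x : R := (E x *m d1 al x *m (E x)^T) b c.

(** Contract [d (d al) = 0] with frame fields; their derivatives are collected
    in the structure functions. *)
Lemma frame_d2 al x a b c : smooth_mx U al -> U x ->
  (fd a (f2co al b c) x + \sum_d fstr E d x a b * f2co al d c x) +
  (fd b (f2co al c a) x + \sum_d fstr E d x b c * f2co al d a x) +
  (fd c (f2co al a b) x + \sum_d fstr E d x c a * f2co al d b x) = 0.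
Proof.
move=> sal Ux.
have sd := smooth_d1 oU sal.
pose O := E x *m d1 al x *m (E x)^T.
have Oanti p q : O p q = - O q p.
  have : O^T = - O by rewrite /O !trmx_mul trmxK d1_anti mulNmx mulmxN mulmxA.
  by move/(congr1 (fun M : 'M[R]_n => M q p)); rewrite !mxE.
pose P k := fdm k E x *m invmx (E x).
have PE k : fdm k E x = P k *m E x by rewrite /P mulmxKV // uE.
have L p q r : fd p (f2co al q r) x =
    \sum_d P p q d * O d r - \sum_d P p r d * O d q + (E x *m fdm p (d1 al) x *m (E x)^T) q r.
  have -> : fd p (f2co al q r) x = fdm p (fun z => E z *m d1 al z *m (E z)^T) x q r by rewrite fdmE.
  have -> : fdm p (fun z => E z *m d1 al z *m (E z)^T) x =
      fdm p E x *m d1 al x *m (E x)^T + E x *m fdm p (d1 al) x *m (E x)^T + E x *m d1 al x *m (fdm p E x)^T.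
    have -> : (fdm p E x)^T = \sum_i E x p i *: (pdm i E x)^T.
      by rewrite /fdm linear_sum; apply: eq_bigr => i _; rewrite linearZ.
    rewrite /fdm mulmx_sumr !mulmx_suml mulmx_sumr -!big_split /=; apply: eq_bigr => i _.
    rewrite (pdm_mul i (smooth_mulmx oU sE sd) (smooth_trmx sE) Ux) (pdm_mul i sE sd Ux) pdm_tr.
    rewrite -!(scalemxAl, scalemxAr) -!scalerDr mulmxDl.
    by [].
  rewrite PE trmx_mul.
  have -> : P p *m E x *m d1 al x *m (E x)^T = P p *m O by rewrite /O !mulmxA.
  have -> : E x *m d1 al x *m ((E x)^T *m (P p)^T) = O *m (P p)^T by rewrite /O !mulmxA.
  rewrite [LHS]mxE [X in X + _]mxE [(P p *m O) _ _]mxE [(O *m _) _ _]mxE.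
  have -> : \sum_j O q j * (P p)^T j r = - \sum_d P p r d * O d q.
    by rewrite -sumrN; apply: eq_bigr => d _; rewrite [_^T _ _]mxE Oanti mulNr mulrC.
  by rewrite addrAC.
have C : (E x *m fdm a (d1 al) x *m (E x)^T) b c + (E x *m fdm b (d1 al) x *m (E x)^T) c a
    + (E x *m fdm c (d1 al) x *m (E x)^T) a b = 0.
  have D p : 'D_(row p (E x)) (d1 al) x = fdm p (d1 al) x.
    apply/matrixP => j k; rewrite derive_mx; last first.
      by apply/derivable_mxP => r s; apply: diff_derivable; exact: smooth_diff (sd r s) Ux.
    rewrite mxE derive_sum_pd; last exact: smooth_diff (sd j k) Ux.
    by rewrite fdmE; apply: eq_bigr => i _; rewrite mxE.
  have F (M : 'M[R]_n) p q : (E x *m M *m (E x)^T) p q = (row p (E x) *m M *m (row q (E x))^T) 0 0.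
    by rewrite -row_mul mxE [RHS]mxE; apply: eq_bigr => i _; rewrite !mxE.
  have := d1_closed (row a (E x)) (row b (E x)) (row c (E x)) oU sal Ux.
  by rewrite !D 2!mxE !F.
rewrite !L.
have S p q r : \sum_d fstr E d x p q * f2co al d r x = \sum_d P q p d * O d r - \sum_d P p q d * O d r.
  rewrite -sumrB; apply: eq_bigr => d _; have := fstr_bracket d p q Ux => e.
  by apply: etrans (congr1 (fun t => t * O d r) e) _; exact: mulrBl.
rewrite !S; move: C; move: (_ b c) (_ c a) (_ a b) => c1 c2 c3.
move: (\sum_d P a b d * O d c) (\sum_d P a c d * O d b) (\sum_d P b c d * O d a) (\sum_d P b a d * O d c)
  (\sum_d P c a d * O d b) (\sum_d P c b d * O d a) => *; lra.
Qed.

End FrameCalculus.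

Section FrameCurvature.
Context {R : realType} {n : nat}.
Variables (U : set 'rV[R]_n) (g E : 'rV[R]_n -> 'M[R]_n) (a : 'rV[R]_n -> 'rV[R]_n).
Hypotheses (oU : open U) (mg : riemannian U g) (sa : smooth_mx U a) (sE : smooth_mx U E)
  (uE : forall x, U x -> E x \in unitmx).

Let sw := smooth_fconn oU mg sa sE uE.

Definition fcurv c d x : 'M[R]_n :=
  \sum_i \sum_j (E x c i * E x d j) *: curv (fconn g E a) i j x.

Lemma smooth_fgam c i j : smooth U (fun x => fgam g E a c x i j).
Proof.
apply: (smooth_ext oU (f := fun x => \sum_k E x c k * fconn g E a k x i j)).
  by move=> z _; rewrite /fgam summxE; apply: eq_bigr => k _; rewrite [RHS]mxE.
by apply: (smooth_sum _ _ oU) => k; exact: (smoothM oU (sE c k) (sw k i j)).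
Qed.

(** The second structure equation. *)
Lemma fcurvE c d x p q : U x -> fcurv c d x p q =
  fd E c (fun z => fgam g E a d z p q) x - fd E d (fun z => fgam g E a c z p q) x
  + \sum_e fgam g E a e x p q * fstr E e x c d
  + (fgam g E a d x *m fgam g E a c x - fgam g E a c x *m fgam g E a d x) p q.
Proof.
move=> Ux; pose w z : 'rV[R]_n := \row_i fconn g E a i z p q.
have sww : smooth_mx U w.
  move=> i j; refine (smooth_ext oU _ (sw j p q)) => z _; by rewrite /w [RHS]mxE.
have wE e z : fgam g E a e z p q = fco E w e z.
  by rewrite /fgam summxE; apply: eq_bigr => k _; rewrite [LHS]mxE /w [X in _ = X * _]mxE mulrC.
have -> : (fgam g E a d x *m fgam g E a c x - fgam g E a c x *m fgam g E a d x) p q =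
   \sum_i \sum_j (E x c i * E x d j) *
     (fconn g E a j x *m fconn g E a i x - fconn g E a i x *m fconn g E a j x) p q.
  rewrite /fgam mulmx_suml [X in _ - X]mulmx_suml.
  under eq_bigr do rewrite mulmx_sumr; under [X in _ - X]eq_bigr do rewrite mulmx_sumr.
  rewrite exchange_big /= -sumrB summxE; apply: eq_bigr => i _.
  rewrite -sumrB summxE; apply: eq_bigr => j _.
  rewrite -!(scalemxAl, scalemxAr) !scalerA (mulrC (E x d j)) -scalerBr mxE.
  by congr (_ * _); rewrite mxE.
under eq_fun do rewrite wE; under [X in _ - fd _ _ X _]eq_fun do rewrite wE.
under [X in _ + X + _]eq_bigr do rewrite wE.
rewrite -(frame_d1 oU sE uE c d sww Ux).
have -> : (E x *m d1 w x *m (E x)^T) c d = \sum_i \sum_j (E x c i * E x d j) * d1 w x i j.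
  rewrite mxE exchange_big /=; apply: eq_bigr => j _; rewrite mxE mulr_suml; apply: eq_bigr => i _.
  by rewrite [_^T _ _]mxE mulrAC.
rewrite -big_split summxE; apply: eq_bigr => i _; rewrite -big_split summxE; apply: eq_bigr => j _.
rewrite mxE /= -mulrDr; congr (_ * _); rewrite /curv !mxE -!addrA; congr (_ + (- _ + _)).
- by congr (pd _ _ _); apply/funext => z; rewrite /w [RHS]mxE.
- by congr (pd _ _ _); apply/funext => z; rewrite /w [RHS]mxE.
Qed.

Lemma fcurv_conj c d x : U x -> fcurv c d x =
  E x *m (\sum_i \sum_j (E x c i * E x d j) *: curv (cmat (weyl_chr g a)) i j x) *m invmx (E x).
Proof.
move=> Ux; rewrite mulmx_sumr mulmx_suml; apply: eq_bigr => i _.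
rewrite mulmx_sumr mulmx_suml; apply: eq_bigr => j _.
rewrite -scalemxAr -scalemxAl (fconn_curv oU mg sa sE uE i j Ux) mulmxK //; exact: uE.
Qed.

Lemma ricci_frame c d x : U x ->
  (E x *m ricci (weyl_chr g a) x *m (E x)^T) c d = \sum_e fcurv e c x d e.
Proof.
move=> Ux; have u := uE Ux.
pose C i j := curv (cmat (weyl_chr g a)) i j x.
transitivity (\sum_j \sum_k E x c j * E x d k * \sum_i C i j k i).
  rewrite mxE exchange_big /=; apply: eq_bigr => k _; rewrite mxE mulr_suml; apply: eq_bigr => j _.
  by rewrite [_^T _ _]mxE ricciE mulrAC.
transitivity (\sum_e \sum_i \sum_j E x e i * E x c j * \sum_l (\sum_k E x d k * C i j k l) * invmx (E x) l e); last first.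
  apply: eq_bigr => e _; rewrite fcurv_conj // mulmx_sumr mulmx_suml summxE; apply: eq_bigr => i _.
  rewrite mulmx_sumr mulmx_suml summxE; apply: eq_bigr => j _.
  rewrite -scalemxAr -scalemxAl mxE; congr (_ * _); rewrite mxE; apply: eq_bigr => l _; congr (_ * _).
  by rewrite mxE.
transitivity (\sum_i \sum_j \sum_k \sum_l (\sum_e invmx (E x) l e * E x e i) * (E x c j * E x d k * C i j k l)).
  rewrite [RHS]exchange_big /=; apply: eq_bigr => j _; rewrite [RHS]exchange_big /=; apply: eq_bigr => k _.
  rewrite mulr_sumr; apply: eq_bigr => i _.
  have I l : \sum_e invmx (E x) l e * E x e i = (l == i)%:R.
    by have := congr1 (fun M : 'M[R]_n => M l i) (mulVmx u); rewrite !mxE.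
  under eq_bigr do rewrite I; rewrite (bigD1 i) //= eqxx mul1r big1 ?addr0 // => l li.
  by rewrite (negbTE li) mul0r.
rewrite [RHS]exchange_big /=; apply: eq_bigr => i _; rewrite [RHS]exchange_big /=; apply: eq_bigr => j _.
rewrite exchange_big /=.
under [RHS]eq_bigr do rewrite mulr_sumr; rewrite [RHS]exchange_big /=; apply: eq_bigr => l _.
under [LHS]eq_bigr do rewrite mulr_suml; rewrite exchange_big /=; apply: eq_bigr => e _.
rewrite mulr_suml mulr_sumr; apply: eq_bigr => k _.
by move: (invmx _ _ _) (E x e i) (E x c j) (E x d k) (C _ _ _ _) => *; ring.
Qed.

(** The first Bianchi identity is tensorial, so it may be stated in any frame.
    *)
Lemma fcurv_bianchi c d e x q : U x -> 
  fcurv c d x e q + fcurv d e x c q + fcurv e c x d q = 0.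
Proof.
move=> Ux.
pose C i j := curv (cmat (weyl_chr g a)) i j x.
have F p r s : fcurv p r x s q = \sum_l (\sum_i \sum_j \sum_k E x p i * E x r j * E x s k * C i j k l) * invmx (E x) l q.
  rewrite fcurv_conj // mxE; apply: eq_bigr => l _; congr (_ * _); rewrite mxE.
  under eq_bigr do rewrite summxE mulr_sumr.
  rewrite exchange_big /=; apply: eq_bigr => i _.
  under eq_bigr do rewrite summxE mulr_sumr.
  rewrite exchange_big /=; apply: eq_bigr => j _; apply: eq_bigr => k _.
  by rewrite mxE -/(C i j); move: (C _ _ _ _) (E x p i) (E x r j) (E x s k) => *; ring.
rewrite !F -!big_split /= big1 // => l _; rewrite -!mulrDl.
set S := (X in X * _); suff -> : S = 0 by rewrite mul0r.
rewrite /S.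
have -> : \sum_i \sum_j \sum_k E x d i * E x e j * E x c k * C i j k l =
   \sum_i \sum_j \sum_k E x c i * E x d j * E x e k * C j k i l.
  rewrite exchange_big /=; under eq_bigr do rewrite exchange_big /=.
  rewrite exchange_big /=; apply: eq_bigr => i _; rewrite exchange_big /=; apply: eq_bigr => j _.
  by apply: eq_bigr => k _; move: (C _ _ _ _) (E x c i) (E x d j) (E x e k) => *; ring.
have -> : \sum_i \sum_j \sum_k E x e i * E x c j * E x d k * C i j k l =
   \sum_i \sum_j \sum_k E x c i * E x d j * E x e k * C k i j l.
  rewrite exchange_big /=; apply: eq_bigr => i _; rewrite exchange_big /=; apply: eq_bigr => j _.
  by apply: eq_bigr => k _; move: (C _ _ _ _) (E x c i) (E x d j) (E x e k) => *; ring.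
rewrite -!big_split /= big1 // => i _; rewrite -!big_split /= big1 // => j _.
rewrite -!big_split /= big1 // => k _; rewrite -!mulrDr.
have -> : C i j k l + C j k i l + C k i j l = 0; last by rewrite mulr0.
apply: (bianchi1 oU Ux) => z p r s Uz; exact: (weyl_chr_torsion_free a oU mg Uz s p r).
Qed.

End FrameCurvature.

(** * Frames on a three dimensional Weyl space *)

Ltac gen_fd := repeat match goal with
  |- context [@fd ?R ?n ?F ?c ?f ?y] => generalize (@fd R n F c f y); intro end.
Ltac gen_fco := repeat match goal with
  |- context [@fco ?R ?n ?F ?c ?f ?y] => generalize (@fco R n F c f y); intro end.

Section OrientedFrames.
Context {R : realType}.
Implicit Types (V : set 'rV[R]_3) (h : 'rV[R]_3 -> 'M[R]_3).

Definition eps3 (i j k : 'I_3) : R := \det (rows [:: bvec i; bvec j; bvec k]).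

Lemma eps3E i j k : eps3 i j k = \det (\matrix_(r < 3, s < 3)
  nth 0 [:: (i == s)%:R; (j == s)%:R; (k == s)%:R] r).
Proof.
rewrite /eps3 /rows; congr (\det _); apply/matrixP => r s.
by elim/ord3P: r; rewrite [LHS]mxE [RHS]mxE /= mxE eqxx eq_sym.
Qed.

Lemma sqrt_det_frame n (g E : 'M[R]_n) : E *m g *m E^T = 1%:M -> 0 < \det E ->
  Num.sqrt (\det g) = (\det E)^-1.
Proof.
move=> EgE dE; have := congr1 determinant EgE; rewrite !det_mulmx det_tr det1 => D.
have -> : \det g = (\det E)^-1 ^+ 2.
  have d0 : \det E != 0 by rewrite gt_eqF.
  by apply: (mulfI d0); apply: (mulIf d0); rewrite D; field.
by rewrite sqrtr_sqr gtr0_norm // invr_gt0.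
Qed.

Lemma invmx_frame n (g E : 'M[R]_n) : E *m g *m E^T = 1%:M -> E \in unitmx -> invmx g = E^T *m E.
Proof.
move=> EgE uE; have ET : E^T \in unitmx by rewrite unitmx_tr.
have gE : g = invmx E *m invmx E^T.
  have : invmx E *m (E *m g *m E^T) *m invmx E^T = invmx E *m 1%:M *m invmx E^T by rewrite EgE.
  by rewrite !mulmxA mulVmx // mul1mx mulmxK // mulmx1.
have ug : g \in unitmx by rewrite gE unitmx_mul !unitmx_inv uE ET.
have K : g *m (E^T *m E) = 1%:M by rewrite gE mulmxA mulmxKV // mulVmx.
by rewrite -[RHS]mul1mx -(mulVmx ug) -mulmxA K mulmx1.
Qed.

Lemma star3_frame h y (F : 'M[R]_3) b c d : F *m h y *m F^T = 1%:M -> 0 < \det F ->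
  (F *m star3 h y b *m F^T) c d = \sum_e (b *m F^T) 0 e * eps3 e c d.
Proof.
move=> FhF dF.
have uF : F \in unitmx by rewrite unitmxE unitfE gt_eqF.
have S k l : star3 h y b k l = \sum_e (b *m F^T) 0 e * ((\det F)^-1 * \det (rows [:: row e F; bvec k; bvec l])).
  rewrite mxE /vol (sqrt_det_frame FhF dF) (invmx_frame FhF uF) mulmxA mulmx_sum_row.
  have -> : \det (\matrix_k0 [:: \sum_i (b *m F^T) 0 i *: row i F; bvec k; bvec l]`_k0) =
      \sum_e (b *m F^T) 0 e * \det (rows [:: row e F; bvec k; bvec l]).
    rewrite -/(rows _) (@det_rows_slot _ _ [::] [:: bvec k; bvec l]) //=.
    under eq_bigr do rewrite summxE mulr_suml.
    rewrite exchange_big /=; apply: eq_bigr => e _.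
    rewrite (@det_rows_slot _ _ [::] [:: bvec k; bvec l] (row e F)) //= mulr_sumr.
    by apply: eq_bigr => j _; rewrite mxE mulrA.
  by rewrite mulr_sumr; apply: eq_bigr => e _; rewrite mulrCA.
rewrite mxE; under eq_bigr do rewrite mxE mulr_suml.
rewrite exchange_big /=.
transitivity (\sum_k \sum_l F c k * F d l * star3 h y b k l).
  by apply: eq_bigr => k _; apply: eq_bigr => l _; rewrite [_^T _ _]mxE mulrAC.
transitivity (\sum_k \sum_l \sum_e F c k * F d l *
    ((b *m F^T) 0 e * ((\det F)^-1 * \det (rows [:: row e F; bvec k; bvec l])))).
  by apply: eq_bigr => k _; apply: eq_bigr => l _; rewrite S mulr_sumr.
transitivity (\sum_k \sum_e \sum_l F c k * F d l *
    ((b *m F^T) 0 e * ((\det F)^-1 * \det (rows [:: row e F; bvec k; bvec l])))).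
  by apply: eq_bigr => k _; rewrite exchange_big.
rewrite exchange_big /=; apply: eq_bigr => e _.
have -> : eps3 e c d = (\det F)^-1 * \det (rows [:: row e F; row c F; row d F]).
  have -> : \det (rows [:: row e F; row c F; row d F]) = eps3 e c d * \det F.
    by rewrite /eps3 -det_mulmx -rows_mul /= /bvec -!rowE.
  by rewrite mulrC mulfK // gt_eqF.
rewrite (@det_rows_slot _ _ [:: row e F] [:: row d F]) //= !mulr_sumr; apply: eq_bigr => k _.
rewrite (@det_rows_slot _ _ [:: row e F; bvec k] [::]) //= !mulr_sumr; apply: eq_bigr => l _.
by rewrite ![row _ _ _ _]mxE; move: (_ 0 e) (\det F)^-1 (\det _) (F c k) (F d l) => *; ring.
Qed.

(** Gram-Schmidt started from the unit field; the third leg is the vector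
    product of the first two, which fixes the orientation. *)
Lemma oriented_frame V h chi y0 : open V -> riemannian V h -> smooth_mx V chi ->
  (forall y, V y -> inner h y (chi y) (chi y) = 1) -> V y0 ->
  exists W (F : 'rV[R]_3 -> 'M[R]_3), [/\ open W, W y0, W `<=` V, smooth_mx W F &
    forall y, W y -> [/\ F y *m h y *m (F y)^T = 1%:M, 0 < \det (F y) & row t0 (F y) = chi y]].
Proof.
move=> oV mh sc uc Vy0.
(* Constant vectors that complete [chi] to a basis at [y0], hence nearby. *)
have [v [w vw]] : exists v w, \det (rows [:: chi y0; v; w]) != 0.
  have c0 : chi y0 != 0.
    apply/negP => /eqP c0; have := uc _ Vy0; rewrite /inner c0 !mul0mx mxE => /eqP.
    by rewrite eq_sym oner_eq0.
  have [i ci] : exists i, chi y0 0 i != 0.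
    apply/existsP; apply: contraNT c0; rewrite negb_exists => /forallP c0; apply/eqP/rowP => i.
    by rewrite [RHS]mxE; apply/eqP; rewrite -[_ == _]negbK.
  have D k p q : chi y0 0 k != 0 -> (forall e, e != k -> eps3 e p q = 0) -> eps3 k p q != 0 ->
      \det (rows [:: chi y0; bvec p; bvec q]) != 0.
    move=> ck ne ek; rewrite (@det_rows_slot _ _ [::] [:: bvec p; bvec q]) //= (bigD1 k) //= big1 ?addr0.
      by rewrite mulf_neq0.
    by move=> e /ne; rewrite /eps3 => ->; rewrite mulr0.
  have eV : [/\ forall e, e != t0 -> eps3 e t1 t2 = 0, forall e, e != t1 -> eps3 e t2 t0 = 0 &
      forall e, e != t2 -> eps3 e t0 t1 = 0].
    by split=> e; elim/ord3P: e => //= _; rewrite eps3E det3E !mxE /=; ring.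
  have eN : [/\ eps3 t0 t1 t2 != 0, eps3 t1 t2 t0 != 0 & eps3 t2 t0 t1 != 0].
    by split; rewrite eps3E det3E !mxE /=; apply/eqP; lra.
  case: eV => v0 v1 v2; case: eN => n0 n1 n2.
  move: i ci; apply: ord3P => ci.
  - by exists (bvec t1), (bvec t2); apply: D ci v0 n0.
  - by exists (bvec t2), (bvec t0); apply: D ci v1 n1.
  - by exists (bvec t0), (bvec t1); apply: D ci v2 n2.
have sh := met_smooth mh.
pose D y := \det (rows [:: chi y; v; w]).
have srows (p q r : 'rV[R]_3 -> 'rV[R]_3) : smooth_mx V p -> smooth_mx V q -> smooth_mx V r ->
    smooth_mx V (fun y => rows [:: p y; q y; r y]).
  move=> sp sq sr i j; under eq_fun do rewrite mxE.
  by elim/ord3P: i => /=; [exact: sp | exact: sq | exact: sr].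
have sD : smooth V D by apply: smooth_det => //; apply: srows => //; exact: smooth_cstmx.
pose W := V `&` [set y | D y != 0].
have oW : open W.
  rewrite openE => y [Vy Dy].
  have : \forall z \near y, `|D z - D y| < `|D y| by apply: (smooth_near oV sD Vy); rewrite normr_gt0.
  have : \forall z \near y, V z by exact: open_nbhs_nbhs (conj oV Vy).
  apply: filterS2 => z Vz Dz; split=> //; apply/negP => /eqP e; move: Dz.
  by rewrite e sub0r normrN ltxx.
have WV : W `<=` V by move=> y [].
have {}sh : smooth_mx W h by exact: smooth_mx_sub sh.
have {}sc : smooth_mx W chi by exact: smooth_mx_sub sc.
pose B y (p q : 'rV[R]_3) := (p *m h y *m q^T) 0 0.
have sB p q : smooth_mx W p -> smooth_mx W q -> smooth W (fun y => B y (p y) (q y)).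
  move=> sp sq; apply: (smooth_mulmx oW (smooth_mulmx oW sp sh) (smooth_trmx sq) 0 0).
have sv : smooth_mx W (fun=> v) by exact: smooth_cstmx.
pose v' y := v - B y v (chi y) *: chi y.
have sv' : smooth_mx W v'.
  apply: (smooth_addmx oW sv); apply: (smooth_oppmx oW); apply: (smooth_scalemx oW _ sc); exact: sB.
have Dv' y p q : \det (rows [:: chi y; p *: v' y; q]) = p * \det (rows [:: chi y; v; q]).
  rewrite !det3E !mxE /=.
  move: (chi y 0 t0) (chi y 0 t1) (chi y 0 t2) (v 0 t0) (v 0 t1) (v 0 t2) (q 0 t0) (q 0 t1) (q 0 t2) (B y v (chi y)) => *.
  ring.
have Bs y p q : W y -> B y p q = B y q p.
  move=> [Vy _]; rewrite /B -[in LHS](met_sym mh Vy).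
  have -> : p *m (h y)^T *m q^T = (q *m h y *m p^T)^T by rewrite !trmx_mul !trmxK mulmxA.
  by rewrite mxE.
have BZ y c p q : B y (c *: p) q = c * B y p q by rewrite /B -!scalemxAl mxE.
have v'0 y : W y -> v' y != 0.
  move=> [_ /=]; apply: contra => /eqP v0.
  by rewrite /D -[X in X == 0]mul1r -(Dv' y 1 w) v0 scaler0 det3E !mxE /=; apply/eqP; ring.
pose N2 y := B y (v' y) (v' y).
have N2p y : W y -> 0 < N2 y by move=> Wy; apply: (met_pos mh (WV _ Wy)); exact: v'0.
have sN2 : smooth W N2 by exact: sB.
have sr : smooth W (fun y => (Num.sqrt (N2 y))^-1).
  apply: (smoothV oW); last exact: (smooth_sqrt oW N2p sN2).
  by move=> y Wy; rewrite gt_eqF // sqrtr_gt0 N2p.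
pose f2 y := (Num.sqrt (N2 y))^-1 *: v' y.
have sf2 : smooth_mx W f2 by exact: smooth_scalemx oW sr sv'.
have cv y : W y -> B y (chi y) (v' y) = 0.
  move=> Wy; rewrite Bs // /v' /B mulmxBl mulmxBl -!scalemxAl mxE [X in _ + X]mxE [X in _ - X]mxE.
  by have := uc _ (WV _ Wy); rewrite /inner => ->; rewrite mulr1 subrr.
have c2 y : W y -> B y (chi y) (f2 y) = 0 by move=> Wy; rewrite Bs // BZ Bs // cv // mulr0.
have b22 y : W y -> B y (f2 y) (f2 y) = 1.
  move=> Wy; rewrite BZ Bs // BZ -/(N2 y).
  have n0 : Num.sqrt (N2 y) != 0 by rewrite gt_eqF // sqrtr_gt0 N2p.
  rewrite -{3}(sqr_sqrtr (ltW (N2p _ Wy))); move: (Num.sqrt _) n0 => n n0; by field.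
(* The vector product of the first two legs, lowered by the metric. *)
pose om y : 'rV[R]_3 := \row_k \det (rows [:: chi y; f2 y; bvec k]).
have som : smooth_mx W om.
  move=> i j; under eq_fun do rewrite mxE; apply: smooth_det => //.
  move=> k l; under eq_fun do rewrite mxE.
  by elim/ord3P: k => /=; [exact: sc | exact: sf2 | exact: smooth_cst].
have omE y (p : 'rV[R]_3) : (om y *m p^T) 0 0 = \det (rows [:: chi y; f2 y; p]).
  rewrite (@det_rows_slot _ _ [:: chi y; f2 y] [::] p) //= mxE; apply: eq_bigr => k _.
  by rewrite !mxE mulrC.
pose e3 y := om y *m invmx (h y).
have uh y : W y -> h y \in unitmx by move=> Wy; exact: (metric_unitmx mh (WV _ Wy)).
have se3 : smooth_mx W e3 by apply: (smooth_mulmx oW som); exact: (smooth_invmx oW uh sh).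
have Be y p : W y -> B y (e3 y) p = \det (rows [:: chi y; f2 y; p]).
  by move=> Wy; rewrite /B /e3 mulmxKV ?uh // omE.
have e30 y : W y -> e3 y != 0.
  move=> Wy; apply/negP => /eqP e0; have := Be y w Wy; rewrite e0 /B !mul0mx mxE /f2 Dv'.
  move/esym/eqP; rewrite mulf_eq0 invr_eq0 sqrtr_eq0 leNgt N2p //=.
  by case: Wy => _ /= /negbTE; rewrite /D => ->.
pose N3 y := B y (e3 y) (e3 y).
have N3p y : W y -> 0 < N3 y by move=> Wy; apply: (met_pos mh (WV _ Wy)); exact: e30.
have sN3 : smooth W N3 by exact: sB.
have srr : smooth W (fun y => (Num.sqrt (N3 y))^-1).
  apply: (smoothV oW); last exact: (smooth_sqrt oW N3p sN3).
  by move=> y Wy; rewrite gt_eqF // sqrtr_gt0 N3p.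
pose f3 y := (Num.sqrt (N3 y))^-1 *: e3 y.
have sf3 : smooth_mx W f3 by exact: smooth_scalemx oW srr se3.
exists W, (fun y => rows [:: chi y; f2 y; f3 y]); split=> //.
- move=> i j; under eq_fun do rewrite mxE.
  by elim/ord3P: i => /=; [exact: sc | exact: sf2 | exact: sf3].
- move=> y Wy.
  have n0 : 0 < (Num.sqrt (N3 y))^-1 by rewrite invr_gt0 sqrtr_gt0 N3p.
  have dF : \det (rows [:: chi y; f2 y; f3 y]) = (Num.sqrt (N3 y))^-1 * N3 y.
    by rewrite -Be // Bs // BZ -/(N3 y).
  have rowsE i : row i (rows [:: chi y; f2 y; f3 y]) = [:: chi y; f2 y; f3 y]`_i by rewrite rowK.
  have dd (p q : 'rV[R]_3) : \det (rows [:: p; q; p]) = 0.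
    by rewrite det3E !mxE /=; gen_entries; ring.
  have dd' (p q : 'rV[R]_3) : \det (rows [:: p; q; q]) = 0.
    by rewrite det3E !mxE /=; gen_entries; ring.
  split; last by rewrite rowsE.
  - have b3c : B y (f3 y) (chi y) = 0 by rewrite BZ Be // dd mulr0.
    have b32 : B y (f3 y) (f2 y) = 0 by rewrite BZ Be // dd' mulr0.
    have b33 : B y (f3 y) (f3 y) = 1.
      rewrite BZ Bs // BZ -/(N3 y) -{3}(sqr_sqrtr (ltW (N3p _ Wy))).
      have : Num.sqrt (N3 y) != 0 by rewrite gt_eqF // sqrtr_gt0 N3p.
      by move: (Num.sqrt _) => n nn0; field.
    have b11 := uc _ (WV _ Wy).
    apply/matrixP => i j.
    have -> : (rows [:: chi y; f2 y; f3 y] *m h y *m (rows [:: chi y; f2 y; f3 y])^T) i j =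
        B y [:: chi y; f2 y; f3 y]`_i [:: chi y; f2 y; f3 y]`_j.
      by rewrite /B -!rowsE -row_mul mxE [RHS]mxE; apply: eq_bigr => k _; rewrite ![_^T _ _]mxE ![row _ _ _ _]mxE.
    by elim/ord3P: i; elim/ord3P: j; rewrite [RHS]mxE /= ?b32 ?b3c ?b33 ?b22 ?c2 //;
      rewrite Bs ?b32 ?b3c ?c2.
  - by rewrite dF mulr_gt0 ?N3p.
Qed.
End OrientedFrames.

Section FrameVector.
Context {R : realType} {n : nat}.
Variables (U : set 'rV[R]_n) (g E : 'rV[R]_n -> 'M[R]_n) (a A : 'rV[R]_n -> 'rV[R]_n).
Hypotheses (oU : open U) (sE : smooth_mx U E) (uE : forall x, U x -> E x \in unitmx).

Lemma covd_vec_frame w f r (X : 'rV[R]_n -> 'rV[R]_n) x : smooth U f ->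
  (forall z, U z -> X z = f z *: row r (E z)) -> U x ->
  E x *m covd_vec w a (weyl_chr g A) X x *m invmx (E x) =
  \matrix_(c, k) ((fd E c f x + w * fco E a c x * f x) * (k == r)%:R + f x * fgam g E A c x r k).
Proof.
move=> sf XE Ux.
have sr : smooth_mx U (fun z => row r (E z)).
  by move=> i j; refine (smooth_ext oU _ (sE r j)) => z _; rewrite mxE.
have pr i : pdm i (fun z => row r (E z)) x = row r (pdm i E x).
  by apply/rowP => k; rewrite !mxE; congr (pd _ _ _); apply/funext => z; rewrite mxE.
have rowD i : row i (covd_vec w a (weyl_chr g A) X x) =
    ((pd i f x + w * a x 0 i * f x) *: bvec r + f x *: row r (fconn g E A i x)) *m E x.
  have -> : row i (covd_vec w a (weyl_chr g A) X x) =
      pdm i X x + X x *m cmat (weyl_chr g A) i x + (w * a x 0 i) *: X x.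
    apply/rowP => k; rewrite [LHS]mxE [LHS]mxE [RHS]mxE [X in _ = X + _]mxE [pdm _ _ _ _ _]mxE.
    rewrite [X in _ = _ + X]mxE; congr (_ + _ + _).
    by rewrite [RHS]mxE; apply: eq_bigr => j _; rewrite [cmat _ _ _ _ _]mxE mulrC.
  rewrite (pdm_ext i oU Ux XE) (pdm_scale i sf sr Ux) pr XE // mulmxDl -!scalemxAl -rowE -row_mul.
  rewrite -[row r (fconn _ _ _ _ _) *m _]row_mul -(fconnE g A uE i Ux) [row r (_ + _)]linearD /= !scalerDr scalerDl scalerA.
  by rewrite addrC !addrA; congr (_ + _ + _); rewrite addrC.
have -> : covd_vec w a (weyl_chr g A) X x =
   (\matrix_(i, k) ((pd i f x + w * a x 0 i * f x) * (k == r)%:R + f x * fconn g E A i x r k)) *m E x.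
  apply/row_matrixP => i; rewrite rowD [RHS]row_mul; congr (_ *m _).
  by apply/rowP => k; rewrite !mxE eqxx /=.
rewrite mulmxA mulmxK ?uE //; apply/matrixP => c k; rewrite mxE [RHS]mxE.
under eq_bigr do rewrite mxE mulrDr.
rewrite big_split /=; congr (_ + _).
  rewrite /fd /fco -mulrA mulr_suml mulr_sumr -big_split mulr_suml; apply: eq_bigr => i _ /=.
  by move: (E x c i) (pd i f x) (a x 0 i) (f x) ((k == r)%:R) => *; ring.
rewrite /fgam [X in _ = _ * X]summxE mulr_sumr; apply: eq_bigr => i _; rewrite [X in _ = _ * X]mxE.
by move: (fconn _ _ _ _ _ _ _) (E x c i) (f x) => *; ring.
Qed.

End FrameVector.

Lemma commutator_cancel (R : realType) n (A B C D S : 'M[R]_n) :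
  S - A - (B - C) - (S - B - (A - D)) = - (D - C).
Proof.
by apply/matrixP => i j; rewrite !mxE; move: (A i j) (B i j) (C i j) (D i j) (S i j) => *; ring.
Qed.

(** * Shear-free geodesic congruences and the Einstein-Weyl equation *)

Section BaseGeometry.
Context {R : realType}.
Variables (V : set 'rV[R]_3) (h F : 'rV[R]_3 -> 'M[R]_3) (b chi : 'rV[R]_3 -> 'rV[R]_3).
Hypotheses (oV : open V) (mh : riemannian V h) (sb : smooth_mx V b) (sF : smooth_mx V F)
  (FhF : forall y, V y -> F y *m h y *m (F y)^T = 1%:M) (dF : forall y, V y -> 0 < \det (F y))
  (Fchi : forall y, V y -> row t0 (F y) = chi y).

Lemma unit_frame y : V y -> F y \in unitmx.
Proof. by move=> Vy; rewrite unitmxE unitfE gt_eqF // dF. Qed.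
Let uF := unit_frame.
Let W := fgam h F b.
Let beta c := fco F b c.
Let one_smooth : smooth V (fun=> 1 : R). Proof. exact: smooth_cst. Qed.
Let one_pos : forall y, V y -> (0 : R) < 1. Proof. by move=> y _; exact: ltr01. Qed.

Lemma base_wt c y : fwt F b (fun=> 1) c y = fco F b c y.
Proof. by apply: eq_bigr => i _; rewrite pd_cst mul0r addr0 mulrC. Qed.

Lemma base_skew c y p q : V y -> W c y q p = 2 * beta c y * (p == q)%:R - W c y p q.
Proof.
move=> Vy; have := congr1 (fun M : 'M[R]_3 => M p q) (fgam_skew b oV mh sF uF one_smooth one_pos FhF c Vy).
by rewrite !mxE base_wt -/(W c y) mulr_natr => <-; rewrite addrAC subrr add0r.
Qed.

Lemma base_diag c y p : V y -> W c y p p = beta c y.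
Proof. by move=> Vy; have := base_skew c p p Vy; rewrite eqxx mulr1; move: (W c y p p) (beta c y) => *; lra. Qed.

Lemma base_str e c d y : V y -> fstr F e y c d = W d y c e - W c y d e.
Proof. by move=> Vy; exact: (fstrE b oV mh sF uF e c d Vy). Qed.

Lemma chi_frame y : V y -> flat h chi y *m (F y)^T = bvec t0.
Proof. by move=> Vy; rewrite /flat -Fchi // rowE -!mulmxA (mulmxA (F y)) FhF // mulmx1. Qed.

Lemma chi_row y : V y -> chi y = 1 *: row t0 (F y).
Proof. by move=> Vy; rewrite scale1r Fchi. Qed.

Lemma covd_chi_frame y c k : V y ->
  (F y *m (covd_vec (-1) b (weyl_chr h b) chi y *m h y) *m (F y)^T) c k =
  W c y t0 k - beta c y * (k == t0)%:R.
Proof.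
move=> Vy; have hF : h y *m (F y)^T = invmx (F y).
  by apply: (can_inj (mulKmx (uF Vy))); rewrite mulmxV ?uF // mulmxA FhF.
rewrite mulmxA -[_ *m h y *m _]mulmxA hF (covd_vec_frame h b b oV sF uF (-1) one_smooth chi_row Vy).
rewrite mxE fd_cst -/W -/(beta c y); move: (W _ _ _ _) (beta c y) (_ == _) => p q e; ring.
Qed.

Lemma eps3_0 : [/\ eps3 t0 t0 t0 = 0 :> R, eps3 t0 t1 t1 = 0 :> R & eps3 t0 t2 t2 = 0 :> R] /\
  [/\ eps3 t0 t0 t1 = 0 :> R, eps3 t0 t0 t2 = 0 :> R, eps3 t0 t1 t0 = 0 :> R & eps3 t0 t2 t0 = 0 :> R] /\
  eps3 t0 t1 t2 = 1 :> R /\ eps3 t0 t2 t1 = -1 :> R.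
Proof. by do ![split]; rewrite eps3E det3E !mxE /=; ring. Qed.

(** The covariant derivative of the first leg of the frame is a row of the
    connection matrix. *)
Lemma sfg_frameP tau kap y : V y ->
  covd_vec (-1) b (weyl_chr h b) chi y *m h y =
    tau *: (h y - (flat h chi y)^T *m flat h chi y) + kap *: star3 h y (flat h chi y) <->
  [/\ W t0 y t0 t1 = 0, W t0 y t0 t2 = 0, W t1 y t0 t1 = tau & W t1 y t0 t2 = kap] /\
  W t2 y t0 t1 = - kap /\ W t2 y t0 t2 = tau.
Proof.
move=> Vy.
have fr : F y *m (tau *: (h y - (flat h chi y)^T *m flat h chi y) + kap *: star3 h y (flat h chi y)) *m (F y)^T =
   \matrix_(c, k) (tau * ((c == k)%:R - (c == t0)%:R * (k == t0)%:R) + kap * eps3 t0 c k).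
  have e0 : (F y *m star3 h y (flat h chi y) *m (F y)^T) = \matrix_(c, k) eps3 t0 c k.
    apply/matrixP => c k; rewrite (star3_frame _ _ _ (FhF Vy) (dF Vy)) chi_frame // [RHS]mxE.
    rewrite (bigD1 t0) //= big1 ?addr0 => [|e e0]; first by rewrite mxE !eqxx mul1r.
    by rewrite mxE (negbTE e0) mul0r.
  rewrite mulmxDr mulmxDl -!scalemxAr -!scalemxAl e0 mulmxBr mulmxBl FhF //.
  have -> : F y *m ((flat h chi y)^T *m flat h chi y) *m (F y)^T = (bvec t0)^T *m bvec t0.
    by move: (flat h chi y) (chi_frame Vy) => f <-; rewrite trmx_mul trmxK !mulmxA.
  apply/matrixP => c k; rewrite [LHS]mxE [X in X + _]mxE [X in _ * X + _]mxE [X in _ + X]mxE [RHS]mxE.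
  congr (_ * _ + _ * _); last by rewrite mxE.
  by rewrite !mxE big_ord1 !mxE.
have E : covd_vec (-1) b (weyl_chr h b) chi y *m h y =
    tau *: (h y - (flat h chi y)^T *m flat h chi y) + kap *: star3 h y (flat h chi y) <->
  forall c k, W c y t0 k - beta c y * (k == t0)%:R =
    tau * ((c == k)%:R - (c == t0)%:R * (k == t0)%:R) + kap * eps3 t0 c k.
  split=> [e c k|e]; first by rewrite -covd_chi_frame // e fr mxE.
  have uT : (F y)^T \in unitmx by rewrite unitmx_tr uF.
  apply: (can_inj (mulKmx (uF Vy))); apply: (can_inj (mulmxK uT)); rewrite fr.
  by apply/matrixP => c k; rewrite covd_chi_frame // e [RHS]mxE.
rewrite E; have [[z00 z11 z22] [[z01 z02 z10 z20] [z12 z21]]] := eps3_0.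
split=> [e|[[e1 e2 e3 e4] [e5 e6]] c k].
  have e01 := e t0 t1; have e02 := e t0 t2; have e11 := e t1 t1; have e12 := e t1 t2.
  have e21 := e t2 t1; have e22 := e t2 t2.
  rewrite /= ?z00 ?z11 ?z22 ?z01 ?z02 ?z10 ?z20 ?z12 ?z21 in e01 e02 e11 e12 e21 e22.
  move: e01 e02 e11 e12 e21 e22; move: (W _ _ _ _) (W _ _ _ _) (W _ _ _ _) (W _ _ _ _) (W _ _ _ _) (W _ _ _ _) (beta t0 y) (beta t1 y) (beta t2 y) => *.
  by do ![split]; lra.
elim/ord3P: c; elim/ord3P: k; rewrite /= ?z00 ?z11 ?z22 ?z01 ?z02 ?z10 ?z20 ?z12 ?z21 ?base_diag ?e1 ?e2 ?e3 ?e4 ?e5 ?e6 //; ring.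
Qed.


Section Congruence.
Variables (tau kap : 'rV[R]_3 -> R).
Hypotheses (st : smooth V tau) (sk : smooth V kap).
Hypothesis SFG : forall y, V y ->
  [/\ W t0 y t0 t1 = 0, W t0 y t0 t2 = 0, W t1 y t0 t1 = tau y & W t1 y t0 t2 = kap y] /\
  W t2 y t0 t1 = - kap y /\ W t2 y t0 t2 = tau y.

(** The one connection component not determined by the congruence: the
    rotation of its normal plane. *)
Definition nrot c y := fgam h F b c y t1 t2.
(** The Weyl derivative of a section of weight [-1], in the frame. *)
Definition weyl_d (f : 'rV[R]_3 -> R) c y : R := fd F c f y - f y * fco F b c y.
(** The exterior derivative of the one-form with components [nrot]. *)
Definition drot c d y := fd F c (nrot d) y - fd F d (nrot c) y + \sum_e nrot e y * fstr F e y c d.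

Lemma base_off c y : V y -> [/\ W c y t1 t0 = - W c y t0 t1, W c y t2 t0 = - W c y t0 t2 & W c y t2 t1 = - nrot c y].
Proof. by move=> Vy; split; rewrite base_skew //= mulr0 sub0r. Qed.

(** The structure equations, with the connection components of the congruence
    substituted; as the congruence is shear-free, few components survive. *)
Lemma base_curv y : V y -> let Rm c d p q := fcurv h F b c d y p q in
  [/\ Rm t0 t1 t0 t1 = weyl_d tau t0 y + tau y ^+ 2 - kap y ^+ 2,
      Rm t0 t2 t0 t2 = weyl_d tau t0 y + tau y ^+ 2 - kap y ^+ 2,
      Rm t0 t2 t0 t1 = - (weyl_d kap t0 y + 2 * tau y * kap y) &
      Rm t0 t1 t0 t2 = weyl_d kap t0 y + 2 * tau y * kap y] /\
  [/\ Rm t1 t2 t0 t1 = - weyl_d tau t2 y - weyl_d kap t1 y,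
      Rm t1 t2 t0 t2 = weyl_d tau t1 y - weyl_d kap t2 y,
      Rm t1 t2 t1 t2 = drot t1 t2 y + tau y ^+ 2 + kap y ^+ 2,
      Rm t0 t1 t1 t2 = drot t0 t1 y &
      Rm t0 t2 t1 t2 = drot t0 t2 y].
Proof.
move=> Vy Rm.
have [[s1 s2 s3 s4] [s5 s6]] := SFG Vy.
have f1 c : fd F c (fun z => fgam h F b t0 z t0 t1) y = 0.
  by rewrite -(fd_cst F c 0 y); apply: (fd_ext F oV c Vy) => z /SFG [[-> _ _ _] _].
have f2 c : fd F c (fun z => fgam h F b t0 z t0 t2) y = 0.
  by rewrite -(fd_cst F c 0 y); apply: (fd_ext F oV c Vy) => z /SFG [[_ -> _ _] _].
have f3 c : fd F c (fun z => fgam h F b t1 z t0 t1) y = fd F c tau y.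
  by apply: (fd_ext F oV c Vy) => z /SFG [[_ _ -> _] _].
have f4 c : fd F c (fun z => fgam h F b t1 z t0 t2) y = fd F c kap y.
  by apply: (fd_ext F oV c Vy) => z /SFG [[_ _ _ ->] _].
have f5 c : fd F c (fun z => fgam h F b t2 z t0 t1) y = - fd F c kap y.
  by rewrite -(fdN F c sk Vy); apply: (fd_ext F oV c Vy) => z /SFG [_ [-> _]].
have f6 c : fd F c (fun z => fgam h F b t2 z t0 t2) y = fd F c tau y.
  by apply: (fd_ext F oV c Vy) => z /SFG [_ [_ ->]].
have o c := base_off c Vy.
have [n1 n2 n3] := o t0; have [p1 p2 p3] := o t1; have [r1 r2 r3] := o t2.
have dg := base_diag _ _ Vy.
have K c d p q : Rm c d p q = fd F c (fun z => fgam h F b d z p q) y - fd F d (fun z => fgam h F b c z p q) y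
   + (W t0 y p q * (W d y c t0 - W c y d t0) + W t1 y p q * (W d y c t1 - W c y d t1) + W t2 y p q * (W d y c t2 - W c y d t2))
   + ((W d y p t0 * W c y t0 q + W d y p t1 * W c y t1 q + W d y p t2 * W c y t2 q)
     - (W c y p t0 * W d y t0 q + W c y p t1 * W d y t1 q + W c y p t2 * W d y t2 q)).
  rewrite /Rm (fcurvE oV mh sb sF uF c d p q Vy) sum3 !(base_str _ _ _ Vy) -/W.
  congr (_ + _); rewrite [LHS]mxE [X in X + _]mxE sum3; congr (_ + _).
  by rewrite [LHS]mxE [X in - X]mxE sum3.
have dr c d : drot c d y = fd F c (nrot d) y - fd F d (nrot c) y
   + (nrot t0 y * (W d y c t0 - W c y d t0) + nrot t1 y * (W d y c t1 - W c y d t1) + nrot t2 y * (W d y c t2 - W c y d t2)).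
  by rewrite /drot sum3 !(base_str _ _ _ Vy).
have rt c : W c y t1 t2 = nrot c y by [].
have fr c d : fd F c (fun z => fgam h F b d z t1 t2) y = fd F c (nrot d) y by [].
have eE := (s1, s2, s3, s4, s5, s6, n1, n2, n3, p1, p2, p3, r1, r2, r3).
rewrite /weyl_d -!/(beta _ y); do ![split]; rewrite K ?dr ?f1 ?f2 ?f3 ?f4 ?f5 ?f6 ?fr;
  rewrite !(dg, rt, eE) /beta; gen_fd; gen_fco; move: (nrot t0 y) (nrot t1 y) (nrot t2 y) (tau y) (kap y) => *; ring.
Qed.

Lemma base_curv_skew c d p q y : V y ->
  fcurv h F b c d y q p = 2 * f2co F b c d y * (p == q)%:R - fcurv h F b c d y p q.
Proof.
move=> Vy.
have sWc e i j : smooth V (fun z => fgam h F b e z i j) by exact: (smooth_fgam oV mh sb sF uF).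
have sbe e : smooth V (fco F b e) by exact: (smooth_fco oV sF e sb).
have D e i j k : fd F k (fun z => fgam h F b e z j i) y =
    2 * (i == j)%:R * fd F k (fco F b e) y - fd F k (fun z => fgam h F b e z i j) y.
  rewrite -(fdZ F k _ (sbe e) Vy) -(fdB F oV k (smoothZ _ oV (sbe e)) (sWc e i j) Vy).
  apply: (fd_ext F oV k Vy) => z Vz; rewrite (base_skew e i j Vz) /beta mulrAC.
  by [].
rewrite !(fcurvE oV mh sb sF uF c d _ _ Vy) -!/(W _ y) (D d p q c) (D c p q d).
rewrite /f2co (frame_d1 oV sF uF c d sb Vy).
have -> : \sum_e W e y q p * fstr F e y c d =
   2 * (p == q)%:R * (\sum_b0 fco F b b0 y * fstr F b0 y c d) - \sum_e W e y p q * fstr F e y c d.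
  rewrite mulr_sumr -sumrB; apply: eq_bigr => e _; rewrite (base_skew e p q Vy) /beta.
  by move: (_ == _)%:R (fco _ _ _ _) (W _ _ _ _) (fstr _ _ _ _ _) => *; ring.
have -> : (W d y *m W c y - W c y *m W d y) q p = - (W d y *m W c y - W c y *m W d y) p q.
  have sk' e : (W e y)^T = (2 * beta e y)%:M - W e y.
    by apply/matrixP => i j; rewrite [LHS]mxE (base_skew e i j Vy) !mxE mulr_natr.
  have -> : (W d y *m W c y - W c y *m W d y) q p = (W d y *m W c y - W c y *m W d y)^T p q by rewrite [RHS]mxE.
  rewrite linearB /= !trmx_mul !sk' !mulmxBl !mulmxBr -!scalar_mxM !mul_scalar_mx !mul_mx_scalar (mulrC (2 * beta c y)).
  by rewrite commutator_cancel [LHS]mxE.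
rewrite /W; move: (\sum_b0 _) => s1; move: (\sum_e _) => s2.
by gen_fd; gen_entries; gen_deltas; ring.
Qed.

(** The exterior derivative of the one-form [nrot + kap chi]; on the total
    space this form is the basic part of the connection form of the canonical
    bundle. *)
Definition dnu c d y := drot c d y + fd F c (fun z => kap z * (d == t0)%:R) y - fd F d (fun z => kap z * (c == t0)%:R) y
  + kap y * fstr F t0 y c d.

Ltac gen_base := repeat match goal with
  | |- context [weyl_d ?f ?c ?y] => generalize (weyl_d f c y); intro
  | |- context [drot ?f ?c ?y] => generalize (drot f c y); intro
  | |- context [f2co ?f ?a ?c ?d ?y] => generalize (f2co f a c d y); intro end.

Lemma base_curv_anti c d y p q : fcurv h F b d c y p q = - fcurv h F b c d y p q.
Proof.
have -> : fcurv h F b d c y = - fcurv h F b c d y; last by rewrite mxE.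
rewrite /fcurv exchange_big /= -sumrN; apply: eq_bigr => i _; rewrite -sumrN; apply: eq_bigr => j _.
by rewrite curv_anti scalerN mulrC.
Qed.

Lemma base_curv_same c y p q : fcurv h F b c c y p q = 0.
Proof. by have := base_curv_anti c c y p q; move: (fcurv _ _ _ _ _ _ _ _) => u; lra. Qed.

Lemma base_curv_diag c d y p : V y -> fcurv h F b c d y p p = f2co F b c d y.
Proof.
by move=> Vy; have := base_curv_skew c d p p Vy; rewrite eqxx mulr1; move: (fcurv _ _ _ _ _ _ _ _) (f2co _ _ _ _ _) => u v; lra.
Qed.

Lemma base_curv_off c d y : V y -> [/\ fcurv h F b c d y t1 t0 = - fcurv h F b c d y t0 t1,
  fcurv h F b c d y t2 t0 = - fcurv h F b c d y t0 t2 & fcurv h F b c d y t2 t1 = - fcurv h F b c d y t1 t2].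
Proof. by move=> Vy; split; rewrite (base_curv_skew _ _ _ _ Vy) mulr0 sub0r. Qed.

Lemma dnuE y : V y -> [/\ dnu t1 t2 y = drot t1 t2 y + 2 * kap y ^+ 2, dnu t2 t0 y = - drot t0 t2 y + weyl_d kap t2 y &
   dnu t0 t1 y = drot t0 t1 y - weyl_d kap t1 y].
Proof.
move=> Vy.
have k0 d : fd F d (fun z => kap z * (t0 == t0)%:R) y = fd F d kap y.
  by apply: (fd_ext F oV d Vy) => u _; rewrite eqxx mulr1.
have k1 c d : c != t0 -> fd F d (fun z => kap z * (c == t0)%:R) y = 0.
  by move=> c0; rewrite -(fd_cst F d 0 y); apply: (fd_ext F oV d Vy) => u _; rewrite (negbTE c0) mulr0.
have [[s1 s2 s3 s4] [s5 s6]] := SFG Vy.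
have [n1 n2 n3] := base_off t0 Vy; have [p1 p2 p3] := base_off t1 Vy; have [r1 r2 r3] := base_off t2 Vy.
have da c d : drot c d y = - drot d c y.
  rewrite /drot; have -> : \sum_e nrot e y * fstr F e y c d = - \sum_e nrot e y * fstr F e y d c.
    by rewrite -sumrN; apply: eq_bigr => e _; rewrite !(base_str _ _ _ Vy) -mulrN opprB.
  by move: (\sum_e _) => q; gen_fd; ring.
have E := (s1, s2, s3, s4, s5, s6, n1, n2, n3, p1, p2, p3, r1, r2, r3, fun c p => base_diag c p Vy).
rewrite /dnu (da t2 t0) /weyl_d !(base_str _ _ _ Vy) !k0 !(k1 t1 _ isT) ?(k1 t2 _ isT) !E /beta.
by move: (drot _ _ _) (drot _ _ _) (drot _ _ _) (kap y) => *; gen_fd; gen_fco; split; ring.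
Qed.

(** Of the five tracefree components of the symmetrized Ricci tensor, the two
    in the normal plane of the congruence vanish by shear-freeness; the other
    three are these equations. *)
Lemma base_einstein_weylP y (S := ricci (weyl_chr h b) y + (ricci (weyl_chr h b) y)^T) : V y ->
  S = (3%:R^-1 * \tr (invmx (h y) *m S)) *: h y <->
  [/\ weyl_d tau t0 y = dnu t1 t2 y, weyl_d tau t1 y = dnu t2 t0 y & weyl_d tau t2 y = dnu t0 t1 y].
Proof.
move=> Vy; pose T := F y *m S *m (F y)^T.
have uT : (F y)^T \in unitmx by rewrite unitmx_tr uF.
have E1 : S = (3%:R^-1 * \tr (invmx (h y) *m S)) *: h y <-> exists s, T = s%:M.
  split=> [|[s Ts]].
    set c := 3%:R^-1 * _ => e; exists c; by rewrite /T e -scalemxAr -scalemxAl FhF // scale_scalar_mx mulr1.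
  have Sh : S = s *: h y.
    apply: (can_inj (mulKmx (uF Vy))); apply: (can_inj (mulmxK uT)).
    by rewrite -/T Ts -scalemxAr -scalemxAl FhF // scale_scalar_mx mulr1.
  rewrite {1}Sh; congr (_ *: _); rewrite Sh -scalemxAr mulVmx ?(metric_unitmx mh Vy) // mxtraceZ mxtrace1.
  by field.
rewrite E1.
have TE c d : T c d = \sum_e fcurv h F b e c y d e + \sum_e fcurv h F b e d y c e.
  rewrite /T /S mulmxDr mulmxDl [LHS]mxE (ricci_frame oV mh sb sF uF c d Vy) -(ricci_frame oV mh sb sF uF d c Vy).
  congr (_ + _); rewrite -[in RHS](trmxK (F y *m _ *m _)) [RHS]mxE; congr (_ _ _).
  by rewrite !trmx_mul trmxK mulmxA.
have [[c1 c2 c3 c4] [c5 c6 c7 c8 c9]] := base_curv Vy.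
have [m01 m02 m12] := base_curv_off t0 t1 Vy; have [l01 l02 l12] := base_curv_off t0 t2 Vy.
have [k01 k02 k12] := base_curv_off t1 t2 Vy; have dd c d p := base_curv_diag c d p Vy.
have an := base_curv_anti.
have all_c := (base_curv_same, an t0 t1, an t0 t2, an t1 t2, dd, (m01, m02, m12, l01, l02, l12, k01, k02, k12),
  (c1, c2, c3, c4, c5, c6, c7, c8, c9)).
have [-> -> ->] := dnuE Vy.
split=> [[s Ts]|[e1 e2 e3]].
  have Tcd c d : T c d = s *+ (c == d) by rewrite Ts mxE.
  have := Tcd t0 t0; have := Tcd t1 t1; have := Tcd t0 t1; have := Tcd t0 t2; have := Tcd t1 t2.
  rewrite !TE !sum3 /= ?mulr0n ?mulr1n !all_c; gen_base; move: (tau y) (kap y) => *.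
  by split; lra.
exists (T t0 t0); apply/matrixP => c d; rewrite [RHS]mxE.
elim/ord3P: c; elim/ord3P: d; rewrite ?mulr0n ?mulr1n !TE !sum3 !all_c ?e1 ?e2 ?e3 ?addr0 ?add0r //=;
  gen_base; move: (tau y) (kap y) => *; ring.
Qed.

(** With the Einstein-Weyl equation, the first Bianchi identity expresses
    [F^B] by the divergence and twist. *)
Lemma base_faraday y : V y ->
  [/\ weyl_d tau t0 y = dnu t1 t2 y, weyl_d tau t1 y = dnu t2 t0 y & weyl_d tau t2 y = dnu t0 t1 y] ->
  [/\ f2co F b t1 t2 y = 2 * weyl_d kap t0 y + 4 * tau y * kap y,
      f2co F b t2 t0 y = 2 * weyl_d kap t1 y + 2 * weyl_d tau t2 y &
      f2co F b t0 t1 y = 2 * weyl_d kap t2 y - 2 * weyl_d tau t1 y].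
Proof.
move=> Vy; have [-> -> ->] := dnuE Vy => -[e1 e2 e3].
have [[c1 c2 c3 c4] [c5 c6 c7 c8 c9]] := base_curv Vy.
have [m01 m02 m12] := base_curv_off t0 t1 Vy; have [l01 l02 l12] := base_curv_off t0 t2 Vy.
have [k01 k02 k12] := base_curv_off t1 t2 Vy; have dd c d p := base_curv_diag c d p Vy.
have an := base_curv_anti.
have all_c := (an t0 t1, an t0 t2, an t1 t2, dd, (m01, m02, m12, l01, l02, l12, k01, k02, k12),
  (c1, c2, c3, c4, c5, c6, c7, c8, c9)).
have B q := fcurv_bianchi oV mh sb sF uF t0 t1 t2 q Vy.
have da : f2co F b t2 t0 y = - f2co F b t0 t2 y by rewrite -!(dd _ _ t0) an.
move: (B t0) (B t1) (B t2); rewrite !all_c da; move: e1 e2 e3; gen_base; move: (tau y) (kap y) => *.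
by split; lra.
Qed.

End Congruence.
End BaseGeometry.

(** * The lifted frame of a conformal submersion *)

(** The horizontal legs of a frame of the total space. *)
Definition w (i : 'I_3) : 'I_4 := widen_ord (isT : (3 <= 4)%N) i.
Lemma w0 : w t0 = q0. Proof. exact: val_inj. Qed.
Lemma w1 : w t1 = q1. Proof. exact: val_inj. Qed.
Lemma w2 : w t2 = q2. Proof. exact: val_inj. Qed.

Lemma ord4w (P : 'I_4 -> Prop) : (forall c, P (w c)) -> P q3 -> forall i, P i.
Proof. by move=> Pw P3; apply: ord4P; rewrite -?w0 -?w1 -?w2. Qed.

Lemma sum4w (V : nmodType) (f : 'I_4 -> V) : \sum_i f i = \sum_c f (w c) + f q3.
Proof. by rewrite sum4 sum3 w0 w1 w2. Qed.

Lemma w_inj : injective w. Proof. by move=> i j /(congr1 val) /= /val_inj. Qed.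
Lemma w3 c : (w c == q3) = false.
Proof. by apply/negP => /eqP /(congr1 val) /= e; have := ltn_ord c; rewrite e. Qed.

Lemma frame_entry (R : realType) n m (E : 'M[R]_(m, n)) (M : 'M[R]_n) p q :
  (E *m M *m E^T) p q = (row p E *m M *m (row q E)^T) 0 0.
Proof. by rewrite -row_mul mxE [RHS]mxE; apply: eq_bigr => i _; rewrite !mxE. Qed.

Lemma frame_entry_delta (R : realType) n (M : 'M[R]_n) i j :
  ((delta_mx 0 i : 'rV_n) *m M *m (delta_mx 0 j : 'rV_n)^T) 0 0 = M i j.
Proof. by have := frame_entry 1%:M M i j; rewrite trmx1 mulmx1 mul1mx !rowE !mulmx1 => ->. Qed.

Lemma eq_bilinear (R : realType) n (A B : 'M[R]_n) :
  (forall u v : 'rV[R]_n, (u *m A *m v^T) 0 0 = (u *m B *m v^T) 0 0) -> A = B.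
Proof.
move=> AB; apply/matrixP => i j; have := AB (delta_mx 0 i) (delta_mx 0 j).
have K (M : 'M[R]_n) : ((delta_mx 0 i : 'rV_n) *m M *m (delta_mx 0 j : 'rV_n)^T) 0 0 = M i j.
  by rewrite frame_entry_delta.
by rewrite !K.
Qed.

Section LiftedFrame.
Context {R : realType}.
Variables (U : set 'rV[R]_4) (V : set 'rV[R]_3) (g : 'rV[R]_4 -> 'M[R]_4)
  (h F : 'rV[R]_3 -> 'M[R]_3) (pi : 'rV[R]_4 -> 'rV[R]_3) (xi : 'rV[R]_4 -> 'rV[R]_4)
  (lam : 'rV[R]_4 -> R).
Hypotheses (oU : open U) (oV : open V) (mg : riemannian U g) (mh : riemannian V h)
  (cs : conformal_submersion U V g h pi xi lam) (sF : smooth_mx V F)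
  (FhF : forall y, V y -> F y *m h y *m (F y)^T = 1%:M) (dF : forall y, V y -> 0 < \det (F y)).

Let sp := csub_smooth cs.
Let lp := csub_lam_pos cs.
Let sl := csub_lam_smooth cs.
Let l0 x : U x -> lam x != 0. Proof. by move=> Ux; rewrite gt_eqF // lp. Qed.

Lemma piV x : U x -> V (pi x).
Proof. by move=> Ux; rewrite -(csub_surj cs); exists x. Qed.

Lemma unitF y : V y -> F y \in unitmx.
Proof. by move=> Vy; rewrite unitmxE unitfE gt_eqF // dF. Qed.

(** A conformal submersion splits the metric: horizontal vectors are measured
    on the base and vertical ones by [xi]. *)
Lemma csub_metric x : U x ->
  g x = (lam x ^+ 2)^-1 *: pull2 pi h x + (flat g xi x)^T *m flat g xi x.
Proof.
move=> Ux; apply: eq_bilinear => u v.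
have gs := met_sym mg Ux.
pose B p q := inner g x p q.
have Bs p q : B p q = B q p.
  by rewrite /B /inner -{1}gs -[in LHS](trmxK p) -!trmx_mul mulmxA [LHS]mxE.
have fE p : B p (xi x) = (p *m (flat g xi x)^T) 0 0.
  by rewrite /B /inner /flat trmx_mul gs mulmxA.
have BD p q r c : B (p - c *: q) r = B p r - c * B q r.
  by rewrite /B /inner !mulmxBl -!scalemxAl !mxE.
have x1 := csub_xi_unit cs Ux.
pose hz p := p - B p (xi x) *: xi x.
have hz0 p : B (hz p) (xi x) = 0 by rewrite BD [B (xi x) _]x1 mulr1 subrr.
have hzB p q : B p q = B (hz p) (hz q) + B p (xi x) * B q (xi x).
  have -> : B (hz p) (hz q) = B p (hz q) by rewrite {1}/hz BD (Bs (xi x)) hz0 mulr0 subr0.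
  by rewrite (Bs p (hz q)) /hz BD (Bs q p) (Bs (xi x) p) (mulrC (B q _)) subrK.
have hzJ p : hz p *m 'J pi x = p *m 'J pi x.
  by rewrite mulmxBl -scalemxAl (csub_xi_vert cs Ux) scaler0 subr0.
have := csub_conformal cs Ux (hz0 u) (hz0 v); rewrite !hzJ => e.
rewrite -[LHS]/(B u v) hzB !fE mulmxDr mulmxDl [RHS]mxE; congr (_ + _).
  rewrite -scalemxAr -scalemxAl [RHS]mxE.
  apply: (mulfI (_ : lam x ^+ 2 != 0)); first by rewrite expf_neq0 ?l0.
  rewrite mulVKf ?expf_neq0 ?l0 // -[LHS]e /inner /pull2 trmx_mul !mulmxA.
  by [].
rewrite [(v *m _) 0 0](_ : _ = (flat g xi x *m v^T) 0 0); last first.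
  by rewrite -{1}(trmxK v) -trmx_mul mxE.
by move: (flat g xi x) => f; rewrite mulmxA -(mulmxA (u *m _)) [RHS]mxE big_ord1.
Qed.

Let P x := 'J pi x *m invmx (F (pi x)).
(** The pulled back coframe of the base, completed by [lam <xi,.>], the unit
    vertical form in the gauge of the base. *)
Definition coframe (x : 'rV[R]_4) : 'M[R]_4 := \matrix_(i, j)
  nth 0 [:: P x i t0; P x i t1; P x i t2; lam x * flat g xi x 0 i] j.
Definition lfr (x : 'rV[R]_4) : 'M[R]_4 := invmx (coframe x).

Lemma coframeE x i c : coframe x i (w c) = P x i c.
Proof. by rewrite mxE; elim/ord3P: c. Qed.
Lemma coframeE3 x i : coframe x i q3 = lam x * flat g xi x 0 i.
Proof. by rewrite mxE. Qed.

Lemma coframe_metric x : U x -> g x = (lam x ^+ 2)^-1 *: (coframe x *m (coframe x)^T).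
Proof.
move=> Ux; rewrite {1}(csub_metric Ux).
have Vy := piV Ux; have uF := unitF Vy; have uT : (F (pi x))^T \in unitmx by rewrite unitmx_tr.
have -> : pull2 pi h x = P x *m (P x)^T.
  rewrite /pull2 /P; have -> : h (pi x) = invmx (F (pi x)) *m (invmx (F (pi x)))^T.
    apply: (can_inj (mulKmx uF)); apply: (can_inj (mulmxK uT)).
    by rewrite FhF // mulKVmx // trmx_inv mulVmx.
  by rewrite trmx_mul !mulmxA.
apply/matrixP => i j; rewrite [LHS]mxE [X in X + _]mxE [RHS]mxE [X in _ = _ * X]mxE sum4w mulrDr.
rewrite [X in _ * X + _]mxE mulr_sumr [X in _ = X + _]mulr_sumr [(coframe x)^T _ _]mxE !coframeE3.
move: (flat g xi x) => f; rewrite [X in _ + X = _]mxE big_ord1 [f^T _ _]mxE; congr (_ + _).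
  by apply: eq_bigr => c _; rewrite ![_^T _ _]mxE !coframeE.
by move: (f 0 i) (f 0 j) (lam x) (l0 Ux) => p q l ll; field.
Qed.

Lemma unit_coframe x : U x -> coframe x \in unitmx.
Proof.
move=> Ux; have := metric_unitmx mg Ux; rewrite (coframe_metric Ux) !unitmxE !unitfE detZ det_mulmx.
by rewrite mulf_eq0 negb_or => /andP [_]; rewrite mulf_eq0 negb_or => /andP [].
Qed.

Lemma unit_lfr x : U x -> lfr x \in unitmx.
Proof. by move=> Ux; rewrite unitmx_inv unit_coframe. Qed.

Lemma lfr_metric x : U x -> lfr x *m g x *m (lfr x)^T = ((lam x ^+ 2)^-1)%:M.
Proof.
move=> Ux; have u := unit_coframe Ux; rewrite (coframe_metric Ux) -scalemxAr -scalemxAl.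
rewrite /lfr mulmxA mulVmx // mul1mx -trmx_mul mulVmx // trmx1 scale_scalar_mx mulr1.
by [].
Qed.

Lemma lfr_coframe x a b : U x -> \sum_i lfr x a i * coframe x i b = (a == b)%:R.
Proof.
by move=> Ux; have := congr1 (fun M : 'M[R]_4 => M a b) (mulVmx (unit_coframe Ux)); rewrite !mxE.
Qed.

Lemma lfr_jac x a : U x -> row a (lfr x) *m 'J pi x = \sum_c (a == w c)%:R *: row c (F (pi x)).
Proof.
move=> Ux; have uF := unitF (piV Ux).
have -> : row a (lfr x) *m 'J pi x = (row a (lfr x) *m P x) *m F (pi x) by rewrite /P !mulmxA mulmxKV.
rewrite mulmx_sum_row; apply: eq_bigr => c _; congr (_ *: _).
rewrite -(lfr_coframe a (w c) Ux) mxE; apply: eq_bigr => i _; by rewrite mxE coframeE.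
Qed.

Lemma lfr_row x c : U x -> row (w c) (lfr x) *m 'J pi x = row c (F (pi x)).
Proof.
move=> Ux; rewrite lfr_jac // (bigD1 c) //= eqxx scale1r big1 ?addr0 // => d dc.
by rewrite (inj_eq w_inj) eq_sym (negbTE dc) scale0r.
Qed.

Lemma lfr_row3 x : U x -> row q3 (lfr x) *m 'J pi x = 0.
Proof. by move=> Ux; rewrite lfr_jac // big1 // => c _; rewrite eq_sym w3 scale0r. Qed.

Lemma lfr_vertical x : U x -> (lam x *: flat g xi x) *m (lfr x)^T = bvec q3.
Proof.
move=> Ux; apply/rowP => a; rewrite mxE [RHS]mxE /= -(lfr_coframe a q3 Ux); apply: eq_bigr => i _.
by rewrite ![_^T _ _]mxE coframeE3 mulrC; congr (_ * _); rewrite mxE.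
Qed.

Lemma xi_lfr x : U x -> xi x = lam x *: row q3 (lfr x).
Proof.
move=> Ux; apply: (can_inj (mulmxK (unit_coframe Ux))).
rewrite -scalemxAl -row_mul /lfr mulVmx ?unit_coframe //.
apply/rowP; apply: ord4w => [c|]; rewrite mxE [RHS]mxE [row _ _ _ _]mxE [1%:M _ _]mxE.
  transitivity ((xi x *m P x) 0 c); first by rewrite mxE; apply: eq_bigr => i _; rewrite coframeE.
  by rewrite /P mulmxA (csub_xi_vert cs Ux) mul0mx mxE eq_sym w3 mulr0.
transitivity (lam x * (xi x *m (flat g xi x)^T) 0 0).
  by rewrite mxE mulr_sumr; apply: eq_bigr => i _; rewrite coframeE3 [_^T _ _]mxE mulrCA.
rewrite /flat trmx_mul (met_sym mg Ux) mulmxA; have := csub_xi_unit cs Ux; rewrite /inner => ->.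
by rewrite eqxx.
Qed.

(** The orientation of the submersion makes the lifted frame oriented when
    that of the base is. *)
Lemma det_lfr x : U x -> 0 < \det (lfr x).
Proof.
move=> Ux; have := csub_orient cs Ux (row q0 (lfr x)) (row q1 (lfr x)) (row q2 (lfr x)).
rewrite -w0 -w1 -w2 !lfr_row // /vol !w0 !w1 !w2.
have -> : \matrix_k [:: row q0 (lfr x); row q1 (lfr x); row q2 (lfr x); xi x]`_k =
   \matrix_(k, j) ((if k == q3 then lam x else 1) * lfr x k j).
  by rewrite xi_lfr //; apply/matrixP => i j; elim/ord4P: i; rewrite !mxE /= ?mul1r.
have -> : \matrix_k [:: row t0 (F (pi x)); row t1 (F (pi x)); row t2 (F (pi x))]`_k = F (pi x).
  by apply/matrixP => i j; elim/ord3P: i; rewrite !mxE /=.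
have -> : \det (\matrix_(k, j) ((if k == q3 then lam x else 1) * lfr x k j)) = lam x * \det (lfr x).
  have -> : \matrix_(k, j) ((if k == q3 then lam x else 1) * lfr x k j) =
      diag_mx (\row_k (if k == q3 then lam x else 1)) *m lfr x.
    by apply/matrixP => i j; rewrite mul_diag_mx !mxE.
  by rewrite det_mulmx det_diag !big_ord_recl big_ord0 !mxE /= !mul1r mulr1.
have Vy := piV Ux; rewrite (sqrt_det_frame (FhF Vy) (dF Vy)) mulVf ?gt_eqF ?dF //.
move=> e; have : 0 < lam x ^+ 3 * (Num.sqrt (\det (g x)) * (lam x * \det (lfr x))) by rewrite e.
rewrite pmulr_rgt0 ?exprn_gt0 ?lp // => Q.
have d0 : \det (lfr x) != 0 by rewrite -unitfE -unitmxE unit_lfr.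
rewrite lt_neqAle eq_sym d0 /= leNgt; apply/negP => dn.
have : Num.sqrt (\det (g x)) * (lam x * \det (lfr x)) <= 0.
  by rewrite mulr_ge0_le0 ?sqrtr_ge0 // pmulr_rle0 ?lp // ltW.
by rewrite leNgt Q.
Qed.

Lemma smooth_flat_xi : smooth_mx U (flat g xi).
Proof. exact: smooth_mulmx oU (csub_xi_smooth cs) (met_smooth mg). Qed.

Lemma smooth_lifted_xi : smooth_mx U (fun x => lam x *: flat g xi x).
Proof. exact: smooth_scalemx oU sl smooth_flat_xi. Qed.

Lemma smooth_coframe : smooth_mx U coframe.
Proof.
have sA : smooth_mx U (fun x => 'J pi x *m invmx (F (pi x))).
  apply: (smooth_mulmx oU (smooth_jacobian oU sp)).
  apply: (smooth_invmx oU) => [x Ux|]; first exact: unitF (piV Ux).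
  exact: (smooth_chain_mx oU piV sp sF).
move=> i; apply: ord4w => [c|].
  refine (smooth_ext oU _ (sA i c)) => z _; by rewrite coframeE.
refine (smooth_ext oU _ (smooth_lifted_xi 0 i)) => z _; by rewrite coframeE3 mxE.
Qed.

Lemma smooth_lfr : smooth_mx U lfr.
Proof. exact: (smooth_invmx oU unit_coframe smooth_coframe). Qed.

Lemma cof_lfr i x : U x -> cof lfr (w i) x = pull1 pi (cof F i) x.
Proof.
move=> Ux; rewrite /cof /lfr invmxK /pull1 -trmx_mul; congr (_^T).
by apply/colP => k; rewrite mxE coframeE !mxE; apply: eq_bigr => j _; rewrite !mxE.
Qed.

Lemma cof_lfr3 x : U x -> cof lfr q3 x = lam x *: flat g xi x.
Proof.
by move=> Ux; rewrite /cof /lfr invmxK; apply/rowP => k; rewrite 2!mxE coframeE3 [RHS]mxE.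
Qed.

Lemma pull_frame (M : 'M[R]_3) x : U x ->
  (forall c d, (lfr x *m ('J pi x *m M *m ('J pi x)^T) *m (lfr x)^T) (w c) (w d) =
     (F (pi x) *m M *m (F (pi x))^T) c d) /\
  (forall c, (lfr x *m ('J pi x *m M *m ('J pi x)^T) *m (lfr x)^T) c q3 = 0) /\
  (forall c, (lfr x *m ('J pi x *m M *m ('J pi x)^T) *m (lfr x)^T) q3 c = 0).
Proof.
move=> Ux.
have K a b : (lfr x *m ('J pi x *m M *m ('J pi x)^T) *m (lfr x)^T) a b =
    ((row a (lfr x) *m 'J pi x) *m M *m (row b (lfr x) *m 'J pi x)^T) 0 0.
  by rewrite frame_entry trmx_mul !mulmxA.
split=> [c d|]; first by rewrite K !lfr_row // -frame_entry.
by split=> c; rewrite K lfr_row3 // ?trmx0 ?mulmx0 ?mul0mx mxE.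
Qed.

(** The exterior derivative commutes with pullback, so the horizontal coframe
    has the structure functions of the base. *)
Lemma fstr_base i x : U x ->
  (forall c d, fstr lfr (w i) x (w c) (w d) = fstr F i (pi x) c d) /\
  (forall c, fstr lfr (w i) x c q3 = 0) /\ (forall c, fstr lfr (w i) x q3 c = 0).
Proof.
move=> Ux.
have uF := unitF.
have e : d1 (cof lfr (w i)) x = 'J pi x *m d1 (cof F i) (pi x) *m ('J pi x)^T.
  rewrite (d1_ext oU Ux (fun z => @cof_lfr i z)) (d1_pull1 oU piV sp _ Ux) //.
  exact: (smooth_cof oV sF unitF).
by rewrite /fstr e; have [a [b c]] := pull_frame (d1 (cof F i) (pi x)) Ux; split=> [? ?|]; [exact: a | split].
Qed.

Lemma pull1_frame (b : 'rV[R]_3 -> 'rV[R]_3) x : U x ->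
  (forall c, fco lfr (pull1 pi b) (w c) x = fco F b c (pi x)) /\ fco lfr (pull1 pi b) q3 x = 0.
Proof.
move=> Ux; have K c : fco lfr (pull1 pi b) c x = (b (pi x) *m (row c (lfr x) *m 'J pi x)^T) 0 0.
  rewrite fcoE /pull1 trmx_mul mulmxA mxE [RHS]mxE; apply: eq_bigr => i _; by rewrite !mxE.
split=> [c|]; rewrite K ?lfr_row ?lfr_row3 //; last by rewrite trmx0 mulmx0 mxE.
by rewrite fcoE mxE [RHS]mxE; apply: eq_bigr => i _; rewrite !mxE.
Qed.

Lemma fd_pull (f : 'rV[R]_3 -> R) x : smooth V f -> U x ->
  (forall c, fd lfr (w c) (fun z => f (pi z)) x = fd F c f (pi x)) /\ fd lfr q3 (fun z => f (pi z)) x = 0.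
Proof.
move=> sf Ux; have [a b] := pull1_frame (grad f) Ux.
have K c : fd lfr c (fun z => f (pi z)) x = fco lfr (pull1 pi (grad f)) c x.
  by rewrite fdE fcoE (grad_chain sp sf Ux (piV Ux)).
by split=> [c|]; rewrite K ?a ?b // fcoE fdE.
Qed.

End LiftedFrame.

(** * The connection of the total space in the lifted frame *)

Lemma fstrU (R : realType) n (E : 'rV[R]_n -> 'M[R]_n) b x : fstr E b x = E x *m d1 (cof E b) x *m (E x)^T.
Proof. by []. Qed.

Lemma wedge_anti (R : realType) n (a b : 'rV[R]_n) : (wedge a b)^T = - wedge a b.
Proof. by rewrite /wedge linearB /= !trmx_mul !trmxK opprB. Qed.

Lemma fgamU (R : realType) n (g E : 'rV[R]_n -> 'M[R]_n) a c x :
  fgam g E a c x = \sum_i E x c i *: fconn g E a i x.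
Proof. by []. Qed.

Lemma fstr_anti (R : realType) n (E : 'rV[R]_n -> 'M[R]_n) b x c d : fstr E b x c d = - fstr E b x d c.
Proof.
have : (fstr E b x)^T = - fstr E b x by rewrite fstrU !trmx_mul trmxK d1_anti mulNmx mulmxN mulmxA.
by move/(congr1 (fun M : 'M[R]_n => M d c)); rewrite !mxE.
Qed.

Lemma fstr_same (R : realType) n (E : 'rV[R]_n -> 'M[R]_n) b x c : fstr E b x c c = 0.
Proof. by have := fstr_anti E b x c c; move: (fstr _ _ _ _ _) => z; lra. Qed.

Lemma conj_add3 (R : realType) n (E A B C : 'M[R]_n) :
  E *m (A + B + C) *m E^T = E *m A *m E^T + E *m B *m E^T + E *m C *m E^T.
Proof. by rewrite !mulmxDr !mulmxDl. Qed.

Lemma conj_scale (R : realType) n k (E A : 'M[R]_n) : E *m (k *: A) *m E^T = k *: (E *m A *m E^T).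
Proof. by rewrite -scalemxAr -scalemxAl. Qed.

Opaque w fstr fgam fconn lfr wedge d1.

Section TotalSpace.
Context {R : realType}.
Variables (U : set 'rV[R]_4) (V : set 'rV[R]_3) (g : 'rV[R]_4 -> 'M[R]_4)
  (h F : 'rV[R]_3 -> 'M[R]_3) (pi : 'rV[R]_4 -> 'rV[R]_3) (xi : 'rV[R]_4 -> 'rV[R]_4)
  (lam : 'rV[R]_4 -> R).
Hypotheses (oU : open U) (oV : open V) (mg : riemannian U g) (mh : riemannian V h)
  (cs : conformal_submersion U V g h pi xi lam) (sF : smooth_mx V F)
  (FhF : forall y, V y -> F y *m h y *m (F y)^T = 1%:M) (dF : forall y, V y -> 0 < \det (F y)).

Let E := lfr g F pi xi lam.
Let sE : smooth_mx U E := smooth_lfr oU mg cs sF FhF dF.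
Let uE x : U x -> E x \in unitmx. Proof. by move=> Ux; exact: (unit_lfr mg cs FhF dF Ux). Qed.
Let lp := csub_lam_pos cs.
Let sl := csub_lam_smooth cs.
Let l0 x : U x -> lam x != 0. Proof. by move=> Ux; rewrite gt_eqF // lp. Qed.
Let phi x := (lam x ^+ 2)^-1.
Let phi0 x : U x -> 0 < phi x. Proof. by move=> Ux; rewrite invr_gt0 exprn_gt0 // lp. Qed.
Let sphi : smooth U phi.
Proof. by apply: (smoothV oU) => [x Ux|]; [rewrite expf_neq0 ?l0 | exact: smoothX oU sl]. Qed.
Let EgE x : U x -> E x *m g x *m (E x)^T = (phi x)%:M. Proof. exact: (lfr_metric mg cs FhF dF). Qed.

(** In the lifted frame: the minimal Weyl derivative and [omega], both read
    off from the structure functions of the vertical leg, and minus the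
    derivative of [log lam].  See [minimal_frame] and [omega_frame]. *)
Definition minimal_co k x : R := fstr E q3 x q3 (w k).
Definition omega_co (k : 'I_3) x : R := match nat_of_ord k with
  | 0 => - fstr E q3 x q1 q2 | 1 => - fstr E q3 x q2 q0 | _ => - fstr E q3 x q0 q1 end.
Definition scale_co c x : R := - (fd E c lam x / lam x).

Lemma fwt_lfr a c x : U x -> fwt E a phi c x = fco E a c x + scale_co c x.
Proof.
move=> Ux; rewrite /fwt /fco /scale_co /fd mulr_suml -sumrN -big_split; apply: eq_bigr => i _ /=.
have dl : differentiable lam x by exact: smooth_diff sl Ux.
have -> : pd i phi x = - (phi x * phi x * (2 * lam x * pd i lam x)).
  have d2 : differentiable (fun z => lam z ^+ 2) x by exact: smooth_diff (smoothX 2 oU sl) Ux.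
  rewrite /phi (pdV i _ d2) ?expf_neq0 ?l0 //.
  have -> : (fun z => lam z ^+ 2) = (fun z => lam z * lam z) by apply/funext => z; rewrite expr2.
  by rewrite (pdM i dl dl) expr2; move: (lam x) (pd i lam x) => p q; congr (- (_ * _)); ring.
rewrite /phi; move: (lam x) (l0 Ux) (pd i lam x) (a x 0 i) (E x c i) => l ll p q e; by field.
Qed.

Lemma fco0 c x : fco E (fun=> 0) c x = 0.
Proof. by rewrite /fco big1 // => i _; rewrite mxE mul0r. Qed.

Let lc c x := fgam g E (fun=> 0) c x.

Lemma lfr_skew c x : U x -> lc c x + (lc c x)^T = (2 * scale_co c x)%:M.
Proof. by move=> Ux; rewrite /lc (fgam_skew (fun=> 0) oU mg sE uE sphi phi0 EgE c Ux) fwt_lfr // fco0 add0r. Qed.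

Lemma weyl_koszul a c i j x : U x -> i != j -> fgam g E a c x i j =
  2^-1 * (fstr E c x i j - fstr E i x j c - fstr E j x c i)
  + (fco E a i x + scale_co i x) * (c == j)%:R - (fco E a j x + scale_co j x) * (c == i)%:R.
Proof.
move=> Ux ij; have := koszul a oU mg sE uE sphi phi0 EgE c i j Ux.
by rewrite (negbTE ij) mulr0 subr0 !fwt_lfr.
Qed.

Lemma str_ww i c d x : U x -> fstr E (w i) x (w c) (w d) = fstr F i (pi x) c d.
Proof. by move=> Ux; have [-> _] := fstr_base oU oV mg cs sF FhF dF i Ux. Qed.
Lemma str_w3 i c x : U x -> fstr E (w i) x c q3 = 0.
Proof. by move=> Ux; have [_ [-> _]] := fstr_base oU oV mg cs sF FhF dF i Ux. Qed.
Lemma str_3w i c x : U x -> fstr E (w i) x q3 c = 0.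
Proof. by move=> Ux; have [_ [_ ->]] := fstr_base oU oV mg cs sF FhF dF i Ux. Qed.

Lemma uni_neq (c : 'I_3) : q3 != w c. Proof. by rewrite eq_sym w3. Qed.

Ltac gen_minimal := repeat match goal with |- context [minimal_co ?c ?x] => generalize (minimal_co c x); intro end.
Ltac gen_scale := repeat match goal with |- context [scale_co ?c ?x] => generalize (scale_co c x); intro end.

Lemma weyl_vert3 a k x : U x ->
  fgam g E a q3 x q3 (w k) = minimal_co k x - (fco E a (w k) x + scale_co (w k) x).
Proof.
move=> Ux; have := weyl_koszul a q3 Ux (uni_neq k); rewrite (negbTE (uni_neq k)) eqxx mulr0 mulr1.
move: (str_3w k q3 Ux) (fstr_anti E q3 x (w k) q3); rewrite /minimal_co; gen_entries; gen_fco; gen_scale; lra.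
Qed.

Lemma weyl_vertw a c k x : U x -> fgam g E a (w c) x q3 (w k) =
  2^-1 * fstr E q3 x (w c) (w k) + (fco E a q3 x + scale_co q3 x) * (c == k)%:R.
Proof.
move=> Ux; have := weyl_koszul a (w c) Ux (uni_neq k); rewrite w3 (inj_eq w_inj) mulr0.
move: (str_3w c (w k) Ux) (str_w3 k (w c) Ux) (fstr_anti E q3 x (w k) (w c)).
gen_entries; gen_fco; gen_scale; move: (c == k)%:R => *; lra.
Qed.

Section Minimal.
Variable a : 'rV[R]_4 -> 'rV[R]_4.
Hypothesis ma : minimal_weyl U g xi a.

(** [xi] is the vertical leg up to scale, so [D xi] is a row of the connection
    matrix; its vertical part and its trace are the two normalizations of the
    minimal Weyl derivative. *)
Lemma minimal_frame x : U x ->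
  (forall k, fco E a (w k) x + scale_co (w k) x = minimal_co k x) /\ fco E a q3 x + scale_co q3 x = 0.
Proof.
move=> Ux; have [_ /(_ _ Ux) [e1 e2]] := ma; move: e1 e2.
set D := covd_vec _ _ _ _ _ => e1 e2.
have xiE z : U z -> xi z = lam z *: row q3 (E z) by move=> Uz; exact: (xi_lfr mg cs FhF dF Uz).
pose M := E x *m D *m invmx (E x).
have ME c k : M c k = (fd E c lam x - fco E a c x * lam x) * (k == q3)%:R + lam x * fgam g E a c x q3 k.
  by rewrite /M (covd_vec_frame g a a oU sE uE (-1) sl xiE Ux) mxE mulN1r mulNr.
have M3 k : M q3 k = 0.
  have : row q3 M = 0.
    rewrite /M !row_mul; apply: (scalerI (l0 Ux)).
    by rewrite scaler0 [LHS]scalemxAl [lam x *: _]scalemxAl -(xiE _ Ux) e1 mul0mx.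
  by move/(congr1 (fun r : 'rV[R]_4 => r 0 k)); rewrite !mxE.
have trM : \tr M = 0.
  by rewrite /M mxtrace_mulC mulmxA mulVmx ?uE // mul1mx.
have wk k : fco E a (w k) x + scale_co (w k) x = minimal_co k x.
  have := M3 (w k); rewrite ME w3 mulr0 add0r (weyl_vert3 _ _ Ux) => /eqP.
  by rewrite mulf_eq0 (negbTE (l0 Ux)) /= subr_eq0 => /eqP.
split=> //; move: trM; rewrite /mxtrace sum4w M3 addr0.
have d c : M (w c) (w c) = lam x * (fco E a q3 x + scale_co q3 x).
  by rewrite ME w3 mulr0 add0r (weyl_vertw _ _ _ Ux) fstr_same mulr0 add0r eqxx mulr1.
rewrite (eq_bigr _ (fun c _ => d c)) sum3 => /eqP; rewrite -mulrDr -mulrDr mulf_eq0 (negbTE (l0 Ux)) /= => /eqP.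
by move: (fco _ _ _ _) (scale_co _ _) => *; lra.
Qed.

Lemma smooth_minimal_co k : smooth U (minimal_co k).
Proof.
have := smooth_mulmx oU (smooth_mulmx oU sE (smooth_d1 oU (smooth_cof oU sE uE q3))) (smooth_trmx sE).
by move=> /(_ q3 (w k)) H; refine (smooth_ext oU _ H) => z _; rewrite /minimal_co fstrU.
Qed.

(** [omega] is the dual of the curvature of the horizontal distribution; the
    part of [d^D xi] containing the vertical leg is annihilated. *)
Lemma omega_frame x : U x ->
  (forall k, fco E (omega g xi a) (w k) x = omega_co k x) /\ fco E (omega g xi a) q3 x = 0.
Proof.
move=> Ux; have [mk m3] := minimal_frame Ux.
have xiE : xi x = lam x *: row q3 (E x) by exact: (xi_lfr mg cs FhF dF Ux).
pose T := twisted_d 1 a (flat g xi) x.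
have TE c d : (E x *m T *m (E x)^T) c d = (lam x)^-1 *
    (fstr E q3 x c d + (fco E a c x + scale_co c x) * (d == q3)%:R - (c == q3)%:R * (fco E a d x + scale_co d x)).
  have sli : smooth U (fun z => (lam z)^-1) by exact: (smoothV oU l0 sl).
  have fE z : U z -> flat g xi z = (lam z)^-1 *: cof E q3 z.
    by move=> Uz; rewrite /E (cof_lfr3 _ _ _ _ _ Uz) scalerA mulVf ?l0 // scale1r.
  rewrite /T /twisted_d scale1r (d1_ext oU Ux fE) (d1_scale sli (smooth_cof oU sE uE q3) Ux) (fE _ Ux).
  have fl e : fd E e (fun z => (lam z)^-1) x = (lam x)^-1 * scale_co e x.
    rewrite /fd /scale_co /fd mulr_suml -sumrN mulr_sumr; apply: eq_bigr => i _.
    rewrite pdV ?l0 //; last exact: smooth_diff sl Ux.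
    by move: (lam x)^-1 (pd i lam x) (E x e i) => *; ring.
  rewrite (conj_add3 (E x)) !wedge_conj conj_scale -fstrU.
  rewrite -[_ *: cof E q3 x *m _]scalemxAl (cof_frame uE q3 Ux).
  have L1 : (wedge (grad (fun z => (lam z)^-1) x *m (E x)^T) (bvec q3)) c d =
      (lam x)^-1 * (scale_co c x * (d == q3)%:R - (c == q3)%:R * scale_co d x).
    by rewrite wedgeE -!fdE !fl /bvec ![delta_mx _ _ _ _]mxE /=; move: (_ == _)%:R (_ == _)%:R => *; ring.
  have L2 : wedge (a x *m (E x)^T) ((lam x)^-1 *: bvec q3) c d =
      (lam x)^-1 * (fco E a c x * (d == q3)%:R - (c == q3)%:R * fco E a d x).
    rewrite wedgeE -!fcoE ![(_ *: bvec q3) _ _]mxE /bvec ![delta_mx _ _ _ _]mxE /=.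
    by move: (_ == _)%:R (_ == _)%:R => *; ring.
  have L3 : ((lam x)^-1 *: fstr E q3 x) c d = (lam x)^-1 * fstr E q3 x c d by rewrite mxE.
  rewrite [LHS]mxE L2 [X in X + _]mxE L1 L3.
  by gen_entries; gen_fco; gen_scale; gen_deltas; move: (lam x)^-1 => *; ring.
have T3 k : (E x *m T *m (E x)^T) (w k) q3 = 0.
  by rewrite TE w3 eqxx mk fstr_anti /minimal_co; move: (fstr _ _ _ _ _) => *; rewrite mul0r subr0 mulr1 addNr mulr0.
have Tw c d : (E x *m T *m (E x)^T) (w c) (w d) = (lam x)^-1 * fstr E q3 x (w c) (w d).
  by rewrite TE !w3 mulr0 mul0r addr0 subr0.
have Tsk : (E x *m T *m (E x)^T)^T = - (E x *m T *m (E x)^T).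
  have -> : (E x *m T *m (E x)^T)^T = E x *m T^T *m (E x)^T by rewrite !trmx_mul trmxK mulmxA.
  rewrite /T /twisted_d scale1r [(_ + _)^T]linearD /= d1_anti.
  by rewrite wedge_anti -opprD mulmxN mulNmx.
have oE c : fco E (omega g xi a) c x = - (lam x * fstar (E x *m T *m (E x)^T) q3 c).
  rewrite -(star4_frame T (phi0 Ux) (det_lfr mg cs FhF dF Ux) (EgE Ux)) fcoE /omega xiE -/T.
  rewrite mulNmx mxE -scalemxAl -scalemxAl mxE -!row_mul; congr (- (_ * _)).
  by rewrite [LHS]mxE.
have [[e0 e1 e2] _] := fstarE Tsk.
have K (c d : 'I_3) : lam x * ((lam x)^-1 * fstr E q3 x (w c) (w d)) = fstr E q3 x (w c) (w d) by rewrite mulVKf ?l0.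
split; last first.
  by rewrite oE (_ : fstar _ q3 q3 = 0) ?mulr0 ?oppr0 //; have := skewP (fstar_skew (E x *m T *m (E x)^T)) q3 q3; move: (fstar _ _ _) => z; lra.
by apply: ord3P; rewrite oE /omega_co /= ?w0 ?w1 ?w2 ?e0 ?e1 ?e2 -?w0 -?w1 -?w2 Tw K.
Qed.

(** The minimal Weyl derivative in the gauge pulled back from the base. *)
Definition mform x : 'rV[R]_4 := a x - (lam x)^-1 *: grad lam x.

Lemma smooth_mform : smooth_mx U mform.
Proof.
apply: (smooth_addmx oU ma.1); apply: (smooth_oppmx oU); apply: (smooth_scalemx oU); last exact: smooth_grad.
exact: (smoothV oU l0 sl).
Qed.

Lemma mform_frame c x : fco E mform c x = fco E a c x + scale_co c x.
Proof.
rewrite /fco /scale_co /fd mulr_suml -sumrN -big_split; apply: eq_bigr => i _ /=.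
rewrite !mxE; move: (a x 0 i) (lam x)^-1 (pd i lam x) (E x c i) => *; ring.
Qed.

Lemma d1_mform x : U x -> d1 mform x = d1 a x.
Proof.
move=> Ux; have sli : smooth U (fun z => (lam z)^-1) by exact: (smoothV oU l0 sl).
rewrite (d1_sub oU ma.1 (smooth_scalemx oU sli (smooth_grad sl)) Ux) (d1_scale sli (smooth_grad sl) Ux).
rewrite (d1_grad oU sl Ux) scaler0 addr0 -[RHS]subr0; congr (_ - _).
apply/matrixP => i j; rewrite wedgeE !mxE !pdV ?l0 //; [|exact: smooth_diff sl Ux..].
move: (lam x)^-1 (pd i lam x) (pd j lam x) => *; ring.
Qed.

(** [d mform = F^0] and [d d = 0] for the vertical coframe leg relate the
    vertical derivatives of [minimal_co] and [omega_co] to the mixed and the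
    horizontal components of [F^0]; selfduality equates these. *)
Lemma quotient_invariant x : U x -> star4 g x (d1 a x) = d1 a x ->
  forall k, fd E q3 (fun z => minimal_co k z + omega_co k z) x = 0.
Proof.
move=> Ux SD.
have sm := smooth_mform.
have mk z k : U z -> fco E mform (w k) z = minimal_co k z by move=> Uz; rewrite mform_frame; have [-> _] := minimal_frame Uz.
have m3 z : U z -> fco E mform q3 z = 0 by move=> Uz; rewrite mform_frame; have [_ ->] := minimal_frame Uz.
have fm c k : fd E c (fco E mform (w k)) x = fd E c (minimal_co k) x by apply: (fd_ext E oU c Ux) => z Uz; exact: mk.
have f3 c : fd E c (fco E mform q3) x = 0.
  by rewrite -(fd_cst E c 0 x); apply: (fd_ext E oU c Ux) => z Uz; exact: m3.
have D3 k : f2co E mform q3 (w k) x = fd E q3 (minimal_co k) x.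
  rewrite /f2co (frame_d1 oU sE uE q3 (w k) sm Ux) fm f3 subr0 sum4w (m3 _ Ux) mul0r addr0 big1 ?addr0 // => i _.
  by rewrite (str_3w i (w k) Ux) mulr0.
have S3 c d : f2co E (cof E q3) c d x = fstr E q3 x c d by rewrite fstrU.
have fS c j k : fd E c (f2co E (cof E q3) j k) x = fd E c (fun z => fstr E q3 z j k) x.
  by apply: (fd_ext E oU c Ux) => z Uz; rewrite fstrU.
(* [d d = 0] for the vertical coframe leg. *)
have Dw j k : f2co E mform (w j) (w k) x = fd E q3 (fun z => fstr E q3 z (w j) (w k)) x.
  have L1 : f2co E mform (w j) (w k) x = fd E (w j) (minimal_co k) x - fd E (w k) (minimal_co j) x
      + \sum_c fco E mform (w c) x * fstr E (w c) x (w j) (w k).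
    by rewrite /f2co (frame_d1 oU sE uE (w j) (w k) sm Ux) !fm sum4w (m3 _ Ux) mul0r addr0.
  have := frame_d2 oU sE uE q3 (w j) (w k) (smooth_cof oU sE uE q3) Ux.
  rewrite L1 !sum4w !(S3 q3) !fS.
  have Z1 : \sum_c fstr E (w c) x q3 (w j) * f2co E (cof E q3) (w c) (w k) x = 0.
    by rewrite big1 // => i _; rewrite (str_3w i (w j) Ux) mul0r.
  have Z2 : \sum_c fstr E (w c) x (w k) q3 * f2co E (cof E q3) (w c) (w j) x = 0.
    by rewrite big1 // => i _; rewrite (str_w3 i (w k) Ux) mul0r.
  have Z3 : \sum_c fstr E (w c) x (w j) (w k) * f2co E (cof E q3) (w c) q3 x =
     - \sum_c fco E mform (w c) x * fstr E (w c) x (w j) (w k).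
    rewrite -sumrN; apply: eq_bigr => c _; have e1 := S3 (w c) q3; have e2 := mk x c Ux; have e3 := fstr_anti E q3 x (w c) q3.
    have A (s f q m m' : R) : f = q -> q = - m' -> m = m' -> s * f = - (m * s) by move=> -> -> ->; rewrite mulrN mulrC.
    exact: (A _ _ _ _ _ e1 e3 e2).
  have f1 : fd E (w j) (fun z => fstr E q3 z (w k) q3) x = - fd E (w j) (minimal_co k) x.
    by rewrite -(fdN E _ (smooth_minimal_co k) Ux); apply: (fd_ext E oU _ Ux) => z _; rewrite fstr_anti.
  rewrite Z1 Z2 Z3 f1; move: (fstr_same E q3 x q3) (fstr_anti E q3 x (w k) q3); rewrite -/(minimal_co j) -/(minimal_co k).
  by move: (\sum_c _) => s; gen_fd; gen_entries => *; nra.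
have Dsk : (E x *m d1 mform x *m (E x)^T)^T = - (E x *m d1 mform x *m (E x)^T).
  by rewrite !trmx_mul trmxK d1_anti mulNmx mulmxN mulmxA.
have sd : fstar (E x *m d1 mform x *m (E x)^T) = 1 *: (E x *m d1 mform x *m (E x)^T).
  by rewrite -(star4_frame _ (phi0 Ux) (det_lfr mg cs FhF dF Ux) (EgE Ux)) d1_mform // SD scale1r.
have [] := (fstar_eigen Dsk (or_introl erefl)).1 sd.
rewrite -w0 -w1 -w2 -!/(f2co _ _ _ _ _) !D3 !Dw !mul1r w0 w1 w2 => e0 e1 e2.
have smo : forall c d, smooth U (fun z => fstr E q3 z c d).
  move=> c d; have := smooth_mulmx oU (smooth_mulmx oU sE (smooth_d1 oU (smooth_cof oU sE uE q3))) (smooth_trmx sE).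
  by move=> /(_ c d) H; refine (smooth_ext oU _ H) => z _; rewrite fstrU.
apply: ord3P.
- have -> : (fun z => minimal_co t0 z + omega_co t0 z) = (fun z => minimal_co t0 z - fstr E q3 z q1 q2) by [].
  by rewrite (fdB E oU _ (smooth_minimal_co t0) (smo _ _) Ux) e0 subrr.
- have -> : (fun z => minimal_co t1 z + omega_co t1 z) = (fun z => minimal_co t1 z - fstr E q3 z q2 q0) by [].
  by rewrite (fdB E oU _ (smooth_minimal_co t1) (smo _ _) Ux) e1 subrr.
- have -> : (fun z => minimal_co t2 z + omega_co t2 z) = (fun z => minimal_co t2 z - fstr E q3 z q0 q1) by [].
  by rewrite (fdB E oU _ (smooth_minimal_co t2) (smo _ _) Ux) e2 subrr.
Qed.

End Minimal.

Lemma smooth_fstr3 c d : smooth U (fun z => fstr E q3 z c d).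
Proof.
have := smooth_mulmx oU (smooth_mulmx oU sE (smooth_d1 oU (smooth_cof oU sE uE q3))) (smooth_trmx sE).
by move=> /(_ c d) H; refine (smooth_ext oU _ H) => z _; rewrite fstrU.
Qed.

(** Half of [omega], corrected by [D^B] and by the change of gauge; these
    combinations are all that the Levi-Civita connection on antiselfdual
    endomorphisms retains of the submersion. *)
Definition defect_co (b : 'rV[R]_3 -> 'rV[R]_3) k x : R := omega_co k x / 2 + scale_co (w k) x - fco F b k (pi x).

Lemma lc_gamma3 x : U x -> forall k, asd_part (lc q3 x) k = minimal_co k x - scale_co (w k) x + omega_co k x / 2.
Proof.
move=> Ux.
have lv k := weyl_vert3 (fun=> 0) k Ux.
have lw (i j : 'I_3) : i != j -> lc q3 x (w i) (w j) = 2^-1 * fstr E q3 x (w i) (w j).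
  move=> ij; have := @weyl_koszul (fun=> 0) q3 (w i) (w j) x Ux; rewrite (inj_eq w_inj) => /(_ ij).
  rewrite !(negbTE (uni_neq _)) !mulr0 -/(lc q3 x).
  move: (str_w3 i (w j) Ux) (str_3w j (w i) Ux); gen_entries; lra.
have := lv t0; have := lv t1; have := lv t2; have := lw t1 t2 isT; have := lw t2 t0 isT; have := lw t0 t1 isT.
rewrite !fco0 !w0 !w1 !w2 -/(lc q3 x) => l1 l2 l3 l4 l5 l6.
apply: ord3P; rewrite /asd_part /omega_co /= ?w0 ?w1 ?w2 ?l1 ?l2 ?l3 ?l4 ?l5 ?l6; gen_entries; gen_scale; move: (minimal_co _ _) => *; lra.
Qed.


(** The structure functions of the base are those of a torsion-free Weyl
    connection [b], whichever it is; this allows the comparison with [D^B]. *)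
Lemma lc_gammaw (b : 'rV[R]_3 -> 'rV[R]_3) x (W := fun j p q => fgam h F b j (pi x) p q) : U x ->
  [/\ [/\ asd_part (lc q0 x) t0 = scale_co q3 x - W t0 t1 t2, asd_part (lc q0 x) t1 = - defect_co b t2 x - W t0 t2 t0 &
          asd_part (lc q0 x) t2 = defect_co b t1 x - W t0 t0 t1],
      [/\ asd_part (lc q1 x) t0 = defect_co b t2 x - W t1 t1 t2, asd_part (lc q1 x) t1 = scale_co q3 x - W t1 t2 t0 &
          asd_part (lc q1 x) t2 = - defect_co b t0 x - W t1 t0 t1] &
      [/\ asd_part (lc q2 x) t0 = - defect_co b t1 x - W t2 t1 t2, asd_part (lc q2 x) t1 = defect_co b t0 x - W t2 t2 t0 &
          asd_part (lc q2 x) t2 = scale_co q3 x - W t2 t0 t1]].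
Proof.
move=> Ux; have Vy := piV cs Ux.
have one_smooth : smooth V (fun=> 1 : R) by exact: smooth_cst.
have one_pos : forall y, V y -> (0 : R) < 1 by move=> y _; exact: ltr01.
have uF := unitF dF.
have FhF' : forall y, V y -> F y *m h y *m (F y)^T = ((fun=> 1) y)%:M by exact: FhF.
have sk c p q : W c q p = 2 * fco F b c (pi x) * (p == q)%:R - W c p q.
  have := congr1 (fun M : 'M[R]_3 => M p q) (fgam_skew b oV mh sF uF one_smooth one_pos FhF' c Vy).
  rewrite [LHS]mxE [X in _ + X = _]mxE [RHS]mxE base_wt -/(W c p q) -/(W c q p).
  by move: (W c p q) (W c q p) (fco F b c (pi x)) => u v f; case: (p == q) => /=; rewrite ?mulr1n ?mulr0n ?mulr1 ?mulr0; lra.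
have st e c d : fstr F e (pi x) c d = W d c e - W c d e by exact: (fstrE b oV mh sF uF e c d Vy).
have lw (c i j : 'I_3) : i != j -> lc (w c) x (w i) (w j) =
    2^-1 * ((W j i c - W i j c) - (W c j i - W j c i) - (W i c j - W c i j))
    + scale_co (w i) x * (c == j)%:R - scale_co (w j) x * (c == i)%:R.
  move=> ij; have := @weyl_koszul (fun=> 0) (w c) (w i) (w j) x Ux; rewrite !(inj_eq w_inj) => /(_ ij).
  rewrite !fco0 !add0r -/(lc (w c) x).
  move: (str_ww c i j Ux) (str_ww i j c Ux) (str_ww j c i Ux) (st c i j) (st i j c) (st j c i).
  by rewrite /W; gen_entries; gen_scale; gen_deltas => *; lra.
have lv c k := weyl_vertw (fun=> 0) c k Ux.
have lv' c k : lc (w c) x q3 (w k) = 2^-1 * fstr E q3 x (w c) (w k) + scale_co q3 x * (c == k)%:R.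
  by rewrite /lc lv fco0 add0r.
have o c d := fstr_anti E q3 x c d.
have := lv' t0 t0; have := lv' t0 t1; have := lv' t0 t2; have := lv' t1 t0; have := lv' t1 t1; have := lv' t1 t2.
have := lv' t2 t0; have := lv' t2 t1; have := lv' t2 t2.
have := lw t0 t1 t2 isT; have := lw t0 t2 t0 isT; have := lw t0 t0 t1 isT.
have := lw t1 t1 t2 isT; have := lw t1 t2 t0 isT; have := lw t1 t0 t1 isT.
have := lw t2 t1 t2 isT; have := lw t2 t2 t0 isT; have := lw t2 t0 t1 isT.
rewrite !fstr_same /= ?mulr0 ?mulr1 !w0 !w1 !w2.
move=> c1 c2 c3 c4 c5 c6 c7 c8 c9 d1' d2 d3 d4 d5 d6 d7 d8 d9.
rewrite /asd_part /defect_co /omega_co /= c1 c2 c3 c4 c5 c6 c7 c8 c9 d1' d2 d3 d4 d5 d6 d7 d8 d9 !w0 !w1 !w2.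
have W10 c : W c t1 t0 = - W c t0 t1 by rewrite (sk c t0 t1) mulr0 sub0r.
have W02 c : W c t0 t2 = - W c t2 t0 by rewrite (sk c t2 t0) mulr0 sub0r.
have W21 c : W c t2 t1 = - W c t1 t2 by rewrite (sk c t1 t2) mulr0 sub0r.
have Wd c p : W c p p = fco F b c (pi x) by have := sk c p p; rewrite eqxx mulr1; move: (W c p p) (fco _ _ _ _) => u v; lra.
rewrite !W10 !W02 !W21 !Wd (o q1 q0) (o q0 q2) (o q2 q1).
have gW : exists W', W = W' by exists W.
case: gW => W' ->.
gen_entries; gen_fco; gen_scale.
move: (W' t0 t1 t2) (W' t0 t2 t0) (W' t0 t0 t1) (W' t1 t1 t2) (W' t1 t2 t0) (W' t1 t0 t1) (W' t2 t1 t2) (W' t2 t2 t0) (W' t2 t0 t1) => *.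
by do ![split]; lra.
Qed.

(** An endomorphism is parallel when its frame matrix is, with the connection
    acting by commutators; by [asd_comm] this is a vector product. *)
Lemma parallel_frame J (c : 'I_3 -> 'rV[R]_4 -> R) x : smooth_mx U J -> (forall k, smooth U (c k)) ->
  (forall z, U z -> E z *m J z = asd (c t0 z) (c t1 z) (c t2 z) *m E z) -> U x ->
  (forall i, covd_end (levi_civita g) J i x = 0) <->
  (forall e, [/\ fd E e (c t0) x + (c t1 x * asd_part (lc e x) t2 - c t2 x * asd_part (lc e x) t1) = 0,
    fd E e (c t1) x + (c t2 x * asd_part (lc e x) t0 - c t0 x * asd_part (lc e x) t2) = 0 &
    fd E e (c t2) x + (c t0 x * asd_part (lc e x) t1 - c t1 x * asd_part (lc e x) t0) = 0]).
Proof.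
move=> sJ sc JE Ux.
pose Jh z := asd (c t0 z) (c t1 z) (c t2 z).
have sJh : smooth_mx U Jh.
  move=> i j; rewrite /Jh.
  by elim/ord4P: i; elim/ord4P: j; under eq_fun do rewrite mxE /=; first [exact: sc | exact: smooth_cst | exact: (smoothN oU (sc _))].
have cv i : E x *m covd_end (levi_civita g) J i x =
    (pdm i Jh x + Jh x *m fconn g E (fun=> 0) i x - fconn g E (fun=> 0) i x *m Jh x) *m E x.
  have D := pdm_ext i oU Ux JE; rewrite (pdm_mul i sE sJ Ux) (pdm_mul i sJh sE Ux) in D.
  have P := fconnE g (fun=> 0) uE i Ux.
  rewrite covd_endE mulmxBr mulmxDr.
  have -> : E x *m pdm i J x = pdm i Jh x *m E x + Jh x *m pdm i E x - pdm i E x *m J x by rewrite -D addrC addKr.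
  have e1 : E x *m (J x *m cmat (levi_civita g) i x) = Jh x *m (E x *m cmat (levi_civita g) i x) by rewrite !mulmxA JE.
  have e2 : E x *m (cmat (levi_civita g) i x *m J x) = fconn g E (fun=> 0) i x *m Jh x *m E x - pdm i E x *m J x.
    have JEx : Jh x *m E x = E x *m J x by rewrite JE.
    by rewrite -mulmxA JEx [fconn _ _ _ _ _ *m _]mulmxA -P mulmxDl addrAC subrr add0r !mulmxA.
  rewrite e1 e2 mulmxBl mulmxDl -[Jh x *m fconn _ _ _ _ _ *m _]mulmxA -P mulmxDr.
  move: (pdm i Jh x *m E x) (Jh x *m pdm i E x) (pdm i E x *m J x) (Jh x *m (E x *m _)) (_ *m Jh x *m E x) => A B C D' E'.
  by apply/matrixP => p q; rewrite !mxE; move: (A p q) (B p q) (C p q) (D' p q) (E' p q) => *; ring.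
pose K e := fdm E e Jh x + Jh x *m lc e x - lc e x *m Jh x.
have Ksum e : K e = \sum_i E x e i *: (pdm i Jh x + Jh x *m fconn g E (fun=> 0) i x - fconn g E (fun=> 0) i x *m Jh x).
  rewrite /K /fdm /lc fgamU mulmx_sumr mulmx_suml -big_split -sumrB; apply: eq_bigr => i _ /=.
  by rewrite -scalemxAr -scalemxAl -scalerDr -scalerBr.
have equ : (forall i, covd_end (levi_civita g) J i x = 0) <-> (forall e, K e = 0).
  split=> [H e|H i].
    rewrite Ksum big1 // => i _; have := cv i; rewrite H mulmx0 => /(congr1 (mulmxr (invmx (E x)))) /=.
    by rewrite mul0mx mulmxK ?uE // => <-; rewrite scaler0.
  have := mulVmx (uE Ux) => V1.
  have S j : \sum_e invmx (E x) i e * E x e j = (i == j)%:R.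
    by have := congr1 (fun M : 'M[R]_4 => M i j) V1; rewrite !mxE.
  have Z : pdm i Jh x + Jh x *m fconn g E (fun=> 0) i x - fconn g E (fun=> 0) i x *m Jh x = 0.
    pose X j := pdm j Jh x + Jh x *m fconn g E (fun=> 0) j x - fconn g E (fun=> 0) j x *m Jh x.
    rewrite -/(X i); transitivity (\sum_j (\sum_e invmx (E x) i e * E x e j) *: X j).
      rewrite (bigD1 i) //= S eqxx scale1r big1 ?addr0 // => j ji.
      by rewrite S eq_sym (negbTE ji) scale0r.
    transitivity (\sum_e invmx (E x) i e *: K e); last by rewrite big1 // => e _; rewrite H scaler0.
    rewrite [RHS](eq_bigr (fun e => \sum_j (invmx (E x) i e * E x e j) *: X j)) => [|e _].
      by rewrite exchange_big; apply: eq_bigr => j _; rewrite scaler_suml.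
    by rewrite Ksum scaler_sumr; apply: eq_bigr => j _; rewrite scalerA.
  by apply: (can_inj (mulKmx (uE Ux))); rewrite cv Z mul0mx mulmx0.
rewrite equ; split=> H e; have := H e; rewrite /K -addrA (asd_comm _ _ _ (lfr_skew e Ux)).
  move=> Z; have P k : fdm E e Jh x q3 k + asd (c t1 x * asd_part (lc e x) t2 - c t2 x * asd_part (lc e x) t1)
      (c t2 x * asd_part (lc e x) t0 - c t0 x * asd_part (lc e x) t2)
      (c t0 x * asd_part (lc e x) t1 - c t1 x * asd_part (lc e x) t0) q3 k = 0.
    by have := congr1 (fun M : 'M[R]_4 => M q3 k) Z; rewrite [LHS]mxE [RHS]mxE.
  have := P q0; have := P q1; have := P q2; rewrite !fdmE !mxE /=.
  have Q k z : Jh z q3 k = asd (c t0 z) (c t1 z) (c t2 z) q3 k by [].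
  have R0 : (fun z => Jh z q3 q0) = c t0 by apply/funext => z; rewrite /Jh mxE.
  have R1 : (fun z => Jh z q3 q1) = c t1 by apply/funext => z; rewrite /Jh mxE.
  have R2 : (fun z => Jh z q3 q2) = c t2 by apply/funext => z; rewrite /Jh mxE.
  by rewrite R0 R1 R2 => -> -> ->.
move=> [z0 z1 z2].
have fN f : smooth U f -> fd E e (fun z => - f z) x = - fd E e f x by move=> sf; exact: (fdN E e sf Ux).
apply/matrixP => p q; rewrite [LHS]mxE fdmE [RHS]mxE /Jh.
have -> : fd E e (fun z => asd (c t0 z) (c t1 z) (c t2 z) p q) x = asd (fd E e (c t0) x) (fd E e (c t1) x) (fd E e (c t2) x) p q.
  elim/ord4P: p; elim/ord4P: q; under eq_fun do rewrite mxE /=; rewrite [RHS]mxE /= ?fd_cst // ?fN //; exact: sc.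
move: z0 z1 z2; move: (fd _ _ _ _) (fd _ _ _ _) (fd _ _ _ _) (_ - _) (_ - _) (_ - _) => a0 a1 a2 d0 d1' d2 z0 z1 z2.
by elim/ord4P: p; elim/ord4P: q; rewrite !mxE /=; lra.
Qed.

(** In the frame [D^0 xi] is skew up to its trace, so only its antiselfdual
    part, proportional to [s], can fail to commute with [J]. *)
Lemma holomorphic_frame J a c0 c1 c2 x (s := fun k => asd_part (lc q3 x) k)
  (D := covd_vec (-1) a (levi_civita g) xi x) : minimal_weyl U g xi a ->
  E x *m J x = asd c0 c1 c2 *m E x -> U x ->
  J x *m D = D *m J x <->
  [/\ c1 * s t2 - c2 * s t1 = 0, c2 * s t0 - c0 * s t2 = 0 & c0 * s t1 - c1 * s t0 = 0].
Proof.
move=> ma JE Ux.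
have xiE z : U z -> xi z = lam z *: row q3 (E z) by move=> Uz; exact: (xi_lfr mg cs FhF dF Uz).
pose M := E x *m D *m invmx (E x).
have [mk m3] := minimal_frame ma Ux.
have ME e k : M e k = (fd E e lam x - fco E a e x * lam x) * (k == q3)%:R + lam x * lc e x q3 k.
  by rewrite /M (covd_vec_frame g a (fun=> 0) oU sE uE (-1) sl xiE Ux) mxE mulN1r mulNr.
have D1 e : lc e x q3 q3 = scale_co e x.
  have := congr1 (fun N : 'M[R]_4 => N q3 q3) (lfr_skew e Ux); rewrite [LHS]mxE [X in _ + X = _]mxE [RHS]mxE mulr1n.
  by move: (lc e x q3 q3) (scale_co e x) => *; lra.
have fl e : fd E e lam x = - (lam x * scale_co e x) by rewrite /scale_co mulrN opprK mulrC divfK ?l0.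
have M3 e : M e q3 = - (lam x * fco E a e x).
  by rewrite ME eqxx mulr1 D1 fl; move: (lam x) (scale_co _ _) (fco _ _ _ _) => *; ring.
have Mw e k : M e (w k) = lam x * lc e x q3 (w k) by rewrite ME w3 mulr0 add0r.
have lv3 k : lc q3 x q3 (w k) = minimal_co k x - scale_co (w k) x by rewrite /lc weyl_vert3 // fco0 add0r.
have lvw e k : lc (w e) x q3 (w k) = 2^-1 * fstr E q3 x (w e) (w k) + scale_co q3 x * (e == k)%:R.
  by rewrite /lc weyl_vertw // fco0 add0r.
have MS : M + M^T = (2 * (lam x * scale_co q3 x))%:M.
  apply/matrixP => p q; rewrite [LHS]mxE [X in _ + X]mxE [RHS]mxE.
  have m3' : fco E a q3 x = - scale_co q3 x by move: m3; move: (fco _ _ _ _) (scale_co _ _) => *; lra.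
  have mk' k : fco E a (w k) x = minimal_co k x - scale_co (w k) x by move: (mk k); move: (fco _ _ _ _) (scale_co _ _) => *; lra.
  move: p q; apply: ord4w => [p|]; apply: ord4w => [q|].
  - rewrite !Mw !lvw (inj_eq w_inj) (eq_sym q p) (fstr_anti E q3 x (w q) (w p)).
    by rewrite -[RHS]mulr_natr; move: (fstr _ _ _ _ _) (scale_co _ _) (lam x) (p == q)%:R => *; field.
  - by rewrite w3 mulr0n M3 Mw lv3 mk'; move: (lam x) (minimal_co _ _) (scale_co _ _) => *; ring.
  - by rewrite eq_sym w3 mulr0n M3 Mw lv3 mk'; move: (lam x) (minimal_co _ _) (scale_co _ _) => *; ring.
  - by rewrite eqxx mulr1n !M3 m3'; move: (lam x) (scale_co _ _) => *; ring.
have gM k : asd_part M k = lam x * s k.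
  have G k' : s k' = minimal_co k' x - scale_co (w k') x + omega_co k' x / 2 by exact: lc_gamma3.
  by rewrite G; elim/ord3P: k; rewrite /asd_part /omega_co /= -w0 -w1 -w2 !Mw lv3 !lvw /= mulr0 addr0; gen_minimal; gen_entries; gen_scale; move: (lam x) => *; field.
have e1 : J x *m D = D *m J x <-> asd c0 c1 c2 *m M - M *m asd c0 c1 c2 = 0.
  have K1 : asd c0 c1 c2 *m M = E x *m (J x *m D) *m invmx (E x) by rewrite /M !mulmxA JE.
  have K2 : M *m asd c0 c1 c2 = E x *m (D *m J x) *m invmx (E x).
    have -> : asd c0 c1 c2 = E x *m J x *m invmx (E x) by rewrite JE mulmxK ?uE.
    by rewrite /M !mulmxA mulmxKV ?uE.
  rewrite K1 K2; split=> [->|]; first by rewrite subrr.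
  move/eqP; rewrite subr_eq0 => /eqP /(congr1 (mulmxr (E x))) /=; rewrite !mulmxKV ?uE // => /(congr1 (mulmx (invmx (E x)))).
  by rewrite !mulKmx ?uE.
rewrite e1 (asd_comm _ _ _ MS) !gM.
have asd0 : asd 0 0 0 = 0 :> 'M[R]_4 by apply/matrixP; apply: ord4P => q; elim/ord4P: q; rewrite !mxE /= ?oppr0.
have L k k' p q : p * (lam x * k) - q * (lam x * k') = lam x * (p * k - q * k') by ring.
rewrite !L; split=> [|[-> -> ->]]; last by rewrite mulr0 asd0.
rewrite -asd0 => /asd_inj [] /eqP + /eqP + /eqP; rewrite !mulf_eq0 !(negbTE (l0 Ux)) /=.
by move=> /eqP ? /eqP ? /eqP ?.
Qed.

End TotalSpace.

Transparent w fstr fgam fconn lfr wedge d1.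

(** * Kaehler structures constant in the lifted frame *)

Lemma asd0 (R : realType) : asd 0 0 0 = 0 :> 'M[R]_4.
Proof. by apply/matrixP => i j; elim/ord4P: i; elim/ord4P: j; rewrite !mxE /= ?oppr0. Qed.

Lemma gam_asd_commP (R : realType) (G : 'M[R]_4) u : G + G^T = (2 * u)%:M ->
  asd 1 0 0 *m G = G *m asd 1 0 0 <-> asd_part G t1 = 0 /\ asd_part G t2 = 0.
Proof.
move=> H; have := asd_comm 1 0 0 H; rewrite !mul0r !mul1r !sub0r subr0 oppr0 => e.
split=> [c|[h1 h2]]; last first.
  by apply/eqP; rewrite -subr_eq0 e h1 h2 oppr0 asd0.
have : asd (0 : R) (- asd_part G t2) (asd_part G t1) = asd 0 0 0.
  by rewrite asd0 -e c subrr.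
by case/asd_inj => _ /eqP; rewrite oppr_eq0 => /eqP.
Qed.

Lemma commutator_skew (R : realType) n (G H : 'M[R]_n) u v : G + G^T = (2 * u)%:M -> H + H^T = (2 * v)%:M ->
  (H *m G - G *m H) + (H *m G - G *m H)^T = 0.
Proof.
move=> eG eH; have -> : (H *m G - G *m H)^T = (G^T *m H^T - H^T *m G^T) by rewrite linearB /= !trmx_mul.
have -> : G^T = (2 * u)%:M - G by rewrite -eG addrC addKr.
have -> : H^T = (2 * v)%:M - H by rewrite -eH addrC addKr.
rewrite !mulmxBl !mulmxBr -!scalar_mxM !mul_scalar_mx !mul_mx_scalar (mulrC (2 * u)).
move: (H *m G) (G *m H) (_ *: G) (_ *: H) (_%:M) => A B C D S.
by apply/matrixP => i j; rewrite !mxE; move: (A i j) (B i j) (C i j) (D i j) (S i j) => *; ring.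
Qed.

(** Conformal matrices with antiselfdual part along [J] form the commutant of
    [J]; the part along [J] is central, so brackets have no antiselfdual part.
    *)
Lemma gam_commutator (R : realType) (G H : 'M[R]_4) u v : G + G^T = (2 * u)%:M -> H + H^T = (2 * v)%:M ->
  asd_part G t1 = 0 /\ asd_part G t2 = 0 -> asd_part H t1 = 0 /\ asd_part H t2 = 0 ->
  forall k, asd_part (H *m G - G *m H) k = 0.
Proof.
move=> eG eH /(gam_asd_commP eG) cG /(gam_asd_commP eH) cH.
have eK : H *m G - G *m H + (H *m G - G *m H)^T = (2 * 0)%:M by rewrite (commutator_skew eG eH) mulr0 raddf0.
have cK : asd 1 0 0 *m (H *m G - G *m H) = (H *m G - G *m H) *m asd 1 0 0.
  by rewrite mulmxBr mulmxBl !mulmxA cH cG -!mulmxA cH cG.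
have [k1 k2] := (gam_asd_commP eK).1 cK.
apply: ord3P => //; have := asd_tr1 eK; rewrite mulmxBr linearB /= !mulmxA cH.
rewrite -(mulmxA H) [X in X - _]mxtrace_mulC -!mulmxA (mxtrace_mulC (asd 1 0 0)) -!mulmxA subrr.
by move: (asd_part _ _) => *; lra.
Qed.

(** The Kulkarni-Nomizu product, as a form-valued form. *)
Definition kn (R : realType) n (S G : 'M[R]_n) (i j : 'I_n) : 'M[R]_n :=
  \matrix_(k, l) (S j k * G i l + G j k * S i l - S i k * G j l - G i k * S j l).

Lemma kn_skew (R : realType) n (S G : 'M[R]_n) i j : (kn S G i j)^T = - kn S G i j.
Proof. by apply/matrixP => k l; rewrite !mxE; gen_entries; ring. Qed.

Lemma kn_scale (R : realType) n (S G : 'M[R]_n) c i j : kn S (c *: G) i j = c *: kn S G i j.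
Proof.
have K p q : (c *: G) p q = c * G p q by rewrite mxE.
by apply/matrixP => k l; rewrite [LHS]mxE [RHS]mxE [X in _ = _ * X]mxE !K; gen_entries; ring.
Qed.

Lemma kn_conj (R : realType) n (E S G : 'M[R]_n) a b :
  \sum_i \sum_j (E a i * E b j) *: (E *m kn S G i j *m E^T) = kn (E *m S *m E^T) (E *m G *m E^T) a b.
Proof.
apply/matrixP => c d.
have K (X : 'M[R]_n) p q : (E *m X *m E^T) p q = \sum_i E p i * (X *m E^T) i q by rewrite -mulmxA mxE.
have Et p q : E^T p q = E q p by rewrite mxE.
have C i j : (E *m kn S G i j *m E^T) c d = (S *m E^T) j c * (G *m E^T) i d + (G *m E^T) j c * (S *m E^T) i d
    - (S *m E^T) i c * (G *m E^T) j d - (G *m E^T) i c * (S *m E^T) j d.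
  have P (X Y : 'M[R]_n) : (X *m E^T) j c * (Y *m E^T) i d = \sum_l \sum_k E c k * (X j k * Y i l) * E d l.
    rewrite exchange_big /= [(X *m _) _ _]mxE mulr_suml; apply: eq_bigr => k _.
    rewrite [(Y *m _) _ _]mxE mulr_sumr; apply: eq_bigr => l _.
    by rewrite !Et (mulrC (X _ _)) -!mulrA.
  have P' (X Y : 'M[R]_n) : (X *m E^T) i c * (Y *m E^T) j d = \sum_l \sum_k E c k * (X i k * Y j l) * E d l.
    rewrite exchange_big /= [(X *m _) _ _]mxE mulr_suml; apply: eq_bigr => k _.
    rewrite [(Y *m _) _ _]mxE mulr_sumr; apply: eq_bigr => l _.
    by rewrite !Et (mulrC (X _ _)) -!mulrA.
  rewrite !P !P' -!big_split -!sumrB /= [LHS]mxE; apply: eq_bigr => l _.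
  rewrite -!big_split -!sumrB /= [(E *m _) _ _]mxE mulr_suml; apply: eq_bigr => k _.
  by rewrite [kn _ _ _ _ _ _]mxE !Et !(mulrBr, mulrDr) !(mulrBl, mulrDl).
rewrite [RHS]mxE !K summxE.
transitivity (\sum_i \sum_j E a i * E b j * ((S *m E^T) j c * (G *m E^T) i d + (G *m E^T) j c * (S *m E^T) i d
    - (S *m E^T) i c * (G *m E^T) j d - (G *m E^T) i c * (S *m E^T) j d)).
  by apply: eq_bigr => i _; rewrite summxE; apply: eq_bigr => j _; rewrite mxE C.
have Q (x y : 'I_n -> R) : (\sum_j E b j * x j) * (\sum_i E a i * y i) = \sum_i \sum_j E a i * E b j * (x j * y i).
  rewrite mulr_suml exchange_big /=; apply: eq_bigr => j _; rewrite mulr_sumr; apply: eq_bigr => i _.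
  by move: (x j) (y i); gen_entries; move=> *; ring.
have Q' (x y : 'I_n -> R) : (\sum_i E a i * x i) * (\sum_j E b j * y j) = \sum_i \sum_j E a i * E b j * (x i * y j).
  rewrite mulr_suml; apply: eq_bigr => j _; rewrite mulr_sumr; apply: eq_bigr => i _.
  by move: (x j) (y i); gen_entries; move=> *; ring.
rewrite !Q !Q' -!big_split -!sumrB /=; apply: eq_bigr => i _.
by rewrite -!big_split -!sumrB /=; apply: eq_bigr => j _; gen_entries; ring.
Qed.

(** The tracefree Ricci tensor of a Kaehler metric with selfdual Ricci form
    [N] accounts for all of the curvature [N] of the bundle of antiselfdual
    forms. *)
Lemma kn_gam (R : realType) (N : 'M[R]_4) a b : N^T = - N -> (forall k, asd_part N k = 0) ->
  [/\ asd_part (kn (2^-1 *: - (asd 1 0 0 *m N)) 1%:M a b) t0 = - N a b,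
      asd_part (kn (2^-1 *: - (asd 1 0 0 *m N)) 1%:M a b) t1 = 0 &
      asd_part (kn (2^-1 *: - (asd 1 0 0 *m N)) 1%:M a b) t2 = 0].
Proof.
move=> skN gN.
have -> : N = \matrix_(i, j) match nat_of_ord i, nat_of_ord j with
  | 3, 0 => N q3 q0 | 3, 1 => N q3 q1 | 3, 2 => N q3 q2
  | 0, 3 => - N q3 q0 | 1, 3 => - N q3 q1 | 2, 3 => - N q3 q2
  | 1, 2 => N q3 q0 | 2, 0 => N q3 q1 | 0, 1 => N q3 q2
  | 2, 1 => - N q3 q0 | 0, 2 => - N q3 q1 | 1, 0 => - N q3 q2
  | _, _ => 0 end.
  have e0 := gN t0; have e1 := gN t1; have e2 := gN t2; move: e0 e1 e2; rewrite /asd_part /= => e0 e1 e2.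
  apply: skew_ext => //; rewrite ?mxE //=.
  - by apply/matrixP => i j; elim/ord4P: i; elim/ord4P: j; rewrite !mxE /= ?opprK ?oppr0.
  - by move: e0; gen_entries; lra.
  - by move: e1; gen_entries; lra.
  - by move: e2; gen_entries; lra.
move: (N q3 q0) (N q3 q1) (N q3 q2) => n0 n1 n2.
set M := \matrix_(i, j) _.
have -> : 2^-1 *: - (asd 1 0 0 *m M) = \matrix_(i, j) (2^-1 * match nat_of_ord i, nat_of_ord j with
  | 0, 0 => n0 | 0, 1 => n1 | 0, 2 => n2 | 1, 0 => n1 | 1, 1 => - n0 | 1, 3 => - n2
  | 2, 0 => n2 | 2, 2 => - n0 | 2, 3 => n1 | 3, 1 => - n2 | 3, 2 => n1 | 3, 3 => n0 | _, _ => 0 end).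
  apply/matrixP => i j; rewrite [LHS]mxE [RHS]mxE; congr (_ * _); rewrite [LHS]mxE [X in - X]mxE sum4 /M.
  elim/ord4P: i; elim/ord4P: j; rewrite !mxE /=; ring.
by rewrite /M /asd_part /=; elim/ord4P: a; elim/ord4P: b; split; rewrite !mxE /= ?mulr1n ?mulr0n; field.
Qed.

Ltac gen_gam := repeat match goal with |- context [asd_part ?G ?k] => generalize (asd_part G k); intro end.

Ltac gen_tot := repeat match goal with
  | |- context [minimal_co ?g ?F ?p ?xi ?l ?k ?x] => generalize (minimal_co g F p xi l k x); intro
  | |- context [omega_co ?g ?F ?p ?xi ?l ?k ?x] => generalize (omega_co g F p xi l k x); intro
  | |- context [scale_co ?g ?F ?p ?xi ?l ?k ?x] => generalize (scale_co g F p xi l k x); intro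
  | |- context [defect_co ?g ?F ?p ?xi ?l ?b ?k ?x] => generalize (defect_co g F p xi l b k x); intro
  end.

Section Adapted.
Context {R : realType}.
Variables (U : set 'rV[R]_4) (V : set 'rV[R]_3) (g : 'rV[R]_4 -> 'M[R]_4)
  (h F : 'rV[R]_3 -> 'M[R]_3) (pi : 'rV[R]_4 -> 'rV[R]_3) (xi : 'rV[R]_4 -> 'rV[R]_4)
  (lam : 'rV[R]_4 -> R).
Hypotheses (oU : open U) (oV : open V) (mg : riemannian U g) (mh : riemannian V h)
  (cs : conformal_submersion U V g h pi xi lam) (sF : smooth_mx V F)
  (FhF : forall y, V y -> F y *m h y *m (F y)^T = 1%:M) (dF : forall y, V y -> 0 < \det (F y)).

Let E := lfr g F pi xi lam.
Let sE : smooth_mx U E := smooth_lfr oU mg cs sF FhF dF.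
Let uE x : U x -> E x \in unitmx. Proof. by move=> Ux; exact: (unit_lfr mg cs FhF dF Ux). Qed.
Let lp := csub_lam_pos cs.
Let l0 x : U x -> lam x != 0. Proof. by move=> Ux; rewrite gt_eqF // lp. Qed.
Let EgE x : U x -> E x *m g x *m (E x)^T = ((lam x ^+ 2)^-1)%:M. Proof. exact: (lfr_metric mg cs FhF dF). Qed.
Let lc c x := fgam g E (fun=> 0) c x.
Let mv := minimal_co g F pi xi lam.
Let ov := omega_co g F pi xi lam.
Let uv := scale_co g F pi xi lam.
Let vv := defect_co g F pi xi lam.

Variable J : 'rV[R]_4 -> 'M[R]_4.
Hypotheses (sJ : smooth_mx U J) (JE : forall z, U z -> E z *m J z = asd 1 0 0 *m E z).

(** A constant [J] is parallel when the connection has antiselfdual part along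
    [J] only. *)
Lemma adapted_kahlerP x : U x ->
  (forall i, covd_end (levi_civita g) J i x = 0) <->
  (forall e, asd_part (lc e x) t1 = 0 /\ asd_part (lc e x) t2 = 0).
Proof.
move=> Ux; pose c (k : 'I_3) (z : 'rV[R]_4) : R := (k == t0)%:R.
have sc k : smooth U (c k) by exact: smooth_cst.
have cJ z : U z -> E z *m J z = asd (c t0 z) (c t1 z) (c t2 z) *m E z by exact: JE.
rewrite (parallel_frame oU mg cs sF FhF dF sJ sc cJ Ux) -/E.
have z k e : fd E e (c k) x = 0 by exact: fd_cst.
split=> H e.
  by have [h0 h1 h2] := H e; move: h0 h1 h2; rewrite !z /c /lc /=; gen_gam => *; split; lra.
by have [h1 h2] := H e; rewrite /lc in h1 h2; rewrite !z /c /= h1 h2; gen_gam => *; split; lra.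
Qed.

Lemma adapted_square z : U z -> J z *m J z = - 1%:M.
Proof.
move=> Uz; apply: (can_inj (mulKmx (uE Uz))); rewrite mulmxA JE // -mulmxA JE // mulmxA asd_sq.
by rewrite expr1n !expr0n !addr0 mulmxN mulmx1 mul_scalar_mx scaleN1r.
Qed.

Variables (b chi : 'rV[R]_3 -> 'rV[R]_3) (tau kap : 'rV[R]_3 -> R).
Hypotheses (sb : smooth_mx V b) (st : smooth V tau) (sk : smooth V kap)
  (Fchi : forall y, V y -> row t0 (F y) = chi y).

(** The equation of a shear-free geodesic congruence, in a frame with first
    leg [chi]. *)
Definition sfg_at y := [/\ fgam h F b t0 y t0 t1 = 0, fgam h F b t0 y t0 t2 = 0,
    fgam h F b t1 y t0 t1 = tau y & fgam h F b t1 y t0 t2 = kap y] /\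
  fgam h F b t2 y t0 t1 = - kap y /\ fgam h F b t2 y t0 t2 = tau y.

(** The Kaehler condition on the submersion itself: its defect from [D^B] is
    [- tau chi], and [lam^-1] decreases along the fibres at the rate of the
    twist. *)
Definition adapted_at x := [/\ vv b t0 x = - tau (pi x), vv b t1 x = 0, vv b t2 x = 0 & uv q3 x = - kap (pi x)].

Lemma base_lower c y : V y -> fgam h F b c y t2 t0 = - fgam h F b c y t0 t2.
Proof. by move=> Vy; have [_ -> _] := base_off b oV mh sF FhF dF c Vy. Qed.

(** Both the components of the connection in horizontal directions and those
    of the congruence are substituted; the eight equations [asd_part = 0] for
    [t1], [t2] collapse to the six on the right. *)
Lemma adapted_of_sfg x : U x -> sfg_at (pi x) ->
  (forall e, asd_part (lc e x) t1 = 0 /\ asd_part (lc e x) t2 = 0) <->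
  adapted_at x /\ [/\ mv t1 x - uv q1 x + ov t1 x / 2 = 0 & mv t2 x - uv q2 x + ov t2 x / 2 = 0].
Proof.
move=> Ux [[s1 s2 s3 s4] [s5 s6]]; have Vy := piV cs Ux.
have [[_ a2 a3] [_ b2 b3] [_ c2 c3]] := lc_gammaw oU oV mg mh cs sF FhF dF b Ux.
have g3 := lc_gamma3 oU oV mg cs sF FhF dF Ux.
have g31 := g3 t1; have g32 := g3 t2.
move: a2 a3 b2 b3 c2 c3 g31 g32; cbv beta.
rewrite w1 w2 !(base_lower _ Vy) s1 s2 s3 s4 s5 s6 => a2 a3 b2 b3 c2 c3 g31 g32.
rewrite /adapted_at /mv /uv /ov /vv; split=> [H|[[e1 e2 e3 e4] [e5 e6]]].
  have [h1 h2] := H q0; have [h3 h4] := H q1; have [h5 h6] := H q2; have [h7 h8] := H q3.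
  rewrite /lc in h1 h2 h3 h4 h5 h6 h7 h8.
  move: a2 a3 b2 b3 c2 c3 g31 g32; rewrite h1 h2 h3 h4 h5 h6 h7 h8.
  gen_tot; move: (tau _) (kap _) => *; do ![split]; lra.
rewrite /lc; apply: ord4P; rewrite ?a2 ?a3 ?b2 ?b3 ?c2 ?c3 ?g31 ?g32 ?e1 ?e2 ?e3 ?e4 ?e5 ?e6; split; lra.
Qed.

Section Curvature.
Hypotheses (SFG : forall y, V y -> sfg_at y)
  (MB : forall x k, U x -> mv k x + ov k x = fco F b k (pi x))
  (KG : forall x, U x -> forall e, asd_part (lc e x) t1 = 0 /\ asd_part (lc e x) t2 = 0).

Let s00 : smooth_mx U (fun=> 0 : 'rV[R]_4). Proof. exact: smooth_cstmx. Qed.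

(** The connection form induced on the canonical bundle, in the trivialization
    given by the frame. *)
Definition nu x : 'rV[R]_4 := \row_i - asd_part (fconn g E (fun=> 0) i x) t0.

Lemma smooth_nu : smooth_mx U nu.
Proof.
move=> i j; under eq_fun do rewrite mxE /asd_part /=.
have sc := smooth_fconn oU mg s00 sE uE j.
exact: (smoothN oU (smoothB oU (sc q3 q0) (sc q1 q2))).
Qed.

Lemma nu_gam e x : fco E nu e x = - asd_part (lc e x) t0.
Proof.
rewrite /asd_part /= /lc fgamU !summxE -sumrB -sumrN; apply: eq_bigr => i _.
rewrite [nu x 0 i]mxE /asd_part /= [X in _ = - (X - _)]mxE [X in _ = - (_ - X)]mxE.
move: (fconn _ _ _ _ _ _ _) (fconn _ _ _ _ _ q1 q2) (E x e i) => *; ring.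
Qed.

(** The vertical component is the divergence and the horizontal ones come from
    the base; this makes [d nu] computable. *)
Lemma nu_frame x : U x -> (forall c, fco E nu (w c) x = nrot h F b c (pi x) + kap (pi x) * (c == t0)%:R) /\
  fco E nu q3 x = - tau (pi x).
Proof.
move=> Ux; have [[e1 e2 e3 e4] _] := (adapted_of_sfg Ux (SFG (piV cs Ux))).1 (KG Ux).
have [[a1 _ _] [b1 _ _] [c1 _ _]] := lc_gammaw oU oV mg mh cs sF FhF dF b Ux.
have g3 := lc_gamma3 oU oV mg cs sF FhF dF Ux t0.
move: a1 b1 c1 g3 (MB t0 Ux) e1 e2 e3 e4; cbv beta; rewrite /mv /uv /ov /vv /nrot => a1 b1 c1 g3 m e1 e2 e3 e4.
split; last first.
  rewrite nu_gam /lc g3; move: e1 m; rewrite /defect_co; gen_tot; gen_fco; move: (tau _) => *; lra.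
apply: ord3P; rewrite ?w0 ?w1 ?w2 nu_gam /lc ?a1 ?b1 ?c1 ?e2 ?e3 ?e4 /=; move: (kap _) (fgam _ _ _ _ _ _ _) => *; lra.
Qed.

(** The mixed components are those of the derivative of [tau] for the minimal
    Weyl derivative. *)
Lemma d_nu x : U x ->
  (forall i, f2co E nu q3 (w i) x = fd F i tau (pi x) - tau (pi x) * mv i x) /\
  (forall j k, f2co E nu (w j) (w k) x = dnu h F b kap j k (pi x) - tau (pi x) * fstr E q3 x (w j) (w k)).
Proof.
move=> Ux; have Vy := piV cs Ux; have sn := smooth_nu.
have srot c : smooth V (nrot h F b c) by exact: (smooth_fgam oV mh sb sF (unitF dF)).
have skd c : smooth V (fun y => kap y * (c == t0)%:R).
  by apply: (smoothM oV sk); exact: smooth_cst.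
have fw e c : fd E e (fco E nu (w c)) x = fd E e (fun z => (fun y => nrot h F b c y + kap y * (c == t0)%:R) (pi z)) x.
  by apply: (fd_ext E oU e Ux) => z Uz; have [-> _] := nu_frame Uz.
have f3 e : fd E e (fco E nu q3) x = - fd E e (fun z => tau (pi z)) x.
  rewrite -(fdN E e (smooth_chain oU (piV cs) (csub_smooth cs) st) Ux).
  by apply: (fd_ext E oU e Ux) => z Uz; have [_ ->] := nu_frame Uz.
have [n1 n3] := nu_frame Ux.
have [pt pt3] := fd_pull mg cs FhF dF st Ux.
have pk c := fd_pull mg cs FhF dF (smoothD oV (srot c) (skd c)) Ux.
split=> [i|j k]; rewrite /f2co (frame_d1 oU sE uE _ _ sn Ux).
  rewrite fw f3 sum4w big1 => [|c _]; last by rewrite (str_3w oU oV mg cs sF FhF dF c (w i) Ux) mulr0.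
  rewrite (pk i).2 pt n3 add0r /mv /minimal_co -/E; move: (fstr _ _ _ _ _) (fd _ _ _ _) (tau _) => *; ring.
rewrite !fw sum4w n3 !(pk _).1 !(fdD F _ (srot _) (skd _) Vy).
have -> : \sum_c fco E nu (w c) x * fstr E (w c) x (w j) (w k) =
    \sum_c nrot h F b c (pi x) * fstr F c (pi x) j k + kap (pi x) * fstr F t0 (pi x) j k.
  have sw c := str_ww oU oV mg cs sF FhF dF c j k Ux.
  have A (a0 a1 a2 s0 s1 s2 r0 r1 r2 l f0 f1 f2 : R) : a0 = r0 + l * (t0 == t0)%:R -> a1 = r1 + l * (t1 == t0)%:R ->
      a2 = r2 + l * (t2 == t0)%:R -> s0 = f0 -> s1 = f1 -> s2 = f2 ->
      a0 * s0 + a1 * s1 + a2 * s2 = (r0 * f0 + r1 * f1 + r2 * f2) + l * f0.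
    by rewrite eqxx /= => -> -> -> -> -> ->; ring.
  apply: etrans (sum3 _) (etrans (A _ _ _ _ _ _ _ _ _ _ _ _ _ (n1 t0) (n1 t1) (n1 t2) (sw t0) (sw t1) (sw t2)) _).
  by congr (_ + _); exact: esym (sum3 _).
rewrite /dnu /drot; move: (\sum_c _) (tau _) (kap _) (fstr _ _ _ _ _) (fstr _ _ _ _ _); gen_fd => *; ring.
Qed.

(** The obstruction to selfduality of the Ricci form is the obstruction to the
    Einstein-Weyl equation. *)
Lemma d_nu_asd x (N := E x *m d1 nu x *m (E x)^T) : U x ->
  [/\ asd_part N t0 = weyl_d F b tau t0 (pi x) - dnu h F b kap t1 t2 (pi x),
      asd_part N t1 = weyl_d F b tau t1 (pi x) - dnu h F b kap t2 t0 (pi x) &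
      asd_part N t2 = weyl_d F b tau t2 (pi x) - dnu h F b kap t0 t1 (pi x)].
Proof.
move=> Ux; have [d3 dw] := d_nu Ux.
have K c d : N c d = f2co E nu c d x by [].
rewrite /asd_part /= !K -w0 -w1 -w2 !d3 !dw /weyl_d -!MB // /ov /omega_co /= !w0 !w1 !w2.
move: (fstr _ _ _ _ _) (fstr _ _ _ q2 q0) (fstr _ _ _ q0 q1) (mv _ _) (mv t1 _) (mv t2 _) (tau _) (dnu _ _ _ _ _ _ _) (dnu _ _ _ _ t2 t0 _) (dnu _ _ _ _ t0 t1 _); gen_fd => *; split; ring.
Qed.

Lemma adapted_orth x : U x -> J x *m g x *m (J x)^T = g x.
Proof.
move=> Ux; have uT : (E x)^T \in unitmx by rewrite unitmx_tr uE.
apply: (can_inj (mulKmx (uE Ux))); apply: (can_inj (mulmxK uT)).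
have -> : E x *m (J x *m g x *m (J x)^T) *m (E x)^T = (E x *m J x) *m g x *m (E x *m J x)^T.
  by rewrite trmx_mul !mulmxA.
rewrite JE // trmx_mul asd_tr mulmxN mulmxN !mulmxA -(mulmxA _ (E x)) -(mulmxA _ _ (E x)^T) EgE //.
rewrite mul_mx_scalar -scalemxAl asd_sq expr1n !expr0n !addr0 scale_scalar_mx mulrN1 raddfN opprK.
by [].
Qed.

Lemma adapted_kahler : kahler U g J.
Proof.
split=> // [x Ux|x Ux|x Ux]; [exact: adapted_square | exact: adapted_orth |].
exact: (adapted_kahlerP Ux).2 (KG Ux).
Qed.

Let Rf c d x := fcurv g E (fun=> 0) c d x.

Lemma curv_skew c d x : U x -> Rf c d x + (Rf c d x)^T = 0.
Proof.
move=> Ux; pose S := \sum_i \sum_j (E x c i * E x d j) *: curv (cmat (levi_civita g)) i j x.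
have SS : S *m g x = - (S *m g x)^T.
  have -> : (S *m g x)^T = \sum_i \sum_j (E x c i * E x d j) *: (curv (cmat (levi_civita g)) i j x *m g x)^T.
    rewrite mulmx_suml linear_sum; apply: eq_bigr => i _; rewrite mulmx_suml linear_sum; apply: eq_bigr => j _.
    by rewrite -scalemxAl linearZ.
  rewrite mulmx_suml -sumrN; apply: eq_bigr => i _; rewrite mulmx_suml -sumrN; apply: eq_bigr => j _.
  by rewrite -scalemxAl -scalerN -(lc_skew oU mg i j Ux).
have p0 : (lam x ^+ 2)^-1 != 0 by rewrite invr_eq0 expf_neq0 // l0.
have RS : (lam x ^+ 2)^-1 *: Rf c d x = E x *m (S *m g x) *m (E x)^T.
  rewrite -mul_mx_scalar -EgE // /Rf (fcurv_conj oU mg s00 sE uE c d Ux) -/(levi_civita g) -/S !mulmxA mulmxKV ?uE //.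
apply: (scalerI p0); rewrite scaler0 scalerDr -[X in _ + X]linearZ /= RS; move: (S *m g x) SS => X SX.
by rewrite !trmx_mul trmxK {1}SX mulmxN mulNmx mulmxA addNr.
Qed.

(** The second structure equation; by [gam_commutator] the quadratic terms do
    not contribute. *)
Lemma curv_gam c d x : U x ->
  [/\ asd_part (Rf c d x) t0 = - f2co E nu c d x, asd_part (Rf c d x) t1 = 0 & asd_part (Rf c d x) t2 = 0].
Proof.
move=> Ux.
have sg e i j : smooth U (fun z => lc e z i j) by exact: (smooth_fgam oU mg s00 sE uE).
have sgam e k : smooth U (fun z => asd_part (lc e z) k) by elim/ord3P: k; exact: (smoothB oU (sg _ _ _) (sg _ _ _)).
have K k : asd_part (Rf c d x) k = fd E c (fun z => asd_part (lc d z) k) x - fd E d (fun z => asd_part (lc c z) k) x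
    + \sum_e asd_part (lc e x) k * fstr E e x c d + asd_part (lc d x *m lc c x - lc c x *m lc d x) k.
  have FE p q := fcurvE oU mg s00 sE uE c d p q Ux.
  have K2 p q p' q' : Rf c d x p q - Rf c d x p' q' =
      fd E c (fun z => lc d z p q - lc d z p' q') x - fd E d (fun z => lc c z p q - lc c z p' q') x
      + \sum_e (lc e x p q - lc e x p' q') * fstr E e x c d
      + ((lc d x *m lc c x - lc c x *m lc d x) p q - (lc d x *m lc c x - lc c x *m lc d x) p' q').
    rewrite /Rf !FE (fdB E oU c (sg d p q) (sg d p' q') Ux) (fdB E oU d (sg c p q) (sg c p' q') Ux) -/(lc c x) -/(lc d x).
    have -> : \sum_e (lc e x p q - lc e x p' q') * fstr E e x c d =
        \sum_e fgam g E (fun=> 0) e x p q * fstr E e x c d - \sum_e fgam g E (fun=> 0) e x p' q' * fstr E e x c d.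
      by rewrite -sumrB; apply: eq_bigr => e _; rewrite mulrBl.
    move: (\sum_e _) (\sum_e _) (_ *m _ - _ *m _) => a1 a2 M.
    by rewrite /lc; gen_fd; gen_entries; ring.
  elim/ord3P: k; exact: K2.
have sk4 e : lc e x + (lc e x)^T = (2 * uv e x)%:M by exact: (lfr_skew oU mg cs sF FhF dF e Ux).
have C := gam_commutator (sk4 c) (sk4 d) (KG Ux c) (KG Ux d).
have Z k : k != t0 -> forall z, U z -> forall e, asd_part (lc e z) k = 0.
  by elim/ord3P: k => // _ z Uz e; have [] := KG Uz e.
have Zk k : k != t0 -> asd_part (Rf c d x) k = 0.
  move=> k0; rewrite K C addr0 big1 ?addr0 => [|e _]; last by rewrite Z // mul0r.
  have z e e' : fd E e (fun z => asd_part (lc e' z) k) x = 0.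
    by rewrite -(fd_cst E e 0 x); apply: (fd_ext E oU e Ux) => z Uz; exact: Z.
  by rewrite !z subrr.
split; [|exact: Zk|exact: Zk].
rewrite K C addr0 /f2co (frame_d1 oU sE uE c d smooth_nu Ux).
have fn e e' : fd E e (fco E nu e') x = - fd E e (fun z => asd_part (lc e' z) t0) x.
  by rewrite -(fdN E e (sgam e' t0) Ux); apply: (fd_ext E oU e Ux) => z _; exact: nu_gam.
rewrite !fn; have -> : \sum_e fco E nu e x * fstr E e x c d = - \sum_e asd_part (lc e x) t0 * fstr E e x c d.
  by rewrite -sumrN; apply: eq_bigr => e _; rewrite nu_gam mulNr.
move: (\sum_e _); gen_fd => *; ring.
Qed.

(** The Ricci form is half the curvature of the canonical bundle. *)
Lemma ricci_nu x : U x ->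
  E x *m ricci (levi_civita g) x *m (E x)^T = - (asd 1 0 0 *m (E x *m d1 nu x *m (E x)^T)).
Proof.
move=> Ux; set N := E x *m d1 nu x *m (E x)^T; set T := E x *m ricci _ x *m (E x)^T.
suff -> : N = asd 1 0 0 *m T.
  by rewrite mulmxA asd_sq expr1n !expr0n !addr0 mul_scalar_mx scaleN1r opprK.
apply/matrixP => c d.
pose S := \sum_i \sum_j (E x c i * E x d j) *: curv (cmat (levi_civita g)) i j x.
have e1 : \tr (asd 1 0 0 *m Rf c d x) = 2 * N c d.
  have sk0 : Rf c d x + (Rf c d x)^T = (2 * 0)%:M by rewrite curv_skew // mulr0 raddf0.
  by rewrite (asd_tr1 sk0); have [-> _ _] := curv_gam c d Ux; rewrite /N -/(f2co E nu c d x); move: (f2co _ _ _ _ _) => *; ring.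
have e2 : \tr (asd 1 0 0 *m Rf c d x) = \tr (J x *m S).
  rewrite /Rf (fcurv_conj oU mg s00 sE uE c d Ux) -/(levi_civita g) -/S !mulmxA -JE // mxtrace_mulC !mulmxA mulVmx ?uE // mul1mx.
  by [].
have e3 : \tr (J x *m S) = 2 * (asd 1 0 0 *m T) c d.
  have -> : asd 1 0 0 *m T = E x *m (J x *m ricci (levi_civita g) x) *m (E x)^T.
    by rewrite /T !mulmxA -JE.
  rewrite mulmx_sumr raddf_sum /= [X in _ = _ * X]mxE mulr_sumr.
  under [RHS]eq_bigr do rewrite [(_ *m (_ *m _)) _ _]mxE mulr_suml mulr_sumr.
  rewrite [RHS]exchange_big /=; apply: eq_bigr => i _; rewrite mulmx_sumr raddf_sum /=; apply: eq_bigr => j _.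
  rewrite -scalemxAr mxtraceZ (kahler_ricci_form oU mg adapted_kahler i j Ux) [(E x)^T _ _]mxE.
  by move: ((J x *m _) i j) (E x c i) (E x d j) => *; ring.
by move: e1; rewrite e2 e3; move: (N c d) ((asd 1 0 0 *m T) c d) => *; lra.
Qed.

Let N x := E x *m d1 nu x *m (E x)^T.

Lemma nu_form_skew x : (N x)^T = - N x.
Proof. by rewrite /N !trmx_mul trmxK d1_anti mulNmx mulmxN mulmxA. Qed.

Let N_skew x : N x + (N x)^T = (2 * 0)%:M.
Proof. by rewrite nu_form_skew subrr mulr0 raddf0. Qed.

(** The Ricci tensor is symmetric, so its form commutes with [J]. *)
Lemma nu_form_asd x : U x -> asd_part (N x) t1 = 0 /\ asd_part (N x) t2 = 0.
Proof.
move=> Ux; apply: (gam_asd_commP (N_skew x)).1.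
have : (E x *m ricci (levi_civita g) x *m (E x)^T)^T = E x *m ricci (levi_civita g) x *m (E x)^T.
  by rewrite !trmx_mul trmxK (ricci_sym oU mg Ux) mulmxA.
rewrite ricci_nu // -/(N x) linearN /= trmx_mul nu_form_skew asd_tr mulNmx mulmxN opprK => /oppr_inj.
by [].
Qed.

Let two_lam x : U x -> 2 * lam x ^+ 2 != 0.
Proof. by move=> Ux; rewrite mulf_neq0 ?pnatr_eq0 // expf_neq0 // l0. Qed.

(** The component of the Ricci form along the Kaehler form. *)
Lemma scal_nu x : U x -> scal g x = 2 * lam x ^+ 2 * asd_part (N x) t0.
Proof.
move=> Ux; have ug := metric_unitmx mg Ux.
have gi : invmx (g x) = lam x ^+ 2 *: ((E x)^T *m E x).
  have F1 : (lam x *: E x) *m g x *m (lam x *: E x)^T = 1%:M.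
    rewrite linearZ /= -scalemxAr -!scalemxAl EgE // !scale_scalar_mx.
    by congr (_%:M); move: (lam x) (l0 Ux) => l ll; field.
  rewrite (invmx_frame F1) ?unitmxZ ?uE ?unitfE ?l0 //.
  have -> : (lam x *: E x)^T = lam x *: (E x)^T by rewrite linearZ.
  by rewrite -scalemxAr -scalemxAl scalerA expr2.
rewrite /scal gi -scalemxAl mxtraceZ -mulmxA mxtrace_mulC ricci_nu // -/(N x) linearN /= (asd_tr1 (N_skew x)).
by move: (asd_part _ _) (lam x) => *; ring.
Qed.

(** Of the three components of the Einstein-Weyl equation two hold by
    [J]-invariance of the Ricci tensor, and the third is the scalar curvature.
    *)
Lemma scalar_flat_einstein_weylP x (S := ricci (weyl_chr h b) (pi x) + (ricci (weyl_chr h b) (pi x))^T) : U x ->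
  scal g x = 0 <-> S = (3%:R^-1 * \tr (invmx (h (pi x)) *m S)) *: h (pi x).
Proof.
move=> Ux; have Vy := piV cs Ux; have [n1 n2] := nu_form_asd Ux; have [d0 d1' d2] := d_nu_asd Ux.
have EW := base_einstein_weylP oV mh sb sF FhF dF sk SFG Vy.
rewrite -/S in EW; rewrite EW scal_nu //; move: n1 n2; rewrite /N d0 d1' d2 => n1 n2.
split=> [/eqP|[e _ _]]; last by rewrite e subrr mulr0.
rewrite mulf_eq0 (negbTE (two_lam Ux)) /= subr_eq0 => /eqP e0.
by split=> //; apply/eqP; rewrite -subr_eq0; apply/eqP.
Qed.

(** The curvature of the bundle of antiselfdual forms consists of the Ricci
    form alone, and this is cancelled by the Kulkarni-Nomizu product of the
    metric with the tracefree Ricci tensor. *)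
Lemma adapted_selfdual x i j : U x -> scal g x = 0 -> star4 g x (weyl_tensor g x i j) = weyl_tensor g x i j.
Proof.
move=> Ux s0; have gN : forall k, asd_part (N x) k = 0.
  have [n1 n2] := nu_form_asd Ux; apply: ord3P => //; move: s0; rewrite scal_nu // => /eqP.
  by rewrite mulf_eq0 (negbTE (two_lam Ux)) /= => /eqP.
pose S := 2^-1 *: ricci (levi_civita g) x.
pose ph := (lam x ^+ 2)^-1.
have p0 : 0 < ph by rewrite invr_gt0 exprn_gt0 // lp.
(* For vanishing scalar curvature the Schouten tensor is half the Ricci tensor.
   *)
have wE p q : weyl_tensor g x p q = curv (cmat (levi_civita g)) p q x *m g x - kn S (g x) p q.
  apply/matrixP => k l.
  have -> : (curv (cmat (levi_civita g)) p q x *m g x - kn S (g x) p q) k l =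
     (curv (cmat (levi_civita g)) p q x *m g x) k l - kn S (g x) p q k l by rewrite mxE [X in _ + X]mxE.
  rewrite [LHS]mxE s0 mul0r scale0r subr0 -/S [kn _ _ _ _ _ _]mxE [X in _ = X - _]mxE.
  by congr (_ - _); apply: eq_bigr => m _; rewrite riemE.
pose T p q := E x *m weyl_tensor g x p q *m (E x)^T.
have Tab a c : \sum_p \sum_q (E x a p * E x c q) *: T p q = ph *: (Rf a c x - kn (2^-1 *: - (asd 1 0 0 *m N x)) 1%:M a c).
  have -> : \sum_p \sum_q (E x a p * E x c q) *: T p q =
      \sum_p \sum_q (E x a p * E x c q) *: (E x *m (curv (cmat (levi_civita g)) p q x *m g x) *m (E x)^T)
      - \sum_p \sum_q (E x a p * E x c q) *: (E x *m kn S (g x) p q *m (E x)^T).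
    rewrite -sumrB; apply: eq_bigr => p _; rewrite -sumrB; apply: eq_bigr => q _.
    by rewrite -scalerBr /T wE mulmxBr mulmxBl.
  rewrite kn_conj EgE // -/ph -[ph%:M]mulr1 -[ph%:M * 1]/(ph%:M *m 1%:M) mul_scalar_mx kn_scale scalerBr.
  have -> : E x *m S *m (E x)^T = 2^-1 *: - (asd 1 0 0 *m N x).
    by rewrite /S -scalemxAr -scalemxAl ricci_nu.
  congr (_ - _); rewrite -mul_mx_scalar -EgE // /Rf (fcurv_conj oU mg s00 sE uE a c Ux) !mulmxA mulmxKV ?uE //.
  rewrite -!mulmxA mulmx_suml mulmx_sumr; apply: eq_bigr => p _; rewrite mulmx_suml mulmx_sumr; apply: eq_bigr => q _.
  by rewrite -scalemxAl -scalemxAr !mulmxA.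
have gT k p q : asd_part (T p q) k = 0.
  pose f : 'M[R]_4 := \matrix_(p, q) asd_part (T p q) k.
  have L (X Y : 'M[R]_4) c : asd_part (c *: (X - Y)) k = c * (asd_part X k - asd_part Y k).
    have Z p' q' : (c *: (X - Y)) p' q' = c * (X p' q' - Y p' q').
      by rewrite mxE [X in _ * X = _]mxE [X in _ * (_ + X)]mxE.
    by elim/ord3P: k @f; rewrite /asd_part /= !Z; gen_entries; ring.
  have L2 a c : \sum_p \sum_q E x a p * E x c q * asd_part (T p q) k = asd_part (\sum_p \sum_q (E x a p * E x c q) *: T p q) k.
    have P (s t s' t' : 'I_4) : \sum_p \sum_q E x a p * E x c q * (T p q s t - T p q s' t') =
        (\sum_p \sum_q (E x a p * E x c q) *: T p q) s t - (\sum_p \sum_q (E x a p * E x c q) *: T p q) s' t'.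
      rewrite !summxE -sumrB; apply: eq_bigr => p' _; rewrite !summxE -sumrB; apply: eq_bigr => q' _.
      by rewrite mulrBr [X in _ = X - _]mxE [X in _ = _ - X]mxE.
    elim/ord3P: k @f L; move=> *; exact: P.
  have fz : E x *m f *m (E x)^T = 0.
    apply/matrixP => a c; rewrite [RHS]mxE.
    transitivity (\sum_p \sum_q E x a p * E x c q * asd_part (T p q) k).
      rewrite exchange_big /= mxE; apply: eq_bigr => q' _; rewrite [(E x *m f) _ _]mxE mulr_suml; apply: eq_bigr => p' _.
      by rewrite [f _ _]mxE [_^T _ _]mxE mulrAC.
    rewrite L2 Tab L; have [r0 r1 r2] := curv_gam a c Ux; have [k0 k1 k2] := kn_gam a c (nu_form_skew x) gN.
    have -> : asd_part (Rf a c x) k = asd_part (kn (2^-1 *: - (asd 1 0 0 *m N x)) 1%:M a c) k.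
      by elim/ord3P: k @f L L2; move=> *; rewrite ?r0 ?r1 ?r2 ?k0 ?k1 ?k2.
    by rewrite subrr mulr0.
  have uT : (E x)^T \in unitmx by rewrite unitmx_tr uE.
  have f0 : f = 0 by apply: (can_inj (mulKmx (uE Ux))); apply: (can_inj (mulmxK uT)); rewrite fz mulmx0 mul0mx.
  by have := congr1 (fun M : 'M[R]_4 => M p q) f0; rewrite !mxE.
have skT : (T i j)^T = - T i j.
  have -> : (T i j)^T = E x *m (weyl_tensor g x i j)^T *m (E x)^T by rewrite /T !trmx_mul trmxK mulmxA.
  rewrite /T wE linearB /= kn_skew [in RHS](lc_skew oU mg i j Ux) -mulNmx -mulmxN opprB opprK.
  by rewrite opprK addrC.
have uT : (E x)^T \in unitmx by rewrite unitmx_tr uE.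
apply: (can_inj (mulKmx (uE Ux))); apply: (can_inj (mulmxK uT)).
rewrite (star4_frame _ p0 (det_lfr mg cs FhF dF Ux) (EgE Ux)) -/(T i j) -[RHS]scale1r.
apply/(fstar_eigen skT (or_introl erefl)).
by have := gT t0 i j; have := gT t1 i j; have := gT t2 i j; rewrite /asd_part /= !mul1r => /subr0_eq -> /subr0_eq -> /subr0_eq ->.
Qed.

End Curvature.
End Adapted.

(** * Descent to the quotient *)

Section Restriction.
Context {R : realType}.
Implicit Types (g J : 'rV[R]_4 -> 'M[R]_4).

Lemma riemannian_sub n (U A : set 'rV[R]_n) (g : 'rV[R]_n -> 'M[R]_n) : A `<=` U -> riemannian U g -> riemannian A g.
Proof.
by move=> AU mg; split; [exact: smooth_mx_sub AU (met_smooth mg) | move=> x /AU; exact: met_sym | move=> x /AU; exact: met_pos].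
Qed.

Lemma minimal_weyl_sub (U A : set 'rV[R]_4) g xi a : A `<=` U -> minimal_weyl U g xi a -> minimal_weyl A g xi a.
Proof. by move=> AU [sa H]; split; [exact: smooth_mx_sub AU sa | move=> x /AU; exact: H]. Qed.

Lemma antiselfdual_acs_sub (U A : set 'rV[R]_4) g J : A `<=` U -> antiselfdual_acs U g J -> antiselfdual_acs A g J.
Proof.
move=> AU [s1 s2 s3 s4]; split; first exact: smooth_mx_sub AU s1.
- by move=> x /AU; exact: s2.
- by move=> x /AU; exact: s3.
- by move=> x /AU; exact: s4.
Qed.

Lemma kahler_sub n (U A : set 'rV[R]_n) (g J : 'rV[R]_n -> 'M[R]_n) : A `<=` U -> kahler U g J -> kahler A g J.
Proof.
move=> AU [s1 s2 s3 s4]; split; first exact: smooth_mx_sub AU s1.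
- by move=> x /AU; exact: s2.
- by move=> x /AU; exact: s3.
- by move=> x /AU; exact: s4.
Qed.

Lemma conformal_submersion_sub (U A : set 'rV[R]_4) (V V' : set 'rV[R]_3) g h pi xi lam :
  A `<=` U -> pi @` A = V' -> conformal_submersion U V g h pi xi lam -> conformal_submersion A V' g h pi xi lam.
Proof.
move=> AU pA [s1 s2 s3 s4 s5 s6 s7 s8 s9 s10]; split=> //.
- exact: smooth_mx_sub AU s1.
- by move=> x /AU; exact: s3.
- exact: smooth_mx_sub AU s4.
- by move=> x /AU; exact: s5.
- by move=> x /AU; exact: s6.
- exact: smooth_sub AU s7.
- by move=> x /AU; exact: s8.
- by move=> x /AU; exact: s9.
- by move=> x /AU; exact: s10.
Qed.
End Restriction.

(** Holds when the fibres are connected. *)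
Definition descends {R : realType} (U : set 'rV[R]_4) (V : set 'rV[R]_3) (pi : 'rV[R]_4 -> 'rV[R]_3)
    (xi : 'rV[R]_4 -> 'rV[R]_4) :=
  forall f, smooth U f -> (forall x, U x -> 'D_(xi x) f x = 0) ->
  exists f', smooth V f' /\ forall x, U x -> f x = f' (pi x).

Section FrameDescent.
Context {R : realType}.
Variables (U : set 'rV[R]_4) (V : set 'rV[R]_3) (g : 'rV[R]_4 -> 'M[R]_4)
  (h F : 'rV[R]_3 -> 'M[R]_3) (pi : 'rV[R]_4 -> 'rV[R]_3) (xi : 'rV[R]_4 -> 'rV[R]_4)
  (lam : 'rV[R]_4 -> R).
Hypotheses (oU : open U) (oV : open V) (mg : riemannian U g) (mh : riemannian V h)
  (cs : conformal_submersion U V g h pi xi lam) (sF : smooth_mx V F)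
  (FhF : forall y, V y -> F y *m h y *m (F y)^T = 1%:M) (dF : forall y, V y -> 0 < \det (F y)).

Let E := lfr g F pi xi lam.
Let sE : smooth_mx U E := smooth_lfr oU mg cs sF FhF dF.
Let uE x : U x -> E x \in unitmx. Proof. by move=> Ux; exact: (unit_lfr mg cs FhF dF Ux). Qed.
Let lp := csub_lam_pos cs.
Let l0 x : U x -> lam x != 0. Proof. by move=> Ux; rewrite gt_eqF // lp. Qed.
Let EgE x : U x -> E x *m g x *m (E x)^T = ((lam x ^+ 2)^-1)%:M. Proof. exact: (lfr_metric mg cs FhF dF). Qed.
Let mv := minimal_co g F pi xi lam.
Let ov := omega_co g F pi xi lam.
Let uv := scale_co g F pi xi lam.
Let vv := defect_co g F pi xi lam.
Let lc c x := fgam g E (fun=> 0) c x.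

Lemma derive_xi f x : smooth U f -> U x -> 'D_(xi x) f x = lam x * fd E q3 f x.
Proof.
move=> sf Ux; rewrite (derive_smooth _ sf Ux) (xi_lfr mg cs FhF dF Ux) -/E -scalemxAl mxE; congr (_ * _).
by rewrite /fd mxE; apply: eq_bigr => i _; rewrite !mxE.
Qed.

Lemma fco_inj al be x : U x -> (forall c, fco E al c x = fco E be c x) -> al x = be x.
Proof. by move=> Ux H; rewrite (fco_expand uE al Ux) (fco_expand uE be Ux); apply: eq_bigr => c _; rewrite H. Qed.

Lemma fco_add al be c x : fco E (fun z => al z + be z) c x = fco E al c x + fco E be c x.
Proof. by rewrite /fco -big_split; apply: eq_bigr => i _; rewrite mxE mulrDl. Qed.

Lemma fco_scale f al c x : fco E (fun z => f z *: al z) c x = f x * fco E al c x.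
Proof. by rewrite /fco mulr_sumr; apply: eq_bigr => i _; rewrite mxE mulrA. Qed.

Lemma fco_grad f c x : fco E (grad f) c x = fd E c f x.
Proof. by rewrite fcoE fdE. Qed.

Lemma fco_base (B : 'I_3 -> 'rV[R]_3 -> R) k y : V y ->
  fco F (fun z => \sum_c B c z *: cof F c z) k y = B k y.
Proof.
move=> Vy; rewrite fcoE mulmx_suml summxE (bigD1 k) //= big1 ?addr0 => [|c ck].
  by rewrite -scalemxAl (cof_frame (unitF dF) k Vy) mxE /bvec mxE !eqxx mulr1.
by rewrite -scalemxAl (cof_frame (unitF dF) c Vy) mxE /bvec mxE eq_sym (negbTE ck) andbF mulr0.
Qed.

Lemma smooth_base_component (B : 'I_3 -> 'rV[R]_3 -> R) : (forall c, smooth V (B c)) ->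
  smooth_mx V (fun z => \sum_c B c z *: cof F c z).
Proof.
move=> sB i j; apply: (smooth_ext oV (f := fun z => \sum_c B c z * cof F c z i j)).
  by move=> z _; rewrite [RHS]summxE; apply: eq_bigr => c _; rewrite [RHS]mxE.
apply: (smooth_sum _ _ oV) => c; exact: (smoothM oV (sB c) (smooth_cof oV sF (unitF dF) c i j)).
Qed.

(** The vertical component of the equation holds by the normalization of the
    minimal Weyl derivative. *)
Lemma quotient_weylP a b : minimal_weyl U g xi a -> smooth_mx V b ->
  quotient_weyl U V g pi xi lam a b <-> forall x k, U x -> mv k x + ov k x = fco F b k (pi x).
Proof.
move=> ma sb.
have mf x : U x -> _ := fun Ux => minimal_frame oU oV mg cs sF FhF dF ma Ux.
have om x : U x -> _ := fun Ux => omega_frame oU oV mg cs sF FhF dF ma Ux.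
have L c x : U x -> fco E (fun z => a z + omega g xi a z) c x = fco E a c x + fco E (omega g xi a) c x.
  by move=> _; exact: fco_add.
have Rr c x : U x -> fco E (fun z => (lam z)^-1 *: grad lam z + pull1 pi b z) c x = - uv c x + fco E (pull1 pi b) c x.
  by move=> Ux; rewrite fco_add fco_scale fco_grad /uv /scale_co -/E opprK mulrC.
split=> [[_ H] x k Ux|H].
  have [p1 _] := pull1_frame mg cs FhF dF b Ux.
  have : fco E (fun z => a z + omega g xi a z) (w k) x = fco E (fun z => (lam z)^-1 *: grad lam z + pull1 pi b z) (w k) x.
    by rewrite !fcoE H.
  rewrite L // Rr // p1; have [m _] := mf x Ux; have [e' _] := om x Ux.
  move: (m k) (e' k); rewrite /mv /ov /uv /E; gen_tot; gen_fco; move=> *; lra.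
split=> // x Ux; apply: (@fco_inj (fun z => a z + omega g xi a z) (fun z => (lam z)^-1 *: grad lam z + pull1 pi b z) _ Ux).
have [p1 p3] := pull1_frame mg cs FhF dF b Ux; have [m m3] := mf x Ux; have [e' e3] := om x Ux.
apply: ord4w => [k|]; rewrite L // Rr // ?p1 ?p3.
  move: (m k) (e' k) (H x k Ux); rewrite /mv /ov /uv /E; gen_tot; gen_fco; move=> *; lra.
by move: m3 e3; rewrite /uv /E; gen_tot; gen_fco; move=> *; lra.
Qed.

Lemma smooth_omega_co k : smooth U (ov k).
Proof.
have s c d := smooth_fstr3 oU mg cs sF FhF dF c d.
by elim/ord3P: k; apply: (smoothN oU); exact: s.
Qed.

(** The horizontal components of [D^0 + omega] are invariant along the fibres.
    *)
Lemma quotient_exists a : descends U V pi xi -> minimal_weyl U g xi a -> selfdual_xi U g a ->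
  exists b, smooth_mx V b /\ quotient_weyl U V g pi xi lam a b.
Proof.
move=> desc ma SD.
have smo k : smooth U (fun z => mv k z + ov k z).
  by apply: (smoothD oU); [exact: (smooth_minimal_co oU mg cs sF FhF dF) | exact: smooth_omega_co].
have /choice [B HB] k : exists B, smooth V B /\ forall x, U x -> mv k x + ov k x = B (pi x).
  apply: (desc _ (smo k)) => x Ux; rewrite (derive_xi (smo k) Ux).
  by rewrite (quotient_invariant oU oV mg cs sF FhF dF ma Ux (SD x Ux) k) mulr0.
have sb := smooth_base_component (fun c => (HB c).1).
exists (fun z => \sum_c B c z *: cof F c z); split=> //.
apply/(quotient_weylP ma sb) => x k Ux.
by rewrite (fco_base B k (piV cs Ux)) (HB k).2.
Qed.

Variable J : 'rV[R]_4 -> 'M[R]_4.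
Hypothesis acs : antiselfdual_acs U g J.
Let sJ := asd_smooth acs.

(** The coordinates of [J] among the antiselfdual endomorphisms; they are also
    the components of [J xi]. *)
Definition jco (k : 'I_3) x : R := (E x *m J x *m invmx (E x)) q3 (w k).

Lemma smooth_jco k : smooth U (jco k).
Proof. exact: (smooth_mulmx oU (smooth_mulmx oU sE sJ) (smooth_invE oU sE uE)). Qed.

Lemma jco_frame x : U x -> E x *m J x = asd (jco t0 x) (jco t1 x) (jco t2 x) *m E x /\
  jco t0 x ^+ 2 + jco t1 x ^+ 2 + jco t2 x ^+ 2 = 1.
Proof.
move=> Ux; have p0 : 0 < (lam x ^+ 2)^-1 by rewrite invr_gt0 exprn_gt0 // lp.
have [] := asd_of_form p0 (det_lfr mg cs FhF dF Ux) (EgE Ux) (met_sym mg Ux) (asd_square acs Ux)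
  (asd_orth acs Ux) (asd_form acs Ux).
by rewrite /jco w0 w1 w2 -/E => <- e; rewrite mulmxKV ?uE.
Qed.

Lemma jco_induces x : U x -> (xi x *m J x) *m 'J pi x = lam x *: \sum_k jco k x *: row k (F (pi x)).
Proof.
move=> Ux; have [JE _] := jco_frame Ux.
rewrite {1}(xi_lfr mg cs FhF dF Ux) -/E -!scalemxAl -row_mul JE row_mul; congr (_ *: _).
rewrite -mulmxA mulmx_sum_row sum4w !row_mul (lfr_row3 mg cs FhF dF Ux) scaler0 addr0.
apply: eq_bigr => k _; rewrite row_mul (lfr_row mg cs FhF dF k Ux); congr (_ *: _).
by elim/ord3P: k; rewrite ?w0 ?w1 ?w2 !mxE.
Qed.

(** The coordinates of [J] are the components of [J xi], here those of the
    first leg. *)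
Lemma induces_adapted chi : induces U J pi xi lam chi -> (forall y, V y -> row t0 (F y) = chi y) ->
  forall x, U x -> E x *m J x = asd 1 0 0 *m E x.
Proof.
move=> ind Fchi x Ux; have [JE _] := jco_frame Ux; have Vy := piV cs Ux.
have := ind x Ux; rewrite jco_induces // -Fchi // => /(scalerI (l0 Ux)) e.
have K : (\row_k jco k x) *m F (pi x) = bvec t0 *m F (pi x).
  rewrite /bvec -rowE -e mulmx_sum_row; apply: eq_bigr => k _; by rewrite mxE.
have {}K : \row_k jco k x = bvec t0 by apply: (can_inj (mulmxK (unitF dF Vy))).
have j k : jco k x = (k == t0)%:R by have := congr1 (fun r : 'rV[R]_3 => r 0 k) K; rewrite !mxE eqxx.
by rewrite JE !j.
Qed.

(** Vertical parallel transport rotates [J] about the axis [asd_part], and by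
    holomorphy this axis is [J] itself; so [J xi] has constant components
    along the fibres. *)
Lemma congruence_exists a : descends U V pi xi -> minimal_weyl U g xi a -> kahler U g J ->
  holomorphic_xi U g J xi a ->
  exists chi, [/\ smooth_mx V chi, (forall y, V y -> inner h y (chi y) (chi y) = 1) & induces U J pi xi lam chi].
Proof.
move=> desc ma kJ hol.
have inv x : U x -> forall k, fd E q3 (jco k) x = 0.
  move=> Ux; have JE z Uz := (@jco_frame z Uz).1.
  have [p0 p1 p2] := (parallel_frame oU mg cs sF FhF dF sJ smooth_jco JE Ux).1 (kahler_parallel kJ Ux) q3.
  have [e0 e1 e2] := (holomorphic_frame oU oV mg cs sF FhF dF ma (JE x Ux) Ux).1 (hol x Ux).
  by move: p0 p1 p2; rewrite e0 e1 e2 !addr0 => p0 p1 p2; apply: ord3P.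
have /choice [C HC] k : exists C, smooth V C /\ forall x, U x -> jco k x = C (pi x).
  by apply: (desc _ (smooth_jco k)) => x Ux; rewrite (derive_xi (smooth_jco k) Ux) inv // mulr0.
pose chi y := \row_k C k y *m F y.
have sC : smooth_mx V (fun y => \row_k C k y) by move=> i j; under eq_fun do rewrite mxE; exact: (HC j).1.
exists chi; split.
- exact: smooth_mulmx oV sC sF.
- move=> y Vy; have [x Ux xy] : (pi @` U) y by rewrite (csub_surj cs).
  have [_ u] := jco_frame Ux; move: u; rewrite !(HC _).2 // xy => u.
  rewrite /inner /chi trmx_mul -!mulmxA (mulmxA (F y)) (mulmxA _ (F y)^T) FhF // mul1mx mxE sum3 !mxE.
  by rewrite -!expr2.
- move=> x Ux; rewrite jco_induces //; congr (_ *: _); rewrite /chi mulmx_sum_row.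
  by apply: eq_bigr => k _; rewrite mxE (HC k).2.
Qed.

(** The divergence and twist are the connection components that the Kaehler
    condition leaves free. *)
Lemma sfg_of_kahler b : (forall x k, U x -> mv k x + ov k x = fco F b k (pi x)) ->
  (forall x, U x -> forall e, asd_part (lc e x) t1 = 0 /\ asd_part (lc e x) t2 = 0) ->
  forall y, V y -> sfg_at h F b (fun y => fgam h F b t1 y t0 t1) (fun y => fgam h F b t1 y t0 t2) y.
Proof.
move=> MB KG y Vy; have [x Ux xy] : (pi @` U) y by rewrite (csub_surj cs).
have [[_ a2 a3] [_ b2 b3] [_ c2 c3]] := lc_gammaw oU oV mg mh cs sF FhF dF b Ux.
have g3 := lc_gamma3 oU oV mg cs sF FhF dF Ux; have g31 := g3 t1; have g32 := g3 t2.
move: a2 a3 b2 b3 c2 c3 g31 g32 (MB x t1 Ux) (MB x t2 Ux); cbv beta.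
have [h1 h2] := KG x Ux q0; have [h3 h4] := KG x Ux q1; have [h5 h6] := KG x Ux q2; have [h7 h8] := KG x Ux q3.
rewrite /lc in h1 h2 h3 h4 h5 h6 h7 h8.
rewrite -/E h1 h2 h3 h4 h5 h6 h7 h8 xy !(base_lower oV mh sF FhF dF b _ Vy) /mv /ov /defect_co xy.
rewrite /sfg_at; move: (fgam _ _ _ t0 _ t0 t1) (fgam _ _ _ t0 _ t0 t2) (fgam _ _ _ t1 _ t0 t1)
  (fgam _ _ _ t1 _ t0 t2) (fgam _ _ _ t2 _ t0 t1) (fgam _ _ _ t2 _ t0 t2).
by gen_tot; gen_fco; move=> *; do ![split]; lra.
Qed.

End FrameDescent.

(** * Affine structure of the fibres *)

Section Directional.
Context {R : realType} {n : nat}.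
Variables (U : set 'rV[R]_n).
Hypothesis oU : open U.
Implicit Types (f k : 'rV[R]_n -> R) (x v : 'rV[R]_n) (X Y : 'rV[R]_n -> 'rV[R]_n).

Lemma smooth_derivable f x v : smooth U f -> U x -> derivable f x v.
Proof. by move=> sf Ux; apply: diff_derivable; exact: smooth_diff sf Ux. Qed.

Lemma derive_ext v f k x : U x -> (forall z, U z -> f z = k z) -> 'D_v f x = 'D_v k x.
Proof.
move=> Ux fk; apply: near_eq_derive; have := open_nbhs_nbhs (conj oU Ux); apply: filterS; exact: fk.
Qed.

Lemma derive_add v f k x : smooth U f -> smooth U k -> U x ->
  'D_v (fun z => f z + k z) x = 'D_v f x + 'D_v k x.
Proof. by move=> sf sk Ux; exact: (deriveD (smooth_derivable sf Ux) (smooth_derivable sk Ux)). Qed.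

Lemma derive_sub v f k x : smooth U f -> smooth U k -> U x ->
  'D_v (fun z => f z - k z) x = 'D_v f x - 'D_v k x.
Proof. by move=> sf sk Ux; exact: (deriveB (smooth_derivable sf Ux) (smooth_derivable sk Ux)). Qed.

Lemma derive_mul v f k x : smooth U f -> smooth U k -> U x ->
  'D_v (fun z => f z * k z) x = 'D_v f x * k x + f x * 'D_v k x.
Proof.
move=> sf sk Ux; rewrite (deriveM (smooth_derivable sf Ux) (smooth_derivable sk Ux)) addrC.
by congr (_ + _); rewrite -[LHS]/(_ * _) mulrC.
Qed.

Lemma derive_const v (c : R) x : 'D_v (fun=> c) x = 0.
Proof. exact: derive_cst. Qed.

Lemma derive_scalev c v f x : smooth U f -> U x -> 'D_(c *: v) f x = c * 'D_v f x.
Proof. by move=> sf Ux; rewrite !(derive_smooth _ sf Ux) -scalemxAl mxE. Qed.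

Lemma lie_comp X Y x i : smooth_mx U X -> smooth_mx U Y -> U x ->
  lie X Y x 0 i = 'D_(X x) (fun z => Y z 0 i) x - 'D_(Y x) (fun z => X z 0 i) x.
Proof.
move=> sX sY Ux; rewrite /lie.
have K (Z : 'rV[R]_n -> 'rV[R]_n) v : smooth_mx U Z -> ('D_v Z x) 0 i = 'D_v (fun z => Z z 0 i) x.
  move=> sZ; rewrite derive_mx; last by apply/derivable_mxP => a b; exact: smooth_derivable (sZ a b) Ux.
  by rewrite mxE.
by rewrite -(K _ _ sX) -(K _ _ sY) mxE [X in _ + X]mxE.
Qed.

(** The bracket acts on functions as the commutator. *)
Lemma lie_grad X Y f x : smooth_mx U X -> smooth_mx U Y -> smooth U f -> U x ->
  (lie X Y x *m (grad f x)^T) 0 0 =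
  'D_(X x) (fun z => 'D_(Y z) f z) x - 'D_(Y x) (fun z => 'D_(X z) f z) x.
Proof.
move=> sX sY sf Ux.
have E Z v : smooth_mx U Z -> 'D_v (fun z => 'D_(Z z) f z) x =
    \sum_i ('D_v (fun z => Z z 0 i) x * pd i f x + Z x 0 i * \sum_j v 0 j * pd j (pd i f) x).
  move=> sZ.
  have sp i : smooth U (fun z => Z z 0 i * pd i f z) by exact: (smoothM oU (sZ 0 i) (smooth_pd i sf)).
  rewrite (derive_ext v Ux (k := fun z => \sum_i Z z 0 i * pd i f z)); last first.
    by move=> z Uz; exact: derive_sum_pd (smooth_diff sf Uz).
  have : forall r : seq 'I_n, 'D_v (fun z => \sum_(i <- r) Z z 0 i * pd i f z) x =
      \sum_(i <- r) ('D_v (fun z => Z z 0 i) x * pd i f x + Z x 0 i * \sum_j v 0 j * pd j (pd i f) x).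
    elim=> [|i r IH].
      by rewrite [RHS]big_nil (derive_ext v Ux (k := fun=> 0)) ?derive_const // => z _; rewrite big_nil.
    rewrite big_cons -IH -(derive_sum_pd _ (smooth_diff (smooth_pd i sf) Ux)) -(derive_mul v (sZ 0 i) (smooth_pd i sf) Ux).
    rewrite -derive_add //; last exact: (smooth_sum _ _ oU).
    by congr ('D_v _ x); apply/funext => z; rewrite big_cons.
  by apply.
rewrite (E Y _ sY) (E X _ sX) mxE -sumrB.
have S : \sum_i Y x 0 i * (\sum_j X x 0 j * pd j (pd i f) x) = \sum_i X x 0 i * (\sum_j Y x 0 j * pd j (pd i f) x).
  under eq_bigr do rewrite mulr_sumr; rewrite exchange_big /=; apply: eq_bigr => i _.
  rewrite mulr_sumr; apply: eq_bigr => j _; rewrite (schwarz i j oU sf Ux).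
  by move: (Y x 0 j) (X x 0 i) (pd _ _ _) => *; ring.
transitivity (\sum_i lie X Y x 0 i * pd i f x + (\sum_i Y x 0 i * (\sum_j X x 0 j * pd j (pd i f) x) -
    \sum_i X x 0 i * (\sum_j Y x 0 j * pd j (pd i f) x))).
  by rewrite S subrr addr0; apply: eq_bigr => i _; rewrite ![_^T _ _]mxE [grad _ _ _ _]mxE.
rewrite -sumrB -big_split; apply: eq_bigr => i _; rewrite (lie_comp i sX sY Ux) /=.
by move: ('D_ _ _ _) ('D_(Y x) _ _) (pd i f x) (Y x 0 i) (X x 0 i) (\sum_j _) (\sum_j _) => *; ring.
Qed.
End Directional.

Section AffineFibres.
Context {R : realType}.
Variables (U : set 'rV[R]_4) (V : set 'rV[R]_3) (g : 'rV[R]_4 -> 'M[R]_4)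
  (h : 'rV[R]_3 -> 'M[R]_3) (pi : 'rV[R]_4 -> 'rV[R]_3) (xi : 'rV[R]_4 -> 'rV[R]_4)
  (lam : 'rV[R]_4 -> R).
Hypotheses (oU : open U) (oV : open V) (mg : riemannian U g)
  (cs : conformal_submersion U V g h pi xi lam).
Variables (t : 'rV[R]_4 -> R) (kap rho : 'rV[R]_3 -> R) (be Phi : 'rV[R]_3 -> 'rV[R]_3).
Hypotheses (st : smooth U t) (sk : smooth V kap) (sr : smooth V rho) (sbe : smooth_mx V be) (sP : smooth_mx V Phi)
  (dt : forall x, U x -> 'D_(xi x) t x = (lam x)^-1)
  (lamE : forall x, U x -> (lam x)^-1 * (lam x)^-1 = rho (pi x) - 2 * t x * kap (pi x))
  (thE : forall x, U x -> (lam x)^-1 *: flat g xi x = grad t x - t x *: pull1 pi be x + pull1 pi Phi x).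

Let piU x : U x -> V (pi x). Proof. by move=> Ux; exact: (piV cs Ux). Qed.
Let sp := csub_smooth cs.
Let sxi := csub_xi_smooth cs.
Let l0 x : U x -> lam x != 0. Proof. by move=> Ux; rewrite gt_eqF // (csub_lam_pos cs). Qed.
Let sl := csub_lam_smooth cs.
Let il x := (lam x)^-1.
Let sil : smooth U il. Proof. exact: (smoothV oU l0 sl). Qed.

Lemma smooth_basic f : smooth V f -> smooth U (fun z => f (pi z)).
Proof. exact: smooth_chain oU piU sp. Qed.

Lemma derive_basic f x : smooth V f -> U x -> 'D_(xi x) (fun z => f (pi z)) x = 0.
Proof.
move=> sf Ux; rewrite (derive_smooth _ (smooth_basic sf) Ux) (grad_chain sp sf Ux (piU Ux)) /pull1 trmx_mul trmxK mulmxA.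
by rewrite (csub_xi_vert cs Ux) mul0mx mxE.
Qed.

Lemma derive_lift f v x : smooth V f -> U x ->
  'D_v (fun z => f (pi z)) x = (v *m 'J pi x *m (grad f (pi x))^T) 0 0.
Proof. by move=> sf Ux; rewrite (derive_smooth _ (smooth_basic sf) Ux) (grad_chain sp sf Ux (piU Ux)) /pull1 trmx_mul trmxK mulmxA. Qed.

Lemma derive_il x : U x -> 'D_(xi x) il x = - kap (pi x).
Proof.
move=> Ux; have : 'D_(xi x) (fun z => il z * il z) x = 'D_(xi x) (fun z => rho (pi z) - 2 * (t z * kap (pi z))) x.
  by apply: (derive_ext oU _ Ux) => z Uz; rewrite lamE // mulrA.
have stk : smooth U (fun z => t z * kap (pi z)) by exact: (smoothM oU st (smooth_basic sk)).
rewrite (derive_mul _ sil sil Ux) (derive_sub _ (smooth_basic sr) (smoothZ 2 oU stk) Ux) (derive_basic sr Ux).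
rewrite (derive_mul _ (smooth_cst _ _) stk Ux) derive_const (derive_mul _ st (smooth_basic sk) Ux) (derive_basic sk Ux) dt //.
rewrite -/(il x); have : il x != 0 by rewrite invr_eq0 l0.
move: ('D_ _ _ _) (il x) (kap _) (t x) => d i k u i0 e.
by apply: (mulfI i0); move: e; lra.
Qed.

(** The connection for which [t] is an affine coordinate, as [D_xi t = lam^-1]
    and [D_xi lam^-1 = - kap]. *)
Definition aff_gam x := - (lam x * kap (pi x)).

Lemma vertical_xi x v : U x -> v *m 'J pi x = 0 -> v = inner g x v (xi x) *: xi x.
Proof.
move=> Ux vJ; set c := inner g x v (xi x); pose u := v - c *: xi x.
have uJ : u *m 'J pi x = 0 by rewrite mulmxBl -scalemxAl vJ (csub_xi_vert cs Ux) scaler0 subr0.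
have ux : inner g x u (xi x) = 0.
  by rewrite /inner /u !mulmxBl -!scalemxAl [LHS]mxE [X in _ + X]mxE [X in _ - X]mxE -!/(inner _ _ _ _) (csub_xi_unit cs Ux) mulr1 subrr.
have := csub_conformal cs Ux ux ux; rewrite uJ /inner !mul0mx mxE => /esym/eqP.
rewrite mulf_eq0 expf_eq0 /= (negbTE (l0 Ux)) /= => /eqP uu.
apply/eqP; rewrite -subr_eq0 -/u; apply: contraT => u0.
by have := met_pos mg Ux u0; rewrite /inner uu ltxx.
Qed.

Lemma affine_coordinate_t : affine_coordinate U xi aff_gam t.
Proof.
split=> // x Ux; rewrite dt // invr_gt0 (csub_lam_pos cs) //; split=> //.
rewrite (derive_ext oU _ Ux (k := il)) => [|z Uz]; last exact: dt.
by rewrite derive_il // /aff_gam mulNr; congr (- _); rewrite mulrAC mulfV ?l0 // mul1r.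
Qed.

(** Horizontal lifts change [t] by an affine function of [t], so they preserve
    fibrewise parallel fields; and [lam^-2] is affine in [t]. *)
Lemma affine_fibres : affine_submersion U V g pi xi lam aff_gam.
Proof.
have sgam : smooth U aff_gam by exact: (smoothN oU (smoothM oU sl (smooth_basic sk))).
split=> //.
  move=> X Xt sX sXt lift W Z oW WU [f [sf ZE]].
  have sW' k : smooth U k -> smooth W k by exact: smooth_sub.
  have sWm p q (A : 'rV[R]_4 -> 'M[R]_(p, q)) : smooth_mx U A -> smooth_mx W A by exact: smooth_mx_sub.
  have sZ : smooth_mx W Z.
    apply: (smooth_mx_ext oW (A := fun z => f z *: xi z)) => [z /ZE [-> _] //|].
    exact: (smooth_scalemx oW sf (sWm _ _ _ sxi)).
  pose s z := f z * il z.
  have ss : smooth W s by exact: (smoothM oW sf (sW' _ sil)).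
  have ds z : W z -> 'D_(xi z) s z = 0.
    move=> Wz; have [_] := ZE z Wz; rewrite /fibre_d /aff_gam (derive_mul _ sf (sW' _ sil) Wz) (derive_il (WU _ Wz)) /il.
    have := l0 (WU _ Wz); move: ('D_ _ _ _) (lam z) (f z) (kap _) => d l u k l0' e.
    have -> : d = l * k * u by move: e; lra.
    by field.
  pose bX y := (be y *m (X y)^T) 0 0.
  have sbX : smooth V bX by exact: (smooth_mulmx oV sbe (smooth_trmx sX)).
  pose pX y := (Phi y *m (X y)^T) 0 0.
  have spX : smooth V pX by exact: (smooth_mulmx oV sP (smooth_trmx sX)).
  have pullX (c : 'rV[R]_3 -> 'rV[R]_3) z : U z -> (Xt z *m (pull1 pi c z)^T) 0 0 = (c (pi z) *m (X (pi z))^T) 0 0.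
    move=> Uz; rewrite /pull1 trmx_mul trmxK mulmxA (lift z Uz).1.
    by rewrite mxE [RHS]mxE; apply: eq_bigr => i _; rewrite ![_^T _ _]mxE mulrC.
  have dXt z : U z -> 'D_(Xt z) t z = t z * bX (pi z) - pX (pi z).
    move=> Uz; rewrite (derive_smooth _ st Uz).
    have -> : grad t z = il z *: flat g xi z + t z *: pull1 pi be z - pull1 pi Phi z by rewrite thE // (addrAC _ (pull1 pi Phi z)) subrK addrK.
    have -> : (il z *: flat g xi z + t z *: pull1 pi be z - pull1 pi Phi z)^T =
        il z *: (flat g xi z)^T + t z *: (pull1 pi be z)^T - (pull1 pi Phi z)^T.
      by rewrite linearB linearD !linearZ.
    rewrite mulmxBr mulmxDr -!scalemxAr [LHS]mxE [X in X + _]mxE [X in X + _ + _]mxE [X in _ + X + _]mxE [X in _ + X]mxE.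
    rewrite !pullX // -/(bX _) -/(pX _) /flat trmx_mul (met_sym mg Uz) mulmxA -/(inner g z (Xt z) (xi z)) (lift z Uz).2.
    by rewrite mulr0 add0r.
  have sWXt := sWm _ _ _ sXt.
  have sDs : smooth W (fun z => 'D_(Xt z) s z) by exact: (smooth_derive oW ss sWXt).
  pose q z := 'D_(Xt z) s z - s z * bX (pi z).
  have sq : smooth W q by apply: (smoothB oW sDs (smoothM oW ss (sW' _ (smooth_basic sbX)))).
  pose proj j : 'rV[R]_3 -> R := fun y => y 0 j.
  have sproj j : smooth V (proj j) by exact: smooth_coord.
  have dproj (Y : 'rV[R]_4 -> 'rV[R]_4) j z : U z -> 'D_(Y z) (fun z => proj j (pi z)) z = (Y z *m 'J pi z) 0 j.
    move=> Uz; rewrite (derive_lift _ (sproj j) Uz) mxE (bigD1 j) //= big1 ?addr0 => [|i ij].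
      by rewrite ![_^T _ _]mxE [grad _ _ _ _]mxE pd_coord eqxx mulr1.
    by rewrite ![_^T _ _]mxE [grad _ _ _ _]mxE pd_coord (negbTE ij) mulr0.
  have vert (Y Y' : 'rV[R]_4 -> 'rV[R]_4) x : W x -> smooth_mx W Y -> smooth_mx W Y' ->
      (forall j, 'D_(Y x) (fun z => (Y' z *m 'J pi z) 0 j) x = 'D_(Y' x) (fun z => (Y z *m 'J pi z) 0 j) x) ->
      lie Y Y' x *m 'J pi x = 0.
    move=> Wx sY sY' e; apply/rowP => j; rewrite [RHS]mxE.
    transitivity ((lie Y Y' x *m (grad (fun z => proj j (pi z)) x)^T) 0 0).
      rewrite (grad_chain sp (sproj j) (WU _ Wx) (piU (WU _ Wx))) /pull1 trmx_mul trmxK mulmxA.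
      rewrite [RHS]mxE (bigD1 j) //= big1 ?addr0 => [|i ij].
        by rewrite ![_^T _ _]mxE [grad _ _ _ _]mxE pd_coord eqxx mulr1.
      by rewrite ![_^T _ _]mxE [grad _ _ _ _]mxE pd_coord (negbTE ij) mulr0.
    rewrite (lie_grad oW sY sY' (sW' _ (smooth_basic (sproj j))) Wx).
    rewrite (derive_ext oW _ Wx (k := fun z => (Y' z *m 'J pi z) 0 j)) => [|z Wz]; last exact: dproj (WU _ Wz).
    rewrite [X in _ - X](derive_ext oW _ Wx (k := fun z => (Y z *m 'J pi z) 0 j)) => [|z Wz]; last exact: dproj (WU _ Wz).
    by rewrite e subrr.
  have XtJ j x : W x -> 'D_(xi x) (fun z => (Xt z *m 'J pi z) 0 j) x = 0.
    move=> Wx; rewrite (derive_ext oW _ Wx (k := fun z => X (pi z) 0 j)) => [|z Wz]; last by rewrite (lift z (WU _ Wz)).1.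
    exact: (derive_basic (f := fun y => X y 0 j) (sX 0 j) (WU _ Wx)).
  have zJ (Y : 'rV[R]_4 -> 'rV[R]_4) v j x : (forall z, W z -> Y z *m 'J pi z = 0) -> W x -> 'D_v (fun z => (Y z *m 'J pi z) 0 j) x = 0.
    move=> Y0 Wx; rewrite (derive_ext oW _ Wx (k := fun=> 0)) ?derive_const // => z Wz.
    by rewrite Y0 // mxE.
  have xiJ z : W z -> xi z *m 'J pi z = 0 by move=> Wz; exact: (csub_xi_vert cs (WU _ Wz)).
  have ZJ z : W z -> Z z *m 'J pi z = 0 by move=> Wz; rewrite (ZE z Wz).1 -scalemxAl xiJ // scaler0.
  have sWxi := sWm _ _ _ sxi.
  have dq x : W x -> 'D_(xi x) q x = 0.
    move=> Wx; have Ux := WU _ Wx; rewrite /q (derive_sub _ sDs (smoothM oW ss (sW' _ (smooth_basic sbX))) Wx).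
    rewrite (derive_mul _ ss (sW' _ (smooth_basic sbX)) Wx) (ds _ Wx) (derive_basic sbX Ux) mul0r mulr0 addr0 subr0.
    have v0 : lie xi Xt x *m 'J pi x = 0 by apply: (vert _ _ _ Wx sWxi sWXt) => j; rewrite XtJ // zJ.
    have := lie_grad oW sWxi sWXt ss Wx; rewrite (derive_ext oW (Xt x) Wx (k := fun=> 0)) => [|z Wz]; last exact: ds.
    rewrite derive_const subr0 => <-; rewrite (vertical_xi Ux v0) -scalemxAl mxE -(derive_smooth _ ss Wx) ds //.
    by rewrite mulr0.
  exists (fun z => lam z * q z); split; first exact: (smoothM oW (sW' _ sl) sq).
  move=> x Wx; have Ux := WU _ Wx; split; last first.
    rewrite /fibre_d /aff_gam (derive_mul _ (sW' _ sl) sq Wx) dq // mulr0 addr0.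
    have dl : 'D_(xi x) (fun z => lam z * il z) x = 0.
      by rewrite (derive_ext oU _ Ux (k := fun=> 1)) ?derive_const // => z Uz; rewrite mulfV ?l0.
    move: dl; rewrite (derive_mul _ sl sil Ux) derive_il // /il; have := l0 Ux.
    move: ('D_ _ _ _) (lam x) (kap _) (q x) => d l k u l0' e.
    have -> : d = l * l * k by apply: (mulIf (_ : l^-1 != 0)); rewrite ?invr_eq0 //; move: e => /eqP; rewrite mulrN subr_eq0 => /eqP ->; field.
    ring.
  have v0 : lie Xt Z x *m 'J pi x = 0.
    apply: (vert _ _ _ Wx sWXt sZ) => j; rewrite (zJ Z) // (ZE x Wx).1.
    have sXJ : smooth W (fun z => (Xt z *m 'J pi z) 0 j) by exact: (smooth_mulmx oW sWXt (sWm _ _ _ (smooth_jacobian oU sp)) 0 j).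
    by rewrite (derive_scalev _ _ sXJ Wx) XtJ // mulr0.
  have pt := lie_grad oW sWXt sZ (sW' _ st) Wx.
  rewrite (vertical_xi Ux v0) in pt *; congr (_ *: _); move: pt; rewrite -scalemxAl mxE -(derive_smooth _ st Ux) dt //.
  rewrite (derive_ext oW _ Wx (k := s)) => [|z Wz]; last first.
    by rewrite (ZE z Wz).1 (derive_scalev _ _ st (WU _ Wz)) (dt (WU _ Wz)).
  rewrite [X in _ - X](derive_ext oW _ Wx (k := fun z => t z * bX (pi z) - pX (pi z))) => [|z Wz]; last exact: dXt (WU _ Wz).
  have sbt : smooth U (fun z => t z * bX (pi z)) by exact: (smoothM oU st (smooth_basic sbX)).
  rewrite (ZE x Wx).1 (derive_scalev _ _ (smoothB oU sbt (smooth_basic spX)) Ux) (derive_sub _ sbt (smooth_basic spX) Ux).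
  rewrite (derive_mul _ st (smooth_basic sbX) Ux) !derive_basic // dt // mulr0 addr0 subr0 /q /s /il.
  have := l0 Ux; move: ('D_ _ _ _) (lam x) (f x) (bX _) (inner _ _ _ _) => d l u b c l0' e.
  by apply: (mulIf (_ : l^-1 != 0)); rewrite ?invr_eq0 // e; field.
move=> s ss; exists (fun z => s (pi z) * il z); split; first exact: (smoothM oU (smooth_basic ss) sil).
move=> x Ux; split=> //; rewrite (derive_ext oU _ Ux (k := fun z => - 2 * (s (pi z) * kap (pi z)))) => [|z Uz].
  have ssk := smoothM oV ss sk.
  by rewrite (derive_mul _ (smooth_cst _ _) (smooth_basic ssk) Ux) derive_const (derive_basic ssk Ux) mul0r mulr0 addr0.
rewrite /fibre_d /aff_gam (derive_mul _ (smooth_basic ss) sil Uz) derive_basic // derive_il // mul0r add0r /il.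
by have := l0 Uz; move: (lam z) (s _) (kap _) => l u k l0'; field.
Qed.

(** Affine fibre coordinates are related by affine changes with basic
    coefficients, under which [t w1 + w0] and the contact form scale by the
    same basic factor. *)
Lemma affine_monopole t' : descends U V pi xi -> affine_coordinate U xi aff_gam t' ->
  monopole_linear_part U V g h pi lam t' (fun y => - 2 * kap y).
Proof.
move=> desc [st' ht']; split; first exact: (smoothZ _ oV sk).
have sdt' : smooth U (fun z => 'D_(xi z) t' z) by exact: (smooth_derive oU st' sxi).
(* [t' = p t + q] with basic [p] and [q]. *)
have [p [sp' pE]] : exists p, smooth V p /\ forall x, U x -> lam x * 'D_(xi x) t' x = p (pi x).
  apply: (desc _ (smoothM oU sl sdt')) => x Ux; rewrite (derive_mul _ sl sdt' Ux) (ht' x Ux).2 /aff_gam.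
  have dl : 'D_(xi x) (fun z => lam z * il z) x = 0.
    by rewrite (derive_ext oU _ Ux (k := fun=> 1)) ?derive_const // => z Uz; rewrite mulfV ?l0.
  move: dl; rewrite (derive_mul _ sl sil Ux) derive_il // /il; have := l0 Ux.
  move: ('D_(xi x) lam x) ('D_(xi x) t' x) (lam x) (kap _) => d d' l k l0' e.
  have -> : d = l * l * k by apply: (mulIf (_ : l^-1 != 0)); rewrite ?invr_eq0 //; move: e => /eqP; rewrite mulrN subr_eq0 => /eqP ->; field.
  ring.
have spU := smooth_basic sp'.
have [q [sq qE]] : exists q, smooth V q /\ forall x, U x -> t' x - p (pi x) * t x = q (pi x).
  apply: (desc _ (smoothB oU st' (smoothM oU spU st))) => x Ux.
  rewrite (derive_sub _ st' (smoothM oU spU st) Ux) (derive_mul _ spU st Ux) derive_basic // dt // -pE //.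
  by have := l0 Ux; move: ('D_ _ _ _) (lam x) (t x) => d l u l0'; field.
have p0 y : V y -> 0 < p y.
  move=> Vy; have [x Ux <-] : (pi @` U) y by rewrite (csub_surj cs).
  by rewrite -pE // mulr_gt0 ?(csub_lam_pos cs) // (ht' x Ux).1.
have pn0 y : V y -> p y != 0 by move=> Vy; rewrite gt_eqF // p0.
(* This form results from substituting [t = (t' - q) / p] in the contact form.
   *)
pose c y := (p y)^-1 *: (grad p y + p y *: be y).
have sc : smooth_mx V c.
  apply: (smooth_scalemx oV (smoothV oV pn0 sp')); apply: (smooth_addmx oV (smooth_grad sp')).
  exact: (smooth_scalemx oV sp' sbe).
exists (fun y => p y * rho y + 2 * q y * kap y), (fun y => q y *: c y - grad q y + p y *: Phi y), (fun y => - c y).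
split.
- exact: (smoothD oV (smoothM oV sp' sr) (smoothM oV (smoothZ 2 oV sq) sk)).
- apply: (smooth_addmx oV); last exact: (smooth_scalemx oV sp' sP).
  apply: (smooth_addmx oV (smooth_scalemx oV sq sc)); exact: (smooth_oppmx oV (smooth_grad sq)).
- exact: (smooth_oppmx oV sc).
move=> x Ux /=; have Vy := piU Ux.
have tE : t' x = p (pi x) * t x + q (pi x) by rewrite -qE // addrC subrK.
have vE : t' x * (- 2 * kap (pi x)) + (p (pi x) * rho (pi x) + 2 * q (pi x) * kap (pi x)) = p (pi x) * (il x * il x).
  rewrite lamE // tE; move: (p _) (q _) (t x) (kap _) (rho _) => *; ring.
have i0 : 0 < il x by rewrite invr_gt0 (csub_lam_pos cs).
rewrite vE; split; first by rewrite !mulr_gt0 ?p0.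
have gt' : grad t' x = p (pi x) *: grad t x + t x *: pull1 pi (grad p) x + pull1 pi (grad q) x.
  have e z : U z -> t' z = p (pi z) * t z + q (pi z) by move=> Uz; rewrite -qE // addrC subrK.
  rewrite -(grad_chain sp sp' Ux Vy) -(grad_chain sp sq Ux Vy).
  apply/rowP => i; rewrite [LHS]mxE (pd_ext i oU Ux e) pdD; last first.
  - exact: smooth_diff (smooth_basic sq) Ux.
  - exact: smooth_diff (smoothM oU spU st) Ux.
  rewrite pdM; [|exact: smooth_diff spU Ux|exact: smooth_diff st Ux].
  by rewrite !mxE; move: (pd _ _ _) (pd _ _ _) (pd _ _ _) (p _) (t x) => *; ring.
have thE' : grad t' x + t' x *: pull1 pi (fun y => - c y) x + pull1 pi (fun y => q y *: c y - grad q y + p y *: Phi y) x =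
    p (pi x) *: (il x *: flat g xi x).
  have cE : pull1 pi c x = (p (pi x))^-1 *: (pull1 pi (grad p) x + p (pi x) *: pull1 pi be x).
    by rewrite /pull1 /c -!scalemxAl mulmxDl -scalemxAl.
  have -> : pull1 pi (fun y => - c y) x = - pull1 pi c x by rewrite /pull1 mulNmx.
  have -> : pull1 pi (fun y => q y *: c y - grad q y + p y *: Phi y) x =
      q (pi x) *: pull1 pi c x - pull1 pi (grad q) x + p (pi x) *: pull1 pi Phi x.
    by rewrite /pull1 !mulmxDl mulNmx -!scalemxAl.
  rewrite thE // gt' cE tE.
  have := pn0 _ Vy; move: (p (pi x)) (q (pi x)) (t x) (grad t x) (pull1 pi (grad p) x) (pull1 pi (grad q) x) (pull1 pi be x) (pull1 pi Phi x).
  move=> P Q T X1 X2 X3 X4 X5 P0; apply/rowP => i.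
  have Ez c' (M : 'rV[R]_4) : (c' *: M) 0 i = c' * M 0 i by rewrite mxE.
  have Ea (M N : 'rV[R]_4) : (M + N) 0 i = M 0 i + N 0 i by rewrite mxE.
  have En (M : 'rV[R]_4) : (- M) 0 i = - M 0 i by rewrite mxE.
  by rewrite !(Ea, En, Ez); move: (X1 0 i) (X2 0 i) (X3 0 i) (X4 0 i) (X5 0 i) => *; field.
rewrite thE' (csub_metric mg cs Ux).
have -> : (p (pi x) *: (il x *: flat g xi x))^T *m (p (pi x) *: (il x *: flat g xi x)) =
    (p (pi x) * il x) ^+ 2 *: ((flat g xi x)^T *m flat g xi x).
  by rewrite scalerA [(_ *: _)^T]linearZ /= -scalemxAl -scalemxAr scalerA expr2.
rewrite scalerDr !scalerA mulfV ?expf_neq0 ?l0 // scale1r; congr (_ + _ *: _).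
by have := l0 Ux; have := pn0 _ Vy; rewrite /il; move: (lam x) (p _) => l P P0 l0'; field; rewrite l0' P0.
Qed.

End AffineFibres.

(** * The normal form of the metric *)

Ltac gen_tt := repeat match goal with
  | |- context [@minimal_co ?R ?g ?F ?p ?xi ?l ?k ?x] => generalize (@minimal_co R g F p xi l k x); intro
  | |- context [@omega_co ?R ?g ?F ?p ?xi ?l ?k ?x] => generalize (@omega_co R g F p xi l k x); intro
  | |- context [@scale_co ?R ?g ?F ?p ?xi ?l ?k ?x] => generalize (@scale_co R g F p xi l k x); intro
  | |- context [@defect_co ?R ?g ?F ?p ?xi ?l ?b ?k ?x] => generalize (@defect_co R g F p xi l b k x); intro
  end.

Section NormalForm.
Context {R : realType}.
Variables (U : set 'rV[R]_4) (V : set 'rV[R]_3) (g : 'rV[R]_4 -> 'M[R]_4)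
  (h F : 'rV[R]_3 -> 'M[R]_3) (pi : 'rV[R]_4 -> 'rV[R]_3) (xi : 'rV[R]_4 -> 'rV[R]_4)
  (lam : 'rV[R]_4 -> R).
Hypotheses (oU : open U) (oV : open V) (mg : riemannian U g) (mh : riemannian V h)
  (cs : conformal_submersion U V g h pi xi lam) (sF : smooth_mx V F)
  (FhF : forall y, V y -> F y *m h y *m (F y)^T = 1%:M) (dF : forall y, V y -> 0 < \det (F y)).
Let E := lfr g F pi xi lam.
Let sE : smooth_mx U E := smooth_lfr oU mg cs sF FhF dF.
Let uE x : U x -> E x \in unitmx. Proof. by move=> Ux; exact: (unit_lfr mg cs FhF dF Ux). Qed.
Let l0 x : U x -> lam x != 0. Proof. by move=> Ux; rewrite gt_eqF // (csub_lam_pos cs). Qed.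
Let sl := csub_lam_smooth cs.
Let il x := (lam x)^-1.
Let sil : smooth U il. Proof. exact: (smoothV oU l0 sl). Qed.

Lemma fd_il c x : U x -> fd E c il x = il x * scale_co g F pi xi lam c x.
Proof.
move=> Ux; have : fd E c (fun z => lam z * il z) x = 0.
  by rewrite -(fd_cst E c 1 x); apply: (fd_ext E oU c Ux) => z Uz; rewrite mulfV ?l0.
rewrite (fdM E c sl sil Ux) /scale_co -/E; move: (fd E c lam x) (fd E c il x) => f d; rewrite /il; have := l0 Ux; move: (lam x) => l l0' e.
by apply: (mulfI l0'); move: e => /eqP; rewrite addrC addr_eq0 => /eqP ->; field.
Qed.

Lemma fco_flat c x : U x -> fco E (flat g xi) c x = il x * (c == q3)%:R.
Proof.
move=> Ux; have := lfr_vertical mg cs FhF dF Ux; rewrite -scalemxAl -/E => /(congr1 (fun r : 'rV[R]_4 => r 0 c)).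
rewrite [LHS]mxE -fcoE [RHS]mxE eqxx /= => e; apply: (mulfI (l0 Ux)); rewrite e mulrA mulfV ?l0 // mul1r.
by [].
Qed.

Variables (b chi : 'rV[R]_3 -> 'rV[R]_3) (tau kap : 'rV[R]_3 -> R) (t : 'rV[R]_4 -> R).
Hypotheses (sb : smooth_mx V b) (sc : smooth_mx V chi) (stau : smooth V tau) (sk : smooth V kap)
  (Fchi : forall y, V y -> row t0 (F y) = chi y) (st : smooth U t)
  (dt : forall x, U x -> 'D_(xi x) t x = il x)
  (MB : forall x k, U x -> minimal_co g F pi xi lam k x + omega_co g F pi xi lam k x = fco F b k (pi x))
  (AD : forall x, U x -> adapted_at g F pi xi lam b tau kap x)
  (desc : descends U V pi xi).

(** The Weyl derivative that pairs with [dt]: the fibre part of the metric is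
    the square of [dt - t bchi + Phi]. *)
Definition bchi y : 'rV[R]_3 := b y - (2 * tau y) *: flat h chi y.

Lemma smooth_bchi : smooth_mx V bchi.
Proof.
apply: (smooth_addmx oV sb); apply: (smooth_oppmx oV).
exact: (smooth_scalemx oV (smoothZ 2 oV stau) (smooth_mulmx oV sc (met_smooth mh))).
Qed.

Lemma fco_bchi k y : V y -> fco F bchi k y = fco F b k y - 2 * tau y * (k == t0)%:R.
Proof.
move=> Vy; rewrite !fcoE /bchi mulmxBl -scalemxAl (chi_frame FhF Fchi Vy) [LHS]mxE [X in _ + X]mxE [X in - X]mxE.
by rewrite /bvec [delta_mx _ _ _ _]mxE eqxx.
Qed.

(** That the remainders are basic is the vanishing of their [xi]-derivatives,
    where [adapted_at] enters. *)
Lemma normal_form : exists (rho : 'rV[R]_3 -> R) (Phi : 'rV[R]_3 -> 'rV[R]_3),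
  [/\ smooth V rho, smooth_mx V Phi,
    forall x, U x -> il x * il x = rho (pi x) - 2 * t x * kap (pi x) &
    forall x, U x -> il x *: flat g xi x = grad t x - t x *: pull1 pi bchi x + pull1 pi Phi x].
Proof.
have piU x : U x -> V (pi x) by move=> Ux; exact: (piV cs Ux).
have sB f : smooth V f -> smooth U (fun z => f (pi z)) by exact: (smooth_basic oU cs).
have DB f x : smooth V f -> U x -> 'D_(xi x) (fun z => f (pi z)) x = 0 by exact: (derive_basic oU cs).
have fdt x : U x -> fd E q3 t x = il x * il x.
  move=> Ux; have := dt Ux; rewrite (derive_xi mg cs FhF dF st Ux) -/E /il; have := l0 Ux.
  by move: (fd _ _ _ _) (lam x) => f l l0' e; apply: (mulfI l0'); rewrite e; field.
have dil x : U x -> 'D_(xi x) il x = - kap (pi x).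
  move=> Ux; rewrite (derive_xi mg cs FhF dF sil Ux) -/E fd_il //; have [_ _ _ ->] := AD Ux.
  by rewrite mulrA mulfV ?l0 // mul1r.
have stk : smooth U (fun z => t z * kap (pi z)) by exact: (smoothM oU st (sB _ sk)).
have [rho [sr rE]] : exists rho, smooth V rho /\ forall x, U x -> il x * il x + 2 * (t x * kap (pi x)) = rho (pi x).
  apply: (desc (smoothD oU (smoothM oU sil sil) (smoothZ 2 oU stk))) => x Ux.
  rewrite (derive_add _ (smoothM oU sil sil) (smoothZ 2 oU stk) Ux) (derive_mul _ sil sil Ux).
  rewrite (derive_mul _ (smooth_cst _ _) stk Ux) derive_const (derive_mul _ st (sB _ sk) Ux) (DB _ _ sk Ux) dt // dil //.
  by move: (il x) (kap _) (t x) => *; ring.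
have sbc := smooth_bchi.
have sbk k : smooth V (fco F bchi k) by exact: (smooth_fco oV sF k sbc).
have sfdt k : smooth U (fd E (w k) t) by exact: (smooth_fd oU sE (w k) st).
(* The components of [Phi]. *)
have /choice [Q HQ] k : exists Q0, smooth V Q0 /\
    forall x, U x -> t x * fco F bchi k (pi x) - fd E (w k) t x = Q0 (pi x).
  apply: (desc (smoothB oU (smoothM oU st (sB _ (sbk k))) (sfdt k))) => x Ux.
  rewrite (derive_sub _ (smoothM oU st (sB _ (sbk k))) (sfdt k) Ux) (derive_mul _ st (sB _ (sbk k)) Ux) (DB _ _ (sbk k) Ux).
  rewrite mulr0 addr0 dt // (derive_xi mg cs FhF dF (sfdt k) Ux) -/E.
  have fg c : fco E (grad t) c = fd E c t by apply/funext => z; rewrite fcoE fdE.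
  have := frame_d1 oU sE uE q3 (w k) (smooth_grad st) Ux.
  rewrite (d1_grad oU st Ux) mulmx0 mul0mx mxE !fg sum4w big1 => [|c _]; last first.
    by rewrite (str_3w oU oV mg cs sF FhF dF c (w k) Ux) mulr0.
  have -> : fd E (w k) (fd E q3 t) x = 2 * (il x * il x) * scale_co g F pi xi lam (w k) x.
    rewrite (fd_ext E oU (w k) Ux fdt) (fdM E _ sil sil Ux) fd_il //.
    by move: (il x) (scale_co _ _ _ _ _ _ _) => *; ring.
  rewrite add0r fg fdt // -/(minimal_co g F pi xi lam k x) (fco_bchi k (piU _ Ux)) -MB //.
  have V0 : defect_co g F pi xi lam b k x = - tau (pi x) * (k == t0)%:R.
    by have [e0 e1 e2 _] := AD Ux; elim/ord3P: k; rewrite ?e0 ?e1 ?e2 /= ?mulr1 ?mulr0.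
  move: V0; rewrite /defect_co -MB // => V0 e.
  have -> : fd E q3 (fd E (w k) t) x = il x * il x * (2 * scale_co g F pi xi lam (w k) x - minimal_co g F pi xi lam k x).
    by move: e; gen_fd; move: (il x) (scale_co _ _ _ _ _ _ _) (minimal_co _ _ _ _ _ _ _) => *; lra.
  have -> : scale_co g F pi xi lam (w k) x = minimal_co g F pi xi lam k x + omega_co g F pi xi lam k x - omega_co g F pi xi lam k x / 2 - tau (pi x) * (k == t0)%:R.
    by move: V0; rewrite mulNr; move: (tau (pi x) * _) => P; gen_tt; lra.
  rewrite /il; have := l0 Ux; gen_deltas; gen_tt; move: (lam x) (tau _) => *; by field.
have sQ := smooth_base_component oV sF dF (fun k => (HQ k).1).
exists rho, (fun y => \sum_c Q c y *: cof F c y); split=> // [x Ux|x Ux].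
  by rewrite -rE //; move: (il x) (t x) (kap _) => *; ring.
have [p1 p3] := pull1_frame mg cs FhF dF bchi Ux.
have [s1 s3] := pull1_frame mg cs FhF dF (fun y => \sum_c Q c y *: cof F c y) Ux.
apply: (@fco_inj R U V g h F pi xi lam mg cs FhF dF (fun z => il z *: flat g xi z)
  (fun z => grad t z - t z *: pull1 pi bchi z + pull1 pi (fun y => \sum_c Q c y *: cof F c y) z) _ Ux) => c.
have L : fco E (fun z => grad t z - t z *: pull1 pi bchi z + pull1 pi (fun y => \sum_c Q c y *: cof F c y) z) c x =
    fd E c t x - t x * fco E (pull1 pi bchi) c x + fco E (pull1 pi (fun y => \sum_c Q c y *: cof F c y)) c x.
  rewrite fdE !fcoE mulmxDl mulmxBl -scalemxAl [LHS]mxE [X in X + _]mxE; congr (_ + _ + _).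
  by rewrite mxE [X in - X]mxE.
have L' : fco E (fun z => il z *: flat g xi z) c x = il x * fco E (flat g xi) c x.
  by rewrite !fcoE -scalemxAl mxE.
rewrite -/E L L' fco_flat //; move: c L L'; apply: ord4w => [k|] _ _.
  rewrite w3 p1 s1 (fco_base dF Q k (piU _ Ux)) -(HQ k).2 //.
  by rewrite !mulr0; move: (fd E (w k) t x) (t x * _) => p q; lra.
by rewrite p3 s3 fdt // eqxx mulr1 mulr0 subr0 addr0.
Qed.

Lemma normal_form_metric rho Phi x : U x -> il x * il x = rho (pi x) - 2 * t x * kap (pi x) ->
  il x *: flat g xi x = grad t x - t x *: pull1 pi bchi x + pull1 pi Phi x ->
  0 < gfactor pi t kap rho x /\ g x = gform pi t h b chi tau kap rho Phi x.
Proof.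
move=> Ux rE tE; have i0 : 0 < il x by rewrite invr_gt0 (csub_lam_pos cs).
rewrite /gform /gfactor -rE mulr_gt0 //; split=> //.
have -> : grad t x - t x *: pull1 pi b x + (2 * tau (pi x) * t x) *: pull1 pi (flat h chi) x + pull1 pi Phi x =
    il x *: flat g xi x.
  rewrite tE; congr (_ + _); rewrite -addrA; congr (_ + _).
  rewrite /pull1 /bchi mulmxBl -scalemxAl scalerBr opprB scalerA mulrC addrC.
  by congr (_ *: _ + _); rewrite mulrCA mulrA.
rewrite (csub_metric mg cs Ux); congr (_ *: _ + _).
  by rewrite /il expr2 invfM.
rewrite [(_ *: _)^T]linearZ /= -scalemxAl -scalemxAr !scalerA.
by rewrite -mulrA mulVf ?scale1r // mulf_neq0 // gt_eqF.
Qed.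

End NormalForm.

Section StraightFrame.
Context {R : realType}.
Variables (U : set 'rV[R]_4) (V : set 'rV[R]_3) (g : 'rV[R]_4 -> 'M[R]_4)
  (h : 'rV[R]_3 -> 'M[R]_3) (pi : 'rV[R]_4 -> 'rV[R]_3) (xi : 'rV[R]_4 -> 'rV[R]_4)
  (lam : 'rV[R]_4 -> R).
Hypotheses (oU : open U) (oV : open V) (mg : riemannian U g) (mh : riemannian V h)
  (cs : conformal_submersion U V g h pi xi lam).

Lemma open_preimage (W : set 'rV[R]_3) : open W -> open (U `&` [set x | W (pi x)]).
Proof.
move=> oW; rewrite openE => x [Ux /= Wx].
have cpi : {for x, continuous pi}.
  by apply: continuous_row => j; exact: (smooth_continuous (csub_smooth cs 0 j) Ux).
have nW : \forall z \near x, W (pi z) by apply: cpi; exact: open_nbhs_nbhs (conj oW Wx).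
have nU : \forall z \near x, U z by exact: open_nbhs_nbhs (conj oU Ux).
by apply: filterS2 nU nW => z Uz Wz; split.
Qed.

(** Near each point the submersion has connected fibres and a coordinate along
    them, and the base below has an oriented orthonormal frame. *)
Lemma straight_frame chi x0 : smooth_mx V chi -> (forall y, V y -> inner h y (chi y) (chi y) = 1) -> U x0 ->
  exists A V' F, [/\ [/\ open A, A x0, A `<=` U, open V' & V' `<=` V],
    conformal_submersion A V' g h pi xi lam,
    [/\ smooth_mx V' F, forall y, V' y -> F y *m h y *m (F y)^T = 1%:M,
      forall y, V' y -> 0 < \det (F y) & forall y, V' y -> row t0 (F y) = chi y],
    descends A V' pi xi &
    exists t, smooth A t /\ forall x, A x -> 'D_(xi x) t x = (lam x)^-1].
Proof.
move=> sc uc Ux0; have [W [F [oW Wx0 WV sF HF]]] := oriented_frame oV mh sc uc (piV cs Ux0).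
pose U1 := U `&` [set x | W (pi x)].
have oU1 : open U1 by exact: open_preimage.
have U1U : U1 `<=` U by move=> x [].
have spi : smooth_mx U1 pi by exact: smooth_mx_sub U1U (csub_smooth cs).
have [|x U1x|x U1x|v vJ|A [d [[oA Ax0 AU] [d0 pA] _ desc tt]]] := @straighten R 3 U1 pi xi x0 oU1 spi.
- by split.
- exact: (csub_xi_vert cs (U1U _ U1x)).
- apply/negP => /eqP x0'; have := csub_xi_unit cs (U1U _ U1x).
  by rewrite /inner x0' !mul0mx mxE => /eqP; rewrite eq_sym oner_eq0.
- by exists (inner g x0 v (xi x0)); exact: (vertical_xi mg cs Ux0 vJ).
have sil : smooth U1 (fun x => (lam x)^-1).
  apply: (smoothV oU1) => [x U1x|]; first by rewrite gt_eqF // (csub_lam_pos cs (U1U _ U1x)).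
  exact: smooth_sub U1U (csub_lam_smooth cs).
have [t [st dt]] := tt _ sil (smooth_mx_sub U1U (csub_xi_smooth cs)).
have VW : ball (pi x0) d `<=` W by rewrite -pA => y [x /AU [_ Wx] <-].
exists A, (ball (pi x0) d), F; split.
- split=> //; first by move=> x /AU [].
    exact: ball_open.
  by move=> y /VW /WV.
- apply: (conformal_submersion_sub _ pA cs); by move=> x /AU [].
- split; first exact: smooth_mx_sub VW sF.
  + by move=> y /VW /HF [].
  + by move=> y /VW /HF [].
  + by move=> y /VW /HF [].
- by move=> f sf df; have [f' [sf' E]] := desc f sf df; exists f'.
- by exists t.
Qed.

End StraightFrame.

Section Direct.
Context {R : realType}.
Variables (U : set 'rV[R]_4) (V : set 'rV[R]_3) (g J : 'rV[R]_4 -> 'M[R]_4)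
  (h : 'rV[R]_3 -> 'M[R]_3) (pi : 'rV[R]_4 -> 'rV[R]_3) (xi : 'rV[R]_4 -> 'rV[R]_4)
  (lam : 'rV[R]_4 -> R) (a : 'rV[R]_4 -> 'rV[R]_4).
Hypotheses (oU : open U) (oV : open V) (mg : riemannian U g) (mh : riemannian V h)
  (acs : antiselfdual_acs U g J) (sfk : scalar_flat_kahler U g J)
  (cs : conformal_submersion U V g h pi xi lam) (ma : minimal_weyl U g xi a)
  (SD : selfdual_xi U g a) (hol : holomorphic_xi U g J xi a).

(** Two frames are needed: an arbitrary one to obtain [D^B] and [chi], then
    one whose first leg is [chi]. *)
Theorem scalar_flat_kahler_quotient x0 : U x0 ->
  (forall i j, star4 g x0 (weyl_tensor g x0 i j) = weyl_tensor g x0 i j) /\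
  exists (U' : set 'rV[R]_4) (V' : set 'rV[R]_3) (b chi : 'rV[R]_3 -> 'rV[R]_3) (tau kap : 'rV[R]_3 -> R),
  [/\ [/\ open U', U' x0, U' `<=` U, open V' & pi @` U' = V'],
      quotient_weyl U' V' g pi xi lam a b /\ einstein_weyl V' h b,
      induces U' J pi xi lam chi /\ shear_free_geodesic V' h b chi tau kap,
      exists gam : 'rV[R]_4 -> R,
        [/\ affine_submersion U' V' g pi xi lam gam,
            exists t, affine_coordinate U' xi gam t &
            forall t, affine_coordinate U' xi gam t ->
              monopole_linear_part U' V' g h pi lam t (fun y => - 2 * kap y)]
    & exists (t : 'rV[R]_4 -> R) (rho : 'rV[R]_3 -> R) (Phi : 'rV[R]_3 -> 'rV[R]_3),
        [/\ smooth U' t, smooth V' rho, smooth_mx V' Phi &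
            forall x, U' x -> [/\ 0 < 'D_(xi x) t x, 0 < gfactor pi t kap rho x &
                                 g x = gform pi t h b chi tau kap rho Phi x]]].
Proof.
move=> Ux0; have [kJ scal0] := sfk.
(* Any unit field can lead the first frame; this one is a normalized coordinate
   field. *)
pose e0 : 'rV[R]_3 := bvec t0.
have e00 : e0 != 0.
  apply/negP => /eqP /(congr1 (fun r : 'rV[R]_3 => r 0 t0)); rewrite !mxE !eqxx => /eqP.
  by rewrite oner_eq0.
pose N y := inner h y e0 e0.
have Np y : V y -> 0 < N y by move=> Vy; exact: (met_pos mh Vy e00).
have sN : smooth V N.
  exact: (smooth_mulmx oV (smooth_mulmx oV (smooth_cstmx V e0) (met_smooth mh)) (smooth_trmx (smooth_cstmx V e0)) 0 0).
pose c0 y := (Num.sqrt (N y))^-1.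
have sc0 : smooth V c0.
  apply: (smoothV oV) => [y Vy|]; first by rewrite gt_eqF // sqrtr_gt0 Np.
  exact: (smooth_sqrt oV Np sN).
have schi0 : smooth_mx V (fun y => c0 y *: e0) by exact: (smooth_scalemx oV sc0 (smooth_cstmx V e0)).
have uchi0 y : V y -> inner h y (c0 y *: e0) (c0 y *: e0) = 1.
  move=> Vy; rewrite /inner linearZ /= -!scalemxAl -scalemxAr mxE [X in _ * X]mxE -/(inner h y e0 e0) -/(N y) /c0.
  have := Np y Vy => Ny; rewrite -{3}(sqr_sqrtr (ltW Ny)).
  have : Num.sqrt (N y) != 0 by rewrite gt_eqF // sqrtr_gt0.
  by move: (Num.sqrt _) => n n0; field.
have [A1 [V1 [F1 [[oA1 A1x A1U oV1 V1V] cs1 [sF1 FhF1 dF1 _] desc1 _]]]] := straight_frame oU oV mg mh cs schi0 uchi0 Ux0.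
have mg1 := riemannian_sub A1U mg; have mh1 := riemannian_sub V1V mh.
have ma1 := minimal_weyl_sub A1U ma; have acs1 := antiselfdual_acs_sub A1U acs.
have kJ1 := kahler_sub A1U kJ.
have SD1 : selfdual_xi A1 g a by move=> x /A1U; exact: SD.
have hol1 : holomorphic_xi A1 g J xi a by move=> x /A1U; exact: hol.
have [b [sb1 qb1]] := quotient_exists oA1 oV1 mg1 cs1 sF1 FhF1 dF1 desc1 ma1 SD1.
have [chi [sc1 uc1 ind1]] := congruence_exists oA1 oV1 mg1 cs1 sF1 FhF1 dF1 acs1 desc1 ma1 kJ1 hol1.
have [A [V' [F [[oA Ax AA1 oV' V'V1] cs' [sF FhF dF Fchi] desc [t [st dt]]]]]] :=
  straight_frame oA1 oV1 mg1 mh1 cs1 sc1 uc1 A1x.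
have AU : A `<=` U by move=> x /AA1 /A1U.
have mg' := riemannian_sub AA1 mg1; have mh' := riemannian_sub V'V1 mh1.
have ma' := minimal_weyl_sub AA1 ma1; have acs' := antiselfdual_acs_sub AA1 acs1.
have kJ' := kahler_sub AA1 kJ1.
have sb := smooth_mx_sub V'V1 sb1; have sc := smooth_mx_sub V'V1 sc1.
have qb : quotient_weyl A V' g pi xi lam a b by split=> // x /AA1; exact: qb1.2.
have ind : induces A J pi xi lam chi by move=> x /AA1; exact: ind1.
have MB := (quotient_weylP oA oV' mg' cs' sF FhF dF ma' sb).1 qb.
have JE := induces_adapted mg' cs' FhF dF acs' ind Fchi.
have KG x : A x -> _ := fun Ax => (adapted_kahlerP oA mg' cs' sF FhF dF (kahler_smooth kJ') JE Ax).1 (kahler_parallel kJ' Ax).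
pose tau y := fgam h F b t1 y t0 t1; pose kap y := fgam h F b t1 y t0 t2.
have SFG : forall y, V' y -> sfg_at h F b tau kap y by exact: (sfg_of_kahler oA oV' mg' mh' cs' sF FhF dF MB KG).
have stau : smooth V' tau by exact: (smooth_fgam oV' mh' sb sF (unitF dF)).
have skap : smooth V' kap by exact: (smooth_fgam oV' mh' sb sF (unitF dF)).
have AD x : A x -> adapted_at g F pi xi lam b tau kap x.
  by move=> Ax'; have [] := (adapted_of_sfg oA oV' mg' mh' cs' sF FhF dF Ax' (SFG _ (piV cs' Ax'))).1 (KG _ Ax').
have [rho [Phi [sr sP rE tE]]] := normal_form oA oV' mg' mh' cs' sF FhF dF sb sc stau skap Fchi st dt MB AD desc.
have sbc := smooth_bchi oV' mh' sb sc stau.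
split=> [i j|]; first exact: (adapted_selfdual oA mg' cs' sF FhF dF (kahler_smooth kJ') JE KG i j Ax (scal0 _ Ux0)).
exists A, V', b, chi, tau, kap; split.
- by split=> //; exact: csub_surj cs'.
- split=> // y Vy; have [x Ax' <-] : (pi @` A) y by rewrite (csub_surj cs').
  by apply/(scalar_flat_einstein_weylP oA oV' mg' mh' cs' sF FhF dF (kahler_smooth kJ') JE sb stau skap SFG MB KG Ax');
    exact: scal0 (AU _ Ax').
- split=> //; split=> // y Vy; first exact: uc1 (V'V1 _ Vy).
  exact: (sfg_frameP b oV' mh' sF FhF dF Fchi _ _ Vy).2 (SFG y Vy).
- exists (aff_gam pi lam kap); split.
  + exact: (affine_fibres oA oV' mg' cs' st skap sr sbc sP dt rE tE).
  + by exists t; exact: (affine_coordinate_t oA cs' st skap sr dt rE).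
  + by move=> t' ht'; exact: (affine_monopole oA oV' mg' cs' st skap sr sbc sP dt rE tE desc ht').
- exists t, rho, Phi; split=> // x Ax'.
  have [G1 G2] := normal_form_metric mg' cs' Ax' (rE _ Ax') (tE _ Ax').
  by split=> //; rewrite dt // invr_gt0 (csub_lam_pos cs').
Qed.

End Direct.

(** * The metric on the product of the base with a line *)

Section ProductMetric.
Context {R : realType}.

(** The differential of the projection. *)
Definition proj_mx : 'M[R]_(4, 3) := \matrix_(i, j) (i == w j)%:R.
Definition vert (c : R) : 'rV[R]_4 := c *: bvec q3.

Lemma mul_proj p (v : 'M[R]_(p, 4)) i c : (v *m proj_mx) i c = v i (w c).
Proof.
rewrite mxE sum4w !mxE eq_sym w3 mulr0 addr0 (bigD1 c) //= !mxE eqxx mulr1 big1 ?addr0 // => d dc.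
by rewrite mxE (inj_eq w_inj) (negbTE dc) mulr0.
Qed.

Lemma vertE c i : vert c 0 i = c * (i == q3)%:R.
Proof. by rewrite /vert /bvec 2!mxE eqxx. Qed.

Lemma vertical_proj c : vert c *m proj_mx = 0.
Proof. by apply/rowP => k; rewrite mul_proj vertE w3 mulr0 mxE. Qed.

Lemma proj_vertical (v : 'rV[R]_4) : v *m proj_mx = 0 -> v = vert (v 0 q3).
Proof.
move=> v0; apply/rowP; apply: ord4w => [c|]; rewrite vertE ?eqxx ?mulr1 // w3 mulr0.
by rewrite -mul_proj v0 mxE.
Qed.

Lemma ord_max4 : ord_max = q3 :> 'I_4. Proof. exact: val_inj. Qed.

Lemma smooth_base (M : set 'rV[R]_4) : smooth_mx M base.
Proof. by move=> i j; under eq_fun do rewrite mxE; exact: smooth_coord. Qed.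

Lemma jacobian_base (z : 'rV[R]_4) : 'J base z = proj_mx.
Proof.
apply/matrixP => i j; rewrite (@jacobian_smooth _ _ _ setT) //; last exact: smooth_base.
rewrite (_ : (fun z => base z 0 j) = fun z => z 0 (w j)); last first.
  by apply/funext => y; rewrite mxE; congr (y 0 _); exact: val_inj.
by rewrite pd_coord mxE.
Qed.

Lemma grad_fibre (z : 'rV[R]_4) : grad fibre_t z = vert 1.
Proof. by apply/rowP => i; rewrite [LHS]mxE pd_coord vertE mul1r ord_max4. Qed.

Variables (H : 'M[R]_3) (W : R) (be : 'rV[R]_3).
Hypotheses (W0 : 0 < W) (Hs : H^T = H) (Hp : forall v : 'rV[R]_3, v != 0 -> 0 < (v *m H *m v^T) 0 0).

(** [dt + be], with [dt] the last coordinate. *)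
Definition contact : 'rV[R]_4 := \row_i nth 0 [:: be 0 t0; be 0 t1; be 0 t2; 1] i.
Definition prod_metric : 'M[R]_4 := W *: (proj_mx *m H *m proj_mx^T) + W^-1 *: (contact^T *m contact).

Lemma contact_w c : contact 0 (w c) = be 0 c.
Proof. by rewrite mxE; elim/ord3P: c. Qed.

Lemma contact_split : contact = vert 1 + be *m proj_mx^T.
Proof.
apply/rowP; apply: ord4w => [c|].
  rewrite contact_w mxE vertE w3 mulr0 add0r mxE (bigD1 c) //= !mxE eqxx mulr1 big1 ?addr0 // => d dc.
  by rewrite !mxE (inj_eq w_inj) eq_sym (negbTE dc) mulr0.
rewrite mxE /= mxE vertE eqxx mulr1 mxE big1 ?addr0 // => c _.
by rewrite !mxE eq_sym w3 mulr0.
Qed.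

Lemma prod_quad (u v : 'rV[R]_4) : (u *m prod_metric *m v^T) 0 0 =
  W * (u *m proj_mx *m H *m (v *m proj_mx)^T) 0 0 + W^-1 * ((u *m contact^T) 0 0 * (v *m contact^T) 0 0).
Proof.
rewrite /prod_metric mulmxDr mulmxDl -!scalemxAr -!scalemxAl [LHS]mxE [X in X + _]mxE [X in _ + X]mxE; congr (_ * _ + _ * _).
  by rewrite trmx_mul !mulmxA.
have -> : (v *m contact^T) 0 0 = (contact *m v^T) 0 0 by rewrite -[in RHS](trmxK contact) -trmx_mul [RHS]mxE.
by rewrite mulmxA -(mulmxA (u *m _)) [LHS]mxE big_ord1.
Qed.

Lemma contact_vertical c : (vert c *m contact^T) 0 0 = c.
Proof.
rewrite mxE (bigD1 q3) //= vertE eqxx [_^T _ _]mxE [contact _ _]mxE /= !mulr1 big1 ?addr0 // => i i3.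
by rewrite vertE (negbTE i3) mulr0 mul0r.
Qed.

Lemma prod_pos (v : 'rV[R]_4) : v != 0 -> 0 < (v *m prod_metric *m v^T) 0 0.
Proof.
move=> v0; rewrite prod_quad; have [p0|p0] := eqVneq (v *m proj_mx) 0.
  have vE := proj_vertical p0; rewrite p0 !mul0mx mxE mulr0 add0r vE contact_vertical.
  have c0 : v 0 q3 != 0 by apply: contraNneq v0 => c0; rewrite vE c0 /vert scale0r.
  by rewrite mulr_gt0 ?invr_gt0 // -expr2 exprn_even_gt0.
apply: ltr_wpDr; last by rewrite mulr_gt0 ?Hp.
by apply: mulr_ge0; [rewrite invr_ge0 ltW | rewrite -expr2 sqr_ge0].
Qed.

Lemma prod_sym : prod_metric^T = prod_metric.
Proof. by rewrite /prod_metric linearD !linearZ /= !trmx_mul !trmxK Hs mulmxA. Qed.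

Lemma vertical_metric c : vert c *m prod_metric = (c / W) *: contact.
Proof.
rewrite /prod_metric mulmxDr -!scalemxAr !mulmxA vertical_proj !mul0mx scaler0 add0r.
have -> : vert c *m contact^T = c%:M by apply/rowP => j; rewrite !ord1 contact_vertical mxE eqxx mulr1n.
by rewrite mul_scalar_mx scalerA mulrC.
Qed.

Lemma prod_entries i j : prod_metric i j =
  W * nth 0 (nth [::] [:: [:: H t0 t0; H t0 t1; H t0 t2; 0]; [:: H t1 t0; H t1 t1; H t1 t2; 0];
    [:: H t2 t0; H t2 t1; H t2 t2; 0]; [:: 0; 0; 0; 0]] i) j + W^-1 * (contact 0 i * contact 0 j).
Proof.
have P3 c : proj_mx q3 c = 0 by rewrite mxE eq_sym w3.
have Pw c d : proj_mx (w c) d = (c == d)%:R by rewrite mxE (inj_eq w_inj).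
rewrite /prod_metric [LHS]mxE [X in X + _]mxE [X in _ + X]mxE; congr (_ * _ + _ * _); last first.
  by rewrite mxE big_ord1 [_^T _ _]mxE.
rewrite frame_entry; have row3 : row q3 proj_mx = 0 by apply/rowP => c; rewrite mxE P3 mxE.
have roww c : row (w c) proj_mx = bvec c by apply/rowP => d; rewrite mxE Pw /bvec mxE eqxx eq_sym.
have K c d : (row (w c) proj_mx *m H *m (row (w d) proj_mx)^T) 0 0 = H c d by rewrite !roww frame_entry_delta.
elim/ord4P: i; elim/ord4P: j; rewrite ?row3 ?mul0mx ?trmx0 ?mulmx0 -?w0 -?w1 -?w2 ?K //=; by rewrite mxE.
Qed.

Lemma det_prod : \det prod_metric = W ^+ 2 * \det H.
Proof.
rewrite det4E det3E !prod_entries /= ![contact _ _]mxE /=.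
move: (H t0 t0) (H t0 t1) (H t0 t2) (H t1 t0) (H t1 t1) (H t1 t2) (H t2 t0) (H t2 t1) (H t2 t2)
  (be 0 t0) (be 0 t1) (be 0 t2) => *; by field; rewrite gt_eqF.
Qed.

Lemma det_lift (u v x : 'rV[R]_4) (s : R) :
  \det (rows [:: u; v; x; vert s]) = s * \det (rows [:: u *m proj_mx; v *m proj_mx; x *m proj_mx]).
Proof.
rewrite det4E det3E ![rows _ _ _]mxE /= !vertE !mul_proj !w0 !w1 !w2 /=.
gen_entries; ring.
Qed.
End ProductMetric.

Section GibbonsHawkingForm.
Context {R : realType}.
Variables (V : set 'rV[R]_3) (h : 'rV[R]_3 -> 'M[R]_3)
  (b chi Phi : 'rV[R]_3 -> 'rV[R]_3) (tau kap rho : 'rV[R]_3 -> R) (M : set 'rV[R]_4).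
Hypotheses (oV : open V) (mh : riemannian V h) (sb : smooth_mx V b) (sc : smooth_mx V chi)
  (stau : smooth V tau) (sk : smooth V kap)
  (sr : smooth V rho) (sP : smooth_mx V Phi) (oM : open M) (bM : base @` M = V)
  (Wp : forall z, M z -> 0 < gfactor base fibre_t kap rho z).

Let W := gfactor base fibre_t kap rho.
Let g := gform base fibre_t h b chi tau kap rho Phi.
Let xi (z : 'rV[R]_4) : 'rV[R]_4 := Num.sqrt (W z) *: bvec ord_max.
Let lam z := (Num.sqrt (W z))^-1.
Let cb z : 'rV[R]_3 := Phi (base z) - fibre_t z *: bchi h b chi tau (base z).

Lemma baseV z : M z -> V (base z). Proof. by move=> Mz; rewrite -bM; exists z. Qed.

Lemma contactE z : grad fibre_t z - fibre_t z *: pull1 base (bchi h b chi tau) z + pull1 base Phi z = contact (cb z).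
Proof.
rewrite grad_fibre contact_split /pull1 jacobian_base -addrA; congr (_ + _).
by rewrite scalemxAl addrC -mulmxBl.
Qed.

Lemma gformE z : g z = prod_metric (h (base z)) (W z) (cb z).
Proof.
rewrite /g /gform /prod_metric -/(W z) -contactE /pull2 jacobian_base.
have -> : grad fibre_t z - fibre_t z *: pull1 base b z + (2 * tau (base z) * fibre_t z) *: pull1 base (flat h chi) z
    + pull1 base Phi z = grad fibre_t z - fibre_t z *: pull1 base (bchi h b chi tau) z + pull1 base Phi z; last by [].
congr (_ + _); rewrite -addrA; congr (_ + _); rewrite /pull1 /bchi mulmxBl -scalemxAl scalerBr opprB scalerA addrC.
by congr (_ *: _ - _); rewrite mulrC.
Qed.

Lemma smooth_gfactor : smooth M W.
Proof.
have sB f : smooth V f -> smooth M (fun z => f (base z)) by exact: (smooth_chain oM baseV (@smooth_base R M)).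
apply: (smoothB oM (sB _ sr)); apply: (smoothM oM _ (sB _ sk)).
exact: (smoothZ 2 oM (smooth_coord _ _)).
Qed.

Lemma xiE z : xi z = vert (Num.sqrt (W z)).
Proof. by rewrite /xi ord_max4. Qed.

Let sW0 z : M z -> 0 < Num.sqrt (W z). Proof. by move=> Mz; rewrite sqrtr_gt0 Wp. Qed.

Lemma gfactor_sqrt z : M z -> Num.sqrt (W z) ^+ 2 = W z.
Proof. by move=> Mz; exact: sqr_sqrtr (ltW (Wp Mz)). Qed.

Lemma flat_xi z : M z -> flat g xi z = lam z *: contact (cb z).
Proof.
move=> Mz; rewrite /flat gformE xiE vertical_metric; congr (_ *: _).
rewrite /lam; have := gfactor_sqrt Mz; have := sW0 Mz; move: (Num.sqrt (W z)) => s s0 <-.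
by rewrite expr2 invfM mulrA mulfV ?gt_eqF // mul1r.
Qed.

Lemma gform_riemannian : riemannian M g.
Proof.
have sB p q (A : 'rV[R]_3 -> 'M[R]_(p, q)) : smooth_mx V A -> smooth_mx M (fun z => A (base z)).
  exact: (smooth_chain_mx oM baseV (@smooth_base R M)).
split=> [|z Mz|z Mz v v0]; last first.
- by rewrite /inner gformE; apply: prod_pos v0; [exact: Wp | move=> u u0; exact: (met_pos mh (baseV Mz) u0)].
- by rewrite gformE; apply: prod_sym; exact: (met_sym mh (baseV Mz)).
have scb : smooth_mx M cb.
  apply: (smooth_addmx oM (sB _ _ _ sP)); apply: (smooth_oppmx oM).
  exact: (smooth_scalemx oM (smooth_coord _ _) (sB _ _ _ (smooth_bchi oV mh sb sc stau))).
have sct : smooth_mx M (fun z => contact (cb z)).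
  apply: (smooth_mx_ext oM (A := fun z => vert 1 + cb z *m proj_mx^T)) => [z _|]; first by rewrite contact_split.
  exact: (smooth_addmx oM (smooth_cstmx M _) (smooth_mulmx oM scb (smooth_cstmx M _))).
have : smooth_mx M (fun z => prod_metric (h (base z)) (W z) (cb z)).
  apply: (smooth_addmx oM).
    apply: (smooth_scalemx oM smooth_gfactor); apply: (smooth_mulmx oM _ (smooth_cstmx M _)).
    exact: (smooth_mulmx oM (smooth_cstmx M _) (sB _ _ _ (met_smooth mh))).
  apply: (smooth_scalemx oM); first by apply: (smoothV oM _ smooth_gfactor) => z Mz; rewrite gt_eqF // Wp.
  exact: (smooth_mulmx oM (smooth_trmx sct) sct).
by apply: (smooth_mx_ext oM) => z _; rewrite gformE.
Qed.

(** The contact form is dual to the vertical coordinate field, so the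
    horizontal space is its kernel. *)
Lemma gform_submersion : conformal_submersion M V g h base xi lam.
Proof.
have ss : smooth M (fun z => Num.sqrt (W z)) by exact: (smooth_sqrt oM Wp smooth_gfactor).
have fx z u : M z -> inner g z u (xi z) = lam z * (u *m (contact (cb z))^T) 0 0.
  move=> Mz; have mg := gform_riemannian.
  rewrite /inner -[LHS]/((u *m g z *m (xi z)^T) 0 0) -mulmxA.
  have -> : g z *m (xi z)^T = (flat g xi z)^T by rewrite /flat trmx_mul (met_sym mg Mz).
  by rewrite flat_xi // linearZ /= -scalemxAr mxE.
split=> //.
- exact: smooth_base.
- move=> z Mz; rewrite jacobian_base; apply/row_fullP; exists proj_mx^T.
  by apply/matrixP => c d; rewrite mul_proj !mxE (inj_eq w_inj) eq_sym.
- exact: (smooth_scalemx oM ss (smooth_cstmx M _)).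
- by move=> z Mz; rewrite fx // xiE contact_vertical mulVf // gt_eqF // sW0.
- by move=> z Mz; rewrite jacobian_base xiE vertical_proj.
- by apply: (smoothV oM _ ss) => z Mz; rewrite gt_eqF // sW0.
- by move=> z Mz; rewrite invr_gt0 sW0.
- move=> z Mz u v /eqP; rewrite !fx // mulf_eq0 invr_eq0 gt_eqF ?sW0 //= => /eqP u0 /eqP.
  rewrite mulf_eq0 invr_eq0 gt_eqF ?sW0 //= => /eqP v0.
  rewrite /inner gformE prod_quad u0 mul0r mulr0 addr0 jacobian_base mulrA /lam.
  have -> : (Num.sqrt (W z))^-1 ^+ 2 * W z = 1.
    by rewrite -{2}(gfactor_sqrt Mz) -exprMn mulVf ?expr1n // gt_eqF // sW0.
  by rewrite mul1r.
- move=> z Mz u v x; rewrite /vol jacobian_base xiE -!/(rows _) det_lift gformE det_prod ?Wp //.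
  have s0 := sW0 Mz; rewrite sqrtrM ?sqr_ge0 // sqrtr_sqr gtr0_norm ?Wp // /lam.
  move: s0 (gfactor_sqrt Mz) (Num.sqrt (\det (h (base z)))) (\det (rows [:: _; _; _])); move: (Num.sqrt (W z)) => s s0 <- d e.
  by field; rewrite gt_eqF.
Qed.

End GibbonsHawkingForm.

(** * The Kaehler condition as a monopole equation *)

Section ContactStructure.
Context {R : realType}.
Variables (U : set 'rV[R]_4) (V : set 'rV[R]_3) (g : 'rV[R]_4 -> 'M[R]_4)
  (h F : 'rV[R]_3 -> 'M[R]_3) (pi : 'rV[R]_4 -> 'rV[R]_3) (xi : 'rV[R]_4 -> 'rV[R]_4)
  (lam : 'rV[R]_4 -> R).
Hypotheses (oU : open U) (oV : open V) (mg : riemannian U g) (mh : riemannian V h)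
  (cs : conformal_submersion U V g h pi xi lam) (sF : smooth_mx V F)
  (FhF : forall y, V y -> F y *m h y *m (F y)^T = 1%:M) (dF : forall y, V y -> 0 < \det (F y)).
Let E := lfr g F pi xi lam.
Let sE : smooth_mx U E := smooth_lfr oU mg cs sF FhF dF.
Let uE x : U x -> E x \in unitmx. Proof. by move=> Ux; exact: (unit_lfr mg cs FhF dF Ux). Qed.
Let l0 x : U x -> lam x != 0. Proof. by move=> Ux; rewrite gt_eqF // (csub_lam_pos cs). Qed.
Let il x := (lam x)^-1.
Let sil : smooth U il. Proof. exact: (smoothV oU l0 (csub_lam_smooth cs)). Qed.
Let piU x : U x -> V (pi x). Proof. by move=> Ux; exact: (piV cs Ux). Qed.

Variables (kap rho : 'rV[R]_3 -> R) (be Phi : 'rV[R]_3 -> 'rV[R]_3) (t : 'rV[R]_4 -> R).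
Hypotheses (sk : smooth V kap) (sr : smooth V rho) (sbe : smooth_mx V be) (sP : smooth_mx V Phi) (st : smooth U t)
  (lamE : forall x, U x -> il x * il x = rho (pi x) - 2 * t x * kap (pi x))
  (thE : forall x, U x -> il x *: flat g xi x = grad t x - t x *: pull1 pi be x + pull1 pi Phi x).

Let th x := il x *: flat g xi x.
Let sth : smooth_mx U th.
Proof. exact: (smooth_scalemx oU sil (smooth_flat_xi oU mg cs)). Qed.

Lemma contact_frame c x : U x -> fco E th c x = il x * il x * (c == q3)%:R.
Proof.
move=> Ux; have -> : fco E th c x = il x * fco E (flat g xi) c x by rewrite !fcoE /th -scalemxAl mxE.
by rewrite (fco_flat mg cs FhF dF c Ux) mulrA.
Qed.

Lemma fibre_frame x : U x -> fd E q3 t x = il x * il x /\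
  forall k, fd E (w k) t x = t x * fco F be k (pi x) - fco F Phi k (pi x).
Proof.
move=> Ux; have L c : fco E th c x = fd E c t x - t x * fco E (pull1 pi be) c x + fco E (pull1 pi Phi) c x.
  rewrite fdE !fcoE /th thE // mulmxDl mulmxBl -scalemxAl [LHS]mxE [X in X + _]mxE; congr (_ + _ + _).
  by rewrite mxE [X in - X]mxE.
have [p1 p3] := pull1_frame mg cs FhF dF be Ux; have [s1 s3] := pull1_frame mg cs FhF dF Phi Ux.
split=> [|k].
  by have := L q3; rewrite contact_frame // eqxx mulr1 p3 s3 mulr0 subr0 addr0.
have := L (w k); rewrite contact_frame // w3 mulr0 p1 s1.
by move: (fd E (w k) t x) (t x * fco F be k (pi x)) (fco F Phi k (pi x)) => p q r; lra.
Qed.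

Lemma conformal_frame c x : U x -> 2 * (il x * il x) * scale_co g F pi xi lam c x =
  fd E c (fun z => rho (pi z)) x - 2 * (fd E c t x * kap (pi x) + t x * fd E c (fun z => kap (pi z)) x).
Proof.
move=> Ux; have sB f : smooth V f -> smooth U (fun z => f (pi z)) by exact: (smooth_basic oU cs).
have stk : smooth U (fun z => t z * kap (pi z)) by exact: (smoothM oU st (sB _ sk)).
have : fd E c (fun z => il z * il z) x = fd E c (fun z => rho (pi z) - 2 * (t z * kap (pi z))) x.
  by apply: (fd_ext E oU c Ux) => z Uz; rewrite lamE // mulrA.
rewrite (fdM E c sil sil Ux) (fdB E oU c (sB _ sr) (smoothZ 2 oU stk) Ux) (fdZ E c 2 stk Ux) (fdM E c st (sB _ sk) Ux).
rewrite (fd_il F oU cs c Ux) -/(il x) => <-; move: (il x) (scale_co _ _ _ _ _ _ _) => *; ring.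
Qed.

Lemma contact_d x j k : U x ->
  f2co E th (w j) (w k) x = fco F Phi j (pi x) * fco F be k (pi x) - fco F be j (pi x) * fco F Phi k (pi x)
    - t x * f2co F be j k (pi x) + f2co F Phi j k (pi x) /\
  f2co E th q3 (w k) x = - (il x * il x * fco F be k (pi x)).
Proof.
move=> Ux; have sB1 c : smooth_mx V c -> smooth_mx U (pull1 pi c) by exact: (smooth_pull1 oU piU (csub_smooth cs)).
have d2 : d1 th x = - (wedge (grad t x) (pull1 pi be x) + t x *: pull2 pi (d1 be) x) + pull2 pi (d1 Phi) x.
  rewrite (d1_ext oU Ux (be := fun z => grad t z - t z *: pull1 pi be z + pull1 pi Phi z)) => [|z Uz]; last exact: thE.
  have stb := smooth_scalemx oU st (sB1 _ sbe).
  rewrite (d1_add (smooth_addmx oU (smooth_grad st) (smooth_oppmx oU stb)) (sB1 _ sP) Ux).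
  rewrite (d1_sub oU (smooth_grad st) stb Ux) (d1_grad oU st Ux) sub0r (d1_scale st (sB1 _ sbe) Ux).
  by rewrite !(d1_pull1 oU piU (csub_smooth cs) _ Ux).
have K p q : f2co E th p q x = - (fd E p t x * fco E (pull1 pi be) q x - fco E (pull1 pi be) p x * fd E q t x
    + t x * (E x *m pull2 pi (d1 be) x *m (E x)^T) p q) + (E x *m pull2 pi (d1 Phi) x *m (E x)^T) p q.
  rewrite /f2co d2 mulmxDr mulmxDl mulmxN mulNmx mulmxDr mulmxDl -scalemxAr -scalemxAl wedge_conj.
  have mxq (A B C : 'M[R]_4) u : (- (A + u *: B) + C) p q = - (A p q + u * B p q) + C p q by rewrite !mxE.
  by rewrite mxq wedgeE -!fdE -!fcoE.
have [p1 p3] := pull1_frame mg cs FhF dF be Ux; have [f3 fk] := fibre_frame Ux.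
have [b1 [b2 b3]] := pull_frame mg cs FhF dF (d1 be (pi x)) Ux.
have [c1 [c2 c3]] := pull_frame mg cs FhF dF (d1 Phi (pi x)) Ux.
have B1 : (E x *m pull2 pi (d1 be) x *m (E x)^T) (w j) (w k) = f2co F be j k (pi x) by exact: b1.
have B3 : (E x *m pull2 pi (d1 be) x *m (E x)^T) q3 (w k) = 0 by exact: b3.
have C1 : (E x *m pull2 pi (d1 Phi) x *m (E x)^T) (w j) (w k) = f2co F Phi j k (pi x) by exact: c1.
have C3 : (E x *m pull2 pi (d1 Phi) x *m (E x)^T) q3 (w k) = 0 by exact: c3.
have Pw c : fco E (pull1 pi be) (w c) x = fco F be c (pi x) by exact: p1.
have P3 : fco E (pull1 pi be) q3 x = 0 by exact: p3.
split; last first.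
  have A (a1 a2 a3 a4 T u v l f : R) : a1 = l * l -> a2 = f -> a3 = 0 -> u = 0 -> v = 0 ->
      - (a1 * a2 - a3 * a4 + T * u) + v = - (l * l * f) by move=> -> -> -> -> ->; ring.
  exact: (etrans (K q3 (w k)) (A _ _ _ _ _ _ _ _ _ f3 (Pw k) P3 B3 C3)).
have A (a1 a2 a3 a4 T u v bj bk Pj Pk u' v' : R) : a1 = T * bj - Pj -> a2 = bk -> a3 = bj -> a4 = T * bk - Pk ->
    u = u' -> v = v' -> - (a1 * a2 - a3 * a4 + T * u) + v = Pj * bk - bj * Pk - T * u' + v' by move=> -> -> -> -> -> ->; ring.
exact: (etrans (K (w j) (w k)) (A _ _ _ _ _ _ _ _ _ _ _ _ _ (fk j) (Pw k) (Pw j) (fk k) B1 C1)).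
Qed.

(** Differentiate the factor [lam^-2 = rho - 2 t kap], and compare [d] of the
    contact form [lam^-2 e] with that of [dt - t be + Phi]. *)
Lemma structure_of_contact x : U x ->
  [/\ scale_co g F pi xi lam q3 x = - kap (pi x),
      forall k, minimal_co g F pi xi lam k x = 2 * scale_co g F pi xi lam (w k) x - fco F be k (pi x) &
      forall j k, il x * il x * fstr E q3 x (w j) (w k) = f2co E th (w j) (w k) x].
Proof.
move=> Ux; have i0 : il x * il x != 0 by rewrite mulf_neq0 // invr_eq0 l0.
have sB f : smooth V f -> smooth U (fun z => f (pi z)) by exact: (smooth_basic oU cs).
have [k1 k3] := fd_pull mg cs FhF dF sk Ux; have [r1 r3] := fd_pull mg cs FhF dF sr Ux.
have [f3 fk] := fibre_frame Ux.
have D c d : f2co E th c d x = (d == q3)%:R * (2 * (il x * il x) * scale_co g F pi xi lam c x)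
    - (c == q3)%:R * (2 * (il x * il x) * scale_co g F pi xi lam d x) + il x * il x * fstr E q3 x c d.
  have F1 e e' : fd E e (fco E th e') x = (e' == q3)%:R * (2 * (il x * il x) * scale_co g F pi xi lam e x).
    rewrite (fd_ext E oU e Ux (h := fun z => (e' == q3)%:R * (il z * il z))) => [|z Uz]; last by rewrite contact_frame // mulrC.
    rewrite (fdZ E e _ (smoothM oU sil sil) Ux) (fdM E e sil sil Ux) (fd_il F oU cs e Ux); congr (_ * _).
    by rewrite -/(il x); move: (il x) (scale_co _ _ _ _ _ _ _) => *; ring.
  rewrite /f2co (frame_d1 oU sE uE c d sth Ux) !F1; congr (_ + _).
  rewrite (bigD1 q3) //= contact_frame // eqxx mulr1 big1 ?addr0 // => e e3.
  by rewrite contact_frame // (negbTE e3) mulr0 mul0r.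
split=> [|k|j k]; last by rewrite D !w3 !mul0r subrr add0r.
  have := conformal_frame q3 Ux; rewrite r3 k3 f3 mulr0 addr0 sub0r => e.
  by apply: (mulfI i0); move: e; move: (il x * il x) (scale_co _ _ _ _ _ _ _) (kap _) => *; lra.
have [_ ] := contact_d k k Ux; rewrite D w3 eqxx mul0r mul1r sub0r -/(minimal_co g F pi xi lam k x) => e.
apply: (mulfI i0); move: e; move: (il x * il x) (scale_co _ _ _ _ _ _ _) (minimal_co _ _ _ _ _ _ _) (fco _ _ _ _) => a u m f e.
by move: e; rewrite mulrBr; nra.
Qed.

End ContactStructure.

Section MonopoleEquation.
Context {R : realType}.
Variables (V : set 'rV[R]_3) (h F : 'rV[R]_3 -> 'M[R]_3) (b chi Phi : 'rV[R]_3 -> 'rV[R]_3)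
  (tau kap rho : 'rV[R]_3 -> R).
Hypotheses (oV : open V) (mh : riemannian V h) (sF : smooth_mx V F)
  (FhF : forall y, V y -> F y *m h y *m (F y)^T = 1%:M) (dF : forall y, V y -> 0 < \det (F y))
  (Fchi : forall y, V y -> row t0 (F y) = chi y)
  (sb : smooth_mx V b) (sc : smooth_mx V chi) (stau : smooth V tau) (sk : smooth V kap).

(** The component of the monopole equation dual to the leg [k], for [i j] the
    complementary legs in cyclic order. *)
Definition monopole_co (k i j : 'I_3) y : R :=
  fd F k rho y - 2 * rho y * fco F b k y + 2 * tau y * rho y * (k == t0)%:R + 2 * kap y * fco F Phi k y
  - (f2co F Phi i j y - (fco F (bchi h b chi tau) i y * fco F Phi j y - fco F (bchi h b chi tau) j y * fco F Phi i y)).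

Lemma eps3_swap i j k : eps3 i k j = - eps3 i j k :> R.
Proof. by rewrite !eps3E !det3E !mxE /=; gen_deltas; ring. Qed.

Lemma monopole_frameP y : V y ->
  star3 h y (covd_fun (-2) b rho y + (2 * tau y * rho y) *: flat h chi y + (2 * kap y) *: Phi y)
  = twisted_d (-1) b Phi y + (2 * tau y) *: wedge (flat h chi y) (Phi y) <->
  [/\ monopole_co t0 t1 t2 y = 0, monopole_co t1 t2 t0 y = 0 & monopole_co t2 t0 t1 y = 0].
Proof.
move=> Vy; set al := (_ + _ + (2 * kap y) *: _); set Rm := twisted_d _ _ _ _ + _.
have uT : (F y)^T \in unitmx by rewrite unitmx_tr (unitF dF).
have chE e : (flat h chi y *m (F y)^T) 0 e = (e == t0)%:R.
  by rewrite (chi_frame FhF Fchi Vy) /bvec mxE eqxx.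
have aE e : (al *m (F y)^T) 0 e = fd F e rho y - 2 * rho y * fco F b e y + 2 * tau y * rho y * (e == t0)%:R + 2 * kap y * fco F Phi e y.
  rewrite /al /covd_fun !mulmxDl -!scalemxAl [LHS]mxE [X in X + _]mxE [X in X + _ + _]mxE -fdE.
  rewrite [X in _ + X + _ + _]mxE [X in _ + _ + X + _]mxE [X in _ + _ + _ + X]mxE chE -!fcoE.
  by move: (fd _ _ _ _) (fco _ _ _ _) (fco _ _ _ _) (rho y) (tau y) (kap y) => *; gen_deltas; ring.
have RE c d : (F y *m Rm *m (F y)^T) c d = f2co F Phi c d y - (fco F (bchi h b chi tau) c y * fco F Phi d y - fco F (bchi h b chi tau) d y * fco F Phi c y).
  rewrite /Rm /twisted_d !mulmxDr !mulmxDl -!scalemxAr -!scalemxAl !wedge_conj [LHS]mxE [X in X + _]mxE.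
  rewrite [X in _ + X + _]mxE [X in _ + _ + X]mxE !wedgeE !chE -!fcoE !(fco_bchi FhF b tau Fchi _ Vy) /f2co.
  move: (fco F b c y) (fco F b d y) (fco F Phi c y) (fco F Phi d y) ((F y *m d1 Phi y *m (F y)^T) c d) (tau y) => *.
  by case: (c == t0); case: (d == t0) => /=; ring.
have LE c d : (F y *m star3 h y al *m (F y)^T) c d = \sum_e (al *m (F y)^T) 0 e * eps3 e c d.
  exact: star3_frame (FhF Vy) (dF Vy).
have iff1 : star3 h y al = Rm <-> forall c d, (F y *m star3 h y al *m (F y)^T) c d = (F y *m Rm *m (F y)^T) c d.
  split=> [-> //|e]; apply: (can_inj (mulKmx (unitF dF Vy))); apply: (can_inj (mulmxK uT)).
  by apply/matrixP => c d; exact: e.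
have Lsk c d : (F y *m star3 h y al *m (F y)^T) d c = - (F y *m star3 h y al *m (F y)^T) c d.
  by rewrite !LE -sumrN; apply: eq_bigr => e _; rewrite eps3_swap mulrN.
have Rsk c d : (F y *m Rm *m (F y)^T) d c = - (F y *m Rm *m (F y)^T) c d.
  rewrite !RE; have -> : f2co F Phi d c y = - f2co F Phi c d y.
    have : (F y *m d1 Phi y *m (F y)^T)^T = - (F y *m d1 Phi y *m (F y)^T).
      by rewrite !trmx_mul trmxK d1_anti mulNmx mulmxN mulmxA.
    by move=> /(congr1 (fun A : 'M[R]_3 => A c d)); rewrite [LHS]mxE [RHS]mxE.
  by move: (f2co _ _ _ _ _); gen_fco; move=> *; ring.
have e12 e : eps3 e t1 t2 = (e == t0)%:R :> R by elim/ord3P: e; rewrite eps3E det3E !mxE /=; ring.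
have e20 e : eps3 e t2 t0 = (e == t1)%:R :> R by elim/ord3P: e; rewrite eps3E det3E !mxE /=; ring.
have e01 e : eps3 e t0 t1 = (e == t2)%:R :> R by elim/ord3P: e; rewrite eps3E det3E !mxE /=; ring.
have L12 : (F y *m star3 h y al *m (F y)^T) t1 t2 = (al *m (F y)^T) 0 t0.
  by rewrite LE sum3 !e12 /= mulr1 !mulr0 !addr0.
have L20 : (F y *m star3 h y al *m (F y)^T) t2 t0 = (al *m (F y)^T) 0 t1.
  by rewrite LE sum3 !e20 /= mulr1 !mulr0 addr0 add0r.
have L01 : (F y *m star3 h y al *m (F y)^T) t0 t1 = (al *m (F y)^T) 0 t2.
  by rewrite LE sum3 !e01 /= mulr1 !mulr0 !add0r.
rewrite iff1 /monopole_co -!aE -!RE -L12 -L20 -L01; move: Lsk Rsk.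
move: (F y *m star3 h y al *m (F y)^T) (F y *m Rm *m (F y)^T) => A B As Bs.
split=> [e|[/subr0_eq e0 /subr0_eq e1 /subr0_eq e2] c d]; first by rewrite !e !subrr.
have dg (C : 'M[R]_3) (Cs : forall c d, C d c = - C c d) i : C i i = 0.
  by have := Cs i i; move: (C i i) => u; lra.
by elim/ord3P: c; elim/ord3P: d; rewrite ?(dg _ As) ?(dg _ Bs) ?e0 ?e1 ?e2 // As Bs ?e0 ?e1 ?e2.
Qed.

Hypothesis SFG : forall y, V y -> sfg_at h F b tau kap y.

(** On an Einstein-Weyl space [bchi] is a connection whose curvature is dual
    to twice the derivative of the twist: the terms with the derivative of
    [tau] in [base_faraday] cancel. *)
Lemma bchi_curvature y : V y -> 
  [/\ weyl_d F b tau t0 y = dnu h F b kap t1 t2 y, weyl_d F b tau t1 y = dnu h F b kap t2 t0 y &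
      weyl_d F b tau t2 y = dnu h F b kap t0 t1 y] ->
  [/\ f2co F (bchi h b chi tau) t1 t2 y = 2 * weyl_d F b kap t0 y, f2co F (bchi h b chi tau) t2 t0 y = 2 * weyl_d F b kap t1 y &
      f2co F (bchi h b chi tau) t0 t1 y = 2 * weyl_d F b kap t2 y].
Proof.
move=> Vy EW; have [f12 f20 f01] := base_faraday oV mh sb sF FhF dF sk SFG Vy EW.
have uF := unitF dF; have [[s1 s2 s3 s4] [s5 s6]] := SFG Vy.
have off c := base_off b oV mh sF FhF dF c Vy.
have dg c p := base_diag b oV mh sF FhF dF c p Vy.
have sbc := smooth_bchi oV mh sb sc stau.
have sfb c : smooth V (fco F b c) by exact: (smooth_fco oV sF c sb).
have std (c : 'I_3) : smooth V (fun z => 2 * tau z * (c == t0)%:R).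
  by apply: (smoothM oV (smoothZ 2 oV stau)); exact: smooth_cst.
have fb c d : fd F c (fco F (bchi h b chi tau) d) y = fd F c (fco F b d) y - 2 * fd F c tau y * (d == t0)%:R.
  rewrite (fd_ext F oV c Vy (h := fun z => fco F b d z - 2 * tau z * (d == t0)%:R)) => [|z Vz]; last by rewrite (fco_bchi FhF b tau Fchi d Vz).
  rewrite (fdB F oV c (sfb d) (std d) Vy) (fdM F c (smoothZ 2 oV stau) (smooth_cst V ((d == t0)%:R : R)) Vy) fd_cst mulr0 addr0.
  by rewrite (fdZ F c 2 stau Vy).
have K c d : f2co F (bchi h b chi tau) c d y = f2co F b c d y -
    2 * (fd F c tau y * (d == t0)%:R - fd F d tau y * (c == t0)%:R + tau y * fstr F t0 y c d).
  rewrite /f2co (frame_d1 oV sF uF c d sbc Vy) (frame_d1 oV sF uF c d sb Vy) !fb !sum3 !(fco_bchi FhF b tau Fchi _ Vy) /=.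
  by gen_fd; gen_fco; gen_entries; gen_deltas; move: (tau y) => *; ring.
rewrite !K f12 f20 f01 !(base_str b oV mh sF dF _ _ _ Vy) /weyl_d.
have [n0 p0 r0] := off t0; have [n1 p1 r1] := off t1; have [n2 p2 r2] := off t2.
rewrite !n0 ?p0 ?r0 ?n1 ?p1 ?r1 ?n2 ?p2 ?r2 !dg s1 s2 s4 s5 /=.
gen_fd; gen_fco; move: (tau y) (kap y) => *; split; ring.
Qed.
End MonopoleEquation.

Section KahlerMonopole.
Context {R : realType}.
Variables (U : set 'rV[R]_4) (V : set 'rV[R]_3) (g : 'rV[R]_4 -> 'M[R]_4)
  (h F : 'rV[R]_3 -> 'M[R]_3) (pi : 'rV[R]_4 -> 'rV[R]_3) (xi : 'rV[R]_4 -> 'rV[R]_4)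
  (lam : 'rV[R]_4 -> R).
Hypotheses (oU : open U) (oV : open V) (mg : riemannian U g) (mh : riemannian V h)
  (cs : conformal_submersion U V g h pi xi lam) (sF : smooth_mx V F)
  (FhF : forall y, V y -> F y *m h y *m (F y)^T = 1%:M) (dF : forall y, V y -> 0 < \det (F y)).
Variables (b chi Phi : 'rV[R]_3 -> 'rV[R]_3) (tau kap rho : 'rV[R]_3 -> R) (t : 'rV[R]_4 -> R).
Hypotheses (Fchi : forall y, V y -> row t0 (F y) = chi y)
  (sb : smooth_mx V b) (sc : smooth_mx V chi) (stau : smooth V tau) (sk : smooth V kap)
  (sr : smooth V rho) (sP : smooth_mx V Phi) (st : smooth U t)
  (SFG : forall y, V y -> sfg_at h F b tau kap y) (EW : einstein_weyl V h b)
  (lamE : forall x, U x -> (lam x)^-1 * (lam x)^-1 = rho (pi x) - 2 * t x * kap (pi x))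
  (thE : forall x, U x -> (lam x)^-1 *: flat g xi x =
     grad t x - t x *: pull1 pi (bchi h b chi tau) x + pull1 pi Phi x).
Let E := lfr g F pi xi lam.
Let l0 x : U x -> lam x != 0. Proof. by move=> Ux; rewrite gt_eqF // (csub_lam_pos cs). Qed.

Lemma base_einstein y : V y -> [/\ weyl_d F b tau t0 y = dnu h F b kap t1 t2 y,
  weyl_d F b tau t1 y = dnu h F b kap t2 t0 y & weyl_d F b tau t2 y = dnu h F b kap t0 t1 y].
Proof. by move=> Vy; apply: (base_einstein_weylP oV mh sb sF FhF dF sk SFG Vy).1; exact: EW. Qed.

Let sbe := smooth_bchi oV mh sb sc stau.

(** The fibre coordinate drops out by [bchi_curvature], leaving an equation on
    the base. *)
Lemma adapted_monopoleP x : U x ->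
  adapted_at g F pi xi lam b tau kap x <->
  [/\ monopole_co h F b chi Phi tau kap rho t0 t1 t2 (pi x) = 0, monopole_co h F b chi Phi tau kap rho t1 t2 t0 (pi x) = 0 &
      monopole_co h F b chi Phi tau kap rho t2 t0 t1 (pi x) = 0].
Proof.
move=> Ux; have Vy := piV cs Ux.
have [u3 mk fs] := structure_of_contact oU mg cs sF FhF dF sk sr sbe sP st lamE thE Ux.
have cf k := conformal_frame F oU cs sk sr st lamE (w k) Ux.
have [f3 fk] := fibre_frame mg cs FhF dF thE Ux.
have cd j k := (contact_d oU mg cs FhF dF sbe sP st thE j k Ux).1.
have [c12 c20 c01] := bchi_curvature oV mh sF FhF dF Fchi sb sc stau sk SFG Vy (base_einstein Vy).
have [k1 _] := fd_pull mg cs FhF dF sk Ux; have [r1 _] := fd_pull mg cs FhF dF sr Ux.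
have W0 : 2 * ((lam x)^-1 * (lam x)^-1) != 0 by rewrite mulf_neq0 ?pnatr_eq0 // mulf_neq0 // invr_eq0 l0.
have main (k i j : 'I_3) (oE : omega_co g F pi xi lam k x = - fstr E q3 x (w i) (w j))
    (cE : f2co F (bchi h b chi tau) i j (pi x) = 2 * weyl_d F b kap k (pi x)) :
    2 * ((lam x)^-1 * (lam x)^-1) * (defect_co g F pi xi lam b k x + tau (pi x) * (k == t0)%:R) =
    monopole_co h F b chi Phi tau kap rho k i j (pi x).
  rewrite /defect_co oE /monopole_co; have := cf k; rewrite fk k1 r1 (fco_bchi FhF b tau Fchi k Vy).
  have := fs i j; rewrite cd cE /weyl_d; have := lamE Ux; rewrite -/E.
  move: (scale_co _ _ _ _ _ _ _) (fstr _ _ _ _ _) (fd F k kap _) (fd F k rho _) ((lam x)^-1 * (lam x)^-1) (t x) (tau _) (kap _) (rho _)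
    (f2co F Phi i j _) (fco F (bchi h b chi tau) i _) (fco F (bchi h b chi tau) j _).
  move: (fco F Phi k _) (fco F Phi i _) (fco F Phi j _) (fco F b k _) ((k == t0)%:R : R).
  move=> Pk Pi Pj bk d u f dk dr W T ta ka rh dP bi bj eW ef eu.
  have -> : 2 * W * (- f / 2 + u - bk + ta * d) = 2 * W * u - W * f - 2 * W * bk + 2 * W * ta * d by field.
  by rewrite eu ef eW; ring.
have m0 := main t0 t1 t2; have m1 := main t1 t2 t0; have m2 := main t2 t0 t1.
rewrite /omega_co /= w0 w1 w2 in m0 m1 m2.
have {}m0 := m0 erefl c12; have {}m1 := m1 erefl c20; have {}m2 := m2 erefl c01.
rewrite /adapted_at -m0 -m1 -m2 /= mulr1 !mulr0 !addr0 u3.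
split=> [[-> -> -> _]|[]]; first by rewrite addNr !mulr0.
have cancel (z : R) : 2 * ((lam x)^-1 * (lam x)^-1) * z = 0 -> z = 0.
  by move/eqP; rewrite mulf_eq0 (negbTE W0) => /eqP.
move=> /cancel /eqP; rewrite addr_eq0 => /eqP -> /cancel -> /cancel ->.
by [].
Qed.

(** The remaining equations of [adapted_of_sfg] follow from [adapted_at] here,
    since [minimal_co] is determined by [scale_co]. *)
Lemma kahler_monopoleP x : U x ->
  (forall e, asd_part (fgam g E (fun=> 0) e x) t1 = 0 /\ asd_part (fgam g E (fun=> 0) e x) t2 = 0) <->
  [/\ monopole_co h F b chi Phi tau kap rho t0 t1 t2 (pi x) = 0, monopole_co h F b chi Phi tau kap rho t1 t2 t0 (pi x) = 0 &
      monopole_co h F b chi Phi tau kap rho t2 t0 t1 (pi x) = 0].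
Proof.
move=> Ux; have Vy := piV cs Ux; rewrite -(adapted_monopoleP Ux).
have H := adapted_of_sfg oU oV mg mh cs sF FhF dF Ux (SFG Vy); rewrite /E.
split=> [k|ad]; first by have [] := H.1 k.
apply: H.2; split=> //; have [_ e1 e2 _] := ad.
have [_ mk _] := structure_of_contact oU mg cs sF FhF dF sk sr sbe sP st lamE thE Ux.
move: e1 e2 (mk t1) (mk t2); rewrite /defect_co !(fco_bchi FhF b tau Fchi _ Vy) /= !mulr0 !subr0 w1 w2.
by gen_tt; gen_fco; move=> *; split; lra.
Qed.

Lemma quotient_of_adapted x k : U x -> adapted_at g F pi xi lam b tau kap x ->
  minimal_co g F pi xi lam k x + omega_co g F pi xi lam k x = fco F b k (pi x).
Proof.
move=> Ux [e0 e1 e2 _]; have Vy := piV cs Ux.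
have [_ mk _] := structure_of_contact oU mg cs sF FhF dF sk sr sbe sP st lamE thE Ux.
have := mk k; rewrite (fco_bchi FhF b tau Fchi k Vy); move: e0 e1 e2; rewrite /defect_co.
by elim/ord3P: k => /=; gen_tt; gen_fco; move: (tau _) => *; lra.
Qed.

End KahlerMonopole.

(** * Hyperkaehler metrics and parallel sections *)

Section Trigonometric.
Context {R : realType} {n : nat}.
Implicit Types (U : set 'rV[R]_n) (f : 'rV[R]_n -> R).

(** The two functions differentiate into each other, so the induction on [k]
    needs both. *)
Lemma Ck_cos_sin k U f : open U -> Ck k U f -> Ck k U (fun x => cos (f x)) /\ Ck k U (fun x => sin (f x)).
Proof.
move=> oU; elim: k => [|k IH] /=.
  move=> cf; split=> x Ux.
    apply: (@continuous_comp _ _ _ f cos); [exact: cf | exact: continuous_cos].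
  apply: (@continuous_comp _ _ _ f sin); [exact: cf | exact: continuous_sin].
move=> Cf; have [df cf] := Cf; have [Cc Cs] := IH (CkW Cf).
have dcs (phi : R -> R) d x : U x -> is_derive (f x) 1 phi d -> differentiable (fun z => phi (f z)) x.
  move=> Ux [dphi _]; apply: differentiable_comp; first exact: df.
  exact/derivable1_diffP.
split; split=> [x Ux|i].
- exact: dcs Ux (is_derive_cos (f x)).
- apply: (@Ck_ext _ _ _ _ (fun x => (-1 * sin (f x)) * pd i f x)) => // [x Ux|].
    by rewrite (pd_comp1 i (df x Ux) (is_derive_cos (f x))) mulN1r.
  by apply: CkM => //; apply: CkM => //; exact: Ck_cst.
- exact: dcs Ux (is_derive_sin (f x)).
- apply: (@Ck_ext _ _ _ _ (fun x => cos (f x) * pd i f x)) => // [x Ux|].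
    by rewrite (pd_comp1 i (df x Ux) (is_derive_sin (f x))).
  exact: CkM.
Qed.

Lemma smooth_cos U f : open U -> smooth U f -> smooth U (fun x => cos (f x)).
Proof. by move=> oU sf k; have [] := Ck_cos_sin oU (sf k). Qed.

Lemma smooth_sin U f : open U -> smooth U f -> smooth U (fun x => sin (f x)).
Proof. by move=> oU sf k; have [] := Ck_cos_sin oU (sf k). Qed.

Lemma grad_cos U f x : smooth U f -> U x -> grad (fun z => cos (f z)) x = - sin (f x) *: grad f x.
Proof.
move=> sf Ux; apply/rowP => i; rewrite !mxE.
exact: (pd_comp1 i (smooth_diff sf Ux) (is_derive_cos (f x))).
Qed.

Lemma grad_sin U f x : smooth U f -> U x -> grad (fun z => sin (f z)) x = cos (f x) *: grad f x.
Proof.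
move=> sf Ux; apply/rowP => i; rewrite !mxE.
exact: (pd_comp1 i (smooth_diff sf Ux) (is_derive_sin (f x))).
Qed.

End Trigonometric.

Section ParallelSections.
Context {R : realType} {n : nat}.
Variables (M : set 'rV[R]_n) (a : 'rV[R]_n -> 'rV[R]_n) (u : 'rV[R]_n -> R).
Hypotheses (oM : open M) (sa : smooth_mx M a) (su : smooth M u)
  (du : forall z, M z -> grad u z = u z *: a z).

Lemma norm_pairing (v c : 'rV[R]_n) : `|\sum_i v 0 i * c 0 i| <= `|v| * \sum_i `|c 0 i|.
Proof.
apply: le_trans (ler_norm_sum _ _ _) _; rewrite mulr_sumr; apply: ler_sum => i _.
by rewrite normrM; apply: ler_wpM2r => //; exact: row_coord_le.
Qed.

(** A parallel section grows along a ray at most at a bounded logarithmic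
    rate; on a short ray the mean value theorem halves any bound, so the
    section vanishes. *)
Lemma parallel_zero_open z0 : M z0 -> u z0 = 0 -> \forall z \near z0, u z = 0.
Proof.
move=> Mz0 u0; pose B := \sum_i (`|a z0 0 i| + 1) + 1.
have B0 : 0 < B by apply: ltr_wpDl => //; apply: sumr_ge0 => i _; rewrite addr_ge0.
have : \forall z \near z0, [/\ M z, `|u z - u z0| < 1 & forall i, `|a z 0 i - a z0 0 i| < 1].
  near=> z; split; near: z; first exact: open_nbhs_nbhs (conj oM Mz0).
    exact: smooth_near oM su Mz0 ltr01.
  by apply: filter_forall => i; exact: smooth_near oM (sa 0 i) Mz0 ltr01.
(* Within this radius the pairing of [a] with a displacement is at most one
   half. *)
move=> /nbhs_ballP [d /= d0 H]; pose r := Num.min d (2^-1 / B).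
have r0 : 0 < r by rewrite lt_min d0 divr_gt0 ?invr_gt0.
have rd : r <= d by rewrite ge_min lexx.
have rB : r * B <= 2^-1 by rewrite -ler_pdivlMr // ge_min lexx orbT.
apply/nbhs_ballP; exists r => // x; rewrite -ball_normE /= => xr.
pose v := x - z0; have vr : `|v| < r by rewrite /v distrC.
pose p s := z0 + s *: v.
have Hp s : 0 <= s <= 1 -> [/\ M (p s), `|u (p s) - u z0| < 1 & forall i, `|a (p s) 0 i - a z0 0 i| < 1].
  move=> /andP[s0 s1]; apply: H; rewrite -ball_normE /= /p opprD addrA subrr sub0r normrN normrZ ger0_norm //.
  by apply: le_lt_trans (lt_le_trans vr rd); apply: ler_piMl.
have ds s : 0 <= s <= 1 -> 'D_v u (p s) = u (p s) * \sum_i v 0 i * a (p s) 0 i.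
  move=> /Hp [Mp _ _]; rewrite (derive_smooth v su Mp) du // linearZ /= -scalemxAr mxE; congr (_ * _).
  by rewrite mxE; apply: eq_bigr => i _; rewrite [X in _ * X]mxE.
have bd s : 0 <= s <= 1 -> `|\sum_i v 0 i * a (p s) 0 i| <= 2^-1.
  move=> /Hp [_ _ ha]; apply: le_trans (norm_pairing _ _) _; apply: le_trans rB.
  apply: ler_pM; [exact: normr_ge0 | exact: sumr_ge0 | exact: ltW | apply: ler_wpDr => //; apply: ler_sum => i _].
  rewrite -[a (p s) 0 i](subrK (a z0 0 i)) addrC (le_trans (ler_normD _ _)) // lerD2l ltW //; exact: ha.
have bu k s : 0 <= s <= 1 -> `|u (p s)| <= (2 ^+ k)^-1.
  elim: k s => [|k IH] s s01; first by have [_ + _] := Hp s s01; rewrite u0 subr0 expr0 invr1 => /ltW.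
  move: (s01) => /andP[]; rewrite le_eqVlt => /predU1P[<- _|s0 s1].
    by rewrite /p scale0r addr0 u0 normr0 invr_ge0 exprn_ge0.
  have [e /andP[es0 es]|e /andP[e0 es]] := @mvt_line R n u z0 v s s0.
    by have [Mp _ _] := Hp e (introT andP (conj es0 (le_trans es s1))); exact: smooth_diff su Mp.
  have e01 : 0 <= e <= 1 by rewrite (ltW e0) (le_trans (ltW es) s1).
  rewrite -/(p s) u0 subr0 => ->; rewrite ds // normrM ger0_norm ?(ltW s0) // normrM exprS invfM.
  rewrite -[leRHS]mul1r; apply: ler_pM; [exact: ltW | exact: mulr_ge0 | exact: s1 |].
  by rewrite mulrC; apply: ler_pM; [exact: normr_ge0 | exact: normr_ge0 | exact: bd | exact: IH].
apply/eqP; rewrite -normr_le0 leNgt; apply/negP => ux.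
have := bu (Num.bound (`|u x|^-1)) 1; rewrite ler01 lexx /p scale1r /v addrC subrK => /(_ isT).
rewrite leNgt => /negP; apply; rewrite -[ltRHS]invrK ltf_pV2 ?posrE ?exprn_gt0 ?invr_gt0 //.
exact: upper_nthrootP.
Unshelve. all: by end_near.
Qed.

Lemma parallel_zero_or_nonzero : connected M -> (forall z, M z -> u z = 0) \/ (forall z, M z -> u z != 0).
Proof.
move=> cM; have [Z|NZ] := pselect (exists2 z, M z & u z = 0); [left | right] => z Mz; last first.
  by apply/eqP => uz; apply: NZ; exists z.
pose Z0 := M `&` [set x | u x = 0].
suff /seteqP[_ /(_ z Mz) [_ //]] : Z0 = M.
have oN : open (M `&` [set x | u x != 0]).
  rewrite openE => x [Mx ux]; near=> y; split; near: y; first exact: open_nbhs_nbhs (conj oM Mx).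
  have nx : 0 < `|u x| by rewrite normr_gt0.
  apply: filterS (smooth_near oM su Mx nx) => y /=; apply: contraTneq => ->.
  by rewrite sub0r normrN ltxx.
apply: cM; first by case: Z => x Mx ux; exists x.
- exists Z0; last by rewrite /Z0 setIA setIid.
  rewrite openE => x [Mx ux]; near=> y; split; near: y; first exact: open_nbhs_nbhs (conj oM Mx).
  exact: parallel_zero_open.
- exists (~` (M `&` [set x | u x != 0])); first exact: open_closedC.
  apply/seteqP; split=> x [Mx ux]; split=> //; first by move=> [_ /=]; rewrite ux eqxx.
  by apply/eqP; apply: contrapT => ux'; apply: ux; split=> //=; apply/negP.
Unshelve. all: by end_near.
Qed.

End ParallelSections.

Section FrameKahler.
Context {R : realType}.
Variables (U : set 'rV[R]_4) (V : set 'rV[R]_3) (g : 'rV[R]_4 -> 'M[R]_4)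
  (h F : 'rV[R]_3 -> 'M[R]_3) (pi : 'rV[R]_4 -> 'rV[R]_3) (xi : 'rV[R]_4 -> 'rV[R]_4)
  (lam : 'rV[R]_4 -> R).
Hypotheses (oU : open U) (mg : riemannian U g)
  (cs : conformal_submersion U V g h pi xi lam) (sF : smooth_mx V F)
  (FhF : forall y, V y -> F y *m h y *m (F y)^T = 1%:M) (dF : forall y, V y -> 0 < \det (F y)).
Let E := lfr g F pi xi lam.
Let sE : smooth_mx U E := smooth_lfr oU mg cs sF FhF dF.
Let uE x : U x -> E x \in unitmx. Proof. by move=> Ux; exact: (unit_lfr mg cs FhF dF Ux). Qed.
Let EgE x : U x -> E x *m g x *m (E x)^T = ((lam x ^+ 2)^-1)%:M. Proof. exact: (lfr_metric mg cs FhF dF). Qed.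
Let lc c x := fgam g E (fun=> 0) c x.

Lemma smooth_asd (c : 'I_3 -> 'rV[R]_4 -> R) : (forall k, smooth U (c k)) ->
  smooth_mx U (fun x => asd (c t0 x) (c t1 x) (c t2 x)).
Proof.
move=> sc i j; elim/ord4P: i; elim/ord4P: j; under eq_fun do rewrite mxE /=;
  by [exact: smooth_cst | exact: sc | exact: (smoothN oU (sc _))].
Qed.

Lemma frame_kahler (c : 'I_3 -> 'rV[R]_4 -> R) : (forall k, smooth U (c k)) ->
  (forall x, U x -> c t0 x ^+ 2 + c t1 x ^+ 2 + c t2 x ^+ 2 = 1) ->
  (forall x e, U x -> [/\ fd E e (c t0) x + (c t1 x * asd_part (lc e x) t2 - c t2 x * asd_part (lc e x) t1) = 0,
    fd E e (c t1) x + (c t2 x * asd_part (lc e x) t0 - c t0 x * asd_part (lc e x) t2) = 0 &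
    fd E e (c t2) x + (c t0 x * asd_part (lc e x) t1 - c t1 x * asd_part (lc e x) t0) = 0]) ->
  kahler U g (fun x => invmx (E x) *m asd (c t0 x) (c t1 x) (c t2 x) *m E x).
Proof.
move=> sc c1 par; set I := fun x => _.
have IE z : U z -> E z *m I z = asd (c t0 z) (c t1 z) (c t2 z) *m E z.
  by move=> Uz; rewrite /I !mulmxA mulmxV ?uE // mul1mx.
have sI : smooth_mx U I.
  exact: (smooth_mulmx oU (smooth_mulmx oU (smooth_invmx oU uE sE) (smooth_asd sc)) sE).
clearbody I.
split=> // x Ux.
- apply: (can_inj (mulKmx (uE Ux))); rewrite mulmxA IE // -mulmxA IE // mulmxA asd_sq c1 //.
  by rewrite mulmxN mulmx1 mul_scalar_mx scaleN1r.
- have uT : (E x)^T \in unitmx by rewrite unitmx_tr uE.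
  apply: (can_inj (mulKmx (uE Ux))); apply: (can_inj (mulmxK uT)).
  have -> : E x *m (I x *m g x *m (I x)^T) *m (E x)^T = (E x *m I x) *m g x *m (E x *m I x)^T.
    by rewrite trmx_mul !mulmxA.
  rewrite IE // trmx_mul asd_tr mulmxN mulmxN !mulmxA -(mulmxA _ (E x)) -(mulmxA _ _ (E x)^T) EgE //.
  by rewrite mul_mx_scalar -scalemxAl asd_sq c1 // scale_scalar_mx mulrN1 raddfN opprK.
- by apply/(parallel_frame oU mg cs sF FhF dF sI sc IE Ux) => e; exact: par.
Qed.

Variable J : 'rV[R]_4 -> 'M[R]_4.
Hypotheses (sJ : smooth_mx U J) (JE : forall z, U z -> E z *m J z = asd 1 0 0 *m E z)
  (KG : forall x, U x -> forall e, asd_part (lc e x) t1 = 0 /\ asd_part (lc e x) t2 = 0).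

(** The connection rotates the plane orthogonal to [J] by its component along
    [J]. *)
Lemma rotated_kahler (p q : 'rV[R]_4 -> R) : smooth U p -> smooth U q ->
  (forall x, U x -> p x ^+ 2 + q x ^+ 2 = 1) ->
  (forall x e, U x -> fd E e p x = - (q x * asd_part (lc e x) t0) /\ fd E e q x = p x * asd_part (lc e x) t0) ->
  kahler U g (fun x => invmx (E x) *m asd 0 (p x) (q x) *m E x).
Proof.
move=> sp sq pq par.
pose c (k : 'I_3) : 'rV[R]_4 -> R := match nat_of_ord k with 0%N => fun=> 0 | 1%N => p | _ => q end.
apply: (@frame_kahler c).
- by apply: ord3P; [exact: smooth_cst | exact: sp | exact: sq].
- by move=> x Ux; rewrite /c /= expr0n add0r pq.
move=> x e Ux; have [ep eq] := par x e Ux; have [k1 k2] := KG Ux e; rewrite /c /= k1 k2 ep eq (fd_cst E e 0 x).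
by move: (asd_part _ _) (p x) (q x) => *; split; ring.
Qed.

(** The potential [phi] is the angle by which parallel endomorphisms rotate
    against the frame. *)
Lemma rotated_triple phi : smooth U phi -> (forall x, U x -> grad phi x = - nu g F pi xi lam x) ->
  exists I K, [/\ kahler U g I, kahler U g J, kahler U g K & forall x, U x -> J x *m I x = K x].
Proof.
move=> sp dp; have g0 x e : U x -> fd E e phi x = asd_part (lc e x) t0.
  move=> Ux; rewrite fdE dp // mulNmx mxE -fcoE (nu_gam g F pi xi lam e x) opprK.
  by [].
have ss := smooth_sin oU sp; have sc := smooth_cos oU sp.
have dc x e : U x -> fd E e (fun z => cos (phi z)) x = - (sin (phi x) * asd_part (lc e x) t0).
  by move=> Ux; rewrite fdE (grad_cos sp Ux) -scalemxAl mxE -fdE g0 // mulNr.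
have ds x e : U x -> fd E e (fun z => sin (phi z)) x = cos (phi x) * asd_part (lc e x) t0.
  by move=> Ux; rewrite fdE (grad_sin sp Ux) -scalemxAl mxE -fdE g0.
exists (fun x => invmx (E x) *m asd 0 (cos (phi x)) (sin (phi x)) *m E x),
  (fun x => invmx (E x) *m asd 0 (- sin (phi x)) (cos (phi x)) *m E x); split.
- apply: (rotated_kahler sc ss) => [x Ux|x e Ux]; first exact: cos2Dsin2.
  by rewrite dc // ds.
- exact: (adapted_kahler oU mg cs sF FhF dF sJ JE KG).
- apply: (rotated_kahler (smoothN oU ss) sc) => [x Ux|x e Ux]; first by rewrite sqrrN addrC cos2Dsin2.
  by rewrite (fdN E e ss Ux) dc // ds // mulNr.
- move=> x Ux; apply: (can_inj (mulKmx (uE Ux))).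
  rewrite !mulmxA JE // mulmxV ?uE // mul1mx -(mulmxA _ (E x)) mulmxV ?uE // mulmx1; congr (_ *m _).
  move: (cos _) (sin _) => p q.
  by apply/matrixP => i j; elim/ord4P: i; elim/ord4P: j; rewrite mxE sum4 !mxE /=; ring.
Qed.

End FrameKahler.

(** * The converse and the theorem *)

Section Converse.
Context {R : realType}.
Variables (V : set 'rV[R]_3) (h : 'rV[R]_3 -> 'M[R]_3)
  (b chi Phi : 'rV[R]_3 -> 'rV[R]_3) (tau kap rho : 'rV[R]_3 -> R) (M : set 'rV[R]_4).
Hypotheses (oV : open V) (mh : riemannian V h) (sb : smooth_mx V b) (EW : einstein_weyl V h b)
  (sfg : shear_free_geodesic V h b chi tau kap) (sr : smooth V rho) (sP : smooth_mx V Phi)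
  (oM : open M) (bM : base @` M = V)
  (Wp : forall z, M z -> 0 < gfactor base fibre_t kap rho z).
Let g := gform base fibre_t h b chi tau kap rho Phi.
Let xi (z : 'rV[R]_4) : 'rV[R]_4 := Num.sqrt (gfactor base fibre_t kap rho z) *: bvec ord_max.
Let lam (z : 'rV[R]_4) : R := (Num.sqrt (gfactor base fibre_t kap rho z))^-1.
Variable J : 'rV[R]_4 -> 'M[R]_4.
Hypotheses (acs : antiselfdual_acs M g J) (ind : induces M J base xi lam chi).
Let sc : smooth_mx V chi := sfg_smooth sfg.
Let stau : smooth V tau := sfg_tau_smooth sfg.
Let skap : smooth V kap := sfg_kap_smooth sfg.
Let mg : riemannian M g := gform_riemannian oV mh sb sc stau skap sr sP oM bM Wp.
Let cs : conformal_submersion M V g h base xi lam := gform_submersion oV mh sb sc stau skap sr sP oM bM Wp.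

(** Data near a point of the total space on which all preceding lemmas apply.
    *)
Record adapted_chart (A : set 'rV[R]_4) (V' : set 'rV[R]_3) (F : 'rV[R]_3 -> 'M[R]_3) : Prop := AdaptedChart {
  chart_open : open A; chart_sub : A `<=` M; chart_base : open V'; chart_base_sub : V' `<=` V;
  chart_csub : conformal_submersion A V' g h base xi lam;
  chart_smooth : smooth_mx V' F;
  chart_orth : forall y, V' y -> F y *m h y *m (F y)^T = 1%:M;
  chart_det : forall y, V' y -> 0 < \det (F y);
  chart_chi : forall y, V' y -> row t0 (F y) = chi y;
  chart_lam : forall x, A x -> (lam x)^-1 * (lam x)^-1 = rho (base x) - 2 * fibre_t x * kap (base x);
  chart_contact : forall x, A x -> (lam x)^-1 *: flat g xi x =
     grad fibre_t x - fibre_t x *: pull1 base (bchi h b chi tau) x + pull1 base Phi x;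
  chart_J : forall x, A x -> lfr g F base xi lam x *m J x = asd 1 0 0 *m lfr g F base xi lam x;
  chart_sfg : forall y, V' y -> sfg_at h F b tau kap y }.

Lemma adapted_chart_exists z0 : M z0 -> exists A V' F, A z0 /\ adapted_chart A V' F.
Proof.
move=> Mz; have [A [V' [F [[oA Az AM oV' V'V] cs' [sF FhF dF Fchi] _ _]]]] :=
  straight_frame oM oV mg mh cs sc (sfg_unit sfg) Mz.
have mh' := riemannian_sub V'V mh; have mg' := riemannian_sub AM mg.
exists A, V', F; split=> //; split=> //.
- by move=> x /AM Mx; rewrite /lam invrK -expr2 (gfactor_sqrt Wp Mx).
- move=> x /AM Mx; rewrite contactE (flat_xi h b chi Phi tau Wp Mx) scalerA /lam invrK mulfV ?scale1r //.
  by rewrite gt_eqF // sqrtr_gt0 Wp.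
- have ind' : induces A J base xi lam chi by move=> x /AM; exact: ind.
  exact: (induces_adapted mg' cs' FhF dF (antiselfdual_acs_sub AM acs) ind' Fchi).
- move=> y V'y; apply: (sfg_frameP b oV' mh' sF FhF dF Fchi _ _ V'y).1.
  exact: (sfg_eq sfg (V'V _ V'y)).
Qed.

Section Chart.
Variables (A : set 'rV[R]_4) (V' : set 'rV[R]_3) (F : 'rV[R]_3 -> 'M[R]_3) (ch : adapted_chart A V' F).
Let oA := chart_open ch.
Let AM := chart_sub ch.
Let oV' := chart_base ch.
Let V'V := chart_base_sub ch.
Let cs' := chart_csub ch.
Let sF := chart_smooth ch.
Let FhF := chart_orth ch.
Let dF := chart_det ch.
Let Fchi := chart_chi ch.
Let mh' : riemannian V' h := riemannian_sub V'V mh.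
Let mg' : riemannian A g := riemannian_sub AM mg.
Let sJ' : smooth_mx A J := smooth_mx_sub AM (asd_smooth acs).
Let sb' := smooth_mx_sub V'V sb.
Let sc' := smooth_mx_sub V'V sc.
Let stau' := smooth_sub V'V stau.
Let skap' := smooth_sub V'V skap.
Let sr' := smooth_sub V'V sr.
Let sP' := smooth_mx_sub V'V sP.
Let sfib : smooth A fibre_t := smooth_coord _ _.
Let EW' : einstein_weyl V' h b.
Proof. by move=> y /V'V; exact: EW. Qed.
Let JE := chart_J ch.
Let SFG := chart_sfg ch.
Let lE := lfr g F base xi lam.

Definition kahler_at x := forall e, asd_part (fgam g lE (fun=> 0) e x) t1 = 0 /\ asd_part (fgam g lE (fun=> 0) e x) t2 = 0.

Lemma chart_parallel x : A x -> (forall i, covd_end (levi_civita g) J i x = 0) <-> kahler_at x.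
Proof. exact: (adapted_kahlerP oA mg' cs' sF FhF dF sJ' JE). Qed.

Lemma chart_monopole x : A x -> kahler_at x <->
  star3 h (base x) (covd_fun (-2) b rho (base x) + (2 * tau (base x) * rho (base x)) *: flat h chi (base x)
    + (2 * kap (base x)) *: Phi (base x))
  = twisted_d (-1) b Phi (base x) + (2 * tau (base x)) *: wedge (flat h chi (base x)) (Phi (base x)).
Proof.
move=> Ax; have Vy := piV cs' Ax.
have P := monopole_frameP b Phi tau kap rho FhF dF Fchi Vy.
have Q := kahler_monopoleP oA oV' mg' mh' cs' sF FhF dF Fchi sb' sc' stau' skap' sr' sP' sfib SFG EW' (chart_lam ch) (chart_contact ch) Ax.
by split=> [/Q /P|/P /Q].
Qed.

Lemma chart_quotient x : A x -> kahler_at x ->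
  forall k, minimal_co g F base xi lam k x + omega_co g F base xi lam k x = fco F b k (base x).
Proof.
move=> Ax k1 k; have := adapted_of_sfg oA oV' mg' mh' cs' sF FhF dF Ax (SFG (piV cs' Ax)).
move=> [/(_ k1) [AD _] _].
exact: (quotient_of_adapted oA oV' mg' mh' cs' sF FhF dF Fchi sb' sc' stau' skap' sr' sP' sfib (chart_lam ch) (chart_contact ch) k Ax AD).
Qed.

Lemma chart_scal_flat : (forall x, A x -> kahler_at x) -> forall x, A x -> scal g x = 0.
Proof.
move=> KG x Ax; have MB x' k (Ax' : A x') := chart_quotient Ax' (KG x' Ax') k.
apply/(scalar_flat_einstein_weylP oA oV' mg' mh' cs' sF FhF dF sJ' JE sb' stau' skap' SFG MB KG Ax).
exact: EW' (piV cs' Ax).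
Qed.

Section RicciForm.
Hypothesis KG : forall x, A x -> kahler_at x.
Let N x := lE x *m d1 (nu g F base xi lam) x *m (lE x)^T.
Let MB x k (Ax : A x) := chart_quotient Ax (KG Ax) k.

(** The Ricci form is selfdual, hence determined by its mixed components. *)
Lemma ricci_form_zeroP x : A x -> N x = 0 <-> forall i, fd F i tau (base x) = tau (base x) * minimal_co g F base xi lam i x.
Proof.
move=> Ax; have [d3 _] := d_nu oA oV' mg' mh' cs' sF FhF dF sb' stau' skap' SFG MB KG Ax.
have K c d : N x c d = f2co lE (nu g F base xi lam) c d x by [].
split=> [N0 i|H].
  by apply/eqP; rewrite -subr_eq0; apply/eqP; rewrite -d3 -K N0 mxE.
have z3 i : N x q3 (w i) = 0 by rewrite K d3 H subrr.
have [a1 a2] := nu_form_asd oA mg' cs' sF FhF dF sJ' JE KG Ax.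
have a0 : asd_part (N x) t0 = 0.
  have := scal_nu oA mg' cs' sF FhF dF sJ' JE KG Ax; rewrite (chart_scal_flat KG Ax) => /esym/eqP.
  rewrite mulf_eq0 mulf_eq0 pnatr_eq0 /= expf_eq0 /= gt_eqF ?(csub_lam_pos cs' Ax) //= => /eqP.
  by [].
move: a0 a1 a2; rewrite /asd_part /= -/(N x) -w0 -w1 -w2 !z3 !w0 !w1 !w2 => /eqP a0 /eqP a1 /eqP a2.
move: a0 a1 a2; rewrite !sub0r !oppr_eq0 => /eqP a0 /eqP a1 /eqP a2.
have z0 : N x q3 q0 = 0 by rewrite -w0 z3.
have z1 : N x q3 q1 = 0 by rewrite -w1 z3.
have z2 : N x q3 q2 = 0 by rewrite -w2 z3.
by apply: skew_ext; rewrite ?[RHS]mxE //; [exact: nu_form_skew | rewrite trmx0 oppr0].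
Qed.

Lemma d_tau_frameP a x : minimal_weyl M g xi a -> A x ->
  covd_fun (-1) a (fun z => tau (base z) * lam z) x = 0 <->
  forall i, fd F i tau (base x) = tau (base x) * minimal_co g F base xi lam i x.
Proof.
move=> ma Ax; have ma' := minimal_weyl_sub AM ma.
have [mw m3] := minimal_frame oA oV' mg' cs' sF FhF dF ma' Ax.
have [pt pt3] := fd_pull mg' cs' FhF dF stau' Ax.
have sl := csub_lam_smooth cs'; have l0 : lam x != 0 by rewrite gt_eqF // (csub_lam_pos cs' Ax).
have stb : smooth A (fun z => tau (base z)) := smooth_chain oA (piV cs') (csub_smooth cs') stau'.
set D := covd_fun _ _ _.
have DE c : fco lE D c x = lam x * (fd lE c (fun z => tau (base z)) x - tau (base x) * (fco lE a c x + scale_co g F base xi lam c x)).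
  rewrite fcoE /D /covd_fun mulmxDl -scalemxAl mxE -fdE [X in _ + X]mxE -fcoE (fdM lE c stb sl Ax) /scale_co -/lE.
  by move: l0; move: (lam x) (fd lE c lam x) (fd _ _ _ _) (fco _ _ _ _) (tau _) => l dl dt f t l0; field.
have D3 : fco lE D q3 x = 0 by rewrite DE pt3 m3 mulr0 subr0 mulr0.
have Dw i : fco lE D (w i) x = lam x * (fd F i tau (base x) - tau (base x) * minimal_co g F base xi lam i x).
  by rewrite DE pt mw.
split=> [D0 i|H].
  have /eqP := Dw i; rewrite fcoE D0 mul0mx mxE eq_sym mulf_eq0 (negbTE l0) subr_eq0 => /eqP.
  by [].
apply: (fco_inj mg' cs' FhF dF (al := D) (be := fun=> 0) Ax) => c.
have -> : fco (lfr g F base xi lam) (fun=> 0) c x = 0 by rewrite fcoE mul0mx mxE.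
elim/ord4w: c => [i|]; [by rewrite Dw H subrr mulr0 | exact: D3].
Qed.

Lemma ricci_flat_form x : A x -> ricci (levi_civita g) x = 0 -> N x = 0.
Proof.
move=> Ax r0; have := ricci_nu oA mg' cs' sF FhF dF sJ' JE KG Ax; rewrite r0 mulmx0 mul0mx -/(N x) => /esym/eqP.
rewrite oppr_eq0 => /eqP /(congr1 (mulmx (asd 1 0 0))); rewrite mulmx0 mulmxA asd_sq expr1n !expr0n !addr0.
by rewrite mul_scalar_mx scaleN1r => /eqP; rewrite oppr_eq0 => /eqP.
Qed.

(** The connection form of the canonical bundle is closed, so it has a
    potential. *)
Lemma chart_hyperkahler : (forall x, A x -> N x = 0) -> forall x, A x ->
  exists W : set 'rV[R]_4, [/\ open W, W x, W `<=` A &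
    exists I K, [/\ kahler W g I, kahler W g J, kahler W g K & forall z, W z -> J z *m I z = K z]].
Proof.
move=> N0 x Ax; have /nbhs_ballP [r /= r0 BA] := open_nbhs_nbhs (conj oA Ax).
have dn z : A z -> d1 (nu g F base xi lam) z = 0.
  move=> Az; have u := unit_lfr mg' cs' FhF dF Az.
  have uT : (lE z)^T \in unitmx by rewrite unitmx_tr.
  by apply: (can_inj (mulKmx u)); apply: (can_inj (mulmxK uT)); rewrite -/lE -/(N z) N0 // mulmx0 mul0mx.
have sn : smooth_mx A (fun z => - nu g F base xi lam z).
  exact: (smooth_oppmx oA (smooth_nu oA mg' cs' sF FhF dF)).
have [|z Bz|r' [phi [/andP[r'0 r'r] sphi dphi]]] := @poincare R 4 x r (fun z => - nu g F base xi lam z) r0.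
- exact: smooth_mx_sub BA sn.
- apply/matrixP => i j; have := congr1 (fun Z : 'M[R]_4 => Z i j) (dn z (BA _ Bz)); rewrite /d1 !mxE.
  have dN k l : pd k (fun z => (- nu g F base xi lam z) 0 l) z = - pd k (fun z => nu g F base xi lam z 0 l) z.
    under eq_fun do rewrite mxE.
    exact: (pdN k (smooth_diff (smooth_nu oA mg' cs' sF FhF dF 0 l) (BA _ Bz))).
  by rewrite !dN opprK => e; rewrite addrC -opprB e oppr0.
pose W := ball x r'; have WA : W `<=` A by move=> z Wz; apply: BA; exact: le_ball r'r _ Wz.
have WV : base @` W `<=` V' by move=> y [z /WA Az <-]; exact: (piV cs' Az).
exists W; split=> //; [exact: ball_open | exact: ballxx |].
have csW : conformal_submersion W (base @` W) g h base xi lam := conformal_submersion_sub WA erefl cs'.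
apply: (rotated_triple (ball_open x r') (riemannian_sub WA mg') csW (smooth_mx_sub WV sF) _ _ (smooth_mx_sub WA sJ') _ _ sphi dphi).
- by move=> y /WV; exact: FhF.
- by move=> y /WV; exact: dF.
- by move=> z /WA; exact: JE.
- by move=> z /WA; exact: KG.
Qed.

End RicciForm.

End Chart.

Lemma monopole_kahler_at A V' F : monopole_eq V h b chi tau kap rho Phi -> adapted_chart A V' F -> forall x, A x -> kahler_at F x.
Proof.
by move=> ME ch x Ax; apply: (chart_monopole ch Ax).2; exact: ME (chart_base_sub ch (piV (chart_csub ch) Ax)).
Qed.

(** Every point of [B] lies below a point of [M], so the pointwise equivalence
    in charts is enough. *)
Lemma scalar_flat_kahler_monopole : scalar_flat_kahler M g J <-> monopole_eq V h b chi tau kap rho Phi.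
Proof.
split=> [[kJ _] y Vy|ME].
  have [z Mz <-] : (base @` M) y by rewrite bM.
  have [A [V' [F [Az ch]]]] := adapted_chart_exists Mz.
  apply: (chart_monopole ch Az).1; apply: (chart_parallel ch Az).1; exact: (kahler_parallel kJ Mz).
have KG A V' F (ch : adapted_chart A V' F) := monopole_kahler_at ME ch.
split=> [|z Mz]; last first.
  by have [A [V' [F [Az ch]]]] := adapted_chart_exists Mz; exact: (chart_scal_flat ch (KG _ _ _ ch) Az).
split=> [|||z Mz]; [exact: asd_smooth acs | exact: asd_square acs | exact: asd_orth acs |].
by have [A [V' [F [Az ch]]]] := adapted_chart_exists Mz; exact: ((chart_parallel ch Az).2 (KG _ _ _ ch _ Az)).
Qed.

Lemma hyperkahler_parallel_divergence a : monopole_eq V h b chi tau kap rho Phi -> minimal_weyl M g xi a ->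
  hyperkahler M g <-> forall z, M z -> covd_fun (-1) a (fun z => tau (base z) * lam z) z = 0.
Proof.
move=> ME ma; split=> [hk z Mz|H z Mz]; have [A [V' [F [Az ch]]]] := adapted_chart_exists Mz;
  have KG := monopole_kahler_at ME ch.
  apply/(d_tau_frameP ch ma Az)/(ricci_form_zeroP ch KG Az); apply: (ricci_flat_form ch KG Az).
  exact: (hyperkahler_ricci_flat oM mg hk Mz).
have N0 x : A x -> lfr g F base xi lam x *m d1 (nu g F base xi lam) x *m (lfr g F base xi lam x)^T = 0.
  by move=> Ax; apply/(ricci_form_zeroP ch KG Ax)/(d_tau_frameP ch ma Ax); exact: H (chart_sub ch Ax).
have [W [oW Wz WA [I [K IJK]]]] := chart_hyperkahler ch KG N0 Az.
exists W; split=> //; first by move=> x /WA; exact: (chart_sub ch).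
by exists I, J, K.
Qed.

(** If [tau] is parallel and not identically zero, then its inverse is the
    gauge in which it is constant. *)
Lemma parallel_divergence_gauge a : minimal_weyl M g xi a -> connected M ->
  (forall z, M z -> covd_fun (-1) a (fun z => tau (base z) * lam z) z = 0) <->
  (forall y, V y -> tau y = 0) \/
  exists f : 'rV[R]_4 -> R, [/\ smooth M f, forall z, M z -> f z != 0 /\ covd_fun 1 a f z = 0 &
    exists c : R, forall z, M z -> tau (base z) * lam z * f z = c].
Proof.
move=> [sa _] cM; set T := fun z => _.
have sT : smooth M T := smoothM oM (smooth_chain oM (piV cs) (csub_smooth cs) stau) (csub_lam_smooth cs).
have gT z : covd_fun (-1) a T z = 0 <-> grad T z = T z *: a z.
  by rewrite /covd_fun mulN1r scaleNr; split=> [/eqP|->]; rewrite ?subrr // subr_eq0 => /eqP.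
split=> [H|[t00 z Mz|[f [sf Hf [c Hc]]] z Mz]]; last 2 first.
- apply/gT; have T0 x : M x -> T x = 0 by move=> Mx; rewrite /T t00 ?mul0r // -bM; exists x.
  rewrite T0 // scale0r; apply/rowP => i; rewrite !mxE.
  by rewrite (pd_ext i oM Mz T0) pd_cst.
- apply/gT; have [f0 cf] := Hf z Mz.
  have gf : grad f z = - f z *: a z by move/eqP: cf; rewrite /covd_fun mul1r addr_eq0 scaleNr => /eqP.
  apply/rowP => i; have := congr1 (fun v : 'rV[R]_4 => v 0 i) gf; rewrite !mxE => e.
  have := pd_ext i oM Mz Hc; rewrite pd_cst -/T (pdM i (smooth_diff sT Mz) (smooth_diff sf Mz)) e.
  move: f0; move: (f z) (a z 0 i) (T z) (pd i T z) => p q r s p0 /eqP k.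
  by apply: (mulIf p0); apply/eqP; rewrite -subr_eq0; move: k; congr (_ == _); ring.
have [Z|NZ] := parallel_zero_or_nonzero oM sa sT (fun z Mz => (gT z).1 (H z Mz)) cM; [left=> y | right].
  rewrite -{1}bM => -[z Mz <-]; have /eqP := Z z Mz; rewrite mulf_eq0 orbC.
  by rewrite gt_eqF ?(csub_lam_pos cs Mz) //= => /eqP.
exists (fun z => (T z)^-1); split=> [|z Mz|]; first exact: (smoothV oM NZ sT).
  split; first by rewrite invr_eq0 NZ.
  have := (gT z).1 (H z Mz) => e; apply/rowP => i; have := congr1 (fun v : 'rV[R]_4 => v 0 i) e; rewrite !mxE => e'.
  rewrite (pdV i (NZ z Mz) (smooth_diff sT Mz)) e'; move: (T z) (NZ z Mz) (a z 0 i) => p p0 q; field.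
  exact: p0.
by exists 1 => z Mz; rewrite mulfV // NZ.
Qed.

End Converse.

Theorem theoremV (R : realType) :
  (forall (U : set 'rV[R]_4) (V : set 'rV[R]_3)
      (g J : 'rV[R]_4 -> 'M[R]_4) (h : 'rV[R]_3 -> 'M[R]_3)
      (pi : 'rV[R]_4 -> 'rV[R]_3) (xi : 'rV[R]_4 -> 'rV[R]_4)
      (lam : 'rV[R]_4 -> R) (a : 'rV[R]_4 -> 'rV[R]_4),
    open U -> open V -> riemannian U g -> riemannian V h ->
    antiselfdual_acs U g J -> scalar_flat_kahler U g J ->
    conformal_submersion U V g h pi xi lam ->
    minimal_weyl U g xi a -> selfdual_xi U g a -> holomorphic_xi U g J xi a ->
    selfdual_conformal U g /\
    forall x0, U x0 ->
    exists (U' : set 'rV[R]_4) (V' : set 'rV[R]_3)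
      (b chi : 'rV[R]_3 -> 'rV[R]_3) (tau kap : 'rV[R]_3 -> R),
      [/\ [/\ open U', U' x0, U' `<=` U, open V' & pi @` U' = V'],
          quotient_weyl U' V' g pi xi lam a b /\ einstein_weyl V' h b,
          induces U' J pi xi lam chi /\
            shear_free_geodesic V' h b chi tau kap,
          exists gam : 'rV[R]_4 -> R,
            [/\ affine_submersion U' V' g pi xi lam gam,
                exists t, affine_coordinate U' xi gam t &
                forall t, affine_coordinate U' xi gam t ->
                  monopole_linear_part U' V' g h pi lam t
                    (fun y => - 2 * kap y)]
        & exists (t : 'rV[R]_4 -> R) (rho : 'rV[R]_3 -> R)
            (Phi : 'rV[R]_3 -> 'rV[R]_3),
            [/\ smooth U' t, smooth V' rho, smooth_mx V' Phi &
                forall x, U' x ->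
                  [/\ 0 < 'D_(xi x) t x,
                      0 < gfactor pi t kap rho x &
                      g x = gform pi t h b chi tau kap rho Phi x]]])
  /\
  (forall (V : set 'rV[R]_3) (h : 'rV[R]_3 -> 'M[R]_3)
      (b chi Phi : 'rV[R]_3 -> 'rV[R]_3) (tau kap rho : 'rV[R]_3 -> R)
      (M : set 'rV[R]_4),
    open V -> riemannian V h -> smooth_mx V b -> einstein_weyl V h b ->
    shear_free_geodesic V h b chi tau kap ->
    smooth V rho -> smooth_mx V Phi ->
    open M -> base @` M = V ->
    (forall z, M z -> 0 < gfactor base fibre_t kap rho z) ->
    let g := gform base fibre_t h b chi tau kap rho Phi in
    let xi := fun z => Num.sqrt (gfactor base fibre_t kap rho z)
                       *: bvec ord_max in
    let lam := fun z => (Num.sqrt (gfactor base fibre_t kap rho z))^-1 in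
    forall J : 'rV[R]_4 -> 'M[R]_4,
    antiselfdual_acs M g J -> induces M J base xi lam chi ->
    (scalar_flat_kahler M g J <-> monopole_eq V h b chi tau kap rho Phi) /\
    (monopole_eq V h b chi tau kap rho Phi ->
     forall a : 'rV[R]_4 -> 'rV[R]_4, minimal_weyl M g xi a ->
     let tauM := fun z => tau (base z) * lam z in
     let D0tau_zero := forall z, M z -> covd_fun (-1) a tauM z = 0 in
     (hyperkahler M g <-> D0tau_zero) /\
     (connected M ->
      (D0tau_zero <->
       (forall y, V y -> tau y = 0) \/
       (exists f : 'rV[R]_4 -> R,
          [/\ smooth M f,
              forall z, M z -> f z != 0 /\ covd_fun 1 a f z = 0 &
              exists c : R, forall z, M z -> tauM z * f z = c]))))).

Proof.
split=> [U V g J h pi xi lam a oU oV mg mh acs sfk cs ma SD hol|V h b chi Phi tau kap rho M oV mh sb EW sfg sr sP oM bM Wp /= J acs ind].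
  have H x0 (Ux0 : U x0) := scalar_flat_kahler_quotient oU oV mg mh acs sfk cs ma SD hol Ux0.
  by split=> [x Ux|x Ux]; have [] := H x Ux.
split; first exact: (scalar_flat_kahler_monopole oV mh sb EW sfg sr sP oM bM Wp acs ind).
move=> ME a ma; split; first exact: (hyperkahler_parallel_divergence oV mh sb EW sfg sr sP oM bM Wp acs ind ME ma).
exact: (parallel_divergence_gauge oV mh sb sfg sr sP oM bM Wp ma).
Qed.
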